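(* Let $f(x)=|\log x|$ and $g(x)=\log^2 x$. There are constants $c,C\in(0,\infty)$ such that for every $\varepsilon\in(0,1/3)$ and every closed subset $A$ of the disk $\{x\in\mathbb{R}^2:|x|\le 1/3\}$, $$c\,\operatorname{Cap}_\varepsilon(A)\ \le\ \mathbf{P}(\mathcal{D}_\varepsilon\cap A\ne\varnothing)\ \le\ C\,\operatorname{Cap}_\varepsilon(A).$$
   Context: $(B_t)_{t\ge0}$ is a standard planar Brownian motion started at the point $(1,0)$ under $\mathbf{P}$, and $\tau_*=\inf\{t:|B_t|=3\}$. The set of $\varepsilon$-separated double points is $$\mathcal{D}_\varepsilon=\{x: B_r=B_s=x\text{ for some }0<r<r+\varepsilon^2\le s<\tau_*\}.$$ For a function $h:(0,\infty)\to[0,\infty)$ (with $h(0)=+\infty$ for the functions used here) and a probability measure $\mu$ on the plane, the $h$-energy is $\mathcal{E}_h(\mu)=\iint h(|x-y|)\,d\mu(x)\,d\mu(y)$, and $\operatorname{Cap}_h(A)=[\inf_\mu \mathcal{E}_h(\mu)]^{-1}$, the infimum being over probability measures $\mu$ supported on $A$ (with $1/\infty=0$, and capacity $0$ for the empty set). With $f(x)=|\log x|$ and $g(x)=\log^2 x$, let $$h_\varepsilon(x)=\begin{cases} f(x), & x\ge\varepsilon,\\ g(x)\,\dfrac{f(\varepsilon)}{g(\varepsilon)}, & x<\varepsilon,\end{cases}$$ and $\operatorname{Cap}_\varepsilon=\operatorname{Cap}_{h_\varepsilon}$. *)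

(* Defs.v *)
From HB Require Import structures.
From mathcomp Require Import all_boot all_order all_algebra.
From mathcomp Require Import all_classical all_reals all_analysis.
Set Implicit Arguments.
Unset Strict Implicit.
Unset Printing Implicit Defensive.
Import Order.TTheory GRing.Theory Num.Theory numFieldNormedType.Exports.
Local Open Scope classical_set_scope.
Local Open Scope ring_scope.

(* The norm provided by the library on R * R is the max norm. *)
Definition eucl_norm (R : realType) (x : R * R) : R :=
  Num.sqrt (x.1 ^+ 2 + x.2 ^+ 2).

(* Letting some of the E i be the whole space gives the product rule for all
   subfamilies. *)
Definition mutually_independent (d d' : measure_display) (T : measurableType d)
    (T' : measurableType d') (R : realType) (P : probability T R)
    (n : nat) (X : 'I_n -> T -> T') : Prop :=
  forall E : 'I_n -> set T', (forall i, measurable (E i)) ->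
    P (\bigcap_(i in [set: 'I_n]) (X i @^-1` E i)) =
    (\prod_(i < n) P (X i @^-1` E i))%E.

(* The time set is [0, +oo[ : values of B at negative times are irrelevant.
   The second parameter of normal_prob is the standard deviation, so that
   increments have covariance matrix (t - s) I_2. *)
Record planar_brownian_motion (d : measure_display) (T : measurableType d)
    (R : realType) (P : probability T R) (x0 : R * R)
    (B : R -> T -> R * R) : Prop := PlanarBrownianMotion {
  pbm_measurable : forall t, 0 <= t -> measurable_fun setT (B t) ;
  pbm_start : forall w, B 0 w = x0 ;
  pbm_continuous : forall w, {within `[0, +oo[, continuous (fun t => B t w)} ;
  pbm_independent : forall (n : nat) (t : nat -> R),
    0 <= t 0%N -> (forall i, t i <= t i.+1) ->
    mutually_independent P (fun (i : 'I_n) w => B (t i.+1) w - B (t i) w) ;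
  pbm_gaussian : forall s t, 0 <= s -> s < t ->
    forall E : set (R * R), measurable E ->
    P [set w | E (B t w - B s w)] =
    (normal_prob 0 (Num.sqrt (t - s)) \x normal_prob 0 (Num.sqrt (t - s)))%E E
}.

(* Equal to +oo when the path b never reaches the circle of radius r. *)
Definition hitting_time (R : realType) (b : R -> R * R) (r : R) : \bar R :=
  ereal_inf [set t%:E | t in [set t : R | 0 <= t /\ eucl_norm (b t) = r]].

Definition separated_double_points (R : realType) (b : R -> R * R) (eps : R) :
    set (R * R) :=
  [set x | exists r s : R,
     [/\ 0 < r, r < r + eps ^+ 2, r + eps ^+ 2 <= s,
         (s%:E < hitting_time b 3)%E & b r = x /\ b s = x]].

Section capacity.
Context {R : realType}.
Implicit Types (h : R -> R) (A : set (R * R)) (mu : probability (R * R)%type R).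

(* A gauge h : R -> R is only used on ]0, +oo[ ; its value at 0 is +oo. *)
Definition gauge_kernel h (r : R) : \bar R :=
  if r == 0 then +oo%E else (h r)%:E.

Definition energy h mu : \bar R :=
  (\int[mu]_x \int[mu]_y gauge_kernel h (eucl_norm (x - y)%R))%E.

(* For a closed set A, mu is supported on A iff mu A = 1.  The inverse on
   \bar R satisfies +oo^-1 = 0, and the infimum of the empty set is +oo. *)
Definition capacity h A : \bar R :=
  ((ereal_inf [set energy h mu |
     mu in [set mu : probability (R * R)%type R | mu A = 1%E]])^-1)%E.

End capacity.

Definition f_gauge (R : realType) (x : R) : R := `|ln x|.

Definition g_gauge (R : realType) (x : R) : R := ln x ^+ 2.

Definition h_gauge (R : realType) (eps x : R) : R :=
  if eps <= x then f_gauge x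
  else g_gauge x * (f_gauge eps / g_gauge eps).

(* Main.v *)
(* Upper bound.  Conditioned on hitting A, let mu be the law of the first
   double point X in A (the value of the path at the first time t by which
   some point of A has been visited at two times at least eps^2 apart).  By
   the Markov property at that time, the expected occupation of the path
   started from X, averaged over mu, is at least P(hit) times the
   logarithmic energy of mu, and it is bounded by the Green function.  The
   short range part of the gauge, which behaves like log^2 / f(eps), is
   treated by a second moment: cut time into blocks of length h = eps^2 / 4,
   so that the two visits are separated by a full block, decouple the
   occupation after that block from the path before it, and apply Doob's L^2
   inequality to the conditional expectation of the occupation.  The
   gaps between the blocks contribute the sum of 1 / (m h), that is f(eps).

   Lower bound.  For a measure mu on A of finite energy, let Z be the mass
   that mu gives to the pairs of times, at distance at least eps^2 and on a
   grid of step eta, at which the path is within delta of a common point.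
   Excursions to radius close to 3 cost only a fraction of E Z, which is
   thus at least of order f(eps).  In E Z^2 the chain of four visits has, up
   to symmetry, the orders yyy'y', yy'yy' and yy'y'y; since both gaps
   are at least eps^2, each order is bounded by K^2 L + K L^2 with K of order
   f(|y - y'|) and L of order f(eps), hence by f(eps)^2 h_eps(|y - y'|).
   Paley-Zygmund bounds P(Z > 0) below and compactness of the path yields
   a genuine double point in the limit of a vanishing mesh. *)
Require Import Defs.
From HB Require Import structures.
From mathcomp Require Import all_boot all_order all_algebra.
From mathcomp Require Import all_classical all_reals all_analysis.
From mathcomp Require Import ring lra zify.
Set Implicit Arguments.
Unset Strict Implicit.
Unset Printing Implicit Defensive.
Import measurable_realfun.
Import Order.TTheory GRing.Theory Num.Theory numFieldNormedType.Exports.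
Local Open Scope classical_set_scope.
Local Open Scope ring_scope.

(** * Independent increments and the Markov property *)

(** All conditioning takes place at deterministic grid times: the strong Markov property is replaced
    by a sum over disjoint events, each adapted to its own grid time, and continuity of the path
    leads back to the true first double time. The obstacle in the upper bound is that the earlier of
    the two visits is not a stopping time. To bound the squared occupation kernel at the hitting
    point, one factor becomes the occupation after the later visit, and the other is carried back to
    the earlier visit, which is located only through its block; hence a maximum over the block. The
    resulting estimate contains the unknown squared energy on both sides and is closed by
    absorption. Kernels are smoothed at a time scale [delta], which keeps them bounded and
    Lipschitz; the gauge itself appears only when [delta] tends to 0. In the lower bound the
    relation [2 * delta ^+ 2 = eta] between the radius of the bumps and the mesh lets the heat
    kernel at time [eta] dominate a bump, so that chains of visits again reduce to Markov steps
    between grid times. *)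

Section plane_measurability.
Context {R : realType}.
Implicit Types U : set (R * R).

(** The sigma-algebra of the plane is the product one. Balls of the max norm are products of
    intervals, so the rational ones form a countable base of measurable sets. *)
Lemma open_measurable2 U : open U -> measurable U.
Proof.
move=> oU.
pose S (q : rat * rat * rat) : set (R * R) :=
  ball (ratr q.1.1 : R) (ratr q.2) `*` ball (ratr q.1.2 : R) (ratr q.2).
have mS q : measurable (S q).
  by by apply: measurableX; rewrite ball_itv; exact: measurable_itv.
have -> : U = \bigcup_q (if `[< S q `<=` U >] then S q else set0).
  apply/seteqP; split=> [x Ux|x [q _]]; last by case: asboolP => // h /h.
  have /nbhs_ballP[e /= e0 xeU] : nbhs x U by exact: open_nbhs_nbhs.
  have [r re] : exists r : rat, 0 < (ratr r : R) < e / 2.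
    have := @rat_in_itvoo R 0 (e / 2); rewrite divr_gt0// => /(_ isT)[r].
    by rewrite in_itv/= => h; exists r.
  have H (y : R) : exists p : rat, ball (ratr p : R) (ratr r) y.
    have := @rat_in_itvoo R (y - ratr r) (y + ratr r).
    have r0 : 0 < (ratr r : R) by case/andP: re.
    rewrite ltrBlDr -addrA ltrDl addr_gt0// => /(_ isT)[p].
    rewrite in_itv/= => /andP[h1 h2]; exists p.
    by rewrite -ball_normE/= ltr_norml; apply/andP; split; lra.
  have [p1 h1] := H x.1; have [p2 h2] := H x.2.
  exists (p1, p2, r) => //; case: asboolP => [_|]; first by split.
  apply: contra_notP => _.
  move=> z [/= z1 z2].
  case/andP: re => r0 re.
  move: h1 h2 z1 z2; rewrite -!ball_normE/= !ltr_norml.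
  move=> /andP[? ?] /andP[? ?] /andP[? ?] /andP[? ?].
  have bR (a b c : R) : (`|a - b| < c) -> ball a c b by rewrite -ball_normE.
  by apply: xeU; split; apply: bR; rewrite ltr_norml; apply/andP; split; lra.
apply: countable_bigcupT_measurable => [|q]; first exact: countableP.
by case: asboolP.
Qed.

Lemma closed_measurable2 U : closed U -> measurable U.
Proof.
by move=> cU; rewrite -(setCK U); apply: measurableC; apply: open_measurable2; rewrite openC.
Qed.

Lemma continuous_measurable2 (f : R * R -> R) : continuous f ->
  measurable_fun setT f.
Proof.
move=> /continuousP cf; apply: (measurability _ (RGenOpens.measurableE R)).
move=> _ [_ [a [b ->] <-]]; rewrite setTI; apply: open_measurable2.
by apply: cf; exact: interval_open.
Qed.

End plane_measurability.

Section independence.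
Context d (T : measurableType d) (R : realType) (P : probability T R).
Local Open Scope ereal_scope.

(** Dynkin's theorem: for fixed [A], the sets that satisfy the product rule form a lambda-system. *)
Lemma indep_g_sigma_r (A : set T) (C : set (set T)) :
  measurable A -> C `<=` measurable -> setI_closed C ->
  (forall c, C c -> P (A `&` c) = P A * P c) ->
  forall c, <<s C >> c -> P (A `&` c) = P A * P c.
Proof.
move=> mA mC CI H c sc.
have sCm : <<s C >> `<=` measurable.
  by apply: smallest_sub => //; exact: sigma_algebra_measurable.
suff : <<s C >> `<=` [set B | measurable B /\ P (A `&` B) = P A * P B].
  by move=> /(_ _ sc)[].
have Pfin B : measurable B -> P B \is a fin_num by move=> mB; exact: fin_num_measure.
apply: (@lambda_system_subset _ _ CI setT) => //; last first.
  by move=> B CB; split; [exact: mC|exact: H].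
apply/dynkin_lambda_system; split.
- by split => //; rewrite setIT probability_setT mule1.
- move=> B [mB PB]; split; first exact: measurableC.
  have -> : A `&` ~` B = A `\` (A `&` B) by rewrite setDIr setDv set0U setDE.
  rewrite measureD//; last 2 first.
    exact: measurableI.
    by rewrite -ge0_fin_numE// Pfin.
  rewrite setIA setIid probability_setC// [X in _ - X]PB.
  by rewrite muleBr ?mule1// ?Pfin// fin_num_adde_defr.
- move=> F tF mF; split.
    by apply: bigcup_measurable => k _; case: (mF k).
  rewrite setI_bigcupr measure_bigcup//; last 2 first.
    by move=> k _; apply: measurableI => //; case: (mF k).
    exact: trivIset_setIl.
  rewrite measure_bigcup//; last by move=> k _; case: (mF k).
  rewrite -[P A](fineK (Pfin _ mA)) -nneseriesZl//.
  by apply: eq_eseriesr => k _; rewrite fineK ?Pfin//; case: (mF k).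
Qed.

Lemma indep_g_sigma (A C : set (set T)) :
  A `<=` measurable -> setI_closed A ->
  C `<=` measurable -> setI_closed C ->
  (forall a c, A a -> C c -> P (a `&` c) = P a * P c) ->
  forall a c, <<s A >> a -> <<s C >> c -> P (a `&` c) = P a * P c.
Proof.
move=> mA AI mC CI H a c sa sc.
have sCm : <<s C >> `<=` measurable.
  by apply: smallest_sub => //; exact: sigma_algebra_measurable.
rewrite setIC muleC; apply: (@indep_g_sigma_r c A) => //; first exact: sCm.
move=> a' Aa'; rewrite setIC muleC; apply: (@indep_g_sigma_r a' C) => //.
  exact: mA.
by move=> c' Cc'; exact: H.
Qed.

(** Uniqueness of product measures identifies the law of the pair with the product of the marginal
    laws; the rest is Tonelli. This is the device that splits one path into two independent
    samples. *)
Lemma indep_integral d1 d2 (T1 : measurableType d1) (T2 : measurableType d2)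
    (X : T -> T1) (Y : T -> T2) (f : T1 * T2 -> \bar R) :
  measurable_fun setT X -> measurable_fun setT Y ->
  (forall A B, measurable A -> measurable B ->
    P ((X @^-1` A) `&` (Y @^-1` B)) = P (X @^-1` A) * P (Y @^-1` B)) ->
  measurable_fun setT f -> (forall x, 0 <= f x) ->
  \int[P]_w f (X w, Y w) = \int[P]_w \int[P]_v f (X w, Y v).
Proof.
move=> mX mY H mf f0.
pose mX' : {mfun T >-> T1} := HB.pack X (isMeasurableFun.Build _ _ _ _ _ mX).
pose mY' : {mfun T >-> T2} := HB.pack Y (isMeasurableFun.Build _ _ _ _ _ mY).
have mXY : measurable_fun setT (fun w => (X w, Y w)) by exact: measurable_fun_pair.
pose mXY' : {mfun T >-> (T1 * T2)%type} :=
  HB.pack (fun w => (X w, Y w)) (isMeasurableFun.Build _ _ _ _ _ mXY).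
pose m1 := distribution P mX'; pose m2 := distribution P mY'.
pose m := distribution P mXY'.
have mE : forall S, measurable S -> (m1 \x m2) S = m S.
  by apply: product_measure_unique => A B mA mB; rewrite /m /m1 /m2 /distribution /pushforward -H.
have -> : \int[P]_w f (X w, Y w) = \int[m]_z f z.
  by rewrite /m /distribution ge0_integral_pushforward.
rewrite (eq_measure_integral (m1 \x m2)); last first.
  by move=> A mA _; apply/esym; exact: mE.
rewrite fubini_tonelli1// /m1 /distribution ge0_integral_pushforward//; last 2 first.
- exact: measurable_fun_fubini_tonelli_F.
- by move=> y _; exact: integral_ge0.
apply: eq_integral => w _ /=; rewrite /fubini_F /m2 /distribution.
rewrite ge0_integral_pushforward//.
exact: measurable_fun_pair2.
Qed.

End independence.

Section plane_operations.
Context d (T : measurableType d) (R : realType).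
Implicit Types f g : T -> R * R.

Lemma measurable_funD2 f g : measurable_fun setT f -> measurable_fun setT g ->
  measurable_fun setT (fun w => f w + g w).
Proof.
move=> /measurable_fun_pairP[f1 f2] /measurable_fun_pairP[g1 g2].
apply/measurable_fun_pairP; split.
- by apply: (measurable_funD f1 g1).
- by apply: (measurable_funD f2 g2).
Qed.

Lemma measurable_funB2 f g : measurable_fun setT f -> measurable_fun setT g ->
  measurable_fun setT (fun w => f w - g w).
Proof.
move=> /measurable_fun_pairP[f1 f2] /measurable_fun_pairP[g1 g2].
apply/measurable_fun_pairP; split.
- by apply: (measurable_funB f1 g1).
- by apply: (measurable_funB f2 g2).
Qed.

Lemma measurable_fun_sum2 (h : nat -> T -> R * R) n :
  (forall i, (i < n)%N -> measurable_fun setT (h i)) ->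
  measurable_fun setT (fun w => \sum_(i < n) h i w).
Proof.
elim: n => [_|n IH H].
  by under eq_fun do rewrite big_ord0; exact: measurable_cst.
under eq_fun do rewrite big_ord_recr/=.
by apply: measurable_funD2; [apply: IH => i ni; apply: H; exact: ltnW|exact: H].
Qed.

End plane_operations.

Section sorting_times.
Context {R : realType}.

(** Brings the times of a cylinder set, given in any order, into the form of a nondecreasing
    sequence indexed by all of [nat], in which independence of increments is assumed. Beyond the
    sorted list the sequence stays at [b]. *)
Lemma sort_times (s : nat -> R) (n : nat) (a b : R) : a <= b ->
  (forall i, (i < n)%N -> a <= s i <= b) ->
  exists (t : nat -> R) (N : nat), [/\ t 0%N = a, forall i, t i <= t i.+1,
    t N = b & forall i, (i < n)%N -> exists2 j, (j <= N)%N & t j = s i].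
Proof.
move=> ab H.
pose l := a :: sort <=%R (mkseq s n).
have inl x : x \in l -> a <= x <= b.
  rewrite inE => /orP[/eqP->|]; first by rewrite lexx.
  by rewrite mem_sort => /mapP[i]; rewrite mem_iota => /= i_n ->; exact: H.
have pl : sorted <=%R l.
  rewrite /l/= path_min_sorted ?(sort_sorted (@le_total _ R))//.
  by apply/allP => x xl; have := inl x; rewrite inE xl orbT => /(_ isT)/andP[].
exists (nth b l), (size l); split => //.
- move=> i; have [il|il] := ltnP i.+1 (size l).
    have /(sortedP b) := pl; apply; exact: il.
  rewrite [leRHS]nth_default//.
  have [il'|il'] := ltnP i (size l); last by rewrite nth_default.
  by have /inl/andP[] := mem_nth b il'.
- by rewrite nth_default.
- move=> i ni; have sil : s i \in l.
    by rewrite inE mem_sort; apply/orP; right; apply/mapP; exists i => //; rewrite mem_iota.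
  by exists (index (s i) l); [exact: index_size|rewrite nth_index].
Qed.

End sorting_times.

Section cylinders.
Context (T : Type) d (S : measurableType d) (R : realType).

(** Finitely many times are constrained at once, rather than a single one, so that this generating
    family is stable under intersection. *)
Definition cylinders (I : set R) (X : R -> T -> S) : set (set T) :=
  [set A | exists (n : nat) (s : nat -> R) (E : nat -> set S),
    [/\ forall i, (i < n)%N -> I (s i), forall i, measurable (E i) &
        A = [set w | forall i, (i < n)%N -> E i (X (s i) w)]]].

Lemma cylindersI I X : setI_closed (cylinders I X).
Proof.
move=> _ _ [n [s [E [sI mE ->]]]] [m [r [F [rI mF ->]]]].
exists (n + m)%N, (fun i => if (i < n)%N then s i else r (i - n)%N),
  (fun i => if (i < n)%N then E i else F (i - n)%N); split.
- move=> i inm; case: ifPn => ni; first exact: sI.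
  by apply: rI; lia.
- by move=> i; case: ifP.
- apply/seteqP; split => [w [H1 H2] i inm|w H]/=.
    case: ifPn => ni; first exact: H1.
    by apply: H2; lia.
  split => i ni.
    by have := H i; rewrite ni; apply; lia.
  have := H (n + i)%N; rewrite ltn_add2l => /(_ ni).
  by rewrite (_ : (n + i < n)%N = false) ?addKn//; lia.
Qed.

Lemma cylinders_preimage (I : set R) X t E : I t -> measurable E ->
  cylinders I X (X t @^-1` E).
Proof.
move=> It mE; exists 1%N, (fun=> t), (fun=> E); split=> //.
by apply/seteqP; split => [w Ew i _//|w /(_ 0%N)]; exact.
Qed.

End cylinders.

Section cylinders_measurable.
Context (T : pointedType) d (S : measurableType d) (R : realType).

Lemma measurable_cylinders (I : set R) (X : R -> T -> S) t : I t ->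
  measurable_fun setT (X t : g_sigma_algebraType (cylinders I X) -> S).
Proof.
move=> It _ E mE; rewrite setTI; apply: sub_sigma_algebra.
exact: cylinders_preimage.
Qed.

Lemma measurable_to_cylinders d1 (T1 : measurableType d1) (I : set R)
    (X : R -> T -> S) (f : T1 -> g_sigma_algebraType (cylinders I X)) :
  (forall t, I t -> measurable_fun setT (fun v => X t (f v))) ->
  measurable_fun setT f.
Proof.
move=> H; apply: (@measurability _ _ _ (g_sigma_algebraType (cylinders I X)) setT f
  (cylinders I X) erefl).
move=> _ [_ [n [s [E [sI mE ->]]]] <-]; rewrite setTI.
have -> : f @^-1` [set w | forall i, (i < n)%N -> E i (X (s i) w)] =
    \bigcap_(i in `I_n) ((fun v => X (s i) (f v)) @^-1` E i).
  by apply/seteqP; split => w /=.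
apply: bigcap_measurableType => i /= ni.
by rewrite -[X in measurable X]setTI; apply: H => //; exact: sI.
Qed.

End cylinders_measurable.

Section brownian_independence.
Context d (T : measurableType d) (R : realType) (P : probability T R).
Context (x0 : R * R) (B : R -> T -> R * R).
Context (pbmB : planar_brownian_motion P x0 B).

Definition past (u : R) := cylinders [set s | 0 <= s <= u] B.
(** Only displacements from the position at [u] are observed; the positions themselves would not be
    independent of the past. *)
Definition future (u : R) :=
  cylinders [set s | u <= s] (fun s w => B s w - B u w).

Lemma past_measurable u : past u `<=` measurable.
Proof.
move=> _ [n [s [E [sI mE ->]]]].
have -> : [set w | forall i, (i < n)%N -> E i (B (s i) w)] =
    \bigcap_(i in `I_n) (B (s i) @^-1` E i) by apply/seteqP; split.
apply: bigcap_measurableType => i /= ni.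
rewrite -[X in measurable X]setTI; apply: (pbm_measurable pbmB) => //.
by have /andP[] := sI i ni.
Qed.

Lemma future_measurable u : 0 <= u -> future u `<=` measurable.
Proof.
move=> u0 _ [n [s [E [sI mE ->]]]].
have -> : [set w | forall i, (i < n)%N -> E i (B (s i) w - B u w)] =
    \bigcap_(i in `I_n) ((fun w => B (s i) w - B u w) @^-1` E i).
  by apply/seteqP; split.
apply: bigcap_measurableType => i /= ni.
rewrite -[X in measurable X]setTI; apply: measurable_funB2 => //.
  by apply: (pbm_measurable pbmB) => //; exact: (le_trans u0 (sI i ni)).
exact: (pbm_measurable pbmB).
Qed.

Let incr (t : nat -> R) i w := B (t i.+1) w - B (t i) w.
Let rect (t : nat -> R) n : set (set T) :=
  [set A | exists E : nat -> set (R * R), (forall i, measurable (E i)) /\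
    A = \bigcap_(i in `I_n) (incr t i @^-1` E i)].

Let rectI t n : setI_closed (rect t n).
Proof.
move=> _ _ [E [mE ->]] [F [mF ->]]; exists (fun i => E i `&` F i); split.
  by move=> i; exact: measurableI.
apply/seteqP; split => [w [H1 H2] i ni|w H].
  by split; [exact: (H1 i ni)|exact: (H2 i ni)].
by split => i ni; case: (H i ni).
Qed.

Let nd_t (t : nat -> R) : (forall i, t i <= t i.+1) ->
  forall i j, (i <= j)%N -> t i <= t j.
Proof.
move=> H i j /subnK <-; elim: (j - i)%N => [|k IH]; first by rewrite add0n.
by rewrite addSn; exact: le_trans (H _).
Qed.

Let mincr t i : 0 <= t 0%N -> (forall i, t i <= t i.+1) ->
  measurable_fun setT (incr t i).
Proof.
move=> t0 tm; apply: measurable_funB2; apply: (pbm_measurable pbmB).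
- by apply: (le_trans t0); exact: nd_t.
- by apply: (le_trans t0); exact: nd_t.
Qed.

Let mrect t n : 0 <= t 0%N -> (forall i, t i <= t i.+1) ->
  rect t n `<=` measurable.
Proof.
move=> t0 tm _ [E [mE ->]]; apply: bigcap_measurableType => i ni.
by rewrite -[X in measurable X]setTI; exact: mincr.
Qed.

Let P_rect t n (E : nat -> set (R * R)) : 0 <= t 0%N ->
  (forall i, t i <= t i.+1) -> (forall i, measurable (E i)) ->
  P (\bigcap_(i in `I_n) (incr t i @^-1` E i)) =
  (\prod_(i < n) P (incr t i @^-1` E i))%E.
Proof.
move=> t0 tm mE.
have := @pbm_independent _ _ _ _ _ _ pbmB n t t0 tm (fun i => E i).
move=> /(_ (fun i => mE i)) <-; congr (P _).
apply/seteqP; split => [w H i _|w H i ni]; first by apply: H => /=.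
exact: (H (Ordinal ni)).
Qed.

Let m_incr_rect t n i : (i < n)%N ->
  measurable_fun setT (incr t i : g_sigma_algebraType (rect t n) -> R * R).
Proof.
move=> ni _ E mE; rewrite setTI; apply: sub_sigma_algebra.
exists (fun j => if j == i then E else setT); split; first by move=> j; case: ifP.
apply/seteqP; split => [w Ew j /= nj|w /(_ i ni)].
  by case: eqP => [->|].
by rewrite eqxx.
Qed.

Let sum_incr t j w : B (t j) w = B (t 0%N) w + \sum_(i < j) incr t i w.
Proof.
elim: j => [|j IH]; first by rewrite big_ord0 addr0.
by rewrite big_ord_recr/= addrA -IH /incr addrC subrK.
Qed.

(** Both cylinders are events on the increments along one sequence of times, the sorted times before
    [u] followed by the sorted times after [u]. Independence of increments gives the product rule on
    rectangles, and Dynkin's theorem carries it first to cylinders and then to the generated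
    sigma-algebras. *)
Lemma past_future_indep u a c : 0 <= u -> <<s past u >> a ->
  <<s future u >> c -> P (a `&` c) = (P a * P c)%E.
Proof.
move=> u0; apply: indep_g_sigma.
- exact: past_measurable.
- exact: cylindersI.
- exact: future_measurable.
- exact: cylindersI.
move=> {}a {}c [n [s [E [sI mE ->]]]] [m [r [F [rI mF ->]]]].
have [t1 [N1 [t10 t1m t1N H1]]] := sort_times u0 sI.
(* A common upper bound of the later times: [u] plus the sum of all delays. *)
have [b ub rb] : exists2 b, u <= b & forall i, (i < m)%N -> u <= r i <= b.
  exists (u + \sum_(i < m) (r i - u)).
    rewrite lerDl sumr_ge0// => i _; rewrite subr_ge0; exact: rI.
  move=> i im; rewrite (rI i im)/= -lerBlDl.
  rewrite (bigD1 (Ordinal im))//= lerDl sumr_ge0// => j _.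
  by rewrite subr_ge0; exact: rI.
have [t2 [N2 [t20 t2m t2N H2]]] := sort_times ub rb.
pose t i := if (i <= N1)%N then t1 i else t2 (i - N1)%N.
have tm i : t i <= t i.+1.
  rewrite /t; case: (ltngtP i N1) => iN.
  - exact: t1m.
  - by rewrite subSn; [exact: t2m|exact: ltnW].
  - by rewrite iN t1N subSn// subnn -t20; exact: t2m.
have t00 : 0 <= t 0%N by rewrite /t leq0n t10.
have tN j : t (N1 + j)%N = t2 j.
  rewrite /t; case: leqP => jN; last by rewrite addKn.
  have -> : j = 0%N by lia.
  by rewrite addn0 t1N t20.
pose t' j := t (N1 + j)%N.
have t'0 : 0 <= t' 0%N by rewrite /t' tN t20.
have t'm i : t' i <= t' i.+1 by rewrite /t' addnS; exact: tm.
apply: (@indep_g_sigma _ _ _ P (rect t N1) (rect t' N2)).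
- exact: mrect.
- exact: rectI.
- exact: mrect.
- exact: rectI.
- move=> _ _ [E' [mE' ->]] [F' [mF' ->]].
  pose G i := if (i < N1)%N then E' i else F' (i - N1)%N.
  have mG i : measurable (G i) by rewrite /G; case: ifP.
  have -> : (\bigcap_(i in `I_N1) (incr t i @^-1` E' i)) `&`
      (\bigcap_(i in `I_N2) (incr t' i @^-1` F' i)) =
      \bigcap_(i in `I_(N1 + N2)) (incr t i @^-1` G i).
    apply/seteqP; split => [w [h1 h2] i /= iN|w h]; rewrite ?/G.
      case: ltnP => iN1; first exact: h1.
      have /(_ (i - N1)%N) := h2.
      by rewrite /= /incr /t' addnS subnKC//; apply; lia.
    split => i /= iN.
      by have := h i; rewrite /G/= iN; apply; lia.
    have := h (N1 + i)%N; rewrite /G/= ltn_add2l addKn => /(_ iN).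
    by rewrite (_ : (N1 + i < N1)%N = false) ?/incr ?/t' ?addnS//; lia.
  rewrite !P_rect// big_split_ord/=; congr (_ * _)%E; apply: eq_bigr => i _.
    by rewrite /G ltn_ord.
  rewrite /G (_ : (N1 + i < N1)%N = false); last by lia.
  by rewrite addKn /incr /t' addnS.
- have -> : [set w | forall i, (i < n)%N -> E i (B (s i) w)] =
    \bigcap_(i in `I_n) (B (s i) @^-1` E i) by apply/seteqP; split.
  apply: (@bigcap_measurableType _ (g_sigma_algebraType (rect t N1))) => i /= ni.
  have [j jN <-] := H1 i ni.
  rewrite (_ : t1 j = t j); last by rewrite /t jN.
  have : measurable_fun setT (B (t j) : g_sigma_algebraType (rect t N1) -> R * R).
    (* The starting point is deterministic, so positions before [u] are functions of the increments
       alone. *)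
    rewrite (_ : B (t j) = fun w => B (t 0%N) w + \sum_(i < j) incr t i w); last first.
      by apply/funext => w; exact: sum_incr.
    apply: measurable_funD2.
      rewrite (_ : B _ = cst x0); first exact: measurable_cst.
      by apply/funext => w; rewrite /t leq0n t10 (pbm_start pbmB).
    by apply: measurable_fun_sum2 => k kj; apply: m_incr_rect; lia.
  by move=> /(_ measurableT _ (mE i)); rewrite setTI.
- have -> : [set w | forall i, (i < m)%N -> F i (B (r i) w - B u w)] =
    \bigcap_(i in `I_m) ((fun w => B (r i) w - B u w) @^-1` F i).
    by apply/seteqP; split.
  apply: (@bigcap_measurableType _ (g_sigma_algebraType (rect t' N2))) => i /= ni.
  have [j jN <-] := H2 i ni.
  have : measurable_fun setT
      ((fun w => B (t2 j) w - B u w) : g_sigma_algebraType (rect t' N2) -> R * R).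
    rewrite (_ : (fun w => _) = fun w => \sum_(i < j) incr t' i w); last first.
      apply/funext => w; have := sum_incr t' j w.
      rewrite /t' tN tN t20 => ->; by rewrite addrC addKr.
    by apply: measurable_fun_sum2 => k kj; apply: m_incr_rect; lia.
  by move=> /(_ measurableT _ (mF i)); rewrite setTI.
Qed.

End brownian_independence.

(** * Integration against densities and translation invariance *)

Section density.
Local Open Scope ereal_scope.
Context d (T : measurableType d) (R : realType).

Import HBNNSimple.

Lemma ge0_integral_density (m m' : {measure set T -> \bar R}) (h : T -> R)
    (f : T -> \bar R) :
  measurable_fun setT h -> (forall x, (0 <= h x)%R) ->
  (forall E, measurable E -> m' E = \int[m]_(x in E) (h x)%:E) ->
  measurable_fun setT f -> (forall x, 0 <= f x) ->
  \int[m']_x f x = \int[m]_x (f x * (h x)%:E).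
Proof.
move=> mh h0 mE mf f0.
pose f_ := nnsfun_approx measurableT mf.
have cf x : (f_ n x)%:E @[n --> \oo] --> f x by exact: cvg_nnsfun_approx.
transitivity (lim (\int[m']_x (f_ n x)%:E @[n --> \oo])).
  rewrite -monotone_convergence//=.
  - by apply: eq_integral => x _; apply/esym/cvg_lim => //.
  - by move=> n; exact/measurable_EFinP/measurable_funTS.
  - by move=> n x _; rewrite lee_fin.
  - by move=> x _ a b ab; rewrite lee_fin; exact/lefP/nd_nnsfun_approx.
transitivity (lim (\int[m]_x ((f_ n x)%:E * (h x)%:E) @[n --> \oo])); last first.
  rewrite -monotone_convergence//=.
  - apply: eq_integral => x _; apply/cvg_lim => //.
    apply: cvgeZr => //; exact: cf.
  - move=> n; apply: emeasurable_funM; last exact/measurable_EFinP.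
    exact/measurable_EFinP/measurable_funTS.
  - by move=> n x _; rewrite mule_ge0 ?lee_fin.
  - move=> x _ a b ab; rewrite lee_wpmul2r ?lee_fin//.
    exact/lefP/nd_nnsfun_approx.
congr (limn _); apply/funext => n.
rewrite integralT_nnsfun sintegralE.
rewrite [RHS](eq_integral (fun x => \sum_(r \in range (f_ n))
    ((r * \1_(f_ n @^-1` [set r]) x)%:E * (h x)%:E))); last first.
  move=> x _; rewrite fimfunE -fsumEFin// ge0_mule_fsuml// => r.
  by rewrite EFinM nnfun_muleindic_ge0.
rewrite ge0_integral_fsum//; last 2 first.
- move=> r; apply: emeasurable_funM; last exact/measurable_EFinP.
  exact/measurable_EFinP/measurable_funM.
- by move=> r x _; rewrite mule_ge0 ?lee_fin// -lee_fin EFinM nnfun_muleindic_ge0.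
apply: eq_fsbigr => r _.
have [r0|r0] := leP 0%R r; last first.
  rewrite preimage_nnfun0// measure0 mule0 integral0_eq// => x _.
  by rewrite indicE in_set0 mulr0 mul0e.
rewrite mE// integral_mkcond -ge0_integralZl//; last 2 first.
- by apply/(measurable_restrictT _ _).1 => //; exact/measurable_funTS/measurable_EFinP.
- by move=> x _; rewrite patchE; case: ifP => //; rewrite lee_fin.
apply: eq_integral => x _; rewrite patchE indicE.
by case: ifP => _; rewrite ?mulr1// mulr0 mul0e mule0.
Qed.

End density.

Section lebesgue_plane.
Local Open Scope ereal_scope.
Context {R : realType}.
Let mu := @lebesgue_measure R.

Lemma lebesgue_measure_translation (c : R) (A : set R) : measurable A ->
  mu [set x | A (x + c)%R] = mu A.
Proof.
move=> mA.
have mf : measurable_fun setT ((fun x => (x + c)%R) : measurableTypeR R -> measurableTypeR R).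
  exact: measurable_funD.
pose f : {mfun measurableTypeR R >-> measurableTypeR R} :=
  HB.pack (fun x : R => (x + c)%R) (isMeasurableFun.Build _ _ _ _ _ mf).
transitivity (pushforward mu f A) => //.
apply/esym/lebesgue_measure_unique => //= _ [[a b]] _ <-.
rewrite /pushforward/=.
have -> : f @^-1` `]a, b]%classic = `](a - c)%R, (b - c)%R]%classic.
  by apply/seteqP; split => x; rewrite /= !in_itv/= ltrBlDr lerBrDr.
rewrite /mu !lebesgue_measure_itv/= !lte_fin ltrD2r.
by rewrite -!EFinB opprB addrA subrK.
Qed.

Lemma ge0_integral_translation (c : R) (f : R -> \bar R) :
  measurable_fun setT f -> (forall x, 0 <= f x) ->
  \int[mu]_x f (x + c)%R = \int[mu]_x f x.
Proof.
move=> mf f0.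
have mg : measurable_fun setT ((fun x => (x + c)%R) : measurableTypeR R -> measurableTypeR R).
  exact: measurable_funD.
pose g : {mfun measurableTypeR R >-> measurableTypeR R} :=
  HB.pack (fun x : R => (x + c)%R) (isMeasurableFun.Build _ _ _ _ _ mg).
transitivity (\int[pushforward mu g]_x f x).
  by rewrite ge0_integral_pushforward.
by apply: eq_measure_integral => A mA _; exact: lebesgue_measure_translation.
Qed.

End lebesgue_plane.

(** * The planar heat kernel *)

Lemma integral_indicT d (T : measurableType d) (R : realType)
    (m : {measure set T -> \bar R}) (E : set T) : measurable E ->
  (\int[m]_x (\1_E x)%:E = m E)%E.
Proof. by move=> mE; rewrite integral_indic// setIT. Qed.

Notation leb2 := (@lebesgue_measure _ \x @lebesgue_measure _)%E.

Section heat_kernel.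
Context {R : realType}.
Implicit Types (t a b : R) (z x y v : R * R).

Definition nsq z : R := z.1 ^+ 2 + z.2 ^+ 2.

Definition gk t z : R := (2 * pi * t)^-1 * expR (- nsq z / (2 * t)).

Lemma nsq_ge0 z : 0 <= nsq z. Proof. by rewrite addr_ge0// sqr_ge0. Qed.

Lemma nsqN z : nsq (- z) = nsq z. Proof. by rewrite /nsq /= !sqrrN. Qed.

Lemma gkN t z : gk t (- z) = gk t z. Proof. by rewrite /gk nsqN. Qed.

Lemma gkC t x y : gk t (x - y) = gk t (y - x). Proof. by rewrite -gkN opprB. Qed.

Lemma twopi_gt0 t : 0 < t -> 0 < 2 * pi * t.
Proof. by move=> t0; rewrite !mulr_gt0// pi_gt0. Qed.

Lemma gk_ge0 t z : 0 <= t -> 0 <= gk t z.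
Proof. by move=> t0; rewrite mulr_ge0 ?expR_ge0// invr_ge0 !mulr_ge0// pi_ge0. Qed.

Lemma gk_le t z : 0 < t -> gk t z <= (2 * pi * t)^-1.
Proof.
move=> t0; rewrite ler_piMr ?invr_ge0 ?(ltW (twopi_gt0 _))//.
by rewrite -expR0 ler_expR mulNr oppr_le0 divr_ge0 ?nsq_ge0// mulr_ge0// ltW.
Qed.

Lemma measurable_nsq : measurable_fun setT nsq.
Proof. by apply: measurable_funD; apply: measurable_funX. Qed.

Lemma measurable_gk t : measurable_fun setT (gk t).
Proof.
apply: measurable_funM => //; apply: measurableT_comp => //.
apply: measurable_funM => //; apply: measurableT_comp => //.
exact: measurable_nsq.
Qed.

(** Completion of the square in [v]. It yields the Chapman-Kolmogorov identity, and later the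
    barycentre attached to two visited points. *)
Lemma normal_pdf_product (a b x y v : R) : 0 < a -> 0 < b ->
  normal_pdf x (Num.sqrt a) v * normal_pdf y (Num.sqrt b) v =
  normal_pdf 0 (Num.sqrt (a + b)) (x - y) *
  normal_pdf ((b * x + a * y) / (a + b)) (Num.sqrt (a * b / (a + b))) v.
Proof.
move=> a0 b0; have ab0 : 0 < a + b by exact: addr_gt0.
have c0 : 0 < a * b / (a + b) by rewrite divr_gt0// mulr_gt0.
have s t : 0 < t -> Num.sqrt t != 0 by move=> t0; rewrite sqrtr_eq0 -ltNge.
rewrite !normal_pdfE ?s// /normal_peak /normal_fun.
rewrite !sqr_sqrtr ?(ltW a0) ?(ltW b0) ?(ltW ab0) ?(ltW c0)//.
rewrite mulrACA [RHS]mulrACA -!expRD -!invfM -!sqrtrM; last 2 first.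
- by rewrite mulrn_wge0// mulr_ge0 ?pi_ge0// ltW.
- by rewrite mulrn_wge0// mulr_ge0 ?pi_ge0// ltW.
have abn := lt0r_neq0 ab0; have an := lt0r_neq0 a0; have bn := lt0r_neq0 b0.
congr (_^-1 * expR _).
  move: (@pi R) => p; rewrite !mulr2n; congr (Num.sqrt _).
  by field.
rewrite !mulr2n; field.
by rewrite abn !lt0r_neq0 ?addr_gt0 ?mulr_gt0.
Qed.

Lemma gkE t z : 0 < t ->
  gk t z = normal_pdf 0 (Num.sqrt t) z.1 * normal_pdf 0 (Num.sqrt t) z.2.
Proof.
move=> t0; rewrite !normal_pdfE ?sqrtr_eq0 -?ltNge// /normal_peak /normal_fun.
rewrite mulrACA -expRD -invfM -expr2 sqr_sqrtr; last first.
  by rewrite mulrn_wge0// mulr_ge0 ?pi_ge0// sqr_ge0.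
rewrite !sqr_sqrtr ?ltW// /gk /nsq !subr0 !mulr2n.
have tn := lt0r_neq0 t0.
congr (_^-1 * expR _); first by move: (@pi R) => p; ring.
by field; rewrite ?tn ?lt0r_neq0 ?addr_gt0.
Qed.

Lemma normal_pdf_translation (m s v : R) : normal_pdf 0 s (v - m) = normal_pdf m s v
  \/ s = 0.
Proof.
have [->|s0] := eqVneq s 0; first by right.
by left; rewrite !normal_pdfE// /normal_fun subr0.
Qed.

Lemma gkBE t v x : 0 < t ->
  gk t (v - x) = normal_pdf x.1 (Num.sqrt t) v.1 * normal_pdf x.2 (Num.sqrt t) v.2.
Proof.
move=> t0; rewrite gkE//.
have s0 : Num.sqrt t <> 0 by apply/eqP; rewrite sqrtr_eq0 -ltNge.
have [->|//] := normal_pdf_translation x.1 (Num.sqrt t) v.1.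
by have [->|//] := normal_pdf_translation x.2 (Num.sqrt t) v.2.
Qed.

Local Open Scope ereal_scope.

Lemma integral_leb2 (f : R * R -> \bar R) :
  measurable_fun setT f -> (forall x, 0 <= f x) ->
  \int[leb2]_v f v =
  \int[@lebesgue_measure R]_x \int[@lebesgue_measure R]_y f (x, y).
Proof. by move=> mf f0; rewrite fubini_tonelli1. Qed.

Lemma integral_leb2_prod (f g : R -> R) :
  measurable_fun setT f -> (forall u, (0 <= f u)%R) ->
  measurable_fun setT g -> (forall u, (0 <= g u)%R) ->
  \int[leb2]_v (f v.1 * g v.2)%:E =
  \int[@lebesgue_measure R]_u (f u)%:E * \int[@lebesgue_measure R]_u (g u)%:E.
Proof.
move=> mf f0 mg g0; rewrite integral_leb2//=; last 2 first.
- apply/measurable_EFinP; apply: measurable_funM; exact: measurableT_comp.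
- by move=> x; rewrite lee_fin mulr_ge0.
under eq_integral => x _.
  under eq_integral do rewrite EFinM.
  rewrite ge0_integralZl//; first over.
  - exact/measurable_EFinP.
  - by move=> y _; rewrite lee_fin.
  - by rewrite lee_fin.
rewrite ge0_integralZr//.
- exact/measurable_EFinP.
- by move=> x _; rewrite lee_fin.
- by apply: integral_ge0 => x _; rewrite lee_fin.
Qed.

Lemma gk_product a b x y v : (0 < a)%R -> (0 < b)%R ->
  (gk a (v - x) * gk b (v - y) = gk (a + b) (x - y) *
   (normal_pdf ((b * x.1 + a * y.1) / (a + b)) (Num.sqrt (a * b / (a + b))) v.1 *
    normal_pdf ((b * x.2 + a * y.2) / (a + b)) (Num.sqrt (a * b / (a + b))) v.2))%R.
Proof.
move=> a0 b0; have ab0 : (0 < a + b)%R by exact: addr_gt0.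
have E1 := normal_pdf_product x.1 y.1 v.1 a0 b0.
have E2 := normal_pdf_product x.2 y.2 v.2 a0 b0.
have -> := gkBE v x a0; have -> := gkBE v y b0; have -> := gkE (x - y)%R ab0.
by rewrite mulrACA; etransitivity; [exact: (congr2 *%R E1 E2)|exact: mulrACA].
Qed.

Lemma integral_gk_gk a b x y : (0 < a)%R -> (0 < b)%R ->
  \int[leb2]_v (gk a (v - x) * gk b (v - y))%:E = (gk (a + b) (x - y))%:E.
Proof.
move=> a0 b0; have ab0 : (0 < a + b)%R by exact: addr_gt0.
under eq_integral do rewrite gk_product// EFinM.
have mnp m s : measurable_fun setT (normal_pdf m s : R -> R).
  exact: measurable_normal_pdf.
have np0 m s (u : R) : (0 <= normal_pdf m s u)%R by exact: normal_pdf_ge0.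
rewrite ge0_integralZl//; last 3 first.
- apply/measurable_EFinP; apply: measurable_funM;
    by apply: measurableT_comp => //; exact: mnp.
- by move=> v _; rewrite lee_fin mulr_ge0.
- by rewrite lee_fin gk_ge0// ltW.
by rewrite integral_leb2_prod// !integral_normal_pdf !mule1.
Qed.

Lemma integral_gk t x : (0 < t)%R -> \int[leb2]_v (gk t (v - x))%:E = 1.
Proof.
move=> t0; under eq_integral do rewrite gkBE//.
have mnp m s : measurable_fun setT (normal_pdf m s : R -> R).
  exact: measurable_normal_pdf.
have np0 m s (u : R) : (0 <= normal_pdf m s u)%R by exact: normal_pdf_ge0.
by rewrite integral_leb2_prod// !integral_normal_pdf mule1.
Qed.

Lemma integral_leb2_translation (c : R * R) (f : R * R -> \bar R) :
  measurable_fun setT f -> (forall x, 0 <= f x) ->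
  \int[leb2]_v f (v + c)%R = \int[leb2]_v f v.
Proof.
move=> mf f0; rewrite !integral_leb2//; last first.
  by apply: measurableT_comp => //; apply: measurable_funD2.
rewrite -[RHS](ge0_integral_translation c.1)//; last 2 first.
- exact: measurable_fun_fubini_tonelli_F.
- by move=> x; apply: integral_ge0.
apply: eq_integral => x _ /=.
rewrite -[RHS](ge0_integral_translation c.2)//.
by apply: measurable_fun_pair2.
Qed.

Lemma integral_normal2 t (f : R * R -> \bar R) : (0 < t)%R ->
  measurable_fun setT f -> (forall x, 0 <= f x) ->
  \int[(normal_prob 0 (Num.sqrt t) \x normal_prob 0 (Num.sqrt t))]_v f v =
  \int[leb2]_v (f v * (gk t v)%:E).
Proof.
move=> t0 mf f0; apply: ge0_integral_density => //.
- exact: measurable_gk.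
- by move=> x; rewrite gk_ge0// ltW.
move=> E mE.
pose np := normal_pdf 0 (Num.sqrt t).
have mnp : measurable_fun setT np by exact: measurable_normal_pdf.
have npd (A : set R) : measurable A ->
    normal_prob 0 (Num.sqrt t) A = \int[lebesgue_measure]_(x in A) (np x)%:E by [].
have mE1 : measurable_fun setT (\1_E : R * R -> R) by exact: measurable_indic.
have mEx (u : R) : measurable_fun setT (fun y : R => (\1_E (u, y) : R)%:E).
  by apply/measurable_EFinP; apply: (measurableT_comp mE1); exact: pair1_measurable.
transitivity (\int[normal_prob 0 (Num.sqrt t) \x normal_prob 0 (Num.sqrt t)]_x
    (\1_E x)%:E).
  by apply/esym; exact: integral_indicT.
rewrite fubini_tonelli1//; last exact/measurable_EFinP.
rewrite (@ge0_integral_density _ _ _ lebesgue_measure _ np)//; last 3 first.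
- by move=> x; exact: normal_pdf_ge0.
- apply: measurable_fun_fubini_tonelli_F => //; exact/measurable_EFinP.
- by move=> x; apply: integral_ge0 => y _; rewrite /= lee_fin.
rewrite [RHS]integral_mkcond.
pose f' : R * R -> \bar R := (fun x => (gk t x)%:E) \_ E.
apply: (etrans _ (esym (@integral_leb2 f' _ _))); last 2 first.
- apply/(measurable_restrictT _ _).1 => //; apply/measurable_funTS/measurable_EFinP.
  exact: measurable_gk.
- by move=> x; rewrite /f' patchE; case: ifP => // _; rewrite lee_fin gk_ge0// ltW.
apply: eq_integral => x _; rewrite /fubini_F.
rewrite (@ge0_integral_density _ _ _ lebesgue_measure _ np)//; last 2 first.
- by move=> y; exact: normal_pdf_ge0.
- exact: mEx.
rewrite -ge0_integralZr//.
- apply: eq_integral => y _; rewrite /f' patchE indicE gkE//=.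
  case: ifP => _; rewrite ?mul1e ?mul0e//.
  by rewrite -EFinM mulrC.
- apply: emeasurable_funM; last exact/measurable_EFinP.
  exact: mEx.
- by move=> y _; rewrite mule_ge0// lee_fin// normal_pdf_ge0.
- by rewrite lee_fin normal_pdf_ge0.
Qed.

End heat_kernel.

(* [lebesgue_measure] lives on [measurableTypeR R], whose display differs from
   the one of [R]; [area] is the planar Lebesgue measure on [R * R] itself. *)
Definition area (R : realType) : set (R * R) -> \bar R := fun A => leb2 A.

Section area.
Context (R : realType).
Local Open Scope ereal_scope.
Let R2 := (measurableTypeR R * measurableTypeR R)%type.

Let area0 : area (R := R) set0 = 0.
Proof. exact: (measure0 (@lebesgue_measure R \x @lebesgue_measure R)). Qed.

Let area_ge0 (A : set (R * R)) : 0 <= area A.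
Proof. exact: (measure_ge0 (@lebesgue_measure R \x @lebesgue_measure R) A). Qed.

Let area_sigma_additive : semi_sigma_additive (@area R).
Proof.
move=> F mF tF mUF.
exact: (@measure_semi_sigma_additive _ R2 R
  (@lebesgue_measure R \x @lebesgue_measure R) F mF tF mUF).
Qed.

HB.instance Definition _ := isMeasure.Build _ (R * R)%type R (@area R)
  area0 area_ge0 area_sigma_additive.

Let area_sigma_finite : sigma_finite setT (@area R).
Proof.
have /sigma_finiteP[F [TF ndF Foo]] := sigma_finiteT (@lebesgue_measure R).
exists (fun k => F k `*` F k).
  rewrite predeqE => -[x y]; split => // _.
  have [n _ Fnx] : (\bigcup_k F k) x by rewrite -TF.
  have [k _ Fky] : (\bigcup_k F k) y by rewrite -TF.
  exists (maxn n k) => //; split => /=.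
  - by move: x Fnx; exact/subsetPset/ndF/leq_maxl.
  - by move: y Fky; exact/subsetPset/ndF/leq_maxr.
move=> k; have [mFk Fk] := Foo k; split; first exact: measurableX.
rewrite /area product_measure1E//.
by apply: lte_mul_pinfty => //; rewrite ge0_fin_numE.
Qed.

HB.instance Definition _ := Measure_isSigmaFinite.Build _ (R * R)%type R (@area R)
  area_sigma_finite.

Let toplane : R2 -> (R * R)%type := id.

Let measurable_toplane : measurable_fun setT toplane.
Proof. exact: (@measurable_id _ R2). Qed.

Lemma integral_area (f : R * R -> \bar R) :
  measurable_fun setT f -> (forall x, 0 <= f x) ->
  \int[@area R]_v f v = \int[leb2]_v f v.
Proof.
move=> mf f0.
transitivity (\int[pushforward (@lebesgue_measure R \x @lebesgue_measure R) toplane]_v f v).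
  exact: eq_measure_integral.
by rewrite ge0_integral_pushforward.
Qed.

End area.

Section area_theory.
Context (R : realType).
Local Open Scope ereal_scope.
Implicit Types (x y c : R * R).

Lemma measurable_gkB (t : R) y : measurable_fun setT (fun v : R * R => gk t (v - y)%R).
Proof.
by apply: (measurableT_comp (measurable_gk _)); exact: measurable_funB2.
Qed.

Lemma area_gk_gk a b x y : (0 < a)%R -> (0 < b)%R ->
  \int[@area R]_v (gk a (v - x) * gk b (v - y))%:E = (gk (a + b) (x - y))%:E.
Proof.
move=> a0 b0; rewrite integral_area ?integral_gk_gk//.
- by apply/measurable_EFinP; apply: measurable_funM; exact: measurable_gkB.
- by move=> v; rewrite lee_fin mulr_ge0// gk_ge0// ltW.
Qed.

Lemma area_gk t x : (0 < t)%R -> \int[@area R]_v (gk t (v - x))%:E = 1.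
Proof.
move=> t0; rewrite integral_area ?integral_gk//.
- by apply/measurable_EFinP; exact: measurable_gkB.
- by move=> v; rewrite lee_fin gk_ge0// ltW.
Qed.

Lemma area_translation (c : R * R) (f : R * R -> \bar R) :
  measurable_fun setT f -> (forall x, 0 <= f x) ->
  \int[@area R]_v f (v + c)%R = \int[@area R]_v f v.
Proof.
move=> mf f0; rewrite !integral_area ?integral_leb2_translation//.
by apply: measurableT_comp => //; exact: measurable_funD2.
Qed.

Lemma area_rect (A B : set R) : measurable A -> measurable B ->
  area (A `*` B) = lebesgue_measure A * lebesgue_measure B.
Proof. by move=> mA mB; rewrite /area product_measure1E. Qed.

End area_theory.

Lemma gk_expR (R : realType) (t : R) z :
  gk t z = (2 * pi * t)^-1 * expR (- nsq z / (2 * t)).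
Proof. by []. Qed.

(** Follows from [u <= expR u] at [u = nsq z / (2 * t)]; the point is uniformity in [t]. *)
Lemma gk_le_nsq (R : realType) (t : R) z : 0 < t -> 0 < nsq z ->
  gk t z <= (pi * nsq z)^-1.
Proof.
move=> t0 z0; rewrite gk_expR mulNr expRN -invfM lef_pV2 ?posrE; last 2 first.
- by rewrite mulr_gt0 ?twopi_gt0 ?expR_gt0.
- by rewrite mulr_gt0 ?pi_gt0.
have p0 : 0 < @pi R by exact: pi_gt0.
have h : nsq z / (2 * t) <= expR (nsq z / (2 * t)).
  by apply: le_trans (expR_ge1Dx _); rewrite lerDr.
apply: le_trans (ler_wpM2l _ h); last by rewrite ltW// twopi_gt0.
move: (@pi R) p0 => p p0; rewrite [leRHS](_ : _ = p * nsq z)//.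
by field; rewrite gt_eqF.
Qed.

#[global] Opaque gk.

(** * The Markov property at deterministic times *)

Section brownian_markov.
Context d (T : measurableType d) (R : realType) (P : probability T R).
Context (x0 : R * R) (B : R -> T -> R * R).
Context (pbmB : planar_brownian_motion P x0 B).
Local Open Scope ereal_scope.

Local Notation pT u := (g_sigma_algebraType (past B u)).
Local Notation fT u := (g_sigma_algebraType (future B u)).

Lemma measurable_B t : (0 <= t)%R -> measurable_fun setT (B t).
Proof. exact: (pbm_measurable pbmB). Qed.

Lemma adapted_B s t : (0 <= s <= t)%R -> measurable_fun setT (B s : pT t -> R * R).
Proof. by move=> st; exact: measurable_cylinders. Qed.

Lemma measurable_to_past u : measurable_fun setT (id : T -> pT u).
Proof.
apply: measurable_to_cylinders => t /= /andP[t0 _]; exact: measurable_B.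
Qed.

Lemma measurable_to_future u : (0 <= u)%R -> measurable_fun setT (id : T -> fT u).
Proof.
move=> u0; apply: measurable_to_cylinders => t /= ut.
by apply: measurable_funB2; apply: measurable_B => //; exact: le_trans ut.
Qed.

Lemma past_mono u v : (u <= v)%R -> measurable_fun setT (id : pT v -> pT u).
Proof.
move=> uv; apply: measurable_to_cylinders => t /= /andP[t0 tu].
by apply: adapted_B; rewrite t0 (le_trans tu).
Qed.

Lemma adapted_measurable d' (S : measurableType d') u (F : T -> S) :
  measurable_fun setT (F : pT u -> S) -> measurable_fun setT F.
Proof.
move=> mF.
exact: (@measurableT_comp _ _ _ T (pT u) S F setT id mF (measurable_to_past (u:=u))).
Qed.

(** Past and future of [u] are two measurable structures on the same sample space. A function
    measurable for their product may be evaluated on the diagonal or on two independent samples with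
    the same expectation. *)
Lemma decoupling u (f : pT u * fT u -> \bar R) : (0 <= u)%R ->
  measurable_fun setT f -> (forall x, 0 <= f x) ->
  \int[P]_w f (w, w) = \int[P]_w \int[P]_v f (w, v).
Proof.
move=> u0 mf f0.
apply: (@indep_integral _ T _ P _ _ (pT u) (fT u) id id) => //.
- exact: measurable_to_past.
- exact: measurable_to_future.
- by move=> a c ma mc; rewrite !preimage_id; exact: (past_future_indep pbmB u0).
Qed.

Lemma incr_law s t (g : R * R -> \bar R) : (0 <= s < t)%R ->
  measurable_fun setT g -> (forall x, 0 <= g x) ->
  \int[P]_w g (B t w - B s w)%R = \int[@area R]_z (g z * (gk (t - s) z)%:E).
Proof.
move=> /andP[s0 st] mg g0; rewrite integral_area; last 2 first.
- apply: emeasurable_funM => //; apply/measurable_EFinP; exact: measurable_gk.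
- by move=> x; rewrite mule_ge0// lee_fin gk_ge0// subr_ge0 ltW.
rewrite -integral_normal2 ?subr_gt0//.
have mX : measurable_fun setT (fun w => (B t w - B s w)%R).
  by apply: measurable_funB2; apply: measurable_B => //; exact: le_trans (ltW st).
pose R2 := (measurableTypeR R * measurableTypeR R)%type.
pose X : {mfun T >-> R2} :=
  HB.pack (fun w => (B t w - B s w)%R) (isMeasurableFun.Build _ _ T R2 _ mX).
transitivity (\int[distribution P X]_z g z).
  by rewrite /distribution ge0_integral_pushforward.
apply: eq_measure_integral => E mE _.
exact: (pbm_gaussian pbmB s0 st).
Qed.

(** The increment after [s] is independent of the past and has density [gk (t - s)]; translation
    invariance of [area] recentres it at [B s w]. *)
Lemma markov s t (f : pT s * (R * R) -> \bar R) : (0 <= s < t)%R ->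
  measurable_fun setT f -> (forall x, 0 <= f x) ->
  \int[P]_w f (w, B t w) =
  \int[P]_w \int[@area R]_v (f (w, v) * (gk (t - s) (v - B s w))%:E).
Proof.
move=> /andP[s0 st] mf f0.
have mBs : measurable_fun setT (B s : pT s -> R * R).
  by apply: adapted_B; rewrite s0 lexx.
pose F (x : pT s * (R * R)) := f (x.1, (x.2 + B s x.1)%R).
have mF : measurable_fun setT F.
  apply: (measurableT_comp mf); apply: measurable_fun_pair => //.
  by apply: measurable_funD2 => //; exact: (measurableT_comp mBs).
transitivity (\int[P]_w F (w, (B t w - B s w)%R)).
  by apply: eq_integral => w _; rewrite /F/= subrK.
rewrite (@indep_integral _ T _ P _ _ (pT s) _ id
  (fun w => (B t w - B s w)%R) F)//; last 4 first.
- exact: (measurable_to_past (u:=s)).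
- by apply: measurable_funB2; apply: measurable_B => //; exact: le_trans (ltW st).
- move=> a c ma mc; rewrite preimage_id; apply: (past_future_indep pbmB s0) => //.
  apply: sub_sigma_algebra; apply: (@cylinders_preimage _ _ _ _ [set r | s <= r]%R
    (fun r w => (B r w - B s w)%R)) => //=; exact: ltW.
- by move=> x; exact: f0.
apply: eq_integral => w _.
have mFw : measurable_fun setT (fun z => F (w, z)).
  apply: (measurableT_comp mF); exact: pair1_measurable.
have st' : (0 <= s < t)%R by rewrite s0.
transitivity (\int[@area R]_z (F (w, z) * (gk (t - s) z)%:E)).
  by apply: (incr_law st' mFw) => z; exact: f0.
have mh : measurable_fun setT
    (fun v => f (w, v) * (gk (t - s) (v - B s w))%:E).
  apply: emeasurable_funM.
    by apply: (measurableT_comp mf); exact: pair1_measurable.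
  apply/measurable_EFinP; apply: (measurableT_comp (measurable_gk _)).
  by apply: measurable_funB2.
pose h v := f (w, v) * (gk (t - s) (v - B s w))%:E.
transitivity (\int[@area R]_z h (z + B s w)%R).
  by apply: eq_integral => z _; rewrite /F/h/= addrK.
apply: (area_translation (B s w) mh) => v.
by rewrite mule_ge0// lee_fin gk_ge0// subr_ge0 ltW.
Qed.

Lemma adapted_tensor d1 d2 (S1 : measurableType d1) (S2 : measurableType d2)
  (F : S1 -> R) (g : S2 -> R) : measurable_fun setT F -> measurable_fun setT g ->
  measurable_fun setT (fun x : S1 * S2 => (F x.1 * g x.2)%:E).
Proof.
move=> mF mg; apply/measurable_EFinP; apply: measurable_funM.
- exact: measurableT_comp.
- exact: measurableT_comp.
Qed.

(** Chapman-Kolmogorov read along the path: running the path from [s] to [t] adds [t - s] to the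
    smoothing parameter. Most conditional expectations below are computed in this form. *)
Lemma markov_gk s t a y (F : T -> R) : (0 <= s <= t)%R -> (0 < a)%R ->
  measurable_fun setT (F : pT s -> R) -> (forall w, (0 <= F w)%R) ->
  \int[P]_w (F w * gk a (B t w - y))%:E =
  \int[P]_w (F w * gk (a + (t - s)) (B s w - y))%:E.
Proof.
move=> /andP[s0]; rewrite le_eqVlt => /predU1P[<-|st] a0 mF F0.
  by rewrite subrr addr0.
have mg : measurable_fun setT (fun z : R * R => gk a (z - y)%R).
  by apply: (measurableT_comp (measurable_gk a)); exact: measurable_funB2.
have := @markov s t (fun x => (F x.1 * gk a (x.2 - y))%:E).
rewrite /= s0 st => ->//.
- apply: eq_integral => w _.
  under eq_integral do rewrite -EFinM -mulrA EFinM.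
  rewrite ge0_integralZl//; last 3 first.
  + apply/measurable_EFinP; apply: measurable_funM => //.
    by apply: (measurableT_comp (measurable_gk _)); exact: measurable_funB2.
  + by move=> v _; rewrite lee_fin mulr_ge0// gk_ge0 ?subr_ge0// ltW.
  + by rewrite lee_fin.
  by rewrite area_gk_gk ?subr_gt0// -EFinM gkC.
- exact: (adapted_tensor mF mg).
- by move=> x; rewrite lee_fin mulr_ge0// gk_ge0// ltW.
Qed.

(** The heat kernel is at most its value at the origin, so the position at time [t] may be replaced
    by Lebesgue measure at the price of a constant, whatever the past. *)
Lemma markov_density s t (f : pT s * (R * R) -> \bar R) : (0 <= s < t)%R ->
  measurable_fun setT f -> (forall x, 0 <= f x) ->
  \int[P]_w f (w, B t w) <=
  ((2 * pi * (t - s))^-1)%:E * \int[@area R]_v \int[P]_w f (w, v).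
Proof.
move=> /andP[s0 st] mf f0; rewrite markov ?s0//.
have ts0 : (0 < t - s)%R by rewrite subr_gt0.
have c0 : (0 <= (2 * pi * (t - s))^-1)%R by rewrite invr_ge0 ltW// twopi_gt0.
pose F (x : T * (R * R)) := f (x.1, x.2).
have mF : measurable_fun setT F.
  apply: (measurableT_comp mf); apply: measurable_fun_pair => //.
  exact: (@measurableT_comp _ _ _ _ _ _ _ setT _ (measurable_to_past (u:=s)) measurable_fst).
have F0 (x : T * (R * R)) : 0 <= F x by exact: f0.
have -> : \int[@area R]_v \int[P]_w f (w, v) = \int[P]_w \int[@area R]_v f (w, v).
  by rewrite -(fubini_tonelli (m1 := P) (m2 := @area R) F).
have mFw w : measurable_fun setT (fun v => f (w, v)).
  by apply: (measurableT_comp mf); exact: pair1_measurable.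
have mI : measurable_fun setT (fun w : T => \int[@area R]_v f (w, v)).
  exact: (measurable_fun_fubini_tonelli_F (m2 := @area R) F mF F0).
rewrite -ge0_integralZl//; last by move=> w _; apply: integral_ge0.
apply: ge0_le_integral => //.
- by move=> w _; apply: integral_ge0 => v _; rewrite mule_ge0// lee_fin gk_ge0// ltW.
- pose G (x : T * (R * R)) := f (x.1, x.2) * (gk (t - s) (x.2 - B s x.1))%:E.
  have mG : measurable_fun setT G.
    apply: emeasurable_funM => //; apply/measurable_EFinP.
    apply: (measurableT_comp (measurable_gk _)); apply: measurable_funB2 => //.
    by apply: (measurableT_comp (measurable_B s0)).
  apply: (measurable_fun_fubini_tonelli_F (m2 := @area R) G mG) => x.
  by rewrite /G mule_ge0// lee_fin gk_ge0// ltW.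
- by apply: emeasurable_funM => //; exact: mI.
- move=> w _; rewrite -ge0_integralZl//.
  apply: ge0_le_integral => //.
  + by move=> v _; rewrite mule_ge0// lee_fin gk_ge0// ltW.
  + apply: emeasurable_funM => //; apply/measurable_EFinP.
    by apply: (measurableT_comp (measurable_gk _)); exact: measurable_funB2.
  + exact: emeasurable_funM.
  + by move=> v _; rewrite muleC lee_wpmul2r// lee_fin gk_le.
Qed.

End brownian_markov.

(** * Paths, double points and hitting events *)

Section plane_norm.
Context {R : realType}.
Implicit Types z : R * R.

Lemma norm_fst z : `|z.1| <= `|z|.
Proof. by rewrite [leRHS]prod_normE le_max lexx. Qed.

Lemma norm_snd z : `|z.2| <= `|z|.
Proof. by rewrite [leRHS]prod_normE le_max lexx orbT. Qed.

Lemma nsq_norm z : nsq z <= 2 * `|z| ^+ 2.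
Proof.
have h1 := norm_fst z; have h2 := norm_snd z.
have : `|z.1| ^+ 2 <= `|z| ^+ 2 by rewrite ler_sqr ?nnegrE.
have : `|z.2| ^+ 2 <= `|z| ^+ 2 by rewrite ler_sqr ?nnegrE.
rewrite !real_normK ?num_real// /nsq; lra.
Qed.

Lemma norm_nsq z : `|z| ^+ 2 <= nsq z.
Proof.
rewrite [X in X ^+ 2]prod_normE /nsq /Num.max; case: ifP => _;
  by rewrite real_normK ?num_real// (lerDl, lerDr) sqr_ge0.
Qed.

Lemma eucl_normE z : eucl_norm z = Num.sqrt (nsq z). Proof. by []. Qed.

Lemma eucl_norm_sqr z : eucl_norm z ^+ 2 = nsq z.
Proof. by rewrite sqr_sqrtr ?nsq_ge0. Qed.

End plane_norm.

Section subsequences.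
Context {R : realType}.

Lemma cvg_increasing (g : nat -> nat) : increasing_seq g -> g n @[n --> \oo] --> \oo.
Proof.
move=> gi; have gn n : (n <= g n)%N.
  elim: n => // n IH; apply: (leq_ltn_trans IH).
  by have := gi n.+1 n; rewrite !leEnat ltnn leqNgt => /negbFE.
move=> A [N _ HN]; exists N => // n /= Nn; apply: HN => /=.
exact: leq_trans (gn n).
Qed.

Lemma pair_subseq (r_ s_ : nat -> R) (t : R) :
  (forall n, 0 <= r_ n <= t) -> (forall n, 0 <= s_ n <= t) ->
  exists (f : nat -> nat) (r s : R), [/\ increasing_seq f,
    0 <= r <= t, 0 <= s <= t, r_ (f n) @[n --> \oo] --> r &
    s_ (f n) @[n --> \oo] --> s].
Proof.
move=> Hr Hs.
have bd (u : nat -> R) : (forall n, 0 <= u n <= t) -> bounded_fun u.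
  move=> Hu; exists t; split; first exact: num_real.
  move=> x tx n _ /=; have /andP[u0 ut] := Hu n.
  by rewrite ger0_norm// (le_trans ut)// ltW.
have limI (u : nat -> R) l : (forall n, 0 <= u n <= t) -> u n @[n --> \oo] --> l ->
    0 <= l <= t.
  move=> Hu ul; have cu : cvgn u by apply/cvg_ex; exists l.
  rewrite -(cvg_lim (@Rhausdorff R) ul); apply/andP; split.
    by apply: limr_ge => //; apply: nearW => n; case/andP: (Hu n).
  by apply: limr_le => //; apply: nearW => n; case/andP: (Hu n).
have [f fi fc] := bolzano_weierstrass (bd _ Hr).
have [g gi gc] := bolzano_weierstrass (bd _ (fun n => Hs (f n))).
have [r cr] : exists r : R, r_ (f n) @[n --> \oo] --> r by exists (limn (r_ \o f)); exact: fc.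
have [s cs] : exists s : R, s_ (f (g n)) @[n --> \oo] --> s by exists (limn ((s_ \o f) \o g)); exact: gc.
have cr' : r_ (f (g n)) @[n --> \oo] --> r.
  apply: (@cvg_comp _ _ _ g (fun n => r_ (f n)) _ \oo); last exact: cr.
  exact: cvg_increasing.
exists (f \o g), r, s; split => //.
- by move=> m n /=; rewrite fi; exact: gi.
- exact: (limI _ _ _ cr).
- exact: (limI _ _ _ cs).
Qed.

(** Rational times are clamped to the interval from 0 to [t], so that the countable descriptions of
    path events look at the path before [t] only and stay adapted. *)
Lemma rational_time (t r d : R) : 0 <= r <= t -> 0 < d ->
  exists q : rat, r <= Num.min t (Num.max 0 (ratr q)) < r + d.
Proof.
move=> /andP[r0 rt] d0.
have [|q] := @rat_in_itvoo R r (r + d); first by rewrite ltrDl.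
rewrite in_itv/= => /andP[h1 h2]; exists q.
rewrite (max_r (ltW (le_lt_trans r0 h1))) le_min rt (ltW h1)/=.
by rewrite gt_min h2 orbT.
Qed.

Lemma rational_time_itv (t : R) q : 0 <= t ->
  0 <= Num.min t (Num.max 0 (ratr q : R)) <= t.
Proof. by move=> t0; rewrite le_min t0 le_max lexx ge_min lexx. Qed.

End subsequences.

Section path.
Context {R : realType} (b : R -> R * R).
Hypothesis cb : {within `[0, +oo[, continuous b}.

(** Composition with [Num.max 0] extends the path to the whole line and removes the subspace
    topology from later arguments. *)
Lemma path_continuous : continuous (fun t : R => b (Num.max 0 t)).
Proof.
move=> t; have /subspace_continuousP/(_ (Num.max 0 t)) := cb.
rewrite /= in_itv/= andbT le_max lexx => /(_ isT) H.
apply: cvg_trans H => A; rewrite /= /within /=.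
move=> /nbhs_ballP[e /= e0 HA]; apply/nbhs_ballP; exists e => //= s ts.
apply: HA; last by rewrite in_itv/= andbT le_max lexx.
move: ts; rewrite -!ball_normE/= !ltr_norml => /andP[h1 h2].
by case: (leP 0 t) => ht; case: (leP 0 s) => hs; apply/andP; split; lra.
Qed.

Lemma path_near t (e : R) : 0 <= t -> 0 < e ->
  exists2 d : R, 0 < d & forall s, 0 <= s -> `|s - t| < d -> `|b s - b t| < e.
Proof.
move=> t0 e0; have /cvgrPdist_lt/(_ _ e0) := @path_continuous t.
move=> /nbhs_ballP[d /= d0 H]; exists d => // s s0 st.
have := H s; rewrite -ball_normE/= distrC => /(_ st).
by rewrite !max_r// distrC.
Qed.

Lemma path_cvg (u : nat -> R) (l : R) : (forall n, 0 <= u n) -> 0 <= l ->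
  u n @[n --> \oo] --> l -> b (u n) @[n --> \oo] --> b l.
Proof.
move=> u0 l0 ul.
have -> : (fun n => b (u n)) = (fun t => b (Num.max 0 t)) \o u.
  by apply/funext => n /=; rewrite max_r.
have -> : b l = (fun t => b (Num.max 0 t)) l by rewrite max_r.
by apply: cvg_comp ul _; exact: path_continuous.
Qed.


(** An adapted substitute for [t] lying strictly before the hitting time of radius 3; the two agree
    by [alive_hitting_time]. *)
Definition alive (t : R) := forall u, 0 <= u <= t -> nsq (b u) < 9.

Lemma alive_le s t : s <= t -> alive t -> alive s.
Proof. by move=> st H u /andP[u0 us]; apply: H; rewrite u0 (le_trans us). Qed.

Lemma continuous_nsq : continuous (nsq : R * R -> R).
Proof.
move=> z; rewrite /nsq; apply: cvgD.
- by apply: (@cvg_comp _ _ _ fst (fun x : R => x ^+ 2));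
    [exact: cvg_fst|exact: exprn_continuous].
- by apply: (@cvg_comp _ _ _ snd (fun x : R => x ^+ 2));
    [exact: cvg_snd|exact: exprn_continuous].
Qed.

Lemma nsq_path_continuous : continuous (fun t : R => nsq (b (Num.max 0 t))).
Proof.
move=> t; apply: (@cvg_comp _ _ _ (fun t : R => b (Num.max 0 t)) nsq).
  exact: path_continuous.
exact: continuous_nsq.
Qed.

Lemma alive_open t : 0 <= t -> alive t -> exists2 t', t < t' & alive t'.
Proof.
move=> t0 H.
have H0 : nsq (b (Num.max 0 t)) < 9 by rewrite max_r// H// t0 lexx.
have : \forall u \near t, nsq (b (Num.max 0 u)) < 9.
  by have /cvgr_lt/(_ _ H0) := @nsq_path_continuous t.
move=> /nbhs_ballP[d /= d0 Hd]; exists (t + d / 2); first by rewrite ltrDl divr_gt0.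
move=> u /andP[u0 ut]; have [ut'|tu] := leP u t; first by apply: H; rewrite u0.
have := Hd u; rewrite -ball_normE/= max_r//; apply.
rewrite ltr_norml; apply/andP; split; lra.
Qed.

(** A path that starts inside and reaches [nsq >= 9] takes the value 9 on the way, by the
    intermediate value theorem. Conversely survival persists slightly beyond [t], so the infimum
    cannot be as small as [t]. *)
Lemma alive_hitting_time x t : b 0 = x -> nsq x < 9 -> 0 <= t ->
  (t%:E < hitting_time b 3)%E <-> alive t.
Proof.
move=> bx x9 t0; split; last first.
  move=> /(alive_open t0)[t' tt' Ht']; apply: (@lt_le_trans _ _ t'%:E).
    by rewrite lte_fin.
  apply: le_ereal_inf_tmp => _ [u [u0 u3] <-]; rewrite lee_fin leNgt.
  apply/negP => ut'; have := Ht' u; rewrite u0 ltW// => /(_ isT).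
  by rewrite -eucl_norm_sqr u3 (_ : 3 ^+ 2 = 9 :> R) ?ltxx//; ring.
move=> H u /andP[u0 ut]; rewrite ltNge; apply/negP => u9.
have [||v] := @IVT _ (fun t => nsq (b (Num.max 0 t))) 0 u 9 u0.
- apply: continuous_subspaceT; exact: nsq_path_continuous.
- have e1 : b (Num.max 0 0) = x by rewrite maxxx.
  have e2 : b (Num.max 0 u) = b u by rewrite max_r.
  by rewrite e1 e2 ge_min le_max (ltW x9) u9 orbT.
rewrite in_itv/= => /andP[v0 vu]; rewrite max_r// => v9.
move: H; rewrite ltNge => /negP; apply.
apply: ge_ereal_inf; exists v%:E; last by rewrite lee_fin (le_trans vu).
exists v => //; split => //; rewrite eucl_normE v9.
by rewrite (_ : 9 = 3 ^+ 2 :> R) ?sqrtr_sqr ?ger0_norm//; ring.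
Qed.

(** A countable description of having left the disk. The margins [n.+1%:R^-1] absorb the rounding to
    rational times, and compactness of the time interval recovers a true exit time. *)
Lemma aliveN t : 0 <= t ->
  ~ alive t <-> forall n : nat, exists q : rat,
    9 - n.+1%:R^-1 < nsq (b (Num.min t (Num.max 0 (ratr q)))).
Proof.
move=> t0; split.
  move=> /existsNP[u /not_implyP[/andP[u0 ut] /negP]]; rewrite -leNgt => u9 n.
  have H0 : 9 - n.+1%:R^-1 < nsq (b (Num.max 0 u)).
    by rewrite max_r// (lt_le_trans _ u9)// ltrBlDr ltrDl invr_gt0.
  have : \forall v \near u, 9 - n.+1%:R^-1 < nsq (b (Num.max 0 v)).
    by have /cvgr_gt/(_ _ H0) := @nsq_path_continuous u.
  move=> /nbhs_ballP[d /= d0 Hd].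
  have ut0 : 0 <= u <= t by rewrite u0.
  have [q /andP[q1 q2]] := rational_time ut0 d0.
  exists q; have /andP[h1 h2] := @rational_time_itv R t q t0.
  have := Hd (Num.min t (Num.max 0 (ratr q))); rewrite -ball_normE/= [Num.max 0 (Num.min _ _)]max_r//.
  apply; rewrite ltr_norml; apply/andP; split; lra.
move=> /choice[q Hq] al.
pose r n := Num.min t (Num.max 0 (ratr (q n))) : R.
have Hr n : 0 <= r n <= t by exact: rational_time_itv.
have [f [u [_ [fi u0t _ cu _]]]] := pair_subseq Hr Hr.
have /andP[u0 ut] := u0t.
have cn : nsq (b (r (f n))) @[n --> \oo] --> nsq (b u).
  apply: (@cvg_comp _ _ _ (fun n => b (r (f n))) nsq); last exact: continuous_nsq.
  by apply: path_cvg => // n; case/andP: (Hr (f n)).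
have : 9 <= nsq (b u).
  have c9 : (9 - (f n).+1%:R^-1 : R) @[n --> \oo] --> (9 - 0 : R).
    apply: cvgB; first exact: cvg_cst.
    apply: (@cvg_comp _ _ _ f (fun n => n.+1%:R^-1 : R)); last exact: cvg_harmonic.
    exact: cvg_increasing.
  rewrite -[9]subr0; apply: (ler_cvg_to c9 cn); apply: nearW => n.
  exact: ltW.
by apply/negP; rewrite -ltNge; exact: al.
Qed.


Definition double_in (A : set (R * R)) (c t : R) := exists r s : R,
  [/\ 0 <= r, r + c <= s, s <= t, b r = b s & A (b s)].

Lemma double_in_le A c s t : s <= t -> double_in A c s -> double_in A c t.
Proof.
move=> st [r [u [r0 ru us rs Au]]]; exists r, u; split => //.
exact: le_trans st.
Qed.

(** Compactness of times, continuity of the path and closedness of [A]: approximate double points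
    with vanishing error accumulate at a genuine one. The lemma serves for measurability, for
    attainment at the first double time, and for the vanishing mesh of the lower bound. *)
Lemma double_limit (A : set (R * R)) (c t : R) (r_ s_ e_ : nat -> R)
    (a_ : nat -> R * R) : closed A -> 0 <= c ->
  (forall n, 0 <= r_ n <= t) -> (forall n, 0 <= s_ n <= t) ->
  e_ n @[n --> \oo] --> 0 ->
  (forall n, [/\ r_ n + c <= s_ n + e_ n, `|b (r_ n) - a_ n| <= e_ n,
     `|b (s_ n) - a_ n| <= e_ n & A (a_ n)]) ->
  exists (f : nat -> nat) (r s : R), [/\ increasing_seq f,
    s_ (f n) @[n --> \oo] --> s,
    [/\ 0 <= r, 0 <= s, r + c <= s & s <= t], b r = b s & A (b s)].
Proof.
move=> cA c0 Hr Hs ce H.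
have [f [r [s [fi /andP[r0 rt] /andP[s0 st] cr cs]]]] := pair_subseq Hr Hs.
exists f, r, s.
have cef : e_ (f n) @[n --> \oo] --> 0.
  apply: (@cvg_comp _ _ _ f (fun n => e_ n)); last exact: ce.
  exact: cvg_increasing.
have cbr : b (r_ (f n)) @[n --> \oo] --> b r.
  by apply: path_cvg => // n; case/andP: (Hr (f n)).
have cbs : b (s_ (f n)) @[n --> \oo] --> b s.
  by apply: path_cvg => // n; case/andP: (Hs (f n)).
have small (u : nat -> R * R) : (forall n, `|u n| <= e_ (f n)) ->
    u n @[n --> \oo] --> (0 : R * R).
  move=> Hu; apply/norm_cvg0P; apply: (squeeze_cvgr _ (cvg_cst 0) cef).
  by apply: nearW => n; rewrite normr_ge0 Hu.
have ca : a_ (f n) @[n --> \oo] --> b s.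
  have h := small (fun n => b (s_ (f n)) - a_ (f n))
    (fun n => let: And4 _ _ h _ := H (f n) in h).
  rewrite (_ : (fun n => a_ (f n)) =
    (fun n => b (s_ (f n)) - (b (s_ (f n)) - a_ (f n)))); last first.
    by apply/funext => n; rewrite subKr.
  by rewrite -[b s]subr0; exact: cvgB.
have ca' : a_ (f n) @[n --> \oo] --> b r.
  have h := small (fun n => b (r_ (f n)) - a_ (f n))
    (fun n => let: And4 _ h _ _ := H (f n) in h).
  rewrite (_ : (fun n => a_ (f n)) =
    (fun n => b (r_ (f n)) - (b (r_ (f n)) - a_ (f n)))); last first.
    by apply/funext => n; rewrite subKr.
  by rewrite -[b r]subr0; exact: cvgB.
split => //.
- split => //.
  have h1 : (r_ (f n) + c) @[n --> \oo] --> r + c.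
    by apply: cvgD => //; exact: cvg_cst.
  have h2 : (s_ (f n) + e_ (f n)) @[n --> \oo] --> s + 0 by exact: cvgD.
  rewrite -[s]addr0; apply: (ler_cvg_to h1 h2); apply: nearW => n.
  by case: (H (f n)).
- exact: (cvg_unique (@norm_hausdorff _ _) ca' ca).
- apply: (@closed_cvg _ _ \oo _ (fun n => a_ (f n)) A cA _ _ ca); apply: nearW => n.
  by case: (H (f n)).
Qed.

Definition neighborhood (A : set (R * R)) (e : R) : set (R * R) :=
  [set z | exists2 a, A a & `|z - a| < e].

Lemma double_inP (A : set (R * R)) (c t : R) : closed A -> 0 <= c -> 0 <= t ->
  double_in A c t <-> forall n : nat, exists q q' : rat,
    let r := Num.min t (Num.max 0 (ratr q)) in
    let s := Num.min t (Num.max 0 (ratr q')) in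
    [/\ r + c < s + n.+1%:R^-1, `|b r - b s| < n.+1%:R^-1 &
        neighborhood A n.+1%:R^-1 (b s)].
Proof.
move=> cA c0 t0; split.
  move=> [r [s [r0 rs st brs Abs]]] n.
  have : 0 < n.+1%:R^-1 :> R by rewrite invr_gt0.
  move: (n.+1%:R^-1) => k k0; have n0 : 0 < k / 2 by rewrite divr_gt0.
  have s0 : 0 <= s by lra.
  have [d1 d10 H1] := path_near r0 n0.
  have [d2 d20 H2] := path_near s0 n0.
  have hr : 0 <= r <= t by rewrite r0; lra.
  have hs : 0 <= s <= t by rewrite s0.
  have [d [d0 hd1 hd2 hdn]] : exists d : R,
      [/\ 0 < d, d <= d1, d <= d2 & d <= k / 2].
    exists (Num.min (Num.min d1 d2) (k / 2)).
    by rewrite !lt_min d10 d20 n0 !ge_min !lexx !orbT.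
  have [q /andP[r1 r2]] := rational_time hr d0.
  have [q' /andP[s1 s2]] := rational_time hs d0.
  move: r1 r2 s1 s2; set r' := Num.min t (Num.max 0 (ratr q)).
  set s' := Num.min t (Num.max 0 (ratr q')) => r1 r2 s1 s2.
  have r'0 : 0 <= r' by lra.
  have s'0 : 0 <= s' by lra.
  have br : `|b r' - b r| < k / 2.
    by apply: H1 => //; rewrite ltr_norml; apply/andP; split; lra.
  have bs : `|b s' - b s| < k / 2.
    by apply: H2 => //; rewrite ltr_norml; apply/andP; split; lra.
  exists q, q' => /=; rewrite -/r' -/s'; split; first by lra.
    rewrite (_ : b r' - b s' = (b r' - b r) - (b s' - b s)); last first.
      by rewrite brs opprB addrA subrK.
    by apply: (le_lt_trans (ler_normB _ _)); lra.
  by exists (b s) => //; lra.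
move=> /choice[q /choice[q' H]].
pose r n := Num.min t (Num.max 0 (ratr (q n))) : R.
pose s n := Num.min t (Num.max 0 (ratr (q' n))) : R.
have /choice[a Ha] : forall n, exists a, A a /\ `|b (s n) - a| < n.+1%:R^-1.
  by move=> n; have [_ _ [a Aa ha]] := H n; exists a.
have ce : (2 * n.+1%:R^-1 : R) @[n --> \oo] --> (0 : R).
  by rewrite -[0](mulr0 2); apply: cvgM; [exact: cvg_cst|exact: cvg_harmonic].
have [|||f [r' [s' [_ _ [r'0 s'0 rs' st'] brs Abs]]]] :=
  @double_limit A c t r s (fun n => 2 * n.+1%:R^-1) a cA c0 _ _ ce.
- by move=> n; exact: rational_time_itv.
- by move=> n; exact: rational_time_itv.
- move=> n; have [h1 h2 _] := H n; have [Aa h3] := Ha n.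
  have : 0 < n.+1%:R^-1 :> R by rewrite invr_gt0.
  move: h1 h2 h3 => /=; rewrite -/(r n) -/(s n).
  move: (n.+1%:R^-1) => k h1 h2 h3 k0; split => //.
  + by lra.
  + rewrite (_ : b (r n) - a n = (b (r n) - b (s n)) + (b (s n) - a n)); last first.
      by rewrite addrA subrK.
    by apply: (le_trans (ler_normD _ _)); lra.
  + by lra.
- by exists r', s'.
Qed.

End path.

Lemma integral_prob_cst d (T : measurableType d) (R : realType)
  (P : probability T R) (r : \bar R) : (\int[P]_w r = r)%E.
Proof.
rewrite integral_cst// [X in (_ * X)%E](_ : _ = 1%E) ?mule1//.
exact: probability_setT.
Qed.

(** * Measurability of path events and killing at the circle of radius 3 *)

Section killed_density.
Context d (T : measurableType d) (R : realType) (P : probability T R).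
Context (x0 : R * R) (B : R -> T -> R * R).
Context (pbmB : planar_brownian_motion P x0 B).

Local Notation pT u := (g_sigma_algebraType (past B u)).

Definition Alive t := [set w | alive (B^~ w) t].

Definition Double (A : set (R * R)) (c t : R) := [set w | double_in (B^~ w) A c t].

Lemma pbm_path w : {within `[0, +oo[, continuous (fun t => B t w)}.
Proof. exact: (pbm_continuous pbmB). Qed.

Lemma adapted_preimage s t (S : set (R * R)) : 0 <= s <= t -> measurable S ->
  measurable (B s @^-1` S : set (pT t)).
Proof.
by move=> st mS; have := adapted_B (B := B) st measurableT mS; rewrite setTI.
Qed.

Lemma measurable_nsq_lt (a : R) : measurable [set z : R * R | nsq z < a].
Proof.
have -> : [set z : R * R | nsq z < a] = nsq @^-1` `]-oo, a[.
  by apply/seteqP; split => z; rewrite /= in_itv.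
rewrite -[X in measurable X]setTI; exact: measurable_nsq.
Qed.

Lemma adapted_alive t : 0 <= t -> measurable (Alive t : set (pT t)).
Proof.
move=> t0; rewrite -[Alive t]setCK; apply: measurableC.
have -> : ~` Alive t = \bigcap_(n : nat) \bigcup_(q : rat)
   (B (Num.min t (Num.max 0 (ratr q))) @^-1` (~` [set z | nsq z < 9 - n.+1%:R^-1 ]
      `&` ~` [set z | nsq z = 9 - n.+1%:R^-1 ])).
  apply/seteqP; split => w /=.
    move=> /(aliveN (@pbm_path w) t0) H n _; have [q Hq] := H n; exists q => //=.
    by split; [apply/negP; rewrite -leNgt ltW|apply/eqP; rewrite gt_eqF].
  move=> H; apply/(aliveN (@pbm_path w) t0) => n; have [q _ [h1 h2]] := H n I.
  exists q; rewrite lt_neqAle leNgt; apply/andP; split; last exact/negP.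
  by apply/eqP => h3; apply: h2.
apply: bigcapT_measurable => n; apply: bigcupT_measurable_rat => q.
apply: adapted_preimage; first exact: rational_time_itv.
apply: measurableI; apply: measurableC; first exact: measurable_nsq_lt.
have -> : [set z : R * R | nsq z = 9 - n.+1%:R^-1] = nsq @^-1` [set 9 - n.+1%:R^-1].
  by [].
rewrite -[X in measurable X]setTI; exact: measurable_nsq.
Qed.

Lemma open_neighborhood (A : set (R * R)) (e : R) : 0 < e -> open (neighborhood A e).
Proof.
move=> e0; have -> : neighborhood A e = \bigcup_(a in A) ball a e.
  apply/seteqP; split => z [a Aa h]; exists a => //.
    by rewrite -ball_normE /ball_/= distrC.
  by move: h; rewrite -ball_normE /ball_/= distrC.
by apply: bigcup_open => a _; exact: ball_open.
Qed.

Lemma adapted_double (A : set (R * R)) (c t : R) : closed A -> 0 <= c -> 0 <= t ->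
  measurable (Double A c t : set (pT t)).
Proof.
move=> cA c0 t0.
pose r (q : rat) : R := Num.min t (Num.max 0 (ratr q)).
have -> : Double A c t = \bigcap_(n : nat) \bigcup_(q : rat) \bigcup_(q' : rat)
   (if r q + c < r q' + n.+1%:R^-1 then
     ((fun w => B (r q) w - B (r q') w) @^-1` ball 0 n.+1%:R^-1) `&`
      (B (r q') @^-1` neighborhood A n.+1%:R^-1) else set0).
  apply/seteqP; split => w /=.
    move=> /(double_inP (@pbm_path w) cA c0 t0) H n _; have [q [q' [h1 h2 h3]]] := H n.
    exists q => //; exists q' => //; rewrite h1; split => //=.
    by rewrite -ball_normE /ball_/= sub0r normrN.
  move=> H; apply/(double_inP (@pbm_path w) cA c0 t0) => n.
  have [q _ [q' _]] := H n I; case: ifP => // h1 [h2 h3].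
  exists q, q'; split => //.
  by move: h2; rewrite /= -ball_normE /ball_/= sub0r normrN.
apply: bigcapT_measurable => n; apply: bigcupT_measurable_rat => q.
apply: bigcupT_measurable_rat => q'; case: ifP => // _.
apply: measurableI; last first.
  apply: adapted_preimage; first exact: rational_time_itv.
  apply: open_measurable2; apply: open_neighborhood; by rewrite invr_gt0.
have : measurable_fun setT ((fun w => B (r q) w - B (r q') w) : pT t -> R * R).
  by apply: measurable_funB2; apply: adapted_B; exact: rational_time_itv.
move=> /(_ measurableT (ball 0 n.+1%:R^-1)); rewrite setTI; apply.
by apply: open_measurable2; apply: ball_open; rewrite invr_gt0.
Qed.

Lemma adapted_indic u (S : set T) : measurable (S : set (pT u)) ->
  measurable_fun setT (\1_S : pT u -> R).
Proof. by move=> mS; exact: measurable_indic. Qed.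

Local Open Scope ereal_scope.

Lemma area_nsq_lt9 : area [set z : R * R | (nsq z < 9)%R] <= 36%:E.
Proof.
apply: (@le_trans _ _ (area (`[(-3)%R, 3%R]%classic `*` `[(-3)%R, 3%R]%classic : set (R * R)))).
  apply: le_measure; rewrite ?inE.
  - exact: measurable_nsq_lt.
  - by apply: measurableX; exact: measurable_itv.
  move=> z /= z9; rewrite !in_itv/= -!ler_norml.
  have h (u : R) : (u ^+ 2 < 9 -> `|u| <= 3)%R.
    move=> u9; rewrite leNgt; apply/negP => u3.
    suff : (9 < u ^+ 2)%R by apply/negP; rewrite -leNgt ltW.
    rewrite -(@real_normK _ u) ?num_real//.
    by have : (3 ^+ 2 < `|u| ^+ 2)%R by [rewrite ltr_pXn2r// nnegrE]; lra.
  by split; apply: h; apply: le_lt_trans z9; rewrite (lerDl, lerDr) sqr_ge0.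
rewrite area_rect ?lebesgue_measure_itv//=.
by rewrite lte_fin gtrN// -EFinB -EFinM lee_fin; lra.
Qed.

Lemma pi_ge2 : (2 <= @pi R)%R. Proof. by have := @pihalf_ge1 R; lra. Qed.

Lemma adapted_etensor d1 d2 (S1 : measurableType d1) (S2 : measurableType d2)
  (F : S1 -> \bar R) (g : S2 -> R) : measurable_fun setT F -> measurable_fun setT g ->
  measurable_fun setT (fun x : S1 * S2 => F x.1 * (g x.2)%:E).
Proof.
move=> mF mg; apply: emeasurable_funM; first exact: measurableT_comp.
by apply/measurable_EFinP; exact: measurableT_comp.
Qed.

Definition chi3 : R * R -> R := \1_[set z : R * R | (nsq z < 9)%R].

Lemma measurable_chi3 : measurable_fun setT chi3.
Proof. by apply: measurable_indic; exact: measurable_nsq_lt. Qed.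

Lemma adapted_chi3 s t (F : T -> \bar R) : (0 <= s <= t)%R ->
  measurable_fun setT (F : pT t -> \bar R) ->
  measurable_fun setT ((fun w => F w * (chi3 (B s w))%:E) : pT t -> \bar R).
Proof.
move=> st mF; apply: emeasurable_funM => //; apply/measurable_EFinP.
by apply: (measurableT_comp measurable_chi3); exact: adapted_B.
Qed.

(** The disk has area at most 36, and the transition density is at most [1 / (2 * pi * (t - s))]
    with [pi >= 2]. *)
Lemma killing s t (F : T -> \bar R) : (0 <= s < t)%R ->
  measurable_fun setT (F : pT s -> \bar R) -> (forall w, 0 <= F w) ->
  \int[P]_w (F w * (chi3 (B t w))%:E) <=
  (9 / (t - s))%:E * \int[P]_w F w.
Proof.
move=> st mF F0; have ts0 : (0 < t - s)%R by case/andP: st => _; rewrite subr_gt0.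
have mg := measurable_chi3.
apply: le_trans (markov_density pbmB st (adapted_etensor mF mg) _) _.
  by move=> x; rewrite mule_ge0// lee_fin.
have mF' := adapted_measurable pbmB mF.
have -> : \int[@area R]_v \int[P]_w (F (w, v).1 * (chi3 (w, v).2)%:E) =
    \int[@area R]_v ((chi3 v)%:E * \int[P]_w F w).
  apply: eq_integral => v _ /=; rewrite -ge0_integralZl//.
  - by apply: eq_integral => w _; rewrite muleC.
  - by rewrite lee_fin.
rewrite ge0_integralZr//; last 3 first.
- exact/measurable_EFinP.
- by move=> v _; rewrite lee_fin.
- exact: integral_ge0.
rewrite integral_indicT; last exact: measurable_nsq_lt.
rewrite muleA; apply: lee_wpmul2r; first exact: integral_ge0.
apply: le_trans (lee_wpmul2l _ area_nsq_lt9) _.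
  by rewrite lee_fin invr_ge0 ltW// twopi_gt0.
rewrite -EFinM lee_fin mulrC ler_pdivrMr ?twopi_gt0//.
rewrite [leRHS](_ : _ = 9 * 2 * pi)%R; last first.
  by move: (@pi R) => p; field; rewrite gt_eqF.
by have := pi_ge2; lra.
Qed.

Lemma alive_le_chi3 s u v w : (0 <= u <= s)%R -> (0 <= v <= s)%R ->
  (\1_(Alive s) w <= chi3 (B u w) * chi3 (B v w))%R.
Proof.
move=> us vs; rewrite /chi3 !indicE.
have [|_] := boolP (w \in Alive s); last by rewrite mulr_ge0.
by rewrite inE => al; rewrite !mem_set ?mulr1//=; exact: al.
Qed.

Lemma adapted_set u (S : set T) : measurable (S : set (pT u)) -> measurable S.
Proof.
by move=> mS; have := measurable_to_past pbmB measurableT mS; rewrite setTI preimage_id.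
Qed.

Lemma past_mono_prod d2 (S2 : measurableType d2) u v (f : T * S2 -> \bar R) :
  (u <= v)%R -> measurable_fun setT (f : pT u * S2 -> \bar R) ->
  measurable_fun setT (f : pT v * S2 -> \bar R).
Proof.
move=> uv mf.
pose g (x : pT v * S2) : pT u * S2 := (x.1, x.2).
have mg : measurable_fun setT g.
  apply: measurable_fun_pair => //.
  exact: (@measurableT_comp _ _ _ _ _ _ _ setT _ (past_mono (B := B) uv) measurable_fst).
by have := measurableT_comp mf mg; rewrite (_ : f \o g = f)//; apply/funext => -[].
Qed.

Lemma measurable_past_B d2 (S2 : measurableType d2) u (Y : T -> S2)
    (f : T * S2 -> \bar R) :
  measurable_fun setT Y -> measurable_fun setT (f : pT u * S2 -> \bar R) ->
  measurable_fun setT (fun w => f (w, Y w)).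
Proof.
move=> mY mf.
pose g (w : T) : pT u * S2 := (w, Y w).
have mg : measurable_fun setT g.
  by apply: measurable_fun_pair => //; exact: (measurable_to_past pbmB (u := u)).
exact: (measurableT_comp mf mg).
Qed.

(** The interval from [s0] to [s] is cut into three equal parts: two provide survival factors, the
    last one smooths the final position. The cubic decay, instead of the linear one of the free
    density, makes sums over all times converge. *)
Lemma killed_density s0 s t (f : T * (R * R) -> \bar R) :
  (0 <= s0 < s)%R -> (s <= t)%R ->
  measurable_fun setT (f : pT s0 * (R * R) -> \bar R) -> (forall x, 0 <= f x) ->
  \int[P]_w ((\1_(Alive s) w)%:E * f (w, B t w)) <=
  (600 / (s - s0) ^+ 3)%:E * \int[@area R]_v \int[P]_w f (w, v).
Proof.
move=> /andP[s00 s0s] st mf f0.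
have [h [h0 hE]] : exists h : R, (0 < h)%R /\ (s = s0 + 3 * h)%R.
  by exists ((s - s0) / 3)%R; split; [rewrite divr_gt0// subr_gt0|field].
have [u1 u1E] : exists u1 : R, (u1 = s0 + h)%R by exists (s0 + h)%R.
have [u2 u2E] : exists u2 : R, (u2 = s0 + 2 * h)%R by exists (s0 + 2 * h)%R.
have s0u1 : (0 <= s0 < u1)%R by apply/andP; split; lra.
have u1u2 : (0 <= u1 < u2)%R by apply/andP; split; lra.
have u2t : (0 <= u2 < t)%R by apply/andP; split; lra.
have u1u2' : (0 <= u1 <= u2)%R by apply/andP; split; lra.
have u2u2 : (0 <= u2 <= u2)%R by apply/andP; split; lra.
have s0u2 : (s0 <= u2)%R by lra.
have s0u1' : (s0 <= u1)%R by lra.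
have t0 : (0 <= t)%R by lra.
have s00' : (0 <= s)%R by lra.
pose f' (x : T * (R * R)) := f x * (chi3 (B u1 x.1))%:E * (chi3 (B u2 x.1))%:E.
have mchi u : (0 <= u <= u2)%R ->
    measurable_fun setT (fun x : pT u2 * (R * R) => (chi3 (B u x.1))%:E).
  move=> uu2; apply/measurable_EFinP; apply: (measurableT_comp measurable_chi3).
  exact: (@measurableT_comp _ _ _ _ _ _ _ setT _ (adapted_B (B := B) uu2) measurable_fst).
have mf' : measurable_fun setT (f' : pT u2 * (R * R) -> \bar R).
  apply: emeasurable_funM; last exact: mchi.
  by apply: emeasurable_funM; [exact: (past_mono_prod s0u2)|exact: mchi].
have f'0 x : 0 <= f' x by rewrite !mule_ge0// lee_fin.
apply: (@le_trans _ _ (\int[P]_w f' (w, B t w))).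
  apply: ge0_le_integral => //.
  - by move=> w _; rewrite mule_ge0// lee_fin.
  - apply: emeasurable_funM; last exact: (measurable_past_B (measurable_B pbmB t0) mf).
    apply/measurable_EFinP; apply: measurable_indic.
    exact: (adapted_set (adapted_alive s00')).
  - exact: (measurable_past_B (measurable_B pbmB t0) mf').
  - move=> w _; rewrite /f'/= -muleA muleC lee_wpmul2l// -EFinM lee_fin.
    by apply: alive_le_chi3; apply/andP; split; lra.
apply: le_trans (markov_density pbmB u2t mf' f'0) _.
have mv u : (s0 <= u)%R -> forall v, measurable_fun setT ((fun w => f (w, v)) : pT u -> \bar R).
  move=> s0u v; apply: (measurableT_comp (past_mono_prod s0u mf)); exact: pair2_measurable.
have step v : \int[P]_w f' (w, v) <= (9 / h * (9 / h))%:E * \int[P]_w f (w, v).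
  have s0u : (s0 <= s0)%R by [].
  have u11 : (0 <= u1 <= u1)%R by apply/andP; split; lra.
  have k2 := killing u1u2 (adapted_chi3 u11 (mv _ s0u1' v)).
  have k1 := killing s0u1 (mv _ s0u v) (fun w => f0 (w, v)).
  have e2 : (9 / (u2 - u1) = 9 / h)%R by congr (_ / _)%R; lra.
  have e1 : (9 / (u1 - s0) = 9 / h)%R by congr (_ / _)%R; lra.
  rewrite e2 in k2; rewrite e1 in k1.
  have h9 : 0 <= (9 / h)%:E by rewrite lee_fin divr_ge0// ltW.
  apply: le_trans (k2 _) _; first by move=> w; rewrite mule_ge0// lee_fin.
  by rewrite [X in _ <= X * _]EFinM -muleA; apply: lee_wpmul2l.
have c0 : (0 <= (2 * pi * (t - u2))^-1)%R.
  by rewrite invr_ge0 ltW// twopi_gt0//; lra.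
have h90 : 0 <= (9 / h * (9 / h))%:E by rewrite lee_fin mulr_ge0 ?divr_ge0// ltW.
have mF (g : T * (R * R) -> \bar R) u : measurable_fun setT (g : pT u * (R * R) -> \bar R) ->
    (forall x, 0 <= g x) -> measurable_fun setT (fun v => \int[P]_w g (w, v)).
  move=> mg g0; pose G (x : T * (R * R)) := g (x.1, x.2).
  have mG : measurable_fun setT G.
    pose i (x : T * (R * R)) : pT u * (R * R) := (x.1, x.2).
    have mi : measurable_fun setT i.
      apply: measurable_fun_pair => //.
      exact: (@measurableT_comp _ _ _ _ _ _ _ setT _
        (measurable_to_past pbmB (u := u)) measurable_fst).
    exact: (measurableT_comp mg mi).
  by apply: (measurable_fun_fubini_tonelli_G (m1 := P) G mG) => x; exact: g0.
have mFf := mF f s0 mf f0.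
apply: (@le_trans _ _ (((2 * pi * (t - u2))^-1)%:E *
    ((9 / h * (9 / h))%:E * \int[@area R]_v \int[P]_w f (w, v)))).
  apply: lee_wpmul2l; first by rewrite lee_fin.
  rewrite -ge0_integralZl//; last by move=> v _; exact: integral_ge0.
  apply: ge0_le_integral => //.
  - by move=> v _; exact: integral_ge0.
  - exact: (mF f' u2 mf' f'0).
  - by apply: emeasurable_funM.
rewrite muleA; apply: lee_wpmul2r.
  by apply: integral_ge0 => v _; apply: integral_ge0.
rewrite -EFinM lee_fin.
(* The constant comes from [9 * 9 / 4 * 27 < 600]. *)
have -> : (600 / (s - s0) ^+ 3 = (600 / 27) * (h^-1 * h^-1 * h^-1))%R.
  by rewrite hE [(_ + _ - _)%R]addrC addKr; field; rewrite gt_eqF.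
have -> : (9 / h * (9 / h) = 81 * (h^-1 * h^-1))%R by field; rewrite gt_eqF.
have hV : (0 < h^-1)%R by rewrite invr_gt0.
have : ((2 * pi * (t - u2))^-1 <= 4^-1 * h^-1)%R.
  rewrite -invfM lef_pV2 ?posrE ?mulr_gt0 ?pi_gt0//; last by lra.
  have p2 := pi_ge2; apply: ler_pM; [lra|lra| |lra].
  by lra.
move=> /(ler_wpM2r (_ : 0 <= 81 * (h^-1 * h^-1))%R)/le_trans; apply.
  by rewrite mulr_ge0// mulr_ge0// ltW.
rewrite (_ : 4^-1 * h^-1 * (81 * (h^-1 * h^-1)) = (81 / 4) * (h^-1 * h^-1 * h^-1))%R; last by ring.
apply: ler_wpM2r; last by lra.
by rewrite !mulr_ge0// ltW.
Qed.

(** At squared distance at least [1 / 9] from the start the heat kernel is at most [9 / pi <= 5] at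
    every time; closer to the start the bound [M] on [g] is used instead. The estimate is therefore
    uniform in [t], including [t = 0]. *)
Lemma start_density (t : R) (g : R * R -> R) (M : R) : (0 <= t)%R -> x0 = (1, 0)%R ->
  measurable_fun setT g -> (forall z, 0 <= g z)%R -> (0 <= M)%R ->
  (forall z, nsq (z - x0) < 9^-1 -> g z <= M)%R ->
  \int[P]_w (g (B t w))%:E <= 5%:E * \int[@area R]_v (g v)%:E + M%:E.
Proof.
rewrite le_eqVlt => /predU1P[<-|t0] x0E mg g0 M0 gM.
  under eq_integral do rewrite (pbm_start pbmB).
  rewrite integral_prob_cst.
  rewrite -[leLHS]add0e; apply: leeD.
    by rewrite mule_ge0// integral_ge0// => v _; rewrite lee_fin.
  by rewrite lee_fin gM// subrr /nsq/= !expr0n/= addr0 invr_gt0.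
have mf := adapted_tensor (S1 := pT 0) (S2 := (R * R)%type)
  (@measurable_cst _ _ _ _ setT (1%R : R)) mg.
have t0' : ((0 : R) <= 0 < t)%R by rewrite lexx t0.
have -> : \int[P]_w (g (B t w))%:E =
    \int[P]_w \int[@area R]_v ((1 * g v)%:E * (gk (t - 0) (v - B 0 w))%:E).
  rewrite -(markov pbmB t0' mf); last by move=> x; rewrite mul1r lee_fin.
  by apply: eq_integral => w _; rewrite mul1r.
under eq_integral do rewrite (pbm_start pbmB).
rewrite integral_prob_cst subr0.
apply: (@le_trans _ _ (\int[@area R]_v (5 * g v + M * gk t (v - x0))%:E)).
  apply: ge0_le_integral => //.
  - by move=> v _; rewrite mule_ge0// lee_fin ?mul1r// gk_ge0// ltW.
  - apply: emeasurable_funM; apply/measurable_EFinP; last exact: measurable_gkB.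
    by apply: measurable_funM.
  - apply/measurable_EFinP; apply: measurable_funD; apply: measurable_funM => //.
    exact: measurable_gkB.
  move=> v _; rewrite mul1r -EFinM lee_fin.
  have k0 := gk_ge0 (v - x0)%R (ltW t0).
  have [h|h] := ltP (nsq (v - x0)%R) 9^-1%R.
    have : (g v * gk t (v - x0) <= M * gk t (v - x0))%R by apply: ler_wpM2r => //; exact: gM.
    by have := g0 v; lra.
  have : (gk t (v - x0) <= 5)%R.
    have n0 : (0 < nsq (v - x0))%R by apply: lt_le_trans h; rewrite invr_gt0.
    apply: le_trans (gk_le_nsq t0 n0) _.
    rewrite invf_ple ?posrE ?mulr_gt0 ?pi_gt0//.
    have p2 := pi_ge2; have : (pi * nsq (v - x0) >= 2 * 9^-1)%R by apply: ler_pM.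
    by lra.
  move=> h5; have : (g v * gk t (v - x0) <= g v * 5)%R by apply: ler_wpM2l.
  by have : (0 <= M * gk t (v - x0))%R by [rewrite mulr_ge0]; lra.
under eq_integral do rewrite EFinD.
rewrite ge0_integralD//; last 4 first.
- by move=> v _; rewrite lee_fin mulr_ge0.
- by apply/measurable_EFinP; apply: measurable_funM.
- by move=> v _; rewrite lee_fin mulr_ge0// gk_ge0// ltW.
- by apply/measurable_EFinP; apply: measurable_funM => //; exact: measurable_gkB.
under eq_integral do rewrite EFinM.
rewrite ge0_integralZl//; last 2 first.
- exact/measurable_EFinP.
- by move=> v _; rewrite lee_fin.
under [X in _ + X <= _]eq_integral do rewrite EFinM.
rewrite (@ge0_integralZl _ _ _ _ _ _ (fun v : R * R => (gk t (v - x0))%:E))//; last 2 first.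
- by apply/measurable_EFinP; exact: measurable_gkB.
- by move=> v _; rewrite lee_fin gk_ge0// ltW.
by rewrite area_gk// mule1.
Qed.

End killed_density.

(** * Discrete Green kernels *)

Section kernel_sums.
Context {R : realType}.
Implicit Types (delta eta : R) (z : R * R).

(** A Green kernel truncated in time: the expected occupation density, smoothed at time [delta], of
    a path observed at [N] grid times of step [eta]. *)
Definition Rk delta eta (N : nat) z : R :=
  \sum_(q < N) eta * gk (delta + q%:R * eta) z.

Lemma gk_le1 (t s : R) z : 0 < s -> s <= t -> gk t z <= s^-1.
Proof.
move=> s0 st; have t0 : 0 < t by exact: lt_le_trans st.
apply: le_trans (gk_le z t0) _; rewrite lef_pV2 ?posrE ?twopi_gt0//.
have p2 := @pi_ge2 R; apply: le_trans st _.
by rewrite ler_peMl ?(ltW t0)//; lra.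
Qed.

Section fixed.
Context delta eta (N : nat).
Hypotheses (d0 : 0 < delta) (e0 : 0 <= eta).

Let t0 (q : nat) : 0 < delta + q%:R * eta.
Proof. by rewrite ltr_wpDr// mulr_ge0. Qed.

Lemma Rk_ge0 z : 0 <= Rk delta eta N z.
Proof. by apply: sumr_ge0 => q _; rewrite mulr_ge0// gk_ge0// ltW. Qed.

Lemma Rk_le z : Rk delta eta N z <= N%:R * (eta / delta).
Proof.
rewrite /Rk -[N in leRHS]card_ord -sumr_const mulr_suml; apply: ler_sum => q _.
rewrite mul1r; apply: ler_wpM2l => //.
by apply: gk_le1 => //; rewrite lerDl mulr_ge0.
Qed.

Lemma measurable_Rk : measurable_fun setT (Rk delta eta N).
Proof.
apply: measurable_sum => q; apply: measurable_funM => //; exact: measurable_gk.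
Qed.

Lemma expRN_lipschitz (u v : R) : 0 <= u -> 0 <= v ->
  `|expR (- u) - expR (- v)| <= `|u - v|.
Proof.
move=> u0 v0; wlog uv : u v u0 v0 / u <= v.
  move=> H; have [|/ltW vu] := leP u v; first exact: H.
  by rewrite distrC [leRHS]distrC; exact: H.
rewrite ger0_norm ?subr_ge0 ?ler_expR ?lerN2// ler0_norm ?subr_le0// opprB.
have -> : - v = - u + (u - v) by ring.
rewrite expRD.
have h1 : expR (- u) <= 1 by rewrite -expR0 ler_expR oppr_le0.
have h0 := expR_gt0 (- u).
have h2 : 1 + (u - v) <= expR (u - v) by exact: expR_ge1Dx.
have : expR (- u) * (1 + (u - v)) <= expR (- u) * expR (u - v).
  by apply: ler_wpM2l => //; exact: ltW.
have : expR (- u) * (v - u) <= 1 * (v - u) by apply: ler_wpM2r => //; rewrite subr_ge0.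
nra.
Qed.

(** Smoothing at [delta] is what makes the kernel Lipschitz, so that its argument can be moved by a
    small error. Radius 8 leaves room for differences between a position of the path in the disk and
    a point of [A]. *)
Lemma gk_lipschitz (t : R) (x y : R * R) : delta <= t -> `|x| <= 8 -> `|y| <= 8 ->
  `|gk t x - gk t y| <= 16 / delta ^+ 2 * `|x - y|.
Proof.
move=> dt x8 y8; have t0' : 0 < t by exact: lt_le_trans dt.
rewrite !gk_expR -mulrBr normrM ger0_norm ?invr_ge0 ?(ltW (twopi_gt0 _))//.
have h : `|nsq x - nsq y| <= 32 * `|x - y|.
  have -> : nsq x - nsq y = (x - y).1 * (x.1 + y.1) + (x - y).2 * (x.2 + y.2).
    by rewrite /nsq /=; ring.
  apply: le_trans (ler_normD _ _) _; rewrite !normrM.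
  have a1 := norm_fst (x - y); have a2 := norm_snd (x - y).
  have b1 : `|x.1 + y.1| <= 16.
    apply: le_trans (ler_normD _ _) _.
    by have := norm_fst x; have := norm_fst y; lra.
  have b2 : `|x.2 + y.2| <= 16.
    apply: le_trans (ler_normD _ _) _.
    by have := norm_snd x; have := norm_snd y; lra.
  have h1 : `|(x - y).1| * `|x.1 + y.1| <= `|x - y| * 16 by apply: ler_pM.
  have h2 : `|(x - y).2| * `|x.2 + y.2| <= `|x - y| * 16 by apply: ler_pM.
  lra.
have h' : `|expR (- nsq x / (2 * t)) - expR (- nsq y / (2 * t))| <= 16 / delta * `|x - y|.
  rewrite !mulNr; apply: le_trans (expRN_lipschitz _ _) _.
  - by rewrite divr_ge0 ?nsq_ge0// mulr_ge0// ltW.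
  - by rewrite divr_ge0 ?nsq_ge0// mulr_ge0// ltW.
  rewrite -mulrBl normrM [X in _ * X]ger0_norm ?invr_ge0 ?mulr_ge0 ?(ltW t0')//.
  apply: (@le_trans _ _ (32 * `|x - y| / (2 * t))).
    by apply: ler_wpM2r => //; rewrite invr_ge0 mulr_ge0// ltW.
  rewrite [leLHS](_ : _ = 16 * `|x - y| / t); last by field; rewrite gt_eqF.
  rewrite mulrAC; apply: ler_wpM2r => //; apply: ler_wpM2l => //.
  by rewrite lef_pV2.
have g1 : (2 * pi * t)^-1 <= delta^-1.
  rewrite lef_pV2 ?posrE ?twopi_gt0//; have p2 := @pi_ge2 R.
  apply: le_trans dt _; rewrite ler_peMl ?(ltW t0')//; lra.
apply: (@le_trans _ _ (delta^-1 * (16 / delta * `|x - y|))).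
  by apply: ler_pM => //; rewrite invr_ge0 ltW// twopi_gt0.
by rewrite le_eqVlt; apply/orP; left; apply/eqP; field; rewrite gt_eqF.
Qed.

Lemma Rk_lipschitz (x y : R * R) : `|x| <= 8 -> `|y| <= 8 ->
  `|Rk delta eta N x - Rk delta eta N y| <=
  N%:R * eta * (16 / delta ^+ 2) * `|x - y|.
Proof.
move=> x8 y8; rewrite /Rk -sumrB; apply: le_trans (ler_norm_sum _ _ _) _.
rewrite -[N in leRHS]card_ord -sumr_const !mulr_suml; apply: ler_sum => q _.
rewrite -mulrBr normrM mul1r -mulrA ger0_norm//; apply: ler_wpM2l => //.
by apply: gk_lipschitz => //; rewrite lerDl mulr_ge0.
Qed.

End fixed.

Lemma sum_shift_le (F : nat -> R) (j L : nat) : (forall g, 0 <= F g) ->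
  \sum_(i < L | (j <= i)%N) F (i - j)%N <= \sum_(g < L) F g.
Proof.
move=> F0; rewrite -(big_mkord (fun i => (j <= i)%N) (fun i => F (i - j)%N)).
rewrite -(big_mkord xpredT F).
have [Lj|jL] := leqP L j.
  rewrite big_nat_cond big1 ?sumr_ge0// => i; lia.
rewrite (big_cat_nat (n := j))//=; last exact: ltnW.
rewrite big_nat_cond big1 ?add0r; last by move=> i; lia.
rewrite big_nat_cond (eq_bigl (fun i => (j <= i < L)%N)); last by move=> i; lia.
rewrite -big_nat (_ : \sum_(j <= i < L) F (i - j)%N = \sum_(0 <= i < L - j) F i).
  rewrite [leRHS](big_cat_nat (n := (L - j)%N))//=; last by lia.
  by rewrite lerDl sumr_ge0.
by rewrite -{1}[j]add0n big_addn; apply: eq_bigr => i _; rewrite addnK.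
Qed.

(** With truncated subtraction [(i - j) + (j - i)] is the distance of the indices. The sum is split
    into [i <= j] and [j <= i], and for fixed first index each half is a sum over gaps. *)
Lemma pair_sum_le eta (L : nat) (kap : nat -> R) : 0 <= eta ->
  (forall g, 0 <= kap g) ->
  \sum_(i < L) \sum_(j < L) eta * eta * kap ((i - j) + (j - i))%N <=
  2 * (L%:R * eta) * (\sum_(g < L) eta * kap g).
Proof.
move=> e0 k0.
pose S := \sum_(g < L) eta * kap g.
have half : \sum_(i < L) \sum_(j < L | (i <= j)%N) eta * eta * kap (j - i)%N <=
    (L%:R * eta) * S.
  rewrite -[L in L%:R]card_ord -sumr_const !mulr_suml; apply: ler_sum => i _.
  rewrite mul1r (eq_bigr (fun j : 'I_L => eta * (eta * kap (j - i)%N))); last first.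
    by move=> j _; rewrite mulrA.
  rewrite -mulr_sumr; apply: ler_wpM2l => //.
  by apply: (sum_shift_le (F := fun g => eta * kap g)) => g; rewrite mulr_ge0.
apply: (@le_trans _ _ (\sum_(i < L) \sum_(j < L | (i <= j)%N) eta * eta * kap (j - i)%N
    + \sum_(i < L) \sum_(j < L | (i <= j)%N) eta * eta * kap (j - i)%N)).
  rewrite [X in _ <= _ + X](_ : _ = \sum_(j < L) \sum_(i < L | (i <= j)%N)
    eta * eta * kap (j - i)%N); last first.
    by rewrite (exchange_big_dep xpredT)//=.
  rewrite -big_split/=; apply: ler_sum => i _.
  rewrite [X in _ <= X + _]big_mkcond [X in _ <= _ + X]big_mkcond -big_split/=.
  apply: ler_sum => j _.
  have h : 0 <= eta * eta by rewrite mulr_ge0.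
  case: leqP => ij; case: leqP => ji.
  - have -> : (i - j + (j - i) = j - i)%N by lia.
    by rewrite lerDl mulr_ge0.
  - have -> : (i - j + (j - i) = j - i)%N by lia.
    by rewrite addr0.
  - have -> : (i - j + (j - i) = i - j)%N by lia.
    by rewrite add0r.
  - by lia.
by have := half; rewrite -/S; lra.
Qed.

(** A term of index at least [N] has time parameter at least [N * eta], so it is at most [1 / N]. *)
Lemma Rk_extend delta eta (N a : nat) z : 0 < delta -> 0 < eta -> (0 < N)%N ->
  Rk delta eta (N + a) z <= Rk delta eta N z + a%:R / N%:R.
Proof.
move=> d0 e0 N0; rewrite /Rk big_split_ord/= lerD2l.
apply: (@le_trans _ _ (\sum_(i < a) N%:R^-1)); last first.
  by rewrite sumr_const card_ord -[leLHS]mulr_natr [leLHS]mulrC lexx.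
apply: ler_sum => i _; rewrite -ler_pdivlMl// -invfM [eta * N%:R]mulrC; apply: gk_le1.
  by rewrite mulr_gt0// ltr0n.
by rewrite natrD mulrDl addrCA lerDl addr_ge0 ?mulr_ge0// ltW.
Qed.

(** A smoothing larger by [a] steps only drops the first [a] terms of a longer sum. *)
Lemma Rk_shift delta eta (N a : nat) z : 0 < delta -> 0 < eta ->
  Rk (delta + a%:R * eta) eta N z <= Rk delta eta (N + a) z.
Proof.
move=> d0 e0.
have g0 (q : nat) : 0 <= eta * gk (delta + q%:R * eta) z.
  by rewrite mulr_ge0 ?(ltW e0)// gk_ge0// addr_ge0 ?mulr_ge0// ltW.
rewrite /Rk addnC big_split_ord/= -[leLHS]add0r; apply: lerD; first exact: sumr_ge0.
by apply: ler_sum => q _; rewrite natrD mulrDl addrA.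
Qed.

End kernel_sums.

(** * Doob's maximal inequality in mean square *)

Section doob.
Context {R : realType}.

Fixpoint running_max (s : nat -> R) n : R :=
  if n is m.+1 then Num.max (running_max s m) (s m.+1) else s 0%N.

Lemma running_max_ge s n i : (i <= n)%N -> s i <= running_max s n.
Proof.
elim: n => [|n IH]; first by rewrite leqn0 => /eqP ->.
rewrite leq_eqVlt => /predU1P[->|]; first by rewrite /= le_max lexx orbT.
by rewrite ltnS /= le_max => /IH ->.
Qed.

Lemma running_max_le s n K : (forall i, s i <= K) -> running_max s n <= K.
Proof. by move=> H; elim: n => [|n IH] //=; rewrite ge_max IH H. Qed.

Lemma running_max_ge0 s n : (forall i, 0 <= s i) -> 0 <= running_max s n.
Proof. by move=> H; apply: le_trans (running_max_ge s (leqnn n)). Qed.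

(* With M the running maximum of s, the discrete stochastic integral of M
   against s is at most M s - M^2 / 2, and 2 M s <= M^2 / 2 + 2 s^2. *)
Lemma doob_pathwise s n : (forall i, 0 <= s i) ->
  running_max s n ^+ 2 + 4 * \sum_(j < n) running_max s j * s j.+1 <=
  4 * s n ^+ 2 + 4 * \sum_(j < n) running_max s j * s j.
Proof.
move=> s0.
have H : \sum_(j < n) running_max s j * s j.+1 - \sum_(j < n) running_max s j * s j <=
    running_max s n * s n - running_max s n ^+ 2 / 2.
  elim: n => [|n IH]; first by rewrite !big_ord0 subrr /=; have := s0 0%N; nra.
  rewrite !big_ord_recr/=.
  have := running_max_ge s (leqnn n).
  move: IH; move: (\sum_(i < n) _) (\sum_(i < n) _) => a b.
  move: (running_max s n) (s n.+1) (s n) => M u v IH h1.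
  have := sqr_ge0 (u - M); case: (leP M u) => h h2; rewrite ?(max_idPr h) ?(max_idPl (ltW h)) !expr2 in IH h2 *; nra.
have := sqr_ge0 (2 * s n - running_max s n); nra.
Qed.

End doob.

Section real_integrals.
Context d (T : measurableType d) (R : realType) (m : {measure set T -> \bar R}).
Implicit Types F G : T -> R.
Local Open Scope ereal_scope.

Lemma intr_ge0 F : (forall w, 0 <= F w)%R -> 0 <= \int[m]_w (F w)%:E.
Proof. by move=> F0; apply: integral_ge0 => w _; rewrite lee_fin. Qed.

Lemma intr_le F G : measurable_fun setT F -> measurable_fun setT G ->
  (forall w, 0 <= F w)%R -> (forall w, F w <= G w)%R ->
  \int[m]_w (F w)%:E <= \int[m]_w (G w)%:E.
Proof.
move=> mF mG F0 FG; apply: ge0_le_integral => //.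
- by move=> w _; rewrite lee_fin.
- exact/measurable_EFinP.
- exact/measurable_EFinP.
- by move=> w _; rewrite lee_fin.
Qed.

Lemma intrD F G : measurable_fun setT F -> measurable_fun setT G ->
  (forall w, 0 <= F w)%R -> (forall w, 0 <= G w)%R ->
  \int[m]_w (F w)%:E + \int[m]_w (G w)%:E = \int[m]_w (F w + G w)%:E.
Proof.
move=> mF mG F0 G0; rewrite -ge0_integralD//.
- by move=> w _; rewrite lee_fin.
- exact/measurable_EFinP.
- by move=> w _; rewrite lee_fin.
- exact/measurable_EFinP.
Qed.

Lemma intrZ (c : R) F : (0 <= c)%R -> measurable_fun setT F ->
  (forall w, 0 <= F w)%R -> c%:E * \int[m]_w (F w)%:E = \int[m]_w (c * F w)%:E.
Proof.
move=> c0 mF F0; rewrite -ge0_integralZl_EFin//.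
- by move=> w _; rewrite lee_fin.
- exact/measurable_EFinP.
Qed.

Lemma intr_sum (I : Type) (r : seq I) (F : I -> T -> R) :
  (forall i, measurable_fun setT (F i)) -> (forall i w, 0 <= F i w)%R ->
  \sum_(i <- r) \int[m]_w (F i w)%:E = \int[m]_w (\sum_(i <- r) F i w)%:E.
Proof.
move=> mF F0; rewrite -ge0_integral_sum//.
- by apply: eq_integral => w _; rewrite sumEFin.
- by move=> i; exact/measurable_EFinP.
- by move=> i w _; rewrite lee_fin.
Qed.

End real_integrals.

Section doob_expectation.
Context d (T : measurableType d) (R : realType) (P : probability T R).
Context (s : nat -> T -> R) (W : T -> R) (K : R) (N : nat).
Hypotheses (ms : forall i, measurable_fun setT (s i)) (mW : measurable_fun setT W).
Hypotheses (s0 : forall i w, 0 <= s i w) (sK : forall i w, s i w <= K).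
Hypotheses (W0 : forall w, 0 <= W w) (W1 : forall w, W w <= 1).
Local Open Scope ereal_scope.

Lemma measurable_running_max n :
  measurable_fun setT (fun w => running_max (s ^~ w) n).
Proof. by elim: n => [|n IH] //=; exact: measurable_maxr. Qed.

Lemma integral_le_cst (f : T -> R) (k : R) : measurable_fun setT f ->
  (forall w, 0 <= f w)%R -> (forall w, f w <= k)%R -> \int[P]_w (f w)%:E <= k%:E.
Proof.
move=> mf f0 fk; rewrite -[leRHS](integral_prob_cst P); apply: ge0_le_integral => //.
- by move=> w _; rewrite lee_fin.
- exact/measurable_EFinP.
- by move=> w _; rewrite lee_fin.
Qed.

(** The pathwise inequality integrated against the weight [W]. The submartingale property enters
    through its test against the running maximum; boundedness makes the two discrete stochastic sums
    finite, so that they can be compared and cancelled. *)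
Lemma doob_L2 :
  (forall j, (j < N)%N -> \int[P]_w (W w * running_max (s ^~ w) j * s j w)%:E <=
     \int[P]_w (W w * running_max (s ^~ w) j * s j.+1 w)%:E) ->
  \int[P]_w (W w * running_max (s ^~ w) N ^+ 2)%:E <=
  4%:E * \int[P]_w (W w * s N w ^+ 2)%:E.
Proof.
move=> H.
pose M j w := running_max (s ^~ w) j.
have M0 j w : (0 <= M j w)%R by exact: running_max_ge0.
have MK j w : (M j w <= K)%R by exact: running_max_le.
have mM j : measurable_fun setT (M j) by exact: measurable_running_max.
pose Y1 := \sum_(j < N) \int[P]_w (W w * M j w * s j.+1 w)%:E.
pose Y0 := \sum_(j < N) \int[P]_w (W w * M j w * s j w)%:E.
have mI j k : measurable_fun setT (fun w => W w * M j w * s k w)%R.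
  by apply: measurable_funM => //; apply: measurable_funM.
have I0 j k w : (0 <= W w * M j w * s k w)%R by rewrite !mulr_ge0.
have Ifin j k : \int[P]_w (W w * M j w * s k w)%:E \is a fin_num.
  rewrite ge0_fin_numE ?intr_ge0//.
  apply: (@le_lt_trans _ _ (1 * K * K)%:E); last exact: ltry.
  apply: integral_le_cst => // w.
  by apply: ler_pM => //; [rewrite mulr_ge0|apply: ler_pM].
have Y0fin : Y0 \is a fin_num by apply/sum_fin_numP => j _ _.
have Y01 : Y0 <= Y1 by apply: lee_sum => j _; exact: H.
suff : \int[P]_w (W w * M N w ^+ 2)%:E + 4%:E * Y1 <=
    4%:E * \int[P]_w (W w * s N w ^+ 2)%:E + 4%:E * Y0.
  move=> h; have : \int[P]_w (W w * M N w ^+ 2)%:E + 4%:E * Y0 <=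
    4%:E * \int[P]_w (W w * s N w ^+ 2)%:E + 4%:E * Y0.
    apply: le_trans h; apply: leeD => //.
    by apply: lee_wpmul2l => //; rewrite lee_fin.
  by rewrite leeD2rE// fin_numM.
have mS k : measurable_fun setT (fun w => \sum_(j < N) W w * M j w * s (k j) w)%R.
  by apply: measurable_sum => j.
have S0 k w : (0 <= \sum_(j < N) W w * M j w * s (k j) w)%R by exact: sumr_ge0.
have mW2 (f : T -> R) : measurable_fun setT f ->
    measurable_fun setT (fun w => W w * f w ^+ 2)%R.
  by move=> mf; apply: measurable_funM => //; exact: measurable_funX.
have W20 (f : T -> R) w : (0 <= W w * f w ^+ 2)%R by rewrite mulr_ge0// sqr_ge0.
have mW2c (c : R) (f : T -> R) : measurable_fun setT f ->
    measurable_fun setT (fun w => c * (W w * f w ^+ 2))%R.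
  by move=> mf; apply: measurable_funM => //; exact: mW2.
have mSc (c : R) k : measurable_fun setT (fun w => c * \sum_(j < N) W w * M j w * s (k j) w)%R.
  by apply: measurable_funM => //; exact: (mS k).
have c4 : (0 <= 4 :> R)%R by [].
rewrite /Y1 /Y0 (intr_sum P _ (fun j => mI _ _)) //.
rewrite (intr_sum P _ (fun j => mI _ _)) //.
rewrite (intrZ P c4 (mS S)) // (intrZ P c4 (mS id)) // (intrZ P c4 (mW2 _ (ms N))) //.
rewrite (intrD P (mW2 _ (mM N)) (mSc 4%R S)) //; last by move=> w; apply: mulr_ge0 => //; exact: (S0 S).
rewrite (intrD P (mW2c 4%R _ (ms N)) (mSc 4%R id)) //; last 2 first.
- by move=> w; apply: mulr_ge0 => //; exact: W20.
- by move=> w; apply: mulr_ge0 => //; exact: (S0 id).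
apply: intr_le.
- by apply: measurable_funD; [exact: mW2|exact: (mSc _ S)].
- by apply: measurable_funD; [exact: mW2c|exact: (mSc _ id)].
- move=> w; apply: addr_ge0 => //; apply: mulr_ge0 => //; exact: (S0 S).
- move=> w.
  have := doob_pathwise N (fun i => s0 i w).
  move=> /(ler_wpM2l (W0 w)); rewrite !mulrDr !(mulrCA _ 4%R) !mulr_sumr.
  rewrite -!mulr_sumr.
  have E (k : nat -> nat) : (\sum_(j < N) W w * M j w * s (k j) w = W w * \sum_(j < N) running_max (s ^~ w) j * s (k j) w)%R.
    by rewrite mulr_sumr; apply: eq_bigr => j _; rewrite mulrA.
  by rewrite (E S) (E id).
Qed.

End doob_expectation.

(** * Dyadic grids and the first double time *)

Section grid.
Context {R : realType} (h : R).
Hypothesis h0 : 0 < h.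

(** Each block of length [h] contains exactly [2 ^ n] steps at level [n], so the ends of blocks are
    grid times at every level. *)
Definition grid (n j : nat) : R := j%:R * (h / 2 ^+ n).

Let step_gt0 n : 0 < h / 2 ^+ n.
Proof. by rewrite divr_gt0// exprn_gt0. Qed.

Lemma grid_ge0 n j : 0 <= grid n j.
Proof. by rewrite mulr_ge0// ltW. Qed.

Lemma grid_le n i j : (grid n i <= grid n j) = (i <= j)%N.
Proof. by rewrite ler_pM2r// ler_nat. Qed.

Lemma grid_lt n i j : (grid n i < grid n j) = (i < j)%N.
Proof. by rewrite ltr_pM2r// ltr_nat. Qed.

Lemma gridD n i j : grid n (i + j) = grid n i + grid n j.
Proof. by rewrite /grid natrD mulrDl. Qed.

Lemma gridS n j : grid n j.+1 = grid n j + grid n 1.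
Proof. by rewrite -addn1 gridD. Qed.

Lemma grid1 n : grid n 1 = h / 2 ^+ n. Proof. by rewrite /grid mul1r. Qed.

Lemma grid1_gt0 n : 0 < grid n 1. Proof. by rewrite grid1. Qed.

Lemma gridE n j : grid n j = j%:R * grid n 1. Proof. by rewrite grid1. Qed.

Lemma grid_block n l : grid n (l * 2 ^ n) = l%:R * h.
Proof.
rewrite /grid natrM natrX -mulrA; congr (_ * _).
by rewrite mulrC mulfVK// gt_eqF// exprn_gt0.
Qed.

Lemma grid1_le n : grid n 1 <= h.
Proof.
rewrite grid1 ler_pdivrMr ?exprn_gt0// ler_peMr ?(ltW h0)//.
by rewrite exprn_ege1// ler1n.
Qed.

Lemma grid_near n t : 0 <= t -> exists j, t <= grid n j < t + grid n 1.
Proof.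
move=> t0; set k := Num.truncn (t / grid n 1).
have st := grid1_gt0 n.
have /andP[k1 k2] : k%:R <= t / grid n 1 < k.+1%:R.
  by rewrite truncn_le ?divr_ge0 ?(ltW st)//= truncnS_gt.
move: k1 k2; rewrite ler_pdivlMr// ltr_pdivrMr// -!gridE => k1 k2.
have [->|kt] := eqVneq t (grid n k); first by exists k; rewrite lexx ltrDl.
exists k.+1; rewrite (ltW k2)/= gridS ltrD2r lt_neqAle k1 andbT.
by rewrite eq_sym.
Qed.

Lemma grid1_small (e : R) : 0 < e -> exists n0, forall n, (n0 <= n)%N -> grid n 1 < e.
Proof.
move=> e0; exists (Num.truncn (h / e)).+1 => n nn.
have h1 : h / e < n%:R.
  by apply: lt_le_trans (truncnS_gt _) _; rewrite ler_nat.
rewrite grid1 ltr_pdivrMr ?exprn_gt0// mulrC -ltr_pdivrMr//.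
apply: lt_le_trans h1 _; rewrite -natrX ler_nat.
exact/ltnW/ltn_expl.
Qed.

End grid.

(** In a monotone Boolean sequence the number of false values is the index of the first true one;
    this turns a first grid time into a sum. *)
Lemma sum_negb_prefix (a : nat -> bool) n : (forall i j, (i <= j)%N -> a i -> a j) ->
  forall j, (j < n)%N -> (j < \sum_(i < n) ~~ a i)%N = ~~ a j.
Proof.
move=> am; elim: n => [//|n IH] j; rewrite ltnS leq_eqVlt big_ord_recr/=.
have le_n : (\sum_(i < n) ~~ a i <= n)%N.
  by rewrite -[leqRHS]card_ord -sum1_card; apply: leq_sum => i _; case: (a i).
case: (boolP (a n)) => an /=.
  rewrite addn0 => /predU1P[->|jn]; last exact: IH.
  by rewrite an ltnNge le_n.
have -> : (\sum_(i < n) ~~ a i = n)%N.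
  rewrite -[RHS]card_ord -sum1_card; apply: eq_bigr => i _.
  by rewrite (contra (am i n (ltnW (ltn_ord i))) an).
rewrite addn1 => /predU1P[->|jn]; first by rewrite ltnSn an.
by rewrite ltnS (ltnW jn) (contra (am j n (ltnW jn)) an).
Qed.

Section first_double.
Context {R : realType} (b : R -> R * R) (A : set (R * R)) (h : R) (M : nat).
Hypotheses (cb : {within `[0, +oo[, continuous b}) (cA : closed A) (h0 : 0 < h).
Local Notation double := (double_in b A (4 * h)).

(** As a supremum of times without a double point it makes sense on every path; it equals the
    horizon [M%:R * h] when there is no double point by then. *)
Definition first_double := sup [set t | 0 <= t <= M%:R * h /\ ~ double t].
Local Notation S := first_double.

(** The first index of a grid time with a double point. If none of the grid times up to the horizon
    has one, the count gives [M * 2 ^ n + 1], one step beyond the horizon. *)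
Definition double_index n : nat :=
  \sum_(j < (M * 2 ^ n).+1) ~~ `[< double (grid h n j) >].

Lemma double_indexP n j : (j <= M * 2 ^ n)%N ->
  (j < double_index n)%N <-> ~ double (grid h n j).
Proof.
move=> jM; rewrite /double_index.
rewrite (sum_negb_prefix (a := fun j => `[< double (grid h n j) >]))//.
  by split=> [/asboolPn|?]; [|apply/asboolPn].
move=> i k ik /asboolP H; apply/asboolP; apply: double_in_le H.
by rewrite grid_le.
Qed.

Lemma double_in0 : ~ double 0.
Proof. by move=> [r [s [r0 rs s0 _ _]]]; have := h0; lra. Qed.

Lemma double_index_gt0 n : (0 < double_index n)%N.
Proof.
by rewrite double_indexP// /grid mul0r; exact: double_in0.
Qed.

Lemma first_double_set : has_sup [set t | 0 <= t <= M%:R * h /\ ~ double t].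
Proof.
split; first by exists 0; split; [rewrite lexx mulr_ge0// ltW|exact: double_in0].
by exists (M%:R * h) => t [/andP[]].
Qed.

Lemma first_double_ge0 : 0 <= S.
Proof.
apply: ub_le_sup; first by case: first_double_set.
by split; [rewrite lexx mulr_ge0// ltW|exact: double_in0].
Qed.

Lemma first_double_le t : double t -> S <= t.
Proof.
move=> dt; apply: ge_sup; first by case: first_double_set.
move=> u [_ du]; rewrite leNgt; apply/negP => tu; apply: du.
by apply: double_in_le dt; exact: ltW.
Qed.

Lemma first_double_index n :
  S <= grid h n (double_index n) <= S + grid h n 1.
Proof.
apply/andP; split.
  apply: ge_sup; first by case: first_double_set.
  move=> t [/andP[t0 tM] dt]; rewrite leNgt; apply/negP => gt.
  have jM : (double_index n < M * 2 ^ n)%N.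
    by rewrite -(grid_lt h0 n) grid_block//; exact: lt_le_trans tM.
  have := @double_indexP n (double_index n) (ltnW jM); rewrite ltnn => -[_ H].
  apply: dt; apply: double_in_le (ltW gt) _.
  by apply: contrapT => /H.
have := double_index_gt0 n; case E : (double_index n) => [//|j] _.
rewrite gridS lerD2r; apply: ub_le_sup; first by case: first_double_set.
have jM : (j <= M * 2 ^ n)%N.
  rewrite -ltnS -E; apply: (@leq_trans (\sum_(j < (M * 2 ^ n).+1) 1)%N).
    by apply: leq_sum => i _; case: asboolP.
  by rewrite sum_nat_const card_ord muln1.
split; last by apply/double_indexP => //; rewrite E.
by rewrite grid_ge0//= -(grid_block h n) grid_le.
Qed.

(** A countable union over grid times, hence measurable. Survival is an open condition in time, so
    asking for it at some grid time after the double point loses no path. *)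
Definition hit := exists n j, [/\ (j <= M * 2 ^ n)%N, alive b (grid h n j) &
  double (grid h n j)].

(** Double pairs that end at most one step after [S] accumulate, by compactness, at a double pair
    that ends exactly at [S]. Survival beyond [S] comes from [alive_open]. *)
Lemma hit_first_double : hit -> exists2 r, [/\ 0 <= r, r + 4 * h <= S,
  b r = b S & A (b S)] & exists2 t, S < t & alive b t.
Proof.
move=> [n0 [j0 [j0M al db]]].
have S0 := first_double_ge0.
have SM : S <= M%:R * h.
  by apply: le_trans (first_double_le db) _; rewrite -(grid_block h n0) grid_le.
have dM n : double (grid h n (double_index n)).
  have iM : (double_index n <= M * 2 ^ n)%N.
    rewrite leqNgt; apply/negP => /double_indexP -/(_ (leqnn _)); apply.
    by rewrite grid_block//; apply: double_in_le db; rewrite -(grid_block h n0) grid_le.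
  by apply: contrapT => /double_indexP -/(_ iM); rewrite ltnn.
have /choice[rs rsP] : forall n, exists p : R * R, [/\ 0 <= p.1, p.1 + 4 * h <= p.2,
    p.2 <= grid h n (double_index n), b p.1 = b p.2 & A (b p.2)].
  by move=> n; have [r [s H]] := dM n; exists (r, s).
have sS n : S <= (rs n).2 <= S + grid h n 1.
  have [r0 rs4 sg e a] := rsP n; apply/andP; split.
    by apply: first_double_le; exists (rs n).1, (rs n).2.
  by apply: le_trans sg _; case/andP: (first_double_index n).
have cs : (rs n).2 @[n --> \oo] --> S.
  apply/cvgrPdist_lt => e e0; have [n1 H] := grid1_small h e0.
  exists n1 => // n /= nn; rewrite distrC ger0_norm ?subr_ge0; last by case/andP: (sS n).
  by rewrite ltrBlDl; apply: le_lt_trans (proj2 (andP (sS n))) _; rewrite ltrD2l H.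
have T0 n : 0 <= (rs n).2 <= S + h.
  have /andP[a1 a2] := sS n; rewrite (le_trans S0 a1)/=.
  by apply: le_trans a2 _; rewrite lerD2l grid1_le.
have [|n|n||n|f [r [s [fi sc [r0 s0 rs4 sT] e a]]]] :=
    @double_limit _ b cb A (4 * h) (S + h) (fun n => (rs n).1) (fun n => (rs n).2)
     (fun=> 0) (fun n => b (rs n).2) cA.
- by rewrite mulr_ge0// ltW.
- have [r0 rs4 sg e a] := rsP n; rewrite r0/=.
  by have := T0 n; have := h0; lra.
- exact: T0.
- exact: cvg_cst.
- have [r0 rs4 sg e a] := rsP n; split => //; first by rewrite addr0.
    by rewrite e subrr normr0.
  by rewrite subrr normr0.
have sE : s = S.
  apply: (@cvg_unique _ (@Rhausdorff R) ((fun n => (rs (f n)).2) @ \oo)) => //.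
  exact: (cvg_comp f (fun n => (rs n).2) (cvg_increasing fi) cs).
exists r; first by rewrite sE in rs4 e a.
have [t' tt' at'] := alive_open cb (grid_ge0 h0 n0 j0) al.
by exists t' => //; apply: le_lt_trans tt'; exact: first_double_le.
Qed.

(** The separation [4 * h] is relaxed to three block lengths because rounding the earlier time up to
    the grid costs at most [h]; three lengths still leave a full block between the blocks of the two
    visits. The tolerance [g] absorbs the displacement caused by the rounding. *)
Definition double_mark (g : R) n j := [/\ double (grid h n j.+1),
  ~ double (grid h n j), alive b (grid h n j.+1) &
  exists2 i, (i + 3 * 2 ^ n <= j.+1)%N &
    `|b (grid h n i) - b (grid h n j.+1)| <= g].

Lemma hit_mark (g : R) : hit -> 0 < g -> exists n0, forall n, (n0 <= n)%N ->
  exists j, [/\ (j < M * 2 ^ n)%N, double_mark g n j &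
    `|b S - b (grid h n j.+1)| <= g].
Proof.
move=> hi g0; have [r [r0 rs e a] [t St at_]] := hit_first_double hi.
have S0 := first_double_ge0.
have g2 : 0 < g / 2 by rewrite divr_gt0.
have [d1 d10 H1] := path_near cb r0 g2.
have [d2 d20 H2] := path_near cb S0 g2.
have [n1 N1] := grid1_small h d10.
have [n2 N2] := grid1_small h d20.
have tS0 : 0 < t - S by rewrite subr_gt0.
have [n3 N3] := grid1_small h tS0.
exists (n1 + n2 + n3)%N => n nn.
have {}N3 := N3 n (leq_trans (leq_addl _ _) nn).
have nn12 := leq_trans (leq_addr _ _) nn.
have {}N1 := N1 n (leq_trans (leq_addr _ _) nn12).
have {}N2 := N2 n (leq_trans (leq_addl _ _) nn12).
have /andP[i1 i2] := first_double_index n.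
have [k0 [j0 [j0M al db]]] := hi.
have iM : (double_index n <= M * 2 ^ n)%N.
  rewrite leqNgt; apply/negP => /double_indexP -/(_ (leqnn _)); apply.
  by rewrite grid_block//; apply: double_in_le db; rewrite -(grid_block h k0) grid_le.
have dj : double (grid h n (double_index n)).
  by apply: contrapT => /double_indexP -/(_ iM); rewrite ltnn.
have := double_index_gt0 n; case E : (double_index n) => [//|j] _.
rewrite E in i1 i2 iM dj.
have bS : `|b (grid h n j.+1) - b S| < g / 2.
  apply: H2; first exact: grid_ge0.
  by rewrite ger0_norm ?subr_ge0//; lra.
exists j; split => //; last by rewrite distrC; lra.
split => //.
- by apply/double_indexP; [exact: ltnW|rewrite E].
- by apply: alive_le at_; lra.
- have [i /andP[ri ir]] := grid_near h0 n r0.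
  exists i.
    rewrite -(grid_le h0 n) gridD grid_block//.
    by have := grid1_le h0 n; have := h0; lra.
  have bi : `|b (grid h n i) - b r| < g / 2.
    apply: H1; first exact: grid_ge0.
    by rewrite ger0_norm ?subr_ge0//; lra.
  rewrite e in bi.
  rewrite (_ : _ - _ = (b (grid h n i) - b S) - (b (grid h n j.+1) - b S)); last first.
    by rewrite opprB addrA subrK.
  by apply: le_trans (ler_normB _ _) _; lra.
Qed.

End first_double.

Section uniqueness_sums.
Context (T : Type) (R : realType) (D : nat -> set T).
Hypothesis D_uniq : forall i j w, D i w -> D j w -> i = j.

Lemma sum_indic_le (F : nat -> R) (C : R) K w : 0 <= C ->
  (forall j, (j < K)%N -> D j w -> F j <= C) -> \sum_(j < K) \1_(D j) w * F j <= C.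
Proof.
move=> C0 FC; have [[i iK Di]|no] := pselect (exists2 i, (i < K)%N & D i w).
  rewrite (bigD1 (Ordinal iK))//= big1 ?addr0 => [|j ji].
    by rewrite indicE mem_set// mul1r FC.
  rewrite indicE memNset ?mul0r// => Dj; case/eqP: ji.
  by apply: val_inj => /=; exact: D_uniq Dj Di.
rewrite big1// => j _; rewrite indicE memNset ?mul0r// => Dj.
by apply: no; exists j.
Qed.

End uniqueness_sums.

(** * The hitting event and the law of the hitting point *)

Section hitting_law.
Context d (T : measurableType d) (R : realType) (P : probability T R).
Context (x0 : R * R) (B : R -> T -> R * R).
Context (pbmB : planar_brownian_motion P x0 B).
Context (A : set (R * R)) (h : R) (M : nat).
Hypotheses (cA : closed A) (h0 : 0 < h).
Local Notation pT u := (g_sigma_algebraType (past B u)).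
Local Notation gr := (grid h).

Let cb w : {within `[0, +oo[, continuous (fun t => B t w)}.
Proof. exact: (pbm_path pbmB). Qed.

Let h4 : 0 <= 4 * h. Proof. by rewrite mulr_ge0// ltW. Qed.

Lemma adapted_set_mono u v (S : set T) : u <= v -> measurable (S : set (pT u)) ->
  measurable (S : set (pT v)).
Proof.
by move=> uv mS; have := @past_mono _ _ _ B _ _ uv measurableT S mS; rewrite setTI.
Qed.

Definition Hit := [set w | hit (B ^~ w) A h M].

Lemma HitE : Hit = \bigcup_n \bigcup_(j in `I_(M * 2 ^ n).+1)
  (Alive B (gr n j) `&` Double B A (4 * h) (gr n j)).
Proof.
apply/seteqP; split => w /=.
  by move=> [n [j [jM a b]]]; exists n => //; exists j.
by move=> [n _ [j jM [a b]]]; exists n, j.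
Qed.

Lemma measurable_Double n j : measurable (Double B A (4 * h) (gr n j)).
Proof.
apply: (adapted_set pbmB); apply: (adapted_double pbmB) => //; exact: grid_ge0.
Qed.

Lemma measurable_Alive t : 0 <= t -> measurable (Alive B t).
Proof. by move=> t0; apply: (adapted_set pbmB); exact: (adapted_alive pbmB). Qed.

Lemma measurable_Hit : measurable Hit.
Proof.
rewrite HitE; apply: bigcupT_measurable => n; apply: bigcup_measurable => j _.
apply: measurableI; last exact: measurable_Double.
by apply: measurable_Alive; exact: grid_ge0.
Qed.

Definition hit_point w := B (first_double (B ^~ w) A h M) w.

Let idx n w := double_index (B ^~ w) A h M n.

Let measurable_lt_idx n k : measurable [set w | (k < idx n w)%N].
Proof.
have [kM|Mk] := leqP k (M * 2 ^ n).
  rewrite (_ : mkset _ = ~` Double B A (4 * h) (gr n k)).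
    by apply: measurableC; exact: measurable_Double.
  by apply/seteqP; split => w /= /double_indexP; apply.
rewrite (_ : mkset _ = set0)//; apply/seteqP; split => w //= kI.
have : (idx n w <= (M * 2 ^ n).+1)%N.
  apply: (@leq_trans (\sum_(j < (M * 2 ^ n).+1) 1)%N).
    by apply: leq_sum => i _; case: asboolP.
  by rewrite sum_nat_const card_ord muln1.
by lia.
Qed.

(** The hitting point is the limit of the positions at the grid times [double_index], and the level
    sets of these indices are differences of events at grid times. *)
Lemma measurable_hit_point : measurable_fun setT hit_point.
Proof.
pose Y n w := B (gr n (idx n w)) w.
have mY n : measurable_fun setT (Y n).
  move=> _ E mE; rewrite setTI.
  rewrite (_ : _ @^-1` _ = \bigcup_k (([set w | (k < idx n w)%N] `\`
      [set w | (k.+1 < idx n w)%N]) `&` (B (gr n k.+1) @^-1` E))).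
    apply: bigcupT_measurable => k; apply: measurableI.
      by apply: measurableD; exact: measurable_lt_idx.
    rewrite -[_ @^-1` _]setTI; apply: (measurable_B pbmB) => //; exact: grid_ge0.
  apply/seteqP; split => w /=.
    move=> EY; exists (idx n w).-1 => //; have := double_index_gt0 (B ^~ w) A M h0 n.
    rewrite -/(idx n w) => i0; rewrite prednK//; split => //; split; first exact: leqnn.
    by apply/negP; rewrite -leqNgt.
  move=> [k _ [[k1 /negP]]]; rewrite -leqNgt => k2.
  have <- // : idx n w = k.+1 by apply/eqP; rewrite eqn_leq k2.
have cY w : Y n w @[n --> \oo] --> hit_point w.
  apply: (path_cvg (@cb w)) => [n||]; first exact: grid_ge0.
    exact: first_double_ge0.
  apply/cvgrPdist_lt => e e0; have [n1 H] := grid1_small h e0.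
  exists n1 => // n /= /H He; rewrite distrC.
  have /andP[a1 a2] := first_double_index (B ^~ w) A M h0 n.
  by rewrite ger0_norm ?subr_ge0// ltrBlDl; apply: le_lt_trans a2 _; rewrite ltrD2l.
apply/measurable_fun_pairP; split.
  apply: (@measurable_fun_cvg _ _ _ _ (fun n w => (Y n w).1)).
    by move=> n; have /measurable_fun_pairP[] := mY n.
  move=> w _; apply/cvgrPdist_lt => e e0; move/cvgrPdist_lt: (cY w) => /(_ _ e0).
  by apply: filterS => n; apply: le_lt_trans; exact: (norm_fst (_ - _)).
apply: (@measurable_fun_cvg _ _ _ _ (fun n w => (Y n w).2)).
  by move=> n; have /measurable_fun_pairP[] := mY n.
move=> w _; apply/cvgrPdist_lt => e e0; move/cvgrPdist_lt: (cY w) => /(_ _ e0).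
by apply: filterS => n; apply: le_lt_trans; exact: (norm_snd (_ - _)).
Qed.

Lemma hit_pointA w : Hit w -> A (hit_point w).
Proof. by move=> /(hit_first_double (@cb w) cA h0)[r []]. Qed.

Lemma hit_point9 w : Hit w -> nsq (hit_point w) < 9.
Proof.
move=> /(hit_first_double (@cb w) cA h0)[r _ [t St al]]; apply: al.
by rewrite (ltW St) andbT; exact: first_double_ge0.
Qed.

Definition Mark (g : R) n j := [set w | double_mark (B ^~ w) A h g n j].

(** Disjointness of the marks plays the part of a decomposition along the values of a stopping
    time. *)
Lemma Mark_uniq g n i j w : Mark g n i w -> Mark g n j w -> i = j.
Proof.
wlog ij : i j / (i <= j)%N.
  by move=> H; have [|/ltnW ji Di Dj] := leqP i j; [exact: H|apply/esym/H].
move=> [di _ _ _] [_ dj _ _]; apply/eqP; rewrite eqn_leq ij leqNgt/=.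
by apply/negP => ij'; apply: dj; apply: double_in_le di; rewrite grid_le.
Qed.

Lemma Mark_alive g n j : Mark g n j `<=` Alive B (gr n j.+1).
Proof. by move=> w []. Qed.

Lemma Mark_Hit g n j : (j < M * 2 ^ n)%N -> Mark g n j `<=` Hit.
Proof. by move=> jM w [D _ a _]; exists n, j.+1. Qed.

Lemma adapted_norm_le u s t (g : R) : 0 <= s <= u -> 0 <= t <= u ->
  measurable ([set w | `|B s w - B t w| <= g] : set (pT u)).
Proof.
move=> su tu.
have m1 : measurable_fun setT ((fun w => B s w - B t w) : pT u -> R * R).
  by apply: measurable_funB2; exact: adapted_B.
have m2 : measurable_fun setT (fun z : R * R => `|z|).
  by apply: continuous_measurable2; exact: norm_continuous.
have := @measurable_fun_le _ (pT u) R setT _ _ measurableT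
  (measurableT_comp m2 m1) (measurable_cst g).
by rewrite setTI.
Qed.

Lemma adapted_Mark g n j : measurable (Mark g n j : set (pT (gr n j.+1))).
Proof.
rewrite (_ : Mark g n j = (Double B A (4 * h) (gr n j.+1) `&`
   ~` Double B A (4 * h) (gr n j)) `&` Alive B (gr n j.+1) `&`
   \bigcup_(i in [set i | (i + 3 * 2 ^ n <= j.+1)%N])
     [set w | `|B (gr n i) w - B (gr n j.+1) w| <= g]); last first.
  apply/seteqP; split => w /=; first by move=> [? ? ? [i ? ?]]; do !split => //; exists i.
  by move=> [[[? ?] ?] [i ? ?]]; split => //; exists i.
have j0 := grid_ge0 h0 n j; have j1 := grid_ge0 h0 n j.+1.
apply: measurableI; last first.
  apply: bigcup_measurable => i /= ij; apply: adapted_norm_le.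
    by rewrite grid_ge0// grid_le//; lia.
  by rewrite grid_ge0//= lexx.
apply: measurableI; last exact: (adapted_alive pbmB).
apply: measurableI; first exact: (adapted_double pbmB).
apply: (@adapted_set_mono (gr n j)); first by rewrite grid_le.
by apply: measurableC; exact: (adapted_double pbmB).
Qed.

Lemma measurable_Mark g n j : measurable (Mark g n j).
Proof. by apply: (adapted_set pbmB); exact: adapted_Mark. Qed.

Let near_mark g n j := Mark g n j `&`
  [set w | `|hit_point w - B (gr n j.+1) w| <= g].

Definition Bad g n := Hit `\` \bigcup_(j in `I_(M * 2 ^ n)) near_mark g n j.

Lemma measurable_Bad g n : measurable (Bad g n).
Proof.
apply: measurableD; first exact: measurable_Hit.
apply: bigcup_measurable => j _; apply: measurableI; first exact: measurable_Mark.
have m1 : measurable_fun setT (fun w => hit_point w - B (gr n j.+1) w).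
  apply: measurable_funB2; first exact: measurable_hit_point.
  by apply: (measurable_B pbmB); exact: grid_ge0.
have m2 : measurable_fun setT (fun z : R * R => `|z|).
  by apply: continuous_measurable2; exact: norm_continuous.
have := @measurable_fun_le _ T R setT _ _ measurableT
  (measurableT_comp m2 m1) (measurable_cst g).
by rewrite setTI.
Qed.

(** By [hit_mark] no path belongs to infinitely many of these events at fixed [g]; continuity from
    above along their tails does the rest. *)
Lemma Bad_small (g e : R) : 0 < g -> 0 < e ->
  exists n0, forall n, (n0 <= n)%N -> (P (Bad g n) <= e%:E)%E.
Proof.
move=> g0 e0; pose E k := \bigcup_(n in [set n | (k <= n)%N]) Bad g n.
have mE k : measurable (E k) by apply: bigcup_measurable => n _; exact: measurable_Bad.
have E0 : \bigcap_k E k = set0.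
  apply/seteqP; split => w //= Ew.
  have [n _ [hw _]] := Ew 0%N I.
  have [n0 H] := hit_mark (@cb w) cA h0 hw g0.
  have [n' /= nn' [_]] := Ew n0 I; apply.
  by have [j [jM mj cl]] := H _ nn'; exists j.
have : P (E n) @[n --> \oo] --> P (\bigcap_k E k).
  apply: nonincreasing_cvg_mu => //.
  - by rewrite (le_lt_trans (probability_le1 P (mE 0%N)))// ltry.
  - by rewrite E0.
  - by move=> m n mn; apply/subsetPset => w [k /= nk Bk]; exists k => //=; exact: leq_trans nk.
rewrite E0 measure0 => /fine_cvgP[_ /cvgrPdist_lt /(_ _ e0)[n0 _ H]].
exists n0 => n nn.
apply: (@le_trans _ _ (P (E n))).
  apply: le_measure; [by rewrite inE; exact: measurable_Bad|by rewrite inE; exact: mE|].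
  by move=> w Bw; exists n => //=.
rewrite -(fineK (fin_num_measure P (E n) (mE n))) lee_fin.
by have := H n nn; rewrite sub0r normrN => /ltW; apply: le_trans; exact: ler_norm.
Qed.

(** Outside the bad event a mark lies within [g] of the hitting point, and the Lipschitz bound moves
    [G] from one to the other. Norm 3 suffices since both points are in the disk. *)
Lemma hit_point_approx (G : R * R -> R) (K L g : R) n :
  measurable_fun setT G -> (forall z, 0 <= G z <= K) -> 0 <= g -> 0 <= L ->
  (forall x y, `|x| <= 3 -> `|y| <= 3 -> `|G x - G y| <= L * `|x - y|) ->
  (\int[P]_w (\1_Hit w * G (hit_point w))%:E <=
   \sum_(j < M * 2 ^ n) \int[P]_w (\1_(Mark g n j) w * G (B (gr n j.+1) w))%:E
   + (L * g)%:E + K%:E * P (Bad g n))%E.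
Proof.
move=> mG GK g0 L0 GL.
have G0 z : 0 <= G z by case/andP: (GK z).
have K0 : 0 <= K by have /andP[a b] := GK 0; exact: le_trans b.
have mB j : measurable_fun setT (B (gr n j)).
  by apply: (measurable_B pbmB); exact: grid_ge0.
have mi (S : set T) : measurable S -> measurable_fun setT (\1_S : T -> R).
  by move=> mS; exact: measurable_indic.
have mF j : measurable_fun setT (fun w => \1_(Mark g n j) w * G (B (gr n j.+1) w) : R).
  apply: measurable_funM; first by apply: mi; exact: measurable_Mark.
  exact: measurableT_comp.
have F0 j w : 0 <= \1_(Mark g n j) w * G (B (gr n j.+1) w) by rewrite mulr_ge0.
have mS : measurable_fun setT (fun w =>
    \sum_(j < M * 2 ^ n) \1_(Mark g n j) w * G (B (gr n j.+1) w) : R).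
  exact: measurable_sum.
have S0 w : 0 <= \sum_(j < M * 2 ^ n) \1_(Mark g n j) w * G (B (gr n j.+1) w).
  exact: sumr_ge0.
have mBd := mi _ (measurable_Bad g n).
rewrite (intr_sum P _ (fun j : 'I_(M * 2 ^ n) => mF j) (fun j => F0 j)) -(integral_prob_cst P (L * g)%:E).
rewrite -(integral_indicT P (measurable_Bad g n)) (intrZ P K0 mBd)//.
rewrite (intrD P mS (measurable_cst (L * g)))//; last by move=> w; rewrite mulr_ge0.
rewrite (intrD P (measurable_funD mS (measurable_cst (L * g))))//; last 3 first.
- exact: measurable_funM.
- by move=> w; rewrite addr_ge0// mulr_ge0.
- by move=> w; rewrite mulr_ge0.
apply: intr_le.
- apply: measurable_funM; first by apply: mi; exact: measurable_Hit.
  by apply: measurableT_comp => //; exact: measurable_hit_point.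
- by apply: measurable_funD; [exact: measurable_funD|exact: measurable_funM].
- by move=> w; rewrite mulr_ge0.
move=> w; have [hw|hw] := pselect (Hit w); last first.
  by rewrite {1}indicE memNset// mul0r !addr_ge0// ?mulr_ge0.
rewrite {1}indicE mem_set// mul1r.
have [Bw|] := pselect (Bad g n w).
  rewrite [\1_(Bad _ _) w]indicE mem_set// mulr1 -[leLHS]add0r; apply: lerD.
    by rewrite addr_ge0// mulr_ge0.
  by case/andP: (GK (hit_point w)).
move=> nB; have [j jM [mj cl]] : (\bigcup_(j in `I_(M * 2 ^ n)) near_mark g n j) w.
  by apply: contrapT => H; apply: nB.
rewrite [\1_(Bad _ _) w]indicE memNset// mulr0 addr0.
rewrite /= (bigD1 (Ordinal jM))//= {1}indicE mem_set// mul1r -addrA.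
have n3 z : nsq z < 9 -> `|z| <= 3.
  move=> z9; rewrite -(ler_pXn2r (n := 2))// ?nnegrE//.
  by have := norm_nsq z; move: (`|z| ^+ 2) => k; lra.
have h1 : `|hit_point w| <= 3 by apply: n3; exact: hit_point9.
have h2 : `|B (gr n j.+1) w| <= 3.
  apply: n3; apply: (Mark_alive mj); rewrite lexx andbT; exact: grid_ge0.
have := GL _ _ h1 h2; have := ler_norm (G (hit_point w) - G (B (gr n j.+1) w)).
have h3 : L * `|hit_point w - B (gr n j.+1) w| <= L * g by exact: ler_wpM2l.
rewrite -lerBlDl => a b; apply: le_trans a _; apply: le_trans b _.
by apply: le_trans h3 _; rewrite lerDr; apply: sumr_ge0.
Qed.

(** Conditional law of the hitting point given the hitting event. The last [P] under [mnormalize] is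
    the default used when the hitting event is null. *)
Definition hit_law : probability (R * R)%type R :=
  distribution (mnormalize (mrestr P measurable_Hit) P : probability T R)
    (mfun_Sub (mem_set measurable_hit_point) : {mfun T >-> (R * R)%type}).

Local Open Scope ereal_scope.

Lemma integral_hit_law (f : R * R -> \bar R) : 0 < P Hit ->
  measurable_fun setT f -> (forall z, 0 <= f z) ->
  P Hit * \int[hit_law]_z f z = \int[P]_w ((\1_Hit w)%:E * f (hit_point w)).
Proof.
move=> p0 mf f0.
have mX := measurable_hit_point; have mH := measurable_Hit.
have pf := fin_num_measure P Hit mH.
pose Q : probability T R := mnormalize (mrestr P mH) P.
have mfX : measurable_fun setT (fun w => f (hit_point w)) by exact: measurableT_comp.
have -> : \int[hit_law]_z f z = \int[Q]_w f (hit_point w).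
  by rewrite /hit_law ge0_integral_distribution.
pose k := (fine (P Hit))^-1%R.
have k0 : (0 <= k)%R by rewrite invr_ge0 fine_ge0.
have QE E : measurable E -> Q E = \int[P]_(x in E) (k * \1_Hit x)%:E.
  move=> mE; transitivity (mnormalize (mrestr P mH) P E); first by [].
  rewrite /mnormalize /= /mrestr /= setTI.
  rewrite gt_eqF//= lt_eqF ?ltey_eq ?pf//.
  under eq_integral do rewrite EFinM.
  rewrite ge0_integralZl_EFin//; last first.
  - by apply/measurable_EFinP; apply: measurable_funTS; exact: measurable_indic.
  by rewrite integral_indic// muleC setIC.
have mk : measurable_fun setT (fun w => k * \1_Hit w)%R.
  by apply: measurable_funM => //; exact: measurable_indic.
rewrite (@ge0_integral_density _ _ _ P Q (fun w => k * \1_Hit w)%R)//; last first.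
  by move=> w; rewrite mulr_ge0.
rewrite -(fineK pf) -ge0_integralZl_EFin//; last 3 first.
- by move=> w _; rewrite mule_ge0// lee_fin mulr_ge0.
- by apply: emeasurable_funM => //; exact/measurable_EFinP.
- by rewrite fine_ge0.
apply: eq_integral => w _.
rewrite muleCA muleC -EFinM; congr (_ %:E * _).
by rewrite mulrA mulfV ?mul1r// gt_eqF// fine_gt0// p0 ltey_eq pf.
Qed.

Lemma hit_lawA : 0 < P Hit -> hit_law A = 1.
Proof.
move=> p0; have mX := measurable_hit_point; have mH := measurable_Hit.
have pf := fin_num_measure P Hit mH.
rewrite /hit_law /distribution /pushforward /= /mnormalize /= /mrestr /= setTI.
rewrite gt_eqF//= lt_eqF ?ltey_eq ?pf//.
rewrite (_ : _ `&` Hit = Hit).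
  rewrite -[in X in X * _](fineK pf) -EFinM mulfV// gt_eqF// fine_gt0// p0 ltey_eq pf//.
apply/seteqP; split => w; first by move=> [].
by move=> hw; split => //; exact: hit_pointA.
Qed.

End hitting_law.

(** * Upper bound: logarithmic energy of the hitting law *)

Section average.
Context d1 d2 (T1 : measurableType d1) (T2 : measurableType d2) (R : realType).
Context (mu : probability T2 R) (W : T1 * T2 -> R) (K : R).
Hypotheses (mW : measurable_fun setT W) (W0 : forall x, 0 <= W x).
Hypothesis (WK : forall x, W x <= K).

(** Real-valued, so that maxima and squares can be formed; the bounds on [W] make the integral
    finite, which justifies [fine]. *)
Definition avg x := fine (\int[mu]_y (W (x, y))%:E)%E.

Let mW2 x : measurable_fun setT (fun y => W (x, y)).
Proof. by apply: (measurableT_comp mW); exact: pair1_measurable. Qed.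

Lemma avgE x : (avg x)%:E = (\int[mu]_y (W (x, y))%:E)%E.
Proof.
rewrite /avg fineK// ge0_fin_numE ?intr_ge0//.
by apply: le_lt_trans (ltry K); exact: integral_le_cst.
Qed.

Lemma avg_ge0 x : 0 <= avg x.
Proof. by rewrite -lee_fin avgE intr_ge0. Qed.

Lemma avg_le x : avg x <= K.
Proof. by rewrite -lee_fin avgE; exact: integral_le_cst. Qed.

Lemma measurable_avg : measurable_fun setT avg.
Proof.
apply: (measurableT_comp (f := fine)); first exact: fine_measurable.
apply: (measurable_fun_fubini_tonelli_F (m2 := mu) (fun z => (W z)%:E)).
  exact/measurable_EFinP.
by move=> z; rewrite lee_fin.
Qed.

Lemma avg_diff x x' (c : R) : 0 <= c -> (forall y, W (x, y) <= W (x', y) + c) ->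
  avg x <= avg x' + c.
Proof.
move=> c0 H; rewrite -lee_fin EFinD !avgE -(integral_prob_cst mu c%:E).
rewrite (intrD mu (mW2 x') (measurable_cst c))//.
apply: intr_le => //.
by apply: measurable_funD => //; exact: measurable_cst.
Qed.

End average.

(** Telescoping: [h / (1 + t + h) ^+ 2] is at most the decrease of [1 / (1 + t)] over a step [h]. *)
Lemma inverse_square_sum (R : realType) (h : R) (K : nat) : 0 < h -> h <= 1 ->
  \sum_(k < K) h / (1 + k%:R * h) ^+ 2 <= 2.
Proof.
move=> h0 h1; case: K => [|K]; first by rewrite big_ord0.
suff : \sum_(k < K.+1) h / (1 + k%:R * h) ^+ 2 <= h + 1 - (1 + K%:R * h)^-1.
  have : 0 < (1 + K%:R * h)^-1 by rewrite invr_gt0 ltr_pwDl// mulr_ge0// ltW.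
  by lra.
elim: K => [|K IH].
  rewrite big_ord1 mul0r addr0 expr1n invr1; lra.
rewrite big_ord_recr/=; move: IH; move: (\sum_(k < _) _) => S IH.
have : 0 <= K%:R * h by rewrite mulr_ge0// ltW.
rewrite -natr1 mulrDl mul1r; move: IH; move: (K%:R * h) => t IH t0.
apply: (@le_trans _ _ (h + 1 - (1 + t)^-1 + h / ((1 + t) * (1 + (t + h))))).
  apply: lerD => //; apply: ler_wpM2l; first exact: ltW.
  rewrite lef_pV2 ?posrE; last 2 first.
  - by apply: exprn_gt0; lra.
  - by apply: mulr_gt0; lra.
  by rewrite expr2; apply: ler_wpM2r; lra.
rewrite le_eqVlt; apply/orP; left; apply/eqP; field.
by apply/andP; split; apply: lt0r_neq0; lra.
Qed.

(** Rests on [(1 + t) ^+ 2 <= 4 * t ^+ 3] for [t > 1]; it puts cubic decay into the form that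
    [inverse_square_sum] adds up. *)
Lemma cube_bound (R : realType) (c x y t : R) : 0 <= c -> 0 <= x -> 0 <= y ->
  1 < t -> c / t ^+ 3 * x <= 4 * c * (x + y) / (1 + t) ^+ 2.
Proof.
move=> c0 x0 y0 t1; rewrite ler_pdivlMr; last by apply: exprn_gt0; lra.
have t3 : 0 < t ^+ 3 by apply: exprn_gt0; lra.
have E : x * (1 + t) ^+ 2 <= (x + y) * (4 * t ^+ 3).
  apply: ler_pM => //; [exact: sqr_ge0|lra|].
  have h1 : 0 <= (t - 1) * (3 * t + 1) by apply: mulr_ge0; lra.
  have h2 : 0 <= t ^+ 2 * (t - 1) by apply: mulr_ge0; [exact: sqr_ge0|lra].
  rewrite -subr_ge0 (_ : _ - _ = 4 * (t ^+ 2 * (t - 1)) + (t - 1) * (3 * t + 1)).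
    by rewrite addr_ge0// mulr_ge0.
  by ring.
have -> : c / t ^+ 3 * x * (1 + t) ^+ 2 = c / t ^+ 3 * (x * (1 + t) ^+ 2) by rewrite -mulrA.
have -> : 4 * c * (x + y) = c / t ^+ 3 * ((x + y) * (4 * t ^+ 3)).
  by field; apply: lt0r_neq0; lra.
by apply: ler_wpM2l => //; rewrite divr_ge0// ltW.
Qed.

Section occupation.
Context d (T : measurableType d) (R : realType) (P : probability T R).
Context (B : R -> T -> R * R) (pbmB : planar_brownian_motion P (1, 0) B).
Local Open Scope ereal_scope.

(** Bound by the Green function of the disk. Up to time 1 the uniform estimate [start_density]
    applies, later the cubic decay of [killed_density]; both lie below
    [4 * 600 * (I + M) / (1 + t) ^+ 2]. The lag [a] lets the path be observed after the last time at
    which survival is known. *)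
Lemma green_sum (g : R * R -> R) (I M h a : R) (K : nat) : (0 <= a)%R ->
  measurable_fun setT g -> (forall z, (0 <= g z)%R) -> (0 <= M)%R ->
  (forall z, nsq (z - (1, 0)) < 9^-1 -> g z <= M)%R ->
  \int[@area R]_v (g v)%:E = I%:E -> (0 < h)%R -> (h <= 1)%R ->
  \sum_(k < K) h%:E * \int[P]_w (\1_(Alive B (k%:R * h)) w * g (B (k%:R * h + a) w))%:E
  <= (8 * 600 * (I + M))%:E.
Proof.
move=> a0 mg g0 M0 gM gI h0 h1.
have I0 : (0 <= I)%R by rewrite -lee_fin -gI intr_ge0.
have t0 k : (0 <= k%:R * h)%R by rewrite mulr_ge0// ltW.
have ta k : (0 <= k%:R * h + a)%R by rewrite addr_ge0.
have mA k : measurable (Alive B (k%:R * h)).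
  by apply: (adapted_set pbmB); exact: (adapted_alive pbmB).
have mgB k : measurable_fun setT (fun w => g (B (k%:R * h + a)%R w)).
  by apply: measurableT_comp => //; exact: (measurable_B pbmB).
have mi k : measurable_fun setT (\1_(Alive B (k%:R * h)) : T -> R).
  exact: measurable_indic.
have E1 k : \int[P]_w (\1_(Alive B (k%:R * h)) w * g (B (k%:R * h + a) w))%:E
    <= (5 * I + M)%:E.
  apply: (@le_trans _ _ (\int[P]_w (g (B (k%:R * h + a) w))%:E)).
    apply: intr_le => //; first exact: measurable_funM.
      by move=> w; rewrite mulr_ge0.
    move=> w; rewrite ler_piMl// indicE; by case: (_ \in _).
  apply: le_trans (start_density pbmB (ta _) erefl mg g0 M0 gM) _.
  by rewrite gI.
have E2 k : (0 < k%:R * h)%R ->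
    \int[P]_w (\1_(Alive B (k%:R * h)) w * g (B (k%:R * h + a) w))%:E
    <= (600 / (k%:R * h) ^+ 3 * I)%:E.
  move=> kh; have s0 : ((0 : R) <= 0 < k%:R * h)%R by rewrite lexx.
  have st : (k%:R * h <= k%:R * h + a)%R by rewrite lerDl.
  have := @killed_density _ _ _ _ _ _ pbmB 0%R _ _ (fun x => (g x.2)%:E) s0 st.
  rewrite subr0 => /(_ ltac:(by apply/measurable_EFinP; apply: measurableT_comp mg _; exact: measurable_snd)
    ltac:(by move=> x; rewrite lee_fin)) H.
  under eq_integral do rewrite EFinM.
  apply: le_trans H _; rewrite [leRHS]EFinM -gI; apply: lee_wpmul2l.
    by rewrite lee_fin; apply: divr_ge0; [exact: ler0n|exact/exprn_ge0/ltW].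
  rewrite le_eqVlt; apply/orP; left; apply/eqP; apply: eq_integral => v _ /=.
  exact: integral_prob_cst.
apply: (@le_trans _ _ (\sum_(k < K) (h * (4 * 600 * (I + M) / (1 + k%:R * h) ^+ 2))%:E)).
  apply: lee_sum => k _; rewrite EFinM; apply: lee_wpmul2l; first by rewrite lee_fin ltW.
  have := t0 k; have := E2 k; have := E1 k; move: (\int[P]_w _) => X.
  move: (k%:R * h)%R => t X1 X2 tt.
  have t1 : (0 < (1 + t) ^+ 2)%R by apply: exprn_gt0; lra.
  have [tl|tg] := leP t 1%R.
    apply: le_trans X1 _; rewrite lee_fin ler_pdivlMr//.
    have h4 : ((1 + t) ^+ 2 <= 4)%R.
      rewrite -subr_ge0 (_ : _ - _ = (1 - t) * (3 + t))%R; last ring.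
      by apply: mulr_ge0; lra.
    have h5 : (0 <= 5 * I + M)%R by lra.
    by apply: le_trans (ler_wpM2l h5 h4) _; lra.
  apply: le_trans (X2 _) _; first lra.
  by rewrite lee_fin; exact: (cube_bound (ler0n R 600) I0 M0 tg).
rewrite sumEFin lee_fin.
rewrite (eq_bigr (fun k : 'I_K => 4 * 600 * (I + M) * (h / (1 + k%:R * h) ^+ 2)))%R; last first.
  by move=> k _; rewrite mulrCA mulrA.
rewrite -mulr_sumr; have := inverse_square_sum K h0 h1.
have IM : (0 <= 4 * 600 * (I + M))%R by lra.
by move=> /(ler_wpM2l IM) H; apply: le_trans H _; lra.
Qed.

End occupation.

(** The first coordinates of [z] and [y] differ by at least [1 / 3], so points near the start are
    far from the target disk and [gk_le_nsq] applies. *)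
Lemma gk_far (R : realType) (t : R) (z y : R * R) : 0 < t -> nsq y <= 9^-1 ->
  nsq (z - (1, 0)) < 9^-1 -> gk t (z - y) <= 5.
Proof.
move=> t0 y9 z9.
have n9 : 9^-1 = 3^-1 ^+ 2 :> R by field.
have h1 : 9^-1 <= nsq (z - y).
  have a1 : y.1 ^+ 2 <= 3^-1 ^+ 2.
    apply: le_trans (_ : nsq y <= _); first by rewrite /nsq lerDl sqr_ge0.
    by rewrite -n9.
  have a2 : (z.1 - 1) ^+ 2 <= 3^-1 ^+ 2.
    apply: le_trans (_ : nsq (z - (1, 0)) <= _); first by rewrite /nsq /= lerDl sqr_ge0.
    by rewrite -n9 ltW.
  have b1 : y.1 <= 3^-1.
    by rewrite leNgt; apply/negP => h; have : 3^-1 ^+ 2 < y.1 ^+ 2; [rewrite ltrXn2r// ?nnegrE//; lra|lra].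
  have b2 : 1 - z.1 <= 3^-1.
    rewrite leNgt; apply/negP => h; have : 3^-1 ^+ 2 < (1 - z.1) ^+ 2; first by rewrite ltrXn2r// ?nnegrE//; lra.
    have -> : (1 - z.1) ^+ 2 = (z.1 - 1) ^+ 2 by ring.
    by lra.
  apply: (@le_trans _ _ ((z.1 - y.1) ^+ 2)); last by rewrite /nsq /= lerDl sqr_ge0.
  have h3 : 3^-1 <= z.1 - y.1 by lra.
  by rewrite n9 lerXn2r// ?nnegrE//; lra.
have h2 : 0 < nsq (z - y) by apply: lt_le_trans h1; rewrite invr_gt0.
apply: le_trans (gk_le_nsq t0 h2) _; have p2 := @pi_ge2 R.
have -> : 5 = 5^-1^-1 :> R by rewrite invrK.
rewrite lef_pV2 ?posrE//; last by apply: mulr_gt0 => //; lra.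
apply: (@le_trans _ _ (2 * 9^-1)); first lra.
by apply: ler_pM => //; rewrite invr_ge0.
Qed.

Lemma real_split_small (R : realType) (K L e : R) : 0 <= K -> 0 <= L -> 0 < e ->
  exists g b : R, [/\ 0 < g, 0 < b & L * g + K * b <= e].
Proof.
move=> K0 L0 e0; exists (e / 2 / (L + 1)), (e / 2 / (K + 1)).
have L1 : 0 < L + 1 by lra.
have K1 : 0 < K + 1 by lra.
have e2 : 0 < e / 2 by lra.
split; [by rewrite divr_gt0|by rewrite divr_gt0|].
have H (x : R) : 0 <= x -> x * (e / 2 / (x + 1)) <= e / 2.
  move=> x0; rewrite mulrCA ler_piMr ?(ltW e2)// ler_pdivrMr; lra.
by have := H _ K0; have := H _ L0; lra.
Qed.

Section first_moment.
Context d (T : measurableType d) (R : realType) (P : probability T R).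
Context (B : R -> T -> R * R) (pbmB : planar_brownian_motion P (1, 0) B).
Context (A : set (R * R)) (h : R) (M N1 : nat).
Hypotheses (cA : closed A) (h0 : 0 < h) (h1 : h <= 1).
Hypothesis A9 : forall y, A y -> nsq y <= 9^-1.
Context (delta : R).
Hypothesis d0 : 0 < delta.
Local Notation pT u := (g_sigma_algebraType (past B u)).
Local Notation gr := (grid h).

(** The number of steps grows with the level, so that the window always lasts [N1%:R * h] in real
    time and its bounds do not depend on [n]. *)
Definition window (n : nat) : R * R -> R := Rk delta (gr n 1) (N1 * 2 ^ n).

Definition restricted (W : R * R -> R) : (R * R) * (R * R) -> R :=
  fun z => \1_A z.2 * W (z.1 - z.2).

Lemma window_ge0 n z : 0 <= window n z.
Proof. by apply: Rk_ge0 => //; exact: grid_ge0. Qed.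

Lemma window_length n : (N1 * 2 ^ n)%:R * gr n 1 = N1%:R * h.
Proof. by rewrite -gridE grid_block. Qed.

Lemma window_le n z : window n z <= N1%:R * h / delta.
Proof.
by rewrite -(window_length n) -mulrA; apply: Rk_le => //; exact: grid_ge0.
Qed.

Lemma measurable_window n : measurable_fun setT (window n).
Proof. by apply: measurable_Rk. Qed.

Lemma measurable_A : measurable A. Proof. exact: closed_measurable2. Qed.

Lemma measurable_restricted W : measurable_fun setT W ->
  measurable_fun setT (restricted W).
Proof.
move=> mW; apply: measurable_funM.
  apply: (measurableT_comp (f := (\1_A : R * R -> R))); last exact: measurable_snd.
  by apply: measurable_indic; exact: measurable_A.
apply: (measurableT_comp mW).
by apply: measurable_funB2; [exact: measurable_fst|exact: measurable_snd].
Qed.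

Lemma restricted_ge0 W : (forall z, 0 <= W z) -> forall z, 0 <= restricted W z.
Proof. by move=> W0 z; rewrite mulr_ge0. Qed.

Lemma restricted_le W K : (forall z, 0 <= W z <= K) -> forall z, restricted W z <= K.
Proof.
move=> WK z; have /andP[a b] := WK (z.1 - z.2).
by apply: le_trans b; rewrite ler_piMl// indicE; case: (_ \in _).
Qed.

Lemma avg_restricted_lipschitz (mu : probability (R * R)%type R) (W : R * R -> R) (K L : R) :
  measurable_fun setT W -> (forall z, 0 <= W z <= K) -> 0 <= L ->
  (forall x y, `|x| <= 8 -> `|y| <= 8 -> `|W x - W y| <= L * `|x - y|) ->
  forall x y, `|x| <= 3 -> `|y| <= 3 ->
  `|avg mu (restricted W) x - avg mu (restricted W) y| <= L * `|x - y|.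
Proof.
move=> mW WK L0 WL.
have W0 z : 0 <= W z by case/andP: (WK z).
have H x y : `|x| <= 3 -> `|y| <= 3 ->
    avg mu (restricted W) x <= avg mu (restricted W) y + L * `|x - y|.
  move=> x3 y3. apply: (avg_diff mu (measurable_restricted mW) (restricted_ge0 W0) (restricted_le WK)).
    by rewrite mulr_ge0.
  move=> a; rewrite /restricted/= !indicE; case: (boolP (a \in A)) => [|_]; last first.
    by rewrite !mul0r add0r mulr_ge0.
  rewrite inE => Aa; rewrite !mul1r -lerBlDl.
  have a1 : `|a| <= 1.
    rewrite -(ler_pXn2r (n := 2))// ?nnegrE// expr1n.
    by have := norm_nsq a; have := A9 Aa; move: (`|a| ^+ 2) => k; lra.
  have -> : x - y = (x - a) - (y - a) by rewrite opprB addrA subrK.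
  apply: le_trans (ler_norm _) _; apply: WL.
    by apply: le_trans (ler_normB _ _) _; lra.
  by apply: le_trans (ler_normB _ _) _; lra.
move=> x y x3 y3; rewrite ler_norml; apply/andP; split.
  by have := H y x y3 x3; rewrite distrC; lra.
by have := H x y x3 y3; lra.
Qed.

Local Open Scope ereal_scope.

Lemma start_gk (t : R) (y : R * R) : (0 <= t)%R -> (nsq y <= 9^-1)%R ->
  \int[P]_w (gk delta (B t w - y))%:E <= (5 + 5)%:E.
Proof.
move=> t0 y9.
apply: le_trans (start_density (M := 5%R) pbmB t0 erefl (measurable_gkB delta y) _ _ _) _ => //.
- by move=> z; rewrite gk_ge0// ltW.
- by move=> z zx; exact: gk_far.
- by rewrite area_gk// mule1.
Qed.

(** Says that the window at the current position is the conditional expectation of the smoothed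
    occupation of [y] during the steps that follow. *)
Lemma markov_window (n j : nat) (y : R * R) (F : T -> R) :
  measurable_fun setT (F : pT (gr n j) -> R) -> (forall w, (0 <= F w)%R) ->
  \int[P]_w (F w * window n (B (gr n j) w - y)%R)%:E =
  \int[P]_w (F w * \sum_(q < N1 * 2 ^ n) gr n 1 * gk delta (B (gr n (j + q)) w - y)%R)%:E.
Proof.
move=> mF F0; set N := (N1 * 2 ^ n)%N; set eta := gr n 1.
have eta0 : (0 < eta)%R by exact: grid1_gt0.
have mF' : measurable_fun setT F by exact: (adapted_measurable pbmB mF).
have mG (a : R) q : measurable_fun setT (fun w => F w * gk a (B (gr n q) w - y))%R.
  apply: measurable_funM => //; apply: (measurableT_comp (measurable_gkB a y)).
  by apply: (measurable_B pbmB); exact: grid_ge0.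
have G0 (a : R) q w : (0 < a)%R -> (0 <= F w * gk a (B (gr n q) w - y))%R.
  by move=> a0; rewrite mulr_ge0// gk_ge0// ltW.
have dq0 (q : nat) : (0 < delta + q%:R * eta)%R by rewrite ltr_wpDr// mulr_ge0// ltW.
transitivity (\sum_(q < N) eta%:E *
   \int[P]_w (F w * gk (delta + q%:R * eta) (B (gr n j) w - y)%R)%:E).
  rewrite (eq_bigr _ (fun (q : 'I_N) _ => intrZ P (ltW eta0) (mG (delta + q%:R * eta)%R j) (fun w => G0 _ j w (dq0 q)))).
  rewrite (intr_sum P _ (fun q : 'I_N => measurable_funM (measurable_cst eta) (mG (delta + q%:R * eta)%R j))); last first.
    by move=> q w; apply: mulr_ge0; [exact: ltW|exact: G0].
  apply: eq_integral => w _; congr EFin; rewrite /window /Rk mulr_sumr.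
  by apply: eq_bigr => q _; rewrite mulrCA.
have E (q : 'I_N) : \int[P]_w (F w * gk (delta + q%:R * eta) (B (gr n j) w - y)%R)%:E
   = \int[P]_w (F w * gk delta (B (gr n (j + q)) w - y)%R)%:E.
  have jq : (0 <= gr n j <= gr n (j + q))%R by rewrite grid_ge0// grid_le// leq_addr.
  have E0 : (gr n (j + q) - gr n j = q%:R * eta)%R.
    by rewrite gridD addrAC subrr add0r gridE.
  by rewrite (markov_gk pbmB y jq d0 mF F0) E0.
rewrite (eq_bigr _ (fun q _ => congr1 (fun u => eta%:E * u) (E q))).
rewrite (eq_bigr _ (fun (q : 'I_N) _ => intrZ P (ltW eta0) (mG delta (j + q)%N) (fun w => G0 _ (j + q)%N w d0))).
rewrite (intr_sum P _ (fun q : 'I_N => measurable_funM (measurable_cst eta) (mG delta (j + q)%N))); last first.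
  by move=> q w; apply: mulr_ge0; [exact: ltW|exact: G0].
apply: eq_integral => w _; congr EFin; rewrite mulr_sumr.
by apply: eq_bigr => q _; rewrite mulrCA.
Qed.

(** Marks are disjoint, so at most one window contributes on each path, and it is contained in the
    occupation over all [N + K] grid times. At index [m] survival is known only up to [m - N]: the
    first [N] terms are bounded one by one through [start_gk], the others by [green_sum] with a lag
    of one window. *)
Lemma mark_occupation (g : R) n (y : R * R) : (nsq y <= 9^-1)%R ->
  \sum_(j < M * 2 ^ n)
     \int[P]_w (\1_(Mark B A h g n j) w * window n (B (gr n j.+1) w - y)%R)%:E <=
  (N1%:R * h * (5 + 5) + 8 * 600 * (1 + 5))%:E.
Proof.
move=> y9; set N := (N1 * 2 ^ n)%N; set K := (M * 2 ^ n)%N; set eta := gr n 1.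
have eta0 : (0 < eta)%R by exact: grid1_gt0.
pose F m w : R := gk delta (B (gr n m) w - y)%R.
have mF m : measurable_fun setT (F m).
  apply: (measurableT_comp (measurable_gkB delta y)).
  by apply: (measurable_B pbmB); exact: grid_ge0.
have F0 m w : (0 <= F m w)%R by rewrite gk_ge0// ltW.
have mi (S : set T) : measurable S -> measurable_fun setT (\1_S : T -> R).
  by move=> mS; exact: measurable_indic.
have mMk j := measurable_Mark pbmB cA h0 g n j.
have mAl m : measurable (Alive B (gr n m)).
  by apply: (measurable_Alive pbmB); exact: grid_ge0.
have step j : \int[P]_w (\1_(Mark B A h g n j) w * window n (B (gr n j.+1) w - y)%R)%:E =
    \int[P]_w (\1_(Mark B A h g n j) w * \sum_(q < N) eta * F (j.+1 + q)%N w)%:E.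
  apply: markov_window; first by apply: adapted_indic; exact: (adapted_Mark pbmB).
  by move=> w; rewrite indicE.
rewrite (eq_bigr _ (fun (j : 'I_K) _ => step j)).
have mS j : measurable_fun setT (fun w => \sum_(q < N) eta * F (j.+1 + q)%N w)%R.
  by apply: measurable_sum => q; apply: measurable_funM.
have S0 j w : (0 <= \sum_(q < N) eta * F (j.+1 + q)%N w)%R.
  by apply: sumr_ge0 => q _; rewrite mulr_ge0// ltW.
rewrite (intr_sum P _ (fun j : 'I_K => measurable_funM (mi _ (mMk j)) (mS j))); last first.
  by move=> j w; rewrite mulr_ge0.
pose H m w := (\1_(Alive B (gr n (m - N)%N)) w * F m w)%R.
have H0 m w : (0 <= H m w)%R by rewrite mulr_ge0.
have mH m : measurable_fun setT (H m) by apply: measurable_funM => //; exact: mi.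
apply: (@le_trans _ _ (\int[P]_w (\sum_(m < N + K) eta * H m w)%:E)).
  apply: intr_le.
  - by apply: measurable_sum => j; apply: measurable_funM => //; exact: mi.
  - by apply: measurable_sum => j; apply: measurable_funM.
  - by move=> w; apply: sumr_ge0 => j _; rewrite mulr_ge0.
  move=> w; apply: (sum_indic_le (@Mark_uniq _ _ _ B A h h0 g n)
     (F := fun j => (\sum_(q < N) eta * F (j.+1 + q)%N w)%R)).
    by apply: sumr_ge0 => m _; rewrite mulr_ge0// ltW.
  move=> j jK Mj.
  (* For [m = j.+1 + q] with [q < N], the survival index [m - N] does not exceed the index of the
     mark. *)
  apply: (@le_trans _ _ (\sum_(q < N) eta * H (j.+1 + q)%N w)%R).
    apply: ler_sum => q _; apply: ler_wpM2l; first exact: ltW.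
    rewrite /H indicE mem_set ?mul1r//.
    apply: alive_le (Mark_alive Mj); rewrite grid_le//; have := ltn_ord q; lia.
  rewrite -(big_mkord xpredT (fun m => eta * H m w)%R).
  rewrite -(big_mkord xpredT (fun q => eta * H (j.+1 + q)%N w)%R).
  rewrite [leRHS](big_cat_nat (n := j.+1))//=; last exact: leq_trans jK (leq_addl _ _).
  rewrite [in leRHS](big_cat_nat (n := (j.+1 + N)%N) (m := j.+1) (p := (N + K)%N))//=; last 2 first.
  - exact: leq_addr.
  - by rewrite addnC leq_add2l.
  have -> : (\sum_(j.+1 <= i < j.+1 + N) eta * H i w =
      \sum_(0 <= q < N) eta * H (j.+1 + q)%N w)%R.
    rewrite -[X in (\sum_(X <= i < _) _)%R = _]add0n big_addn addKn.
    by apply: eq_bigr => q _; rewrite addnC.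
  have s1 : (0 <= \sum_(0 <= i < j.+1) eta * H i w)%R.
    by apply: sumr_ge0 => i _; rewrite mulr_ge0// ltW.
  have s2 : (0 <= \sum_(j.+1 + N <= i < N + K) eta * H i w)%R.
    by apply: sumr_ge0 => i _; rewrite mulr_ge0// ltW.
  by rewrite addrCA lerDl addr_ge0.
rewrite -(intr_sum P _ (fun m : 'I_(N + K) => measurable_funM (measurable_cst eta) (mH m))); last first.
  by move=> m w; rewrite mulr_ge0// ltW.
rewrite (eq_bigr _ (fun (m : 'I_(N + K)) _ => esym (intrZ P (ltW eta0) (mH m) (H0 m)))).
rewrite big_split_ord/= EFinD; apply: leeD.
  apply: (@le_trans _ _ (\sum_(m < N) (eta * (5 + 5))%:E)).
    apply: lee_sum => m _; rewrite [leRHS]EFinM; apply: lee_wpmul2l; first by rewrite lee_fin ltW.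
    apply: le_trans (start_gk (grid_ge0 h0 n m) y9); apply: intr_le; [exact: mH|exact: mF|exact: H0|].
    by move=> w; rewrite /H ler_piMl// indicE; case: (_ \in _).
  rewrite sumEFin sumr_const card_ord lee_fin -[leLHS]mulr_natl mulrA /N window_length.
  exact: lexx.
have eta1 : (eta <= 1)%R by apply: le_trans h1; exact: grid1_le.
have := @green_sum _ _ _ P B pbmB (fun z => gk delta (z - y)%R) 1 5 eta (gr n N) K
   (grid_ge0 h0 n N) (measurable_gkB delta y) _ (ler0n R 5) _ (area_gk y d0) eta0 eta1.
move=> /(_ (fun z => gk_ge0 (z - y)%R (ltW d0)) (fun z => @gk_far _ _ z _ d0 y9)).
apply: le_trans; apply: lee_sum => k _; rewrite /H /F.
by rewrite (addnC N k) addnK -!gridE -gridD.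
Qed.

Lemma avg_fubini (mu : probability (R * R)%type R) (W : R * R -> R) (K : R) (S : set T)
    (Y : T -> R * R) :
  measurable_fun setT W -> (forall z, (0 <= W z <= K)%R) -> measurable S ->
  measurable_fun setT Y ->
  \int[P]_w (\1_S w * avg mu (restricted W) (Y w))%:E =
  \int[mu]_y \int[P]_w (\1_S w * restricted W (Y w, y))%:E.
Proof.
move=> mW WK mS mY.
have W0 z : (0 <= W z)%R by case/andP: (WK z).
have mr := measurable_restricted mW.
have mF : measurable_fun setT (fun z : T * (R * R) => (\1_S z.1 * restricted W (Y z.1, z.2))%:E).
  apply/measurable_EFinP; apply: measurable_funM.
    apply: (measurableT_comp (f := (\1_S : T -> R))); last exact: measurable_fst.
    exact: measurable_indic.
  apply: (measurableT_comp mr); apply/measurable_fun_pairP; split.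
    by apply: (measurableT_comp mY); exact: measurable_fst.
  exact: measurable_snd.
have F0 z : 0 <= (\1_S z.1 * restricted W (Y z.1, z.2))%:E.
  by rewrite lee_fin mulr_ge0// restricted_ge0.
rewrite -(fubini_tonelli (m1 := P) (m2 := mu) (fun z => (\1_S z.1 * restricted W (Y z.1, z.2))%:E))//.
apply: eq_integral => w _ /=.
rewrite EFinM (avgE mu mr (restricted_ge0 W0) (restricted_le WK)).
rewrite (intrZ mu (c := \1_S w) (F := fun y => restricted W (Y w, y)))//.
  by apply: (measurableT_comp mr); exact: pair1_measurable.
by move=> y; exact: restricted_ge0.
Qed.

Local Notation hlaw := (hit_law pbmB M cA h0).

(** Replaces one of the two independent hitting points by the position at a mark, up to an
    arbitrarily small error. The bound [g <= e] is recorded because the squared estimate needs a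
    small tolerance too. *)
Lemma hit_average (W : nat -> R * R -> R) (K L e : R) :
  0 < P (Hit B A h M) ->
  (forall n, measurable_fun setT (W n)) -> (forall n z, (0 <= W n z <= K)%R) ->
  (0 <= L)%R ->
  (forall n x y, `|x| <= 8 -> `|y| <= 8 -> `|W n x - W n y| <= L * `|x - y|)%R ->
  (0 < e)%R -> exists g n0, [/\ (0 < g)%R, (g <= e)%R & forall n, (n0 <= n)%N ->
   P (Hit B A h M) * \int[hlaw]_x \int[hlaw]_y (restricted (W n) (x, y))%:E <=
   \sum_(j < M * 2 ^ n) \int[hlaw]_y
      \int[P]_w (\1_(Mark B A h g n j) w * restricted (W n) (B (gr n j.+1) w, y))%:E
   + e%:E].
Proof.
move=> p0 mW WK L0 WL e0.
have K0 : (0 <= K)%R by have /andP[a b] := WK 0%N 0%R; exact: le_trans b.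
have [g' [b [g'0 b0 gb]]] := real_split_small K0 L0 e0.
pose g := Num.min g' e.
have g0 : (0 < g)%R by rewrite lt_min g'0.
have gg : (g <= g')%R by rewrite ge_min lexx.
have [n0 Hn] := Bad_small pbmB M cA h0 g0 b0.
exists g, n0; split => //; first by rewrite ge_min lexx orbT.
move=> n nn.
have HB := Hn n nn.
set mu := hlaw.
have W0 k z : (0 <= W k z)%R by case/andP: (WK k z).
have mr := measurable_restricted (mW n).
have r0 := restricted_ge0 (W0 n).
have rK := restricted_le (WK n).
rewrite (eq_integral (fun x => (avg mu (restricted (W n)) x)%:E)); last first.
  by move=> x _; rewrite (avgE mu mr r0 rK).
rewrite integral_hit_law//; last first.
- by move=> z; rewrite lee_fin; exact: (avg_ge0 mu mr r0 rK).
- by apply/measurable_EFinP; exact: (measurable_avg mu mr r0).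
have mX := measurable_hit_point pbmB M cA h0.
have aK z : (0 <= avg mu (restricted (W n)) z <= K)%R.
  by rewrite (avg_ge0 mu mr r0 rK) (avg_le mu mr r0 rK).
have := hit_point_approx (g := g) pbmB M cA h0 n (measurable_avg mu mr r0) aK (ltW g0) L0
  (avg_restricted_lipschitz mu (mW n) (WK n) L0 (WL n)).
move=> H; apply: (le_trans (le_trans _ H)).
  by rewrite le_eqVlt; apply/orP; left; apply/eqP; apply: eq_integral => w _; rewrite EFinM.
rewrite -addeA; apply: leeD.
  apply: lee_sum => j _; rewrite (avg_fubini mu (mW n) (WK n))//.
    exact: (measurable_Mark pbmB).
  by apply: (measurable_B pbmB); exact: grid_ge0.
apply: (@le_trans _ _ ((L * g)%:E + K%:E * b%:E)).
  by apply: leeD => //; apply: lee_wpmul2l => //; rewrite lee_fin.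
rewrite -EFinM -EFinD lee_fin; apply: le_trans gb; rewrite lerD2r.
exact: ler_wpM2l.
Qed.

(** For each [y] in [A] the sum over marks is bounded by [mark_occupation], and integration of [y]
    against a probability keeps the bound. The level exceeds a prescribed [c] because comparison
    with the logarithm needs a step below [delta]. *)
Lemma energy_window (e : R) (c : nat) : 0 < P (Hit B A h M) -> (0 < e)%R ->
  exists2 n, (c <= n)%N & P (Hit B A h M) * \int[hlaw]_x \int[hlaw]_y (restricted (window n) (x, y))%:E <=
   (N1%:R * h * (5 + 5) + 8 * 600 * (1 + 5) + e)%:E.
Proof.
move=> p0 e0; pose K := (N1%:R * h / delta)%R; pose L := (N1%:R * h * (16 / delta ^+ 2))%R.
have N0 : (0 <= N1%:R * h)%R by rewrite mulr_ge0// ltW.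
have WK n z : (0 <= window n z <= K)%R by rewrite window_ge0 window_le.
have L0 : (0 <= L)%R by rewrite mulr_ge0// divr_ge0// exprn_ge0// ltW.
have WL n x y : (`|x| <= 8 -> `|y| <= 8 -> `|window n x - window n y| <= L * `|x - y|)%R.
  move=> x8 y8; rewrite /L -(window_length n).
  by apply: Rk_lipschitz => //; exact: grid_ge0.
have [g [n1 [g0 _ H]]] := hit_average (W := window) p0 measurable_window WK L0 WL e0.
pose n0 := (n1 + c)%N; have {}H := H n0 (leq_addr _ _).
exists n0; first exact: leq_addl.
apply: le_trans H _; rewrite EFinD leeD2r//.
have mr := measurable_restricted (measurable_window n0).
have r0 := restricted_ge0 (window_ge0 n0).
set mu' := hlaw.
pose F j y := \int[P]_w (\1_(Mark B A h g n0 j) w * restricted (window n0) (B (gr n0 j.+1) w, y))%:E.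
have F0 j y : 0 <= F j y by apply: intr_ge0 => w; rewrite mulr_ge0.
have mF j : measurable_fun setT (F j).
  apply: (measurable_fun_fubini_tonelli_G (m1 := P)
    (fun z => (\1_(Mark B A h g n0 j) z.1 * restricted (window n0) (B (gr n0 j.+1) z.1, z.2))%:E)).
    apply/measurable_EFinP; apply: measurable_funM.
      apply: (measurableT_comp (f := (\1_(Mark B A h g n0 j) : T -> R))); last exact: measurable_fst.
      by apply: measurable_indic; exact: (measurable_Mark pbmB).
    apply: (measurableT_comp mr); apply/measurable_fun_pairP; split.
      apply: (measurableT_comp (measurable_B pbmB (grid_ge0 h0 n0 j.+1))).
      exact: measurable_fst.
    exact: measurable_snd.
  by move=> z; rewrite lee_fin mulr_ge0.
rewrite -(@ge0_integral_sum _ _ _ mu' setT measurableT _ (fun j : 'I_(M * 2 ^ n0) => F j)); last 2 first.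
- by move=> j; exact: mF.
- by move=> j y _; exact: F0.
rewrite -[leRHS](integral_prob_cst mu'); apply: ge0_le_integral => //.
- by move=> y _; apply: sume_ge0 => j _; exact: F0.
- by apply: emeasurable_sum => j.
move=> y _; have [Ay|nAy] := pselect (A y); last first.
  rewrite big1 ?lee_fin; first by move: N0; move: (N1%:R * h)%R => t; lra.
  move=> j _; rewrite /F; apply: integral0_eq => w _.
  by rewrite /restricted /= [X in (_ * (X * _))%R]indicE memNset// mul0r mulr0.
apply: le_trans (mark_occupation g n0 (A9 Ay)).
apply: lee_sum => j _; rewrite le_eqVlt; apply/orP; left; apply/eqP.
apply: eq_integral => w _.
by rewrite /restricted /= [X in (_ * (X * _))%R]indicE mem_set// mul1r.
Qed.

End first_moment.

(** * Upper bound: squared logarithmic energy of the hitting law *)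

Section gaussian_pairs.
Context {R : realType}.
Implicit Types (x y v : R * R).

Definition barycenter (a b : R) x y : R * R :=
  ((b * x.1 + a * y.1) / (a + b), (b * x.2 + a * y.2) / (a + b)).

Lemma gk_mult (a b : R) x y v : 0 < a -> 0 < b ->
  gk a (v - x) * gk b (v - y) =
  gk (a + b) (x - y) * gk (a * b / (a + b)) (v - barycenter a b x y).
Proof.
move=> a0 b0; rewrite (gk_product x y v a0 b0) (@gkBE _ (a * b / (a + b)))//.
by apply: divr_gt0; [exact: mulr_gt0|exact: addr_gt0].
Qed.

(** Convexity keeps the barycentre of two target points in the target disk, so that estimates for
    one visited point apply to it. *)
Lemma nsq_barycenter (a b r : R) x y : 0 < a -> 0 < b -> nsq x <= r -> nsq y <= r ->
  nsq (barycenter a b x y) <= r.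
Proof.
move=> a0 b0 xr yr; have ab : 0 < a + b by exact: addr_gt0.
have -> : nsq (barycenter a b x y) = (b * nsq x + a * nsq y) / (a + b) -
    a * b / (a + b) ^+ 2 * nsq (x - y).
  by rewrite /nsq /=; field; rewrite gt_eqF.
apply: (@le_trans _ _ ((b * nsq x + a * nsq y) / (a + b))).
  by rewrite lerBlDr lerDl mulr_ge0 ?nsq_ge0// divr_ge0 ?exprn_ge0 ?mulr_ge0// ltW.
rewrite ler_pdivrMr//.
by have := ler_wpM2l (ltW b0) xr; have := ler_wpM2l (ltW a0) yr; lra.
Qed.

End gaussian_pairs.

Section pairs.
Context d (T : measurableType d) (R : realType) (P : probability T R).
Context (B : R -> T -> R * R) (pbmB : planar_brownian_motion P (1, 0) B).
Context (delta eta h : R).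
Hypotheses (d0 : 0 < delta) (e0 : 0 < eta) (h0 : 0 < h) (h1 : h <= 1).
Local Notation pT u := (g_sigma_algebraType (past B u)).
Local Open Scope ereal_scope.

Local Notation tm s q := (s + q%:R * eta)%R.
Local Notation kap y y' g := (gk (2 * delta + g%:R * eta) (y - y')%R).

Lemma indicator_ge0 (S : set T) w : (0 <= \1_S w :> R)%R.
Proof. by rewrite indicE. Qed.

Lemma pair_kernel_ge0 (y y' : R * R) (g : nat) : (0 <= kap y y' g)%R.
Proof. by rewrite gk_ge0// addr_ge0// mulr_ge0// ltW. Qed.

Let mgkB (s : R) (q : nat) (a : R) (y : R * R) : (0 <= s)%R ->
  measurable_fun setT (fun w => gk a (B (tm s q) w - y)%R).
Proof.
move=> s0; apply: (measurableT_comp (measurable_gkB a y)).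
by apply: (measurable_B pbmB); rewrite addr_ge0// mulr_ge0// ltW.
Qed.

Let mAlive (s : R) : (0 <= s)%R -> measurable_fun setT (\1_(Alive B s) : T -> R).
Proof. by move=> s0; apply: measurable_indic; exact: (measurable_Alive pbmB). Qed.

(** The kernel at the later time is pulled back to the earlier one by the Markov property. The
    product of two kernels at one time is a kernel in [y - y'] times a kernel around a barycentre,
    and [green_sum] handles the latter. *)
Lemma green_pair_le (K i j : nat) (y y' : R * R) : (i <= j)%N ->
  (nsq y <= 9^-1)%R -> (nsq y' <= 9^-1)%R ->
  \sum_(k < K) h%:E * \int[P]_w (\1_(Alive B (k%:R * h)) w *
     (gk delta (B (tm (k%:R * h) i) w - y) * gk delta (B (tm (k%:R * h) j) w - y'))%R)%:E
  <= (8 * 600 * (1 + 5) * kap y y' (j - i))%:E.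
Proof.
move=> ij y9 y9'; pose b := (delta + (j - i)%:R * eta)%R.
have b0 : (0 < b)%R by rewrite ltr_wpDr// mulr_ge0// ltW.
pose c := (delta * b / (delta + b))%R.
have c0 : (0 < c)%R by apply: divr_gt0; [exact: mulr_gt0|exact: addr_gt0].
have E : (delta + b = 2 * delta + (j - i)%:R * eta)%R by rewrite /b; ring.
pose m := barycenter delta b y y'.
have m9 : (nsq m <= 9^-1)%R by exact: nsq_barycenter.
have k0 (k : nat) : (0 <= k%:R * h)%R by rewrite mulr_ge0// ltW.
have step (k : nat) : \int[P]_w (\1_(Alive B (k%:R * h)) w *
     (gk delta (B (tm (k%:R * h) i) w - y) * gk delta (B (tm (k%:R * h) j) w - y'))%R)%:E =
    (kap y y' (j - i))%:E * \int[P]_w (\1_(Alive B (k%:R * h)) w *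
     gk c (B (tm (k%:R * h) i) w - m)%R)%:E.
  have si : (0 <= tm (k%:R * h) i <= tm (k%:R * h) j)%R.
    by rewrite addr_ge0 ?k0 ?mulr_ge0 ?(ltW e0)//= lerD2l ler_pM2r// ler_nat.
  have kk' : (k%:R * h <= tm (k%:R * h) i)%R by rewrite lerDl mulr_ge0// ltW.
  have dt : (delta + (tm (k%:R * h) j - tm (k%:R * h) i) = b)%R.
    by rewrite /b natrB//; ring.
  have := markov_gk pbmB y' (F := fun w =>
    \1_(Alive B (k%:R * h)) w * gk delta (B (tm (k%:R * h) i) w - y))%R si d0.
  rewrite dt => H.
  have mF : measurable_fun setT (fun w => \1_(Alive B (k%:R * h)) w *
      gk c (B (tm (k%:R * h) i) w - m))%R.
    by apply: measurable_funM; [exact: mAlive|exact: mgkB].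
  have F0 w : (0 <= \1_(Alive B (k%:R * h)) w * gk c (B (tm (k%:R * h) i) w - m))%R.
    by apply: mulr_ge0; [exact: indicator_ge0|exact: gk_ge0 (ltW c0)].
  rewrite (intrZ P (pair_kernel_ge0 y y' (j - i)) mF F0).
  transitivity (\int[P]_w (\1_(Alive B (k%:R * h)) w * gk delta (B (tm (k%:R * h) i) w - y) *
      gk delta (B (tm (k%:R * h) j) w - y'))%R%:E).
    by apply: eq_integral => w _; rewrite mulrA.
  rewrite H; last 2 first.
  - apply: measurable_funM.
      apply: adapted_indic; apply: (adapted_set_mono kk').
      exact: (adapted_alive pbmB).
    apply: (measurableT_comp (measurable_gkB delta y)).
    by apply: adapted_B; rewrite (le_trans (k0 k) kk')/=.
  - by move=> w; rewrite mulr_ge0// gk_ge0// ltW.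
  apply: eq_integral => w _; congr EFin.
  by rewrite -mulrA gk_mult// -E mulrCA.
rewrite (eq_bigr (fun k : 'I_K => (kap y y' (j - i))%:E * (h%:E *
   \int[P]_w (\1_(Alive B (k%:R * h)) w * gk c (B (tm (k%:R * h) i) w - m)%R)%:E))); last first.
  by move=> k _; rewrite step muleCA.
rewrite -ge0_sume_distrr; last first.
  move=> k _; rewrite mule_ge0 ?lee_fin ?(ltW h0)//; apply: intr_ge0 => w.
  by rewrite mulr_ge0// gk_ge0// ltW.
rewrite [leRHS](_ : _ = (kap y y' (j - i))%:E * (8 * 600 * (1 + 5))%:E); last first.
  by rewrite -EFinM mulrC.
apply: lee_wpmul2l; first by rewrite lee_fin pair_kernel_ge0.
have ie : (0 <= i%:R * eta)%R by rewrite mulr_ge0// ltW.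
have := @green_sum _ _ _ P B pbmB (fun z => gk c (z - m)%R) 1 5 h (i%:R * eta) K
   ie (measurable_gkB c m) _ (ler0n R 5) _ (area_gk m c0) h0 h1.
by move=> /(_ (fun z => gk_ge0 (z - m)%R (ltW c0)) (fun z => @gk_far _ _ z _ c0 m9)).
Qed.

Lemma green_pair (K i j : nat) (y y' : R * R) :
  (nsq y <= 9^-1)%R -> (nsq y' <= 9^-1)%R ->
  \sum_(k < K) h%:E * \int[P]_w (\1_(Alive B (k%:R * h)) w *
     (gk delta (B (tm (k%:R * h) i) w - y) * gk delta (B (tm (k%:R * h) j) w - y'))%R)%:E
  <= (8 * 600 * (1 + 5) * kap y y' ((i - j) + (j - i)))%:E.
Proof.
move=> y9 y9'; have [ij|/ltnW ji] := leqP i j.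
  have -> : (i - j + (j - i) = j - i)%N by lia.
  exact: green_pair_le.
have -> : (i - j + (j - i) = i - j)%N by lia.
rewrite gkC; apply: le_trans (green_pair_le K ji y9' y9).
apply: lee_sum => k _; rewrite le_eqVlt; apply/orP; left; apply/eqP.
by congr (_ * _); apply: eq_integral => w _; rewrite [X in (_ * X)%R]mulrC.
Qed.

(** Lebesgue measure is invariant under translation, so after integration over [v] only the
    increment between the two times matters, and the result depends on their gap alone. *)
Lemma area_pair (s : R) (i j : nat) (y y' : R * R) : (0 <= s)%R ->
  \int[P]_w \int[@area R]_v (gk delta (v + (B (tm s i) w - B s w) - y)%R *
     gk delta (v + (B (tm s j) w - B s w) - y')%R)%:E =
  (kap y y' ((i - j) + (j - i)))%:E.
Proof.
move=> s0; wlog ij : i j y y' / (i <= j)%N.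
  move=> H; have [|/ltnW ji] := leqP i j; first exact: H.
  have := H j i y' y ji; rewrite (addnC (j - i)%N) gkC => <-.
  apply: eq_integral => w _; apply: eq_integral => v _.
  by rewrite mulrC.
have -> : (i - j + (j - i) = j - i)%N by lia.
transitivity (\int[P]_w (gk (2 * delta) ((B (tm s j) w - B (tm s i) w) - (y' - y))%R)%:E).
  apply: eq_integral => w _.
  transitivity (\int[@area R]_v (gk delta (v - (y - (B (tm s i) w - B s w)))%R *
      gk delta (v - (y' - (B (tm s j) w - B s w)))%R)%:E).
    by apply: eq_integral => v _; rewrite !opprB !addrA.
  rewrite area_gk_gk// (_ : (delta + delta = 2 * delta)%R); last by ring.
  have -> // : (y - (B (tm s i) w - B s w) - (y' - (B (tm s j) w - B s w)) =
     B (tm s j) w - B (tm s i) w - (y' - y))%R.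
  rewrite !opprB !addrA; move: (B (tm s i) w) (B (tm s j) w) (B s w) => p q r.
  by case: p q r y y' => [? ?] [? ?] [? ?] [? ?] [? ?]; congr pair => /=; ring.
have [->|ij'] := eqVneq i j.
  rewrite subnn mul0r addr0 -[RHS](integral_prob_cst P); apply: eq_integral => w _.
  by rewrite subrr sub0r opprB.
have st : (0 <= tm s i < tm s j)%R.
  rewrite addr_ge0 ?mulr_ge0 ?(ltW e0)//= ltrD2l ltr_pM2r// ltr_nat.
  by rewrite ltn_neqAle ij'.
rewrite (incr_law pbmB (g := fun z => (gk (2 * delta) (z - (y' - y))%R)%:E) st); last 2 first.
- by apply/measurable_EFinP; exact: measurable_gkB.
- by move=> z; rewrite lee_fin gk_ge0// mulr_ge0// ltW.
have dt : (tm s j - tm s i = (j - i)%:R * eta)%R by rewrite natrB//; ring.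
have dt0 : (0 < (j - i)%:R * eta)%R by rewrite mulr_gt0// ltr0n subn_gt0 ltn_neqAle ij'.
transitivity (\int[@area R]_v (gk (2 * delta) (v - (y' - y))%R *
   gk ((j - i)%:R * eta) (v - 0)%R)%:E).
  by apply: eq_integral => v _; rewrite dt subr0 EFinM.
by rewrite area_gk_gk// ?mulr_gt0// subr0 -gkN opprB.
Qed.

End pairs.

Lemma running_max_mono (R : realType) (s s' : nat -> R) n m :
  (forall i, s i <= s' i) -> (n <= m)%N -> running_max s n <= running_max s' m.
Proof.
move=> ss; elim: n => [|n IH] nm /=.
  exact: le_trans (ss 0%N) (running_max_ge s' (leq0n m)).
by rewrite ge_max IH ?(ltnW nm)//= (le_trans (ss _))// running_max_ge.
Qed.

Lemma measurable_gk2 d (S : measurableType d) (R : realType) (a : R) (b : S -> R * R) :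
  measurable_fun setT b ->
  measurable_fun setT (fun z : S * (R * R) => gk a (b z.1 - z.2)).
Proof.
move=> mb; apply: (measurableT_comp (measurable_gk a)).
apply: measurable_funB2; last exact: measurable_snd.
by apply: (measurableT_comp mb); exact: measurable_fst.
Qed.

Section weighted_average.
Context d1 d2 (T1 : measurableType d1) (T2 : measurableType d2) (R : realType).
Context (P : probability T1 R) (mu : probability T2 R) (W : T1 * T2 -> R) (K : R).
Hypotheses (mW : measurable_fun setT W) (W0 : forall x, 0 <= W x).
Hypothesis (WK : forall x, W x <= K).
Local Open Scope ereal_scope.

Lemma weighted_average (F : T1 -> R) : measurable_fun setT F ->
  (forall w, 0 <= F w)%R ->
  \int[P]_w (F w * avg mu W w)%:E = \int[mu]_y \int[P]_w (F w * W (w, y))%:E.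
Proof.
move=> mF F0.
rewrite -(fubini_tonelli (m1 := P) (m2 := mu) (fun z => (F z.1 * W (z.1, z.2))%:E)); last 2 first.
- apply/measurable_EFinP; apply: measurable_funM.
    by apply: (measurableT_comp mF); exact: measurable_fst.
  by apply: (eq_measurable_fun W) => // -[].
- by move=> z; rewrite lee_fin mulr_ge0.
apply: eq_integral => w _ /=.
rewrite EFinM (avgE mu mW W0 WK) (intrZ mu (F0 w) (F := fun y => W (w, y)))//.
by apply: (measurableT_comp mW); exact: pair1_measurable.
Qed.

End weighted_average.

(** * Doob's inequality within one block *)

Section block.
Context d (T : measurableType d) (R : realType) (P : probability T R).
Context (x0 : R * R) (B : R -> T -> R * R) (pbmB : planar_brownian_motion P x0 B).
Context (A : set (R * R)) (delta eta s0 : R) (mu : probability (R * R)%type R).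
Context (lam : R * R -> R) (K : R) (N L : nat).
Hypotheses (d0 : 0 < delta) (e0 : 0 < eta) (s00 : 0 <= s0) (mA : measurable A).
Hypotheses (mlam : measurable_fun setT lam) (lam0 : forall y, 0 <= lam y).
Hypothesis (lamK : forall y, lam y <= K).
Local Notation pT u := (g_sigma_algebraType (past B u)).
Local Notation tm q := (s0 + q%:R * eta).

Let tm_le i j : (i <= j)%N -> tm i <= tm j.
Proof. by move=> ij; rewrite lerD2l ler_pM2r// ler_nat. Qed.

Let tm0 q : 0 <= tm q.
Proof. by rewrite addr_ge0// mulr_ge0// ltW. Qed.

Let K0 : 0 <= K. Proof. exact: le_trans (lam0 0) (lamK 0). Qed.

(** The weight [lam] will be an occupation field of the later path, kept fixed while the earlier
    block varies. *)
Definition weighted (Q : T -> R * R -> R) : T * (R * R) -> R :=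
  fun z => \1_A z.2 * lam z.2 * Q z.1 z.2.

Lemma measurable_weighted d' (S : measurableType d') (Q : S -> R * R -> R) :
  measurable_fun setT (fun z : S * (R * R) => Q z.1 z.2) ->
  measurable_fun setT (fun z : S * (R * R) => \1_A z.2 * lam z.2 * Q z.1 z.2).
Proof.
move=> mQ; apply: measurable_funM => //; apply: measurable_funM.
  apply: (measurableT_comp (f := (\1_A : R * R -> R))); last exact: measurable_snd.
  exact: measurable_indic.
by apply: (measurableT_comp mlam); exact: measurable_snd.
Qed.

Lemma weighted_ge0 Q : (forall w y, 0 <= Q w y) -> forall z, 0 <= weighted Q z.
Proof. by move=> Q0 z; rewrite !mulr_ge0// indicE. Qed.

Lemma weighted_le Q C : (forall w y, 0 <= Q w y <= C) -> forall z, weighted Q z <= K * C.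
Proof.
move=> QC z; have /andP[a b] := QC z.1 z.2; apply: ler_pM => //.
  by rewrite mulr_ge0// indicE.
by apply: le_trans (lamK z.2); rewrite ler_piMl// indicE; case: (_ \in _).
Qed.

(* Conditional expectation at time [tm o] of the occupation of [y] over the
   [L] grid times following [s0]. *)
Definition predicted (o : nat) (w : T) (y : R * R) : R :=
  \sum_(j < L) eta * gk (delta + (j - o)%:R * eta) (B (tm (minn o j)) w - y).

Definition occupation (w : T) (y : R * R) : R :=
  \sum_(q < L) eta * gk delta (B (tm q) w - y).

Let dg0 (q : nat) : 0 < delta + q%:R * eta.
Proof. by rewrite ltr_wpDr// mulr_ge0// ltW. Qed.

Lemma predicted_bound o w y : 0 <= predicted o w y <= L%:R * (eta / delta).
Proof.
apply/andP; split.
  by apply: sumr_ge0 => q _; rewrite mulr_ge0 ?(ltW e0)// gk_ge0// ltW.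
rewrite /predicted -[L in leRHS]card_ord -sumr_const mulr_suml; apply: ler_sum => q _.
rewrite mul1r; apply: ler_wpM2l; first exact: ltW.
by apply: gk_le1 => //; rewrite lerDl mulr_ge0// ltW.
Qed.

Lemma predicted_last w y : predicted L w y = occupation w y.
Proof.
apply: eq_bigr => j _; have jL := ltn_ord j.
have -> : (j - L = 0)%N by apply/eqP; rewrite subn_eq0 ltnW.
by rewrite mul0r addr0 (minn_idPr (ltnW jL)).
Qed.

(** Among the terms predicted at index [o], those from [o] up to [o + N] form the window at the
    current position; the others are nonnegative. *)
Lemma window_le_predicted o w y : (o + N <= L)%N ->
  Rk delta eta N (B (tm o) w - y) <= predicted o w y.
Proof.
move=> oN; rewrite /Rk /predicted.
rewrite -(big_mkord xpredT (fun q => eta * gk (delta + q%:R * eta) (B (tm o) w - y))).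
rewrite -(big_mkord xpredT (fun j => eta * gk (delta + (j - o)%:R * eta) (B (tm (minn o j)) w - y))).
have G0 j : 0 <= eta * gk (delta + (j - o)%:R * eta) (B (tm (minn o j)) w - y).
  by rewrite mulr_ge0 ?(ltW e0)// gk_ge0// ltW.
rewrite [leRHS](big_cat_nat (n := o))//=; last exact: leq_trans (leq_addr _ _) oN.
rewrite [in leRHS](big_cat_nat (n := (o + N)%N) (m := o) (p := L))//=; last exact: leq_addr.
have -> : \sum_(o <= j < o + N) eta * gk (delta + (j - o)%:R * eta) (B (tm (minn o j)) w - y) =
    \sum_(0 <= q < N) eta * gk (delta + q%:R * eta) (B (tm o) w - y).
  rewrite -[X in \sum_(X <= i < _) _ = _]add0n big_addn addKn; apply: eq_bigr => q _.
  by rewrite addnK (minn_idPl (leq_addl _ _)).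
by rewrite addrCA lerDl addr_ge0// sumr_ge0.
Qed.

Lemma measurable_predicted d' (S : measurableType d') (b : S -> T) o :
  (forall q, (q <= o)%N -> measurable_fun setT (fun x => B (tm q) (b x))) ->
  measurable_fun setT (fun z : S * (R * R) => predicted o (b z.1) z.2).
Proof.
move=> mb; apply: measurable_sum => j; apply: measurable_funM => //.
by apply: (@measurable_gk2 _ _ _ _ (fun x => B (tm (minn o j)) (b x))); apply: mb; exact: geq_minl.
Qed.

Let s (o : nat) : T -> R := avg mu (weighted (predicted o)).

Let mB q : measurable_fun setT (B (tm q)).
Proof. exact: (measurable_B pbmB). Qed.

Let mpred o : measurable_fun setT (weighted (predicted o)).
Proof. by apply: measurable_weighted; apply: (measurable_predicted (b := id)). Qed.

Let wp0 o : forall z, 0 <= weighted (predicted o) z.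
Proof. by apply: weighted_ge0 => w y; case/andP: (predicted_bound o w y). Qed.

Let wpK o : forall z, weighted (predicted o) z <= K * (L%:R * (eta / delta)).
Proof. by apply: weighted_le => w y; exact: predicted_bound. Qed.

Let adapted_s i o : (i <= o)%N -> measurable_fun setT (s i : pT (tm o) -> R).
Proof.
move=> io; apply: (measurable_avg (T1 := pT (tm o)) mu (W := weighted (predicted i))).
  apply: (@measurable_weighted _ (pT (tm o)) (predicted i)).
  apply: (@measurable_predicted _ (pT (tm o)) id) => q qi; apply: adapted_B.
  by rewrite tm0 tm_le// (leq_trans qi).
exact: wp0.
Qed.

Let adapted_max i o : (i <= o)%N ->
  measurable_fun setT ((fun w => running_max (s ^~ w) i) : pT (tm o) -> R).
Proof.
elim: i => [|i IH] io /=; first exact: adapted_s.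
exact: (measurable_maxr (IH (ltnW io)) (adapted_s io)).
Qed.

Local Open Scope ereal_scope.

(** Terms of index at most [o] are already determined and do not change. For the others the
    smoothing parameter drops by [eta] while the path runs one step, which is [markov_gk]. *)
Let martingale o (F : T -> R) : (o < L)%N -> measurable_fun setT (F : pT (tm o) -> R) ->
  (forall w, 0 <= F w)%R ->
  \int[P]_w (F w * s o w)%:E = \int[P]_w (F w * s o.+1 w)%:E.
Proof.
move=> oL mF F0.
have mF' : measurable_fun setT F by exact: (adapted_measurable pbmB mF).
rewrite /s (weighted_average P mu (mpred o) (wp0 o) (wpK o) mF' F0).
rewrite (weighted_average P mu (mpred o.+1) (wp0 o.+1) (wpK o.+1) mF' F0).
apply: eq_integral => y _; rewrite /weighted /=.
set c := (\1_A y * lam y)%R; have c0 : (0 <= c)%R by rewrite mulr_ge0// indicE.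
have mFg (a : R) q : measurable_fun setT (fun w => F w * gk a (B (tm q) w - y))%R.
  apply: measurable_funM => //; apply: (measurableT_comp (measurable_gkB a y)); exact: mB.
have Fg0 (g q : nat) w : (0 <= F w * gk (delta + g%:R * eta) (B (tm q) w - y))%R.
  by rewrite mulr_ge0// gk_ge0// ltW.
have ex i : \int[P]_w (F w * (c * predicted i w y))%:E =
   \sum_(j < L) (c * eta)%:E * \int[P]_w (F w * gk (delta + (j - i)%:R * eta)
      (B (tm (minn i j)) w - y))%:E.
  have ce : (0 <= c * eta)%R by rewrite mulr_ge0// ltW.
  rewrite (eq_bigr _ (fun (j : 'I_L) _ => intrZ P ce (mFg _ (minn i j)) (Fg0 (j - i)%N (minn i j)))).
  rewrite (intr_sum P _ (fun j : 'I_L => measurable_funM (measurable_cst (c * eta)%R) (mFg (delta + (j - i)%:R * eta)%R (minn i j)))); last first.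
    by move=> j w; apply: mulr_ge0.
  apply: eq_integral => w _; congr EFin.
  rewrite /predicted !mulr_sumr; apply: eq_bigr => j _.
  by rewrite [RHS]mulrCA; congr (F w * _)%R; exact: mulrA.
rewrite !ex; apply: eq_bigr => j _; congr (_ * _).
have [jo|oj] := leqP j o.
  have -> : (j - o = 0)%N by apply/eqP; rewrite subn_eq0.
  have -> : (j - o.+1 = 0)%N by apply/eqP; rewrite subn_eq0 leqW.
  by rewrite ?(minn_idPr jo) (minn_idPr (leqW jo)).
rewrite ?(minn_idPl (ltnW oj)) (minn_idPl oj).
have st : (0 <= tm o <= tm o.+1)%R by rewrite tm0 tm_le.
rewrite (markov_gk pbmB y st (dg0 (j - o.+1)) mF F0).
apply: eq_integral => w _; congr (F w * gk _ _)%:E.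
have -> : (j - o = (j - o.+1).+1)%N by rewrite subnSK.
by rewrite -![in RHS]natr1 -!natr1; ring.
Qed.

(** A maximum because the index of the earlier visit within its block depends on the whole path. *)
Definition block_max (n : nat) (w : T) : R :=
  running_max (fun o => avg mu (weighted (fun w y => Rk delta eta N (B (tm o) w - y)%R)) w) n.

(** Since [n + N <= L], each window that starts in the block is below the predicted occupation, a
    martingale. Its terminal value is the occupation itself, which is why the right side involves no
    maximum. *)
Lemma block_doob (n : nat) (S : set T) : (n + N <= L)%N -> measurable (S : set (pT s0)) ->
  \int[P]_w (\1_S w * block_max n w ^+ 2)%:E <=
  4%:E * \int[P]_w (\1_S w * avg mu (weighted occupation) w ^+ 2)%:E.
Proof.
move=> nN mS.
have mS' : measurable S by exact: (adapted_set pbmB mS).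
have ms i : measurable_fun setT (s i) by exact: (measurable_avg mu (mpred i) (wp0 i)).
have s_ge0 i w : (0 <= s i w)%R by exact: (avg_ge0 mu (mpred i) (wp0 i) (wpK i)).
have s_le i w : (s i w <= K * (L%:R * (eta / delta)))%R.
  exact: (avg_le mu (mpred i) (wp0 i) (wpK i)).
have mI : measurable_fun setT (\1_S : T -> R) by exact: measurable_indic.
have wR0 o z : (0 <= weighted (fun w y => Rk delta eta N (B (tm o) w - y)%R) z)%R.
  by apply: weighted_ge0 => w y; apply: Rk_ge0 => //; exact: ltW.
have wRK o z : (weighted (fun w y => Rk delta eta N (B (tm o) w - y)%R) z <= K * (N%:R * (eta / delta)))%R.
  apply: weighted_le => w y; rewrite Rk_ge0 ?Rk_le//; exact: ltW.
have mR o : measurable_fun setT (weighted (fun w y => Rk delta eta N (B (tm o) w - y)%R)).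
  apply: measurable_weighted; apply: (measurableT_comp (measurable_Rk delta eta N)).
  apply: measurable_funB2; last exact: measurable_snd.
  by apply: (measurableT_comp (mB o)); exact: measurable_fst.
have mbm : measurable_fun setT (block_max n).
  by apply: measurable_running_max => o; exact: (measurable_avg mu (mR o) (wR0 o)).
have bm0 w : (0 <= block_max n w)%R.
  by apply: running_max_ge0 => o; exact: (avg_ge0 mu (mR o) (wR0 o) (wRK o)).
apply: (@le_trans _ _ (\int[P]_w (\1_S w * running_max (s ^~ w) n ^+ 2)%:E)).
  apply: intr_le.
  - by apply: measurable_funM => //; exact: measurable_funX.
  - by apply: measurable_funM => //; apply: measurable_funX; exact: measurable_running_max.
  - by move=> w; rewrite mulr_ge0 ?sqr_ge0// indicE.
  move=> w; apply: ler_wpM2l; first by rewrite indicE.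
  rewrite ler_sqr ?nnegrE//; last exact: running_max_ge0.
  rewrite /block_max.
  have H o : (o <= n)%N -> (avg mu (weighted (fun w y => Rk delta eta N (B (tm o) w - y)%R)) w <= s o w)%R.
    move=> on; rewrite -lee_fin /s (avgE mu (mR o) (wR0 o) (wRK o)) (avgE mu (mpred o) (wp0 o) (wpK o)).
    apply: intr_le.
    - by apply: (measurableT_comp (mR o)); exact: pair1_measurable.
    - by apply: (measurableT_comp (mpred o)); exact: pair1_measurable.
    - by move=> y; exact: wR0.
    move=> y; apply: ler_wpM2l; first by rewrite mulr_ge0// indicE.
    by apply: window_le_predicted; rewrite (leq_trans _ nN)// leq_add2r.
  elim: (n) H => [|m IH] H /=; first exact: H.
  by rewrite ge_max !le_max H// IH ?orbT// => o om; apply: H; exact: leqW.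
have nL : (n <= L)%N by apply: leq_trans nN; exact: leq_addr.
apply: (@le_trans _ _ (\int[P]_w (\1_S w * running_max (s ^~ w) L ^+ 2)%:E)).
  apply: intr_le.
  - by apply: measurable_funM => //; apply: measurable_funX; exact: measurable_running_max.
  - by apply: measurable_funM => //; apply: measurable_funX; exact: measurable_running_max.
  - by move=> w; rewrite mulr_ge0 ?sqr_ge0// indicE.
  move=> w; apply: ler_wpM2l; first by rewrite indicE.
  rewrite ler_sqr ?nnegrE; [|exact: running_max_ge0|exact: running_max_ge0].
  exact: running_max_mono.
have sL : s L = avg mu (weighted occupation).
  by rewrite /s; congr (avg mu _); apply/funext => z; rewrite /weighted predicted_last.
rewrite -sL; apply: (doob_L2 ms mI s_ge0 s_le).
- by move=> w; rewrite indicE.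
- by move=> w; rewrite indicE; case: (_ \in _).
move=> j jL; rewrite le_eqVlt; apply/orP; left; apply/eqP.
apply: (martingale (F := fun w => \1_S w * running_max (s ^~ w) j)%R); first exact: jL.
  apply: measurable_funM; last exact: adapted_max.
  apply: adapted_indic; apply: (adapted_set_mono (B := B) _ mS).
  by rewrite lerDl mulr_ge0// ltW.
by move=> w; rewrite mulr_ge0 ?indicE//; exact: running_max_ge0.
Qed.

End block.

Lemma running_max_eq (R : realType) (s s' : nat -> R) n :
  (forall i, (i <= n)%N -> s i = s' i) -> running_max s n = running_max s' n.
Proof.
elim: n => [|n IH] H /=; first exact: H.
by rewrite IH ?H// => i ni; apply: H; exact: leqW.
Qed.

Lemma ge0_integral_cstM d (T : measurableType d) (R : realType)
    (m : {measure set T -> \bar R}) (c : R) (F : T -> \bar R) :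
  (0 <= c)%R -> measurable_fun setT F -> (forall w, 0 <= F w)%E ->
  (\int[m]_w (c%:E * F w) = c%:E * \int[m]_w F w)%E.
Proof. by move=> c0 mF F0; rewrite ge0_integralZl_EFin. Qed.

(** * Decoupling two blocks separated by a full block *)

Section decoupled_blocks.
Context d (T : measurableType d) (R : realType) (P : probability T R).
Context (x0 : R * R) (B : R -> T -> R * R) (pbmB : planar_brownian_motion P x0 B).
Context (A : set (R * R)) (delta eta h : R) (mu : probability (R * R)%type R).
Context (N L n l k : nat).
Hypotheses (d0 : 0 < delta) (e0 : 0 < eta) (h0 : 0 < h) (mA : measurable A).
Hypotheses (nh : n%:R * eta = h) (nN : (n + N <= L)%N) (kl : (k.+1 < l)%N).
Local Notation pT u := (g_sigma_algebraType (past B u)).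
Local Notation fT u := (g_sigma_algebraType (future B u)).
Local Notation tm s q := (s + q%:R * eta).

(** The occupation after time [l%:R * h] with the position at that time reset to [v]: it depends on
    [w] only through later displacements. *)
Definition restarted (v : R * R) (w : T) (y : R * R) : R :=
  \sum_(q < L) eta * gk delta (v + (B (tm (l%:R * h) q) w - B (l%:R * h) w) - y).

Lemma restarted_bound v w y : 0 <= restarted v w y <= L%:R * (eta / delta).
Proof.
apply/andP; split.
  by apply: sumr_ge0 => q _; apply: mulr_ge0; [exact: ltW|exact: gk_ge0 (ltW d0)].
rewrite /restarted -[L in leRHS]card_ord -sumr_const mulr_suml; apply: ler_sum => q _.
by rewrite mul1r; apply: ler_wpM2l; [exact: ltW|exact: gk_le1].
Qed.

Lemma restarted_self w y :
  restarted (B (l%:R * h) w) w y = occupation B delta eta (l%:R * h) L w y.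
Proof.
by apply: eq_bigr => q _; rewrite addrCA subrr addr0.
Qed.

(** The position at time [l%:R * h], the future sample and the past sample are separate arguments,
    so that each can be integrated on its own. *)
Definition block_square (v : R * R) (w' w : T) : R :=
  block_max B A delta eta (k%:R * h) mu (restarted v w') N n w ^+ 2.

Lemma block_square_ge0 v w' w : 0 <= block_square v w' w.
Proof. exact: sqr_ge0. Qed.

Lemma measurable_restarted d' (S : measurableType d') (v : S -> R * R) (b : S -> T) :
  measurable_fun setT v ->
  (forall q, measurable_fun setT (fun x => B (tm (l%:R * h) q) (b x) - B (l%:R * h) (b x))) ->
  measurable_fun setT (fun z : S * (R * R) => restarted (v z.1) (b z.1) z.2).
Proof.
move=> mv mb; apply: measurable_sum => q; apply: measurable_funM => //.
apply: (@measurable_gk2 _ _ _ _ (fun x => v x + (B (tm (l%:R * h) q) (b x) - B (l%:R * h) (b x)))).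
exact: measurable_funD2.
Qed.

Lemma measurable_block_square d' (S : measurableType d') (v : S -> R * R) (b' b : S -> T) :
  measurable_fun setT v ->
  (forall q, measurable_fun setT (fun x => B (tm (l%:R * h) q) (b' x) - B (l%:R * h) (b' x))) ->
  (forall q, measurable_fun setT (fun x => B (tm (k%:R * h) (minn q n)) (b x))) ->
  measurable_fun setT (fun x => block_square (v x) (b' x) (b x)).
Proof.
move=> mv mb' mb; apply: measurable_funX.
pose H o (z : S * (R * R)) := \1_A z.2 * restarted (v z.1) (b' z.1) z.2 *
  Rk delta eta N (B (tm (k%:R * h) (minn o n)) (b z.1) - z.2).
have mH o : measurable_fun setT (H o).
  apply: measurable_funM; first apply: measurable_funM.
  - apply: (measurableT_comp (f := (\1_A : R * R -> R))); last exact: measurable_snd.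
    exact: measurable_indic.
  - exact: measurable_restarted.
  - apply: (measurableT_comp (measurable_Rk delta eta N)).
    apply: measurable_funB2; last exact: measurable_snd.
    by apply: (measurableT_comp (mb o)); exact: measurable_fst.
have H0 o z : 0 <= H o z.
  apply: mulr_ge0; last by apply: Rk_ge0 => //; exact: ltW.
  apply: mulr_ge0; first by rewrite indicE.
  by case/andP: (restarted_bound (v z.1) (b' z.1) z.2).
have mmax i : measurable_fun setT (fun x => running_max (fun o => avg mu (H o) x) i).
  by apply: measurable_running_max => o; exact: (measurable_avg mu (mH o) (H0 o)).
apply: (eq_measurable_fun (fun x => running_max (fun o => avg mu (H o) x) n)); last exact: mmax.
move=> x _.
rewrite /block_max.
have E o : (o <= n)%N -> avg mu (H o) x =
    avg mu (weighted A (restarted (v x) (b' x)) (fun w y => Rk delta eta N (B (tm (k%:R * h) o) w - y))) (b x).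
  by move=> on; rewrite /H (minn_idPl on).
by rewrite (running_max_eq E).
Qed.

(** Bounds the density of the surviving path at time [l%:R * h] given the past at the end of block
    [k]: the free bound serves for short gaps, the killed one for long gaps. *)
Definition gap_density : R :=
  Num.min ((l%:R * h - k.+1%:R * h)^-1) (600 / (l%:R * h - k.+1%:R * h) ^+ 3).

Local Open Scope ereal_scope.

Let k0 (j : nat) : (0 <= j%:R * h)%R. Proof. by rewrite mulr_ge0// ltW. Qed.
Let kh1 : (k%:R * h + h = k.+1%:R * h)%R. Proof. by rewrite -natr1; ring. Qed.
Let gap : (k.+1%:R * h < l%:R * h)%R. Proof. by rewrite ltr_pM2r// ltr_nat. Qed.

Let tmk q : (0 <= tm (k%:R * h) (minn q n) <= k.+1%:R * h)%R.
Proof.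
rewrite addr_ge0 ?k0 ?mulr_ge0 ?(ltW e0)//= -kh1 lerD2l -nh ler_pM2r// ler_nat.
exact: geq_minr.
Qed.

Let tml q : (0 <= tm (l%:R * h) q)%R.
Proof. by apply: addr_ge0 => //; apply: mulr_ge0 => //; exact: ltW. Qed.

(** With the future sample fixed, the block maximum depends on the past up to [k.+1%:R * h] and on
    the position at [l%:R * h]. The full block in between gives this position a bounded density. *)
Lemma frozen_block (w' : T) :
  \int[P]_w ((\1_(Alive B (l%:R * h)) w)%:E *
     (\1_(Alive B (k%:R * h)) w * block_square (B (l%:R * h) w) w' w)%:E) <=
  gap_density%:E * \int[@area R]_v \int[P]_w
     (\1_(Alive B (k%:R * h)) w * block_square v w' w)%:E.
Proof.
pose f (x : T * (R * R)) := (\1_(Alive B (k%:R * h)) x.1 * block_square x.2 w' x.1)%:E.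
have mf : measurable_fun setT (f : pT (k.+1%:R * h)%R * (R * R) -> \bar R).
  apply/measurable_EFinP; apply: measurable_funM.
    apply: (measurableT_comp (f := (\1_(Alive B (k%:R * h)) : pT (k.+1%:R * h)%R -> R))); last exact: measurable_fst.
    apply: adapted_indic; apply: (@adapted_set_mono _ _ _ _ (k%:R * h)%R); last exact: (adapted_alive pbmB).
    by rewrite ler_pM2r// ler_nat.
  apply: measurable_block_square; first exact: measurable_snd.
    by move=> q; exact: measurable_cst.
  move=> q; apply: (measurableT_comp (f := (B (tm (k%:R * h) (minn q n)) : pT (k.+1%:R * h)%R -> R * R))); last exact: measurable_fst.
  by apply: adapted_B; exact: tmk.
have f0 x : 0 <= f x by rewrite lee_fin; apply: mulr_ge0; [rewrite indicE|exact: block_square_ge0].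
have st : (0 <= k.+1%:R * h < l%:R * h)%R by rewrite k0.
have mfB : measurable_fun setT (fun w => f (w, B (l%:R * h)%R w)).
  exact: (measurable_past_B pbmB (measurable_B pbmB (k0 l)) mf).
rewrite /gap_density /Order.min; case: ifP => _.
  apply: (@le_trans _ _ (\int[P]_w f (w, B (l%:R * h)%R w))).
    apply: ge0_le_integral => //.
    - move=> w _; apply: mule_ge0; last exact: (f0 (w, B (l%:R * h)%R w)).
      by rewrite lee_fin indicE.
    - apply: emeasurable_funM; last exact: mfB.
      by apply/measurable_EFinP; apply: measurable_indic; exact: (measurable_Alive pbmB).
    - move=> w _; rewrite -[leRHS]mul1e; apply: lee_wpmul2r; first exact: (f0 (w, B (l%:R * h)%R w)).
      by rewrite lee_fin indicE; case: (_ \in _).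
  apply: le_trans (markov_density pbmB st mf f0) _.
  apply: lee_wpmul2r.
    by apply: integral_ge0 => v _; apply: integral_ge0 => w _; exact: f0.
  rewrite lee_fin lef_pV2 ?posrE; last 2 first.
  - by apply: twopi_gt0; rewrite subr_gt0.
  - by rewrite subr_gt0.
  have p2 := @pi_ge2 R; rewrite ler_peMl ?subr_ge0 ?(ltW gap)//; lra.
exact: (killed_density pbmB st (lexx _) mf f0).
Qed.

(** Decoupling at [l%:R * h] separates the later occupation from the block maximum, [frozen_block]
    removes the remaining dependence through the position, and [block_doob] applies with the
    restarted occupation as weight. *)
Lemma decoupled_block :
  \int[P]_w (\1_(Alive B (l%:R * h)) w * block_max B A delta eta (k%:R * h) mu
     (occupation B delta eta (l%:R * h) L w) N n w ^+ 2)%:E <=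
  (gap_density * 4)%:E * \int[P]_w' \int[@area R]_v \int[P]_w
     (\1_(Alive B (k%:R * h)) w *
      avg mu (weighted A (restarted v w') (occupation B delta eta (k%:R * h) L)) w ^+ 2)%:E.
Proof.
have lk : (k%:R * h <= l%:R * h)%R.
  by apply: le_trans (ltW gap); rewrite ler_pM2r// ler_nat.
pose F (z : T * T) := ((\1_(Alive B (l%:R * h)) z.1)%:E *
  (\1_(Alive B (k%:R * h)) z.1 * block_square (B (l%:R * h) z.1) z.2 z.1)%:E).
have F0 z : 0 <= F z.
  apply: mule_ge0; rewrite lee_fin; first by rewrite indicE.
  by apply: mulr_ge0; [rewrite indicE|exact: block_square_ge0].
have mF : measurable_fun setT (F : pT (l%:R * h)%R * fT (l%:R * h)%R -> \bar R).
  apply: emeasurable_funM; apply/measurable_EFinP.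
    apply: (measurableT_comp (f := (\1_(Alive B (l%:R * h)) : pT (l%:R * h)%R -> R))); last exact: measurable_fst.
    by apply: adapted_indic; exact: (adapted_alive pbmB).
  apply: measurable_funM.
    apply: (measurableT_comp (f := (\1_(Alive B (k%:R * h)) : pT (l%:R * h)%R -> R))); last exact: measurable_fst.
    by apply: adapted_indic; apply: (adapted_set_mono lk); exact: (adapted_alive pbmB).
  apply: measurable_block_square.
  - apply: (measurableT_comp (f := (B (l%:R * h)%R : pT (l%:R * h)%R -> R * R))); last exact: measurable_fst.
    by apply: adapted_B; rewrite k0 lexx.
  - move=> q.
    apply: (measurableT_comp (f := ((fun w => B (tm (l%:R * h) q) w - B (l%:R * h) w)%R : fT (l%:R * h)%R -> R * R))); last exact: measurable_snd.
    apply: (@measurable_cylinders T _ (R * R)%type R [set s | (l%:R * h <= s)%R] (fun s w => B s w - B (l%:R * h) w)%R).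
    by rewrite /= lerDl mulr_ge0// ltW.
  - move=> q; apply: (measurableT_comp (f := (B (tm (k%:R * h) (minn q n)) : pT (l%:R * h)%R -> R * R))); last exact: measurable_fst.
    by apply: adapted_B; have /andP[-> /le_trans] := tmk q; apply; exact: ltW.
have mF' : measurable_fun setT (F : T * T -> \bar R).
  have m1 : measurable_fun setT (fun z : T * T => (z.1, z.2) : pT (l%:R * h)%R * fT (l%:R * h)%R).
    apply/measurable_fun_pairP; split.
      apply: (measurableT_comp (f := (id : T -> pT (l%:R * h)%R))); last exact: measurable_fst.
      exact: (measurable_to_past pbmB).
    apply: (measurableT_comp (f := (id : T -> fT (l%:R * h)%R))); last exact: measurable_snd.
    exact: (measurable_to_future pbmB).
  apply: (eq_measurable_fun (fun z => F (z.1, z.2))); first by case.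
  exact: (measurableT_comp mF m1).
apply: (@le_trans _ _ (\int[P]_w F (w, w))).
  rewrite le_eqVlt; apply/orP; left; apply/eqP; apply: eq_integral => w _.
  rewrite /F /block_square /= -EFinM; congr EFin.
  have -> : restarted (B (l%:R * h) w) w = occupation B delta eta (l%:R * h) L w.
    by apply/funext => y; exact: restarted_self.
  rewrite !indicE; case: (boolP (w \in Alive B (l%:R * h))); last by rewrite !mul0r.
  rewrite inE => al; rewrite mem_set ?mul1r//; exact: alive_le al.
rewrite (decoupling pbmB (k0 l) mF F0).
rewrite (fubini_tonelli (m1 := P) (m2 := P) F mF' F0).
have H0 (w' : T) v w : 0 <= (\1_(Alive B (k%:R * h)) w * block_square v w' w)%:E.
  by rewrite lee_fin; apply: mulr_ge0; [rewrite indicE|exact: block_square_ge0].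
have mA2 d1 (S : measurableType d1) (b : S -> T) : measurable_fun setT b ->
    measurable_fun setT (fun x => \1_(Alive B (k%:R * h)) (b x) : R).
  move=> mb; apply: (measurableT_comp (f := (\1_(Alive B (k%:R * h)) : T -> R))) => //.
  by apply: measurable_indic; exact: (measurable_Alive pbmB).
have mI : measurable_fun setT (fun w' => \int[@area R]_v \int[P]_w
    (\1_(Alive B (k%:R * h)) w * block_square v w' w)%:E).
  apply: (measurable_fun_fubini_tonelli_F (m2 := @area R) (fun z : T * (R * R) => \int[P]_w
    (\1_(Alive B (k%:R * h)) w * block_square z.2 z.1 w)%:E)).
    apply: (measurable_fun_fubini_tonelli_F (m2 := P) (fun z : T * (R * R) * T =>
      (\1_(Alive B (k%:R * h)) z.2 * block_square z.1.2 z.1.1 z.2)%:E)) => //.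
    apply/measurable_EFinP; apply: measurable_funM; first by apply: mA2; exact: measurable_snd.
    apply: measurable_block_square.
    - exact: measurableT_comp measurable_snd measurable_fst.
    - move=> q; apply: measurable_funB2.
        by apply: (measurableT_comp (measurable_B pbmB (tml q))); exact: measurableT_comp measurable_fst measurable_fst.
      by apply: (measurableT_comp (measurable_B pbmB (k0 l))); exact: measurableT_comp measurable_fst measurable_fst.
    - move=> q; have /andP[t0 _] := tmk q.
      by apply: (measurableT_comp (measurable_B pbmB t0)); exact: measurable_snd.
  by move=> z; apply: integral_ge0 => w _.
have mJ : measurable_fun setT (fun w' => \int[P]_w F (w, w')).
  exact: (measurable_fun_fubini_tonelli_G (m1 := P) F mF' F0).
have c0 : (0 <= gap_density)%R.
  have g0 : (0 < l%:R * h - k.+1%:R * h)%R by rewrite subr_gt0.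
  rewrite /gap_density le_min; apply/andP; split; first by rewrite invr_ge0; exact: ltW.
  apply: divr_ge0; first exact: ler0n.
  by apply: exprn_ge0; exact: ltW.
apply: (@le_trans _ _ (\int[P]_w' (gap_density%:E * \int[@area R]_v \int[P]_w
     (\1_(Alive B (k%:R * h)) w * block_square v w' w)%:E))).
  apply: ge0_le_integral => //.
  - by move=> w' _; apply: integral_ge0 => w _; exact: F0.
  - by apply: measurable_funeM.
  - by move=> w' _; exact: frozen_block.
rewrite (ge0_integral_cstM P c0 mI); last first.
  by move=> w'; apply: integral_ge0 => v _; apply: integral_ge0 => w _; exact: H0.
rewrite EFinM -muleA; apply: lee_wpmul2l; first by rewrite lee_fin.
pose G (z : T * (R * R) * T) := (\1_(Alive B (k%:R * h)) z.2 *
   avg mu (weighted A (restarted z.1.2 z.1.1) (occupation B delta eta (k%:R * h) L)) z.2 ^+ 2)%:E.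
have G0 z : 0 <= G z by rewrite lee_fin mulr_ge0 ?sqr_ge0// indicE.
have mG : measurable_fun setT G.
  apply/measurable_EFinP; apply: measurable_funM; first by apply: mA2; exact: measurable_snd.
  apply: measurable_funX.
  pose H (z : T * (R * R) * T * (R * R)) := (\1_A z.2 * restarted z.1.1.2 z.1.1.1 z.2 *
    occupation B delta eta (k%:R * h) L z.1.2 z.2)%R.
  have mH : measurable_fun setT H.
    apply: measurable_funM; first apply: measurable_funM.
    - apply: (measurableT_comp (f := (\1_A : R * R -> R))); last exact: measurable_snd.
      exact: measurable_indic.
    - apply: (@measurable_restarted _ _ (fun x : T * (R * R) * T => x.1.2) (fun x => x.1.1)).
        exact: measurableT_comp measurable_snd measurable_fst.
      move=> q; apply: measurable_funB2.
        by apply: (measurableT_comp (measurable_B pbmB (tml q))); exact: measurableT_comp measurable_fst measurable_fst.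
      by apply: (measurableT_comp (measurable_B pbmB (k0 l))); exact: measurableT_comp measurable_fst measurable_fst.
    - apply: measurable_sum => q; apply: measurable_funM => //.
      apply: (@measurable_gk2 _ _ _ _ (fun x : T * (R * R) * T => B (tm (k%:R * h) q) x.2)).
      have t0 : (0 <= tm (k%:R * h) q)%R by rewrite addr_ge0// mulr_ge0// ltW.
      by apply: (measurableT_comp (measurable_B pbmB t0)); exact: measurable_snd.
  have H1 z : (0 <= H z)%R.
    apply: mulr_ge0; first apply: mulr_ge0; first by rewrite indicE.
      by case/andP: (restarted_bound z.1.1.2 z.1.1.1 z.2).
    by apply: sumr_ge0 => q _; apply: mulr_ge0; [exact: ltW|exact: gk_ge0 (ltW d0)].
  exact: (measurable_avg mu mH H1).
have mGw : measurable_fun setT (fun z : T * (R * R) => \int[P]_w G (z, w)).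
  exact: (measurable_fun_fubini_tonelli_F (m2 := P) G mG G0).
have mGv : measurable_fun setT (fun w' : T => \int[@area R]_v \int[P]_w G (w', v, w)).
  apply: (measurable_fun_fubini_tonelli_F (m2 := @area R) (fun z => \int[P]_w G (z, w)) mGw).
  by move=> z; apply: integral_ge0 => w _; exact: G0.
rewrite -(ge0_integral_cstM P (ler0n R 4) mGv); last first.
  by move=> w'; apply: integral_ge0 => v _; apply: integral_ge0 => w _; exact: (G0 (w', v, w)).
apply: ge0_le_integral; first exact: measurableT.
- by move=> w' _; apply: integral_ge0 => v _; apply: integral_ge0 => w _; exact: H0.
- exact: mI.
- by apply: measurable_funeM.
move=> w' _.
have mGw' : measurable_fun setT (fun v => \int[P]_w G (w', v, w)).
  by apply: (measurableT_comp mGw); exact: pair1_measurable.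
rewrite -(ge0_integral_cstM (@area R) (ler0n R 4) mGw'); last first.
  by move=> v; apply: integral_ge0 => w _; exact: (G0 (w', v, w)).
apply: ge0_le_integral; first exact: measurableT.
- by move=> v _; apply: integral_ge0 => w _; exact: H0.
- apply: (measurable_fun_fubini_tonelli_F (m2 := P) (fun z : (R * R) * T =>
      (\1_(Alive B (k%:R * h)) z.2 * block_square z.1 w' z.2)%:E)) => //.
  apply/measurable_EFinP; apply: measurable_funM; first by apply: mA2; exact: measurable_snd.
  apply: measurable_block_square; first exact: measurable_fst.
    by move=> q; exact: measurable_cst.
  move=> q; have /andP[t0 _] := tmk q.
  by apply: (measurableT_comp (measurable_B pbmB t0)); exact: measurable_snd.
- exact: measurable_funeM.
move=> v _; rewrite /block_square.
have mlam : measurable_fun setT (restarted v w').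
  have m1 : measurable_fun setT (fun z : T * (R * R) => restarted v w' z.2).
    by apply: (@measurable_restarted _ T (fun=> v) (fun=> w')) => [|q]; exact: measurable_cst.
  exact: (measurableT_comp m1 (@pair1_measurable _ _ T (R * R)%type w')).
have lam0 y : (0 <= restarted v w' y)%R by case/andP: (restarted_bound v w' y).
have lamK y : (restarted v w' y <= L%:R * (eta / delta))%R.
  by case/andP: (restarted_bound v w' y).
have mAl := adapted_alive pbmB (k0 k).
exact: (block_doob pbmB mu d0 e0 (k0 k) mA mlam lam0 lamK nN mAl).
Qed.

End decoupled_blocks.

Section separated_tonelli.
Context d1 d2 (T1 : measurableType d1) (T2 : measurableType d2) (R : realType).
Context (m1 : {sigma_finite_measure set T1 -> \bar R}).
Context (m2 : {sigma_finite_measure set T2 -> \bar R}).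
Local Open Scope ereal_scope.

Lemma separated_tonelli (a : T1 * T2 -> \bar R) (X : T2 -> \bar R) :
  measurable_fun setT a -> (forall z, 0 <= a z) ->
  measurable_fun setT X -> (forall u, 0 <= X u) ->
  \int[m1]_x \int[m2]_u (a (x, u) * X u) = \int[m2]_u ((\int[m1]_x a (x, u)) * X u).
Proof.
move=> ma a0 mX X0; pose F (z : T1 * T2) := a z * X z.2.
have mF : measurable_fun setT F.
  apply: emeasurable_funM => //; apply: (measurableT_comp mX); exact: measurable_snd.
have F0 z : 0 <= F z by exact: mule_ge0.
transitivity (\int[m1]_x \int[m2]_u F (x, u)); first by [].
rewrite (fubini_tonelli (m1 := m1) (m2 := m2) F mF F0).
apply: eq_integral => u _; rewrite /F /=.
rewrite ge0_integralZr//; last by exact: (measurableT_comp ma (@pair2_measurable _ _ T1 T2 u)).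
Qed.

End separated_tonelli.

(** * Energy of a block as an integral over pairs of points *)

Section pair_energy.
Context d (T : measurableType d) (R : realType) (P : probability T R).
Context (B : R -> T -> R * R) (pbmB : planar_brownian_motion P (1, 0) B).
Context (A : set (R * R)) (delta eta h : R) (mu : probability (R * R)%type R).
Context (N L n : nat).
Hypotheses (d0 : 0 < delta) (e0 : 0 < eta) (h0 : 0 < h) (h1 : h <= 1).
Hypotheses (mA : measurable A) (A9 : forall y, A y -> nsq y <= 9^-1).
Hypotheses (nh : n%:R * eta = h) (nN : (n + N <= L)%N).
Local Notation tm s q := (s + q%:R * eta).
Local Notation m2 := (mu \x mu)%E.
Local Notation R2 := (R * R)%type.
Local Notation occ k := (occupation B delta eta (k%:R * h) L).
Local Notation rest l := (restarted B delta eta h L l).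
Local Notation kap y y' g := (gk (2 * delta + g%:R * eta) (y - y')).

(** Mixed second moment, at two points, of the occupation of a path started from Lebesgue measure;
    see [restarted2E]. *)
Definition pair_sum (u : R2 * R2) : R :=
  \sum_(p : 'I_L * 'I_L) eta * eta * kap u.1 u.2 ((p.1 - p.2) + (p.2 - p.1)).

Lemma pair_sum_bound u :
  0 <= pair_sum u <= 2 * (L%:R * eta) * Rk (2 * delta) eta L (u.1 - u.2).
Proof.
have k0 g : 0 <= kap u.1 u.2 g.
  by apply: gk_ge0; apply: addr_ge0; apply: mulr_ge0 => //; exact: ltW.
apply/andP; split.
  by apply: sumr_ge0 => p _; apply: mulr_ge0 => //; apply: mulr_ge0; exact: ltW.
rewrite /pair_sum -(pair_big xpredT xpredT (fun i j : 'I_L => eta * eta * kap u.1 u.2 ((i - j) + (j - i))))/=.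
exact: (pair_sum_le L (ltW e0) k0).
Qed.

Let k0 (k : nat) : 0 <= k%:R * h. Proof. by rewrite mulr_ge0// ltW. Qed.
Let tm0 (k q : nat) : 0 <= tm (k%:R * h) q.
Proof. by apply: addr_ge0 => //; apply: mulr_ge0 => //; exact: ltW. Qed.
Let ee0 : 0 <= eta * eta. Proof. by apply: mulr_ge0; exact: ltW. Qed.
Let g0 z : 0 <= gk delta z. Proof. by apply: gk_ge0; exact: ltW. Qed.

Lemma sum_prod_pair (f g : 'I_L -> R) :
  (\sum_(i < L) eta * f i) * (\sum_(j < L) eta * g j) =
  \sum_(p : 'I_L * 'I_L) eta * eta * (f p.1 * g p.2).
Proof.
rewrite big_distrlr /= pair_big; apply: eq_bigr => p _ /=; ring.
Qed.

Local Open Scope ereal_scope.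

Definition occupation2 (k : nat) (u : R2 * R2) : \bar R :=
  \int[P]_w (\1_(Alive B (k%:R * h)) w * (occ k w u.1 * occ k w u.2))%:E.

Definition restarted2 (l : nat) (u : R2 * R2) : \bar R :=
  \int[P]_w' \int[@area R]_v (rest l v w' u.1 * rest l v w' u.2)%:E.

Lemma restarted2E l u : restarted2 l u = (pair_sum u)%:E.
Proof.
pose f (p : 'I_L * 'I_L) (z : T * R2) : R :=
  (gk delta (z.2 + (B (tm (l%:R * h) p.1) z.1 - B (l%:R * h) z.1) - u.1) *
   gk delta (z.2 + (B (tm (l%:R * h) p.2) z.1 - B (l%:R * h) z.1) - u.2))%R.
have mf p : measurable_fun setT (f p).
  have mg q y : measurable_fun setT (fun z : T * R2 =>
      gk delta (z.2 + (B (tm (l%:R * h) q) z.1 - B (l%:R * h) z.1) - y)%R).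
    apply: (measurableT_comp (measurable_gkB delta y)); apply: measurable_funD2; first exact: measurable_snd.
    apply: measurable_funB2.
      by apply: (measurableT_comp (measurable_B pbmB (tm0 l q))); exact: measurable_fst.
    by apply: (measurableT_comp (measurable_B pbmB (k0 l))); exact: measurable_fst.
  exact: measurable_funM (mg _ _) (mg _ _).
have f0 p z : (0 <= f p z)%R by apply: mulr_ge0; exact: g0.
have mef p : measurable_fun setT (fun z => eta * eta * f p z)%R.
  by apply: measurable_funM => //; exact: measurable_cst.
have ef0 p z : (0 <= eta * eta * f p z)%R by apply: mulr_ge0.
transitivity (\int[P]_w' \int[@area R]_v (\sum_(p : 'I_L * 'I_L) eta * eta * f p (w', v))%:E).
  by apply: eq_integral => w' _; apply: eq_integral => v _; rewrite /restarted sum_prod_pair.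
transitivity (\int[P]_w' \sum_(p : 'I_L * 'I_L) \int[@area R]_v (eta * eta * f p (w', v))%:E).
  apply: eq_integral => w' _; rewrite (intr_sum (@area R) _ (F := fun p v => (eta * eta * f p (w', v))%R))//.
  by move=> p; exact: (measurableT_comp (mef p) (@pair1_measurable _ _ T R2 w')).
have mI p : measurable_fun setT (fun w' => \int[@area R]_v (eta * eta * f p (w', v))%:E).
  apply: (measurable_fun_fubini_tonelli_F (m2 := @area R) (fun z => (eta * eta * f p z)%:E)).
    exact/measurable_EFinP.
  by move=> z; rewrite lee_fin.
rewrite ge0_integral_sum//; last by move=> p w' _; exact: intr_ge0.
rewrite /pair_sum -sumEFin; apply: eq_bigr => p _.
rewrite EFinM -(area_pair pbmB d0 e0 h0 h1 p.1 p.2 u.1 u.2 (k0 l)).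
rewrite -(ge0_integral_cstM P ee0); last 2 first.
- apply: (measurable_fun_fubini_tonelli_F (m2 := @area R) (fun z => (f p z)%:E)).
    exact/measurable_EFinP.
  by move=> z; rewrite lee_fin.
- by move=> w'; apply: intr_ge0 => v; exact: (f0 p (w', v)).
apply: eq_integral => w' _; rewrite (intrZ (@area R) ee0 (F := fun v => f p (w', v)))//.
exact: (measurableT_comp (mf p) (@pair1_measurable _ _ T R2 w')).
Qed.

Lemma measurable_occupation2 k : measurable_fun setT (occupation2 k).
Proof.
pose F (z : T * (R2 * R2)) := (\1_(Alive B (k%:R * h)) z.1 * (occ k z.1 z.2.1 * occ k z.1 z.2.2))%:E.
have mo : measurable_fun setT (fun z : T * R2 => occ k z.1 z.2).
  apply: measurable_sum => q; apply: measurable_funM => //.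
  by apply: (@measurable_gk2 _ _ _ _ (B (tm (k%:R * h) q))); exact: (measurable_B pbmB).
have o0 w y : (0 <= occ k w y)%R by apply: sumr_ge0 => q _; apply: mulr_ge0 => //; exact: ltW.
apply: (measurable_fun_fubini_tonelli_G (m1 := P) F).
  apply/measurable_EFinP; apply: measurable_funM.
    apply: (measurableT_comp (f := (\1_(Alive B (k%:R * h)) : T -> R))); last exact: measurable_fst.
    by apply: measurable_indic; exact: (measurable_Alive pbmB).
  apply: measurable_funM.
    apply: (measurableT_comp mo (g := fun z : T * (R2 * R2) => (z.1, z.2.1))).
    apply/measurable_fun_pairP; split; first exact: measurable_fst.
    exact: measurableT_comp measurable_fst measurable_snd.
  apply: (measurableT_comp mo (g := fun z : T * (R2 * R2) => (z.1, z.2.2))).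
  apply/measurable_fun_pairP; split; first exact: measurable_fst.
  exact: measurableT_comp measurable_snd measurable_snd.
by move=> z; rewrite lee_fin mulr_ge0 ?indicE// mulr_ge0.
Qed.

Lemma occupation2_ge0 k u : 0 <= occupation2 k u.
Proof.
apply: intr_ge0 => w; rewrite mulr_ge0 ?indicE//.
by apply: mulr_ge0; apply: sumr_ge0 => q _; apply: mulr_ge0 => //; exact: ltW.
Qed.

Lemma occupation2_sum (K : nat) u : A u.1 -> A u.2 ->
  \sum_(k < K) h%:E * occupation2 k u <= (8 * 600 * (1 + 5) * pair_sum u)%:E.
Proof.
move=> Au1 Au2.
pose f (k : nat) (p : 'I_L * 'I_L) (w : T) : R := (\1_(Alive B (k%:R * h)) w *
  (gk delta (B (tm (k%:R * h) p.1) w - u.1) * gk delta (B (tm (k%:R * h) p.2) w - u.2)))%R.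
have mf k p : measurable_fun setT (f k p).
  apply: measurable_funM.
    by apply: measurable_indic; exact: (measurable_Alive pbmB).
  apply: measurable_funM.
    by apply: (measurableT_comp (measurable_gkB delta u.1)); exact: (measurable_B pbmB).
  by apply: (measurableT_comp (measurable_gkB delta u.2)); exact: (measurable_B pbmB).
have f0 k p w : (0 <= f k p w)%R by rewrite mulr_ge0 ?indicE// mulr_ge0.
have E k : h%:E * occupation2 k u =
    \sum_(p : 'I_L * 'I_L) (eta * eta)%:E * (h%:E * \int[P]_w (f k p w)%:E).
  transitivity (h%:E * \sum_(p : 'I_L * 'I_L) (eta * eta)%:E * \int[P]_w (f k p w)%:E).
    congr (_ * _); rewrite (eq_bigr _ (fun (p : 'I_L * 'I_L) _ => intrZ P ee0 (mf k p) (f0 k p))).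
    rewrite (intr_sum P _ (fun p : 'I_L * 'I_L => measurable_funM (measurable_cst (eta * eta)%R) (mf k p))); last first.
      by move=> p w; apply: mulr_ge0.
    apply: eq_integral => w _; congr EFin.
    rewrite /occupation sum_prod_pair mulr_sumr; apply: eq_bigr => p _ /=.
    by rewrite mulrCA.
  rewrite ge0_sume_distrr; last first.
    by move=> p _; apply: mule_ge0; [rewrite lee_fin|exact: intr_ge0].
  by apply: eq_bigr => p _; rewrite muleCA.
rewrite (eq_bigr _ (fun (k : 'I_K) _ => E k)) exchange_big /=.
rewrite /pair_sum mulr_sumr -sumEFin; apply: lee_sum => p _.
rewrite -ge0_sume_distrr; last first.
  by move=> k _; apply: mule_ge0; [rewrite lee_fin ltW|exact: intr_ge0].
rewrite mulrCA [leRHS]EFinM; apply: lee_wpmul2l; first by rewrite lee_fin.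
exact: (green_pair pbmB d0 e0 h0 h1 K p.1 p.2 (A9 Au1) (A9 Au2)).
Qed.

Definition pair_indicator (u : R2 * R2) : R := (\1_A u.1 * \1_A u.2)%R.

Lemma measurable_pair_indicator : measurable_fun setT pair_indicator.
Proof.
have mi : measurable_fun setT (\1_A : R2 -> R) by exact: measurable_indic.
by apply: measurable_funM; [exact: (measurableT_comp mi measurable_fst)|exact: (measurableT_comp mi measurable_snd)].
Qed.

Lemma pair_indicator_ge0 u : (0 <= pair_indicator u)%R.
Proof. by rewrite mulr_ge0// indicE. Qed.

Definition block_energy (k : nat) : \bar R :=
  \int[m2]_u ((pair_sum u)%:E * ((pair_indicator u)%:E * occupation2 k u)).

(** A squared average is an integral over two independent points. In that form the integrals over
    the future sample and over [v] act on one factor only, which becomes [pair_sum] and no longer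
    depends on [l]. *)
Lemma block_energyE (l k : nat) :
  \int[P]_w' \int[@area R]_v \int[P]_w (\1_(Alive B (k%:R * h)) w *
      avg mu (weighted A (rest l v w') (occ k)) w ^+ 2)%:E = block_energy k.
Proof.
have mi : measurable_fun setT (\1_A : R2 -> R) by exact: measurable_indic.
have mo : measurable_fun setT (fun z : T * R2 => occ k z.1 z.2).
  apply: measurable_sum => q; apply: measurable_funM => //.
  by apply: (@measurable_gk2 _ _ _ _ (B (tm (k%:R * h) q))); exact: (measurable_B pbmB).
have o0 w y : (0 <= occ k w y)%R by apply: sumr_ge0 => q _; apply: mulr_ge0 => //; exact: ltW.
have r0 v w' y : (0 <= rest l v w' y)%R by case/andP: (restarted_bound B h L l d0 e0 v w' y).
have mr : measurable_fun setT (fun z : (T * R2) * R2 => rest l z.1.2 z.1.1 z.2).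
  apply: (@measurable_restarted _ _ _ _ _ _ _ _ _ _ _ (fun x : T * R2 => x.2) (fun x : T * R2 => x.1)).
    exact: measurable_snd.
  move=> q; apply: measurable_funB2.
    by apply: (measurableT_comp (measurable_B pbmB (tm0 l q))); exact: measurable_fst.
  by apply: (measurableT_comp (measurable_B pbmB (k0 l))); exact: measurable_fst.
pose a1 (z : T * (R2 * R2)) : \bar R :=
  (\1_(Alive B (k%:R * h)) z.1 * (occ k z.1 z.2.1 * occ k z.1 z.2.2))%:E.
pose a2 (z : (T * R2) * (R2 * R2)) : \bar R :=
  (rest l z.1.2 z.1.1 z.2.1 * rest l z.1.2 z.1.1 z.2.2)%:E.
have ma1 : measurable_fun setT a1.
  apply/measurable_EFinP; apply: measurable_funM.
    apply: (measurableT_comp (f := (\1_(Alive B (k%:R * h)) : T -> R))); last exact: measurable_fst.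
    by apply: measurable_indic; exact: (measurable_Alive pbmB).
  apply: measurable_funM.
    apply: (measurableT_comp mo (g := fun z : T * (R2 * R2) => (z.1, z.2.1))).
    apply/measurable_fun_pairP; split; first exact: measurable_fst.
    exact: measurableT_comp measurable_fst measurable_snd.
  apply: (measurableT_comp mo (g := fun z : T * (R2 * R2) => (z.1, z.2.2))).
  apply/measurable_fun_pairP; split; first exact: measurable_fst.
  exact: measurableT_comp measurable_snd measurable_snd.
have a10 z : 0 <= a1 z by rewrite lee_fin mulr_ge0 ?indicE// mulr_ge0.
have ma2 : measurable_fun setT a2.
  apply/measurable_EFinP; apply: measurable_funM.
    apply: (measurableT_comp mr (g := fun z : (T * R2) * (R2 * R2) => (z.1, z.2.1))).
    apply/measurable_fun_pairP; split; first exact: measurable_fst.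
    exact: measurableT_comp measurable_fst measurable_snd.
  apply: (measurableT_comp mr (g := fun z : (T * R2) * (R2 * R2) => (z.1, z.2.2))).
  apply/measurable_fun_pairP; split; first exact: measurable_fst.
  exact: measurableT_comp measurable_snd measurable_snd.
have a20 z : 0 <= a2 z by rewrite lee_fin mulr_ge0.
pose M2 : probability (R2 * R2)%type R := (mu \x mu).
have mpi := measurable_pair_indicator; have pi0 := pair_indicator_ge0.
have mY := measurable_occupation2 k; have Y0 := occupation2_ge0 k.
have sq w' v w : (\1_(Alive B (k%:R * h)) w * avg mu (weighted A (rest l v w') (occ k)) w ^+ 2)%:E =
   \int[m2]_u (a1 (w, u) * (a2 ((w', v), u) * (pair_indicator u)%:E)).
  pose f y := weighted A (rest l v w') (occ k) (w, y).
  have mf : measurable_fun setT f.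
    apply: measurable_funM; first apply: measurable_funM => //.
      exact: (measurableT_comp mr (@pair1_measurable _ _ _ R2 (w', v))).
    exact: (measurableT_comp mo (@pair1_measurable _ _ T R2 w)).
  have f0 y : (0 <= f y)%R.
    by apply: mulr_ge0 => //; apply: mulr_ge0 => //; rewrite indicE.
  have mff : measurable_fun setT (fun u : R2 * R2 => (f u.1 * f u.2)%:E).
    apply/measurable_EFinP; apply: measurable_funM.
      exact: (measurableT_comp mf measurable_fst).
    exact: (measurableT_comp mf measurable_snd).
  have avE : (avg mu (weighted A (rest l v w') (occ k)) w)%:E = \int[mu]_y (f y)%:E.
    rewrite /avg fineK// ge0_fin_numE ?intr_ge0//.
    pose C := (L%:R * (eta / delta) * (L%:R * (eta / delta)))%R.
    apply: (@le_lt_trans _ _ C%:E); last exact: ltry.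
    apply: integral_le_cst => // y; apply: ler_pM => //.
    - by apply: mulr_ge0 => //; rewrite indicE.
    - case/andP: (restarted_bound B h L l d0 e0 v w' y) => _; apply: le_trans.
      by rewrite ler_piMl// indicE; case: (_ \in _).
    - rewrite -[leLHS](predicted_last B delta eta (k%:R * h)).
      by case/andP: (predicted_bound B (k%:R * h) L d0 e0 L w y).
  rewrite expr2 !EFinM avE.
  rewrite -(ge0_integralZr _ measurableT _ _ (intr_ge0 mu f0))//; last 2 first.
  - exact/measurable_EFinP.
  - by move=> y _; rewrite lee_fin.
  transitivity ((\1_(Alive B (k%:R * h)) w)%:E * \int[m2]_u (f u.1 * f u.2)%:E).
    congr (_ * _); rewrite (fubini_tonelli1 (m1 := mu) (m2 := mu) (fun u => (f u.1 * f u.2)%:E))//; last first.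
      by move=> u; rewrite lee_fin mulr_ge0.
    apply: eq_integral => y _; rewrite /fubini_F /= (intrZ mu (f0 y))//.
  have i0 : (0 <= \1_(Alive B (k%:R * h)) w :> R)%R by rewrite indicE.
  have mff' : measurable_fun setT (fun u : R2 * R2 => f u.1 * f u.2)%R.
    exact/measurable_EFinP.
  have ff0 (u : R2 * R2) : (0 <= f u.1 * f u.2)%R by rewrite mulr_ge0.
  rewrite (intrZ m2 i0 mff' ff0).
  apply: eq_integral => u _; rewrite /a1 /a2 -!EFinM; congr EFin.
  by rewrite /f /weighted /pair_indicator /=; ring.
transitivity (\int[P]_w' \int[@area R]_v \int[m2]_u (a2 ((w', v), u) * ((pair_indicator u)%:E * occupation2 k u))).
  apply: eq_integral => w' _; apply: eq_integral => v _.
  rewrite (eq_integral _ _ (fun w _ => sq w' v w)).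
  rewrite (separated_tonelli P M2 (X := fun u => a2 ((w', v), u) * (pair_indicator u)%:E) ma1 a10).
  - apply: eq_integral => u _; rewrite muleCA; congr (_ * _).
    exact: muleC.
  - apply: emeasurable_funM; last exact/measurable_EFinP.
    exact: (measurableT_comp ma2 (@pair1_measurable _ _ _ (R2 * R2)%type (w', v))).
  - by move=> u; apply: mule_ge0 => //; rewrite lee_fin.
have mX : measurable_fun setT (fun u => (pair_indicator u)%:E * occupation2 k u).
  by apply: emeasurable_funM => //; exact/measurable_EFinP.
have X0 u : 0 <= (pair_indicator u)%:E * occupation2 k u.
  by apply: mule_ge0 => //; rewrite lee_fin.
pose b2 (z : T * (R2 * R2)) := \int[@area R]_v a2 ((z.1, v), z.2).
have mb2 : measurable_fun setT b2.
  apply: (measurable_fun_fubini_tonelli_F (m2 := @area R) (fun z : (T * (R2 * R2)) * R2 => a2 ((z.1.1, z.2), z.1.2))).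
    apply: (measurableT_comp ma2 (g := fun z : (T * (R2 * R2)) * R2 => ((z.1.1, z.2), z.1.2))).
    apply/measurable_fun_pairP; split; last exact: measurableT_comp measurable_snd measurable_fst.
    apply/measurable_fun_pairP; split; last exact: measurable_snd.
    exact: measurableT_comp measurable_fst measurable_fst.
  by move=> z.
have b20 z : 0 <= b2 z by apply: integral_ge0 => v _.
transitivity (\int[P]_w' \int[m2]_u (b2 (w', u) * ((pair_indicator u)%:E * occupation2 k u))).
  apply: eq_integral => w' _.
  rewrite (separated_tonelli (@area R) M2 (a := fun z => a2 ((w', z.1), z.2)) _ _ mX X0)//.
  apply: (measurableT_comp ma2 (g := fun z : R2 * (R2 * R2) => ((w', z.1), z.2))).
  apply/measurable_fun_pairP; split; last exact: measurable_snd.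
  apply/measurable_fun_pairP; split; last exact: measurable_fst.
  exact: measurable_cst.
rewrite (separated_tonelli P M2 mb2 b20 mX X0).
by apply: eq_integral => u _; congr (_ * _); exact: restarted2E.
Qed.

Lemma measurable_pair_Rk (a : R) (K : nat) :
  measurable_fun setT (fun u : R2 * R2 => Rk a eta K (u.1 - u.2)%R).
Proof.
apply: (measurableT_comp (measurable_Rk a eta K)).
by apply: measurable_funB2; [exact: measurable_fst|exact: measurable_snd].
Qed.

Lemma measurable_pair_sum : measurable_fun setT pair_sum.
Proof.
apply: measurable_sum => p; apply: measurable_funM => //.
apply: (measurableT_comp (measurable_gk _)).
by apply: measurable_funB2; [exact: measurable_fst|exact: measurable_snd].
Qed.

Definition overlap : \bar R :=
  \int[m2]_u (pair_indicator u * Rk (2 * delta) eta L (u.1 - u.2)%R ^+ 2)%:E.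

(** The restarted occupation and the actual one contribute one [pair_sum] each, whence the square of
    [Rk] in [overlap]. *)
Lemma block_energy_sum (K : nat) :
  \sum_(k < K) h%:E * block_energy k <=
  (8 * 600 * (1 + 5) * (2 * (L%:R * eta)) ^+ 2)%:E * overlap.
Proof.
have ps0 u : (0 <= pair_sum u)%R by case/andP: (pair_sum_bound u).
have mps := measurable_pair_sum; have mpi := measurable_pair_indicator.
have mF k : measurable_fun setT (fun u => (pair_sum u)%:E * ((pair_indicator u)%:E * occupation2 k u)).
  apply: emeasurable_funM; first exact/measurable_EFinP.
  by apply: emeasurable_funM; [exact/measurable_EFinP|exact: measurable_occupation2].
have F0 k u : 0 <= (pair_sum u)%:E * ((pair_indicator u)%:E * occupation2 k u).
  apply: mule_ge0; first by rewrite lee_fin.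
  by apply: mule_ge0; [rewrite lee_fin pair_indicator_ge0|exact: occupation2_ge0].
rewrite (eq_bigr _ (fun (k : 'I_K) _ => esym (ge0_integral_cstM m2 (ltW h0) (mF k) (F0 k)))).
have mhF k : measurable_fun setT (fun u => h%:E * ((pair_sum u)%:E * ((pair_indicator u)%:E * occupation2 k u))).
  exact: measurable_funeM.
have hF0 k u : 0 <= h%:E * ((pair_sum u)%:E * ((pair_indicator u)%:E * occupation2 k u)).
  by apply: mule_ge0; [rewrite lee_fin ltW|exact: F0].
rewrite -(@ge0_integral_sum _ _ _ m2 setT measurableT _ (fun (k : 'I_K) u => h%:E * ((pair_sum u)%:E * ((pair_indicator u)%:E * occupation2 k u)))); last 2 first.
- by move=> k; exact: mhF.
- by move=> k u _; exact: hF0.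
pose C := (8 * 600 * (1 + 5) * (2 * (L%:R * eta)) ^+ 2)%R.
have G600 : (0 <= 8 * 600 * (1 + 5) :> R)%R by lra.
have C0 : (0 <= C)%R by apply: mulr_ge0; [exact: G600|exact: sqr_ge0].
have mR : measurable_fun setT (fun u : R2 * R2 => pair_indicator u * Rk (2 * delta) eta L (u.1 - u.2) ^+ 2)%R.
  by apply: measurable_funM => //; apply: measurable_funX; exact: measurable_pair_Rk.
have R0 u : (0 <= pair_indicator u * Rk (2 * delta) eta L (u.1 - u.2) ^+ 2)%R.
  by apply: mulr_ge0; [exact: pair_indicator_ge0|exact: sqr_ge0].
rewrite /overlap (intrZ m2 C0 mR R0); apply: ge0_le_integral; first exact: measurableT.
- by move=> u _; apply: sume_ge0 => k _; exact: hF0.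
- by apply: emeasurable_sum => k; exact: mhF.
- by apply/measurable_EFinP; apply: measurable_funM => //; exact: measurable_cst.
move=> u _.
rewrite (eq_bigr (fun k : 'I_K => (pair_sum u * pair_indicator u)%:E * (h%:E * occupation2 k u))); last first.
  by move=> k _; rewrite [in RHS]EFinM -[RHS]muleA [LHS]muleCA; congr (_ * _); exact: muleCA.
rewrite -ge0_sume_distrr; last first.
  by move=> k _; apply: mule_ge0; [rewrite lee_fin ltW|exact: occupation2_ge0].
have [[Au1 Au2]|nA] := pselect (A u.1 /\ A u.2); last first.
  have -> : pair_indicator u = 0%R.
    rewrite /pair_indicator !indicE; case: (boolP (u.1 \in A)) => [|_]; last by rewrite mul0r.
    case: (boolP (u.2 \in A)) => [|_]; last by rewrite mulr0.
    by rewrite !inE => ? ?; case: nA.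
  by rewrite mulr0 mul0e mul0r mulr0.
apply: (@le_trans _ _ ((pair_sum u * pair_indicator u)%:E * (8 * 600 * (1 + 5) * pair_sum u)%:E)).
  apply: lee_wpmul2l; last exact: occupation2_sum.
  by rewrite lee_fin; apply: mulr_ge0 => //; exact: pair_indicator_ge0.
rewrite -EFinM lee_fin /C.
have -> : pair_indicator u = 1%R by rewrite /pair_indicator !indicE !mem_set// mulr1.
have /andP[p0 p1] := pair_sum_bound u.
rewrite mulr1 mul1r mulrCA -[leRHS]mulrA; apply: ler_wpM2l; first exact: G600.
by rewrite -exprMn expr2; apply: ler_pM.
Qed.

End pair_energy.

(** * Summation over the gaps between blocks *)

Section gap_sums.
Context {R : realType}.

Lemma harmonic_le (K : nat) : \sum_(m < K.+1) m.+1%:R^-1 <= 1 + ln K.+1%:R :> R.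
Proof.
elim: K => [|K IH]; first by rewrite big_ord1 ln1 invr1 addr0.
rewrite big_ord_recr/=; apply: le_trans (lerD IH (lexx _)) _.
have k1 : 0 < K.+1%:R :> R by rewrite ltr0n.
have k2 : 0 < K.+2%:R :> R by rewrite ltr0n.
have q0 : 0 < K.+1%:R / K.+2%:R :> R by rewrite divr_gt0.
have := expR_ge1Dx (ln (K.+1%:R / K.+2%:R : R)).
rewrite lnK ?posrE// ln_div ?posrE//.
have -> : K.+1%:R / K.+2%:R = 1 - K.+2%:R^-1 :> R.
  rewrite -[K.+2%:R]natr1; move: (k1); move: (K.+1%:R : R) => x xp.
  by field; apply: lt0r_neq0; lra.
by move: (K.+2%:R^-1 : R) (ln _) (ln _) => x y z; lra.
Qed.

Definition gap_function (t : R) : R := Num.min t^-1 (600 / t ^+ 3).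

Lemma gap_function_ge0 t : 0 < t -> 0 <= gap_function t.
Proof.
move=> t0; rewrite /gap_function le_min; apply/andP; split; first by rewrite invr_ge0 ltW.
by apply: divr_ge0; [exact: ler0n|exact/exprn_ge0/ltW].
Qed.

(** Gaps up to 1 contribute a harmonic sum, hence the logarithm; longer gaps contribute a bounded
    amount by cubic decay. *)
Lemma gap_sum (h : R) (M : nat) : 0 < h -> h <= 1 ->
  \sum_(m < M) h * gap_function (m.+1%:R * h) <= (8 * 600 + 1) * (1 + ln h^-1).
Proof.
move=> h0 h1.
have hi1 : 1 <= h^-1 by rewrite invr_ge1// unitfE gt_eqF.
have Lam1 : 0 <= ln h^-1 by rewrite ln_ge0.
(* The number of gaps [m.+1%:R * h] that do not exceed 1. *)
pose K := Num.truncn h^-1.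
have K1 : (0 < K)%N by rewrite truncn_gt0.
have Kh : K%:R <= h^-1 by rewrite truncn_le (le_trans _ hi1).
have hK : h^-1 < K.+1%:R by exact: truncnS_gt.
have step (m : nat) : h * gap_function (m.+1%:R * h) <=
    (if (m < K)%N then m.+1%:R^-1 else 0) + 4 * 600 * (h / (1 + m%:R * h) ^+ 2).
  have t0 : 0 < m.+1%:R * h by rewrite mulr_gt0// ltr0n.
  have c0 : 0 <= 4 * 600 * (h / (1 + m%:R * h) ^+ 2).
    apply: mulr_ge0; first lra.
    by apply: divr_ge0; [exact: ltW|exact: sqr_ge0].
  case: ltnP => mK.
    apply: (@le_trans _ _ m.+1%:R^-1); last by rewrite lerDl.
    apply: (@le_trans _ _ (h * (m.+1%:R * h)^-1)).
      by apply: ler_wpM2l; [exact: ltW|rewrite /gap_function ge_min lexx].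
    by rewrite invfM mulrCA mulfV ?gt_eqF// mulr1.
  have t1 : 1 < m.+1%:R * h.
    rewrite -ltr_pdivrMr// div1r; apply: lt_le_trans hK _.
    by rewrite ler_nat ltnS.
  rewrite add0r; apply: (@le_trans _ _ (h * (600 / (m.+1%:R * h) ^+ 3))).
    by apply: ler_wpM2l; [exact: ltW|rewrite /gap_function ge_min lexx orbT].
  have := @cube_bound R 600 1 0 _ (ler0n R 600) ler01 (lexx 0) t1.
  rewrite mulr1 addr0 mulr1 => cb.
  apply: (@le_trans _ _ (h * (4 * 600 / (1 + m.+1%:R * h) ^+ 2))).
    by apply: ler_wpM2l; [exact: ltW|exact: cb].
  rewrite mulrCA; apply: ler_wpM2l; first lra.
  apply: ler_wpM2l; first exact: ltW.
  have m0 : 0 <= m%:R * h by rewrite mulr_ge0// ltW.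
  have mm : m%:R * h <= m.+1%:R * h by rewrite ler_pM2r// ler_nat.
  rewrite lef_pV2 ?posrE; last 2 first.
  - by apply: exprn_gt0; lra.
  - by apply: exprn_gt0; lra.
  by rewrite ler_sqr ?nnegrE; lra.
apply: le_trans (ler_sum _ (fun (m : 'I_M) _ => step m)) _.
rewrite big_split/= -mulr_sumr.
have s2 := inverse_square_sum M h0 h1.
have s1 : \sum_(m < M) (if (m < K)%N then m.+1%:R^-1 else 0) <= 1 + ln h^-1.
  apply: (@le_trans _ _ (\sum_(m < K) m.+1%:R^-1)).
    rewrite -big_mkcond/= -(big_mkord (fun m => (m < K)%N) (fun m => m.+1%:R^-1)).
    rewrite -(big_mkord xpredT (fun m => m.+1%:R^-1)).
    have [MK|KM] := leqP M K.
      rewrite big_nat_cond (eq_bigl (fun m => (0 <= m < M)%N)); last first.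
        by move=> m; case: (ltnP m M) => //= mM; rewrite (leq_trans mM MK).
      rewrite -big_nat [leRHS](big_cat_nat (n := M))//= lerDl.
      by apply: sumr_ge0 => i _; rewrite invr_ge0.
    rewrite (big_cat_nat (n := K))//=; last exact: ltnW.
    rewrite [X in _ + X]big_nat_cond [X in _ + X]big1 ?addr0; last first.
      by move=> m /andP[/andP[Km _] mK]; rewrite ltnNge Km in mK.
    rewrite big_nat_cond (eq_bigl (fun m => (0 <= m < K)%N)) -?big_nat//.
    by move=> m; case: (m < K)%N; rewrite ?andbF ?andbT.
  have [k KE] : exists k, K = k.+1 by exists K.-1; rewrite prednK.
  rewrite KE; apply: le_trans (harmonic_le k) _; rewrite lerD2l ler_ln ?posrE ?ltr0n//.
    by rewrite -KE.
  exact: lt_le_trans hi1.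
have := ler_wpM2l (_ : 0 <= 4 * 600 :> R) s2; lra.
Qed.

End gap_sums.

Section second_moment.
Context d (T : measurableType d) (R : realType) (P : probability T R).
Context (B : R -> T -> R * R) (pbmB : planar_brownian_motion P (1, 0) B).
Context (A : set (R * R)) (delta eta h : R) (mu : probability (R * R)%type R).
Context (N L n : nat).
Hypotheses (d0 : 0 < delta) (e0 : 0 < eta) (h0 : 0 < h) (h1 : h <= 1).
Hypotheses (mA : measurable A) (A9 : forall y, A y -> nsq y <= 9^-1).
Hypotheses (nh : n%:R * eta = h) (nN : (n + N <= L)%N).
Local Open Scope ereal_scope.
Local Notation bsq l k w := (block_max B A delta eta (k%:R * h) mu
     (occupation B delta eta (l%:R * h) L w) N n w ^+ 2)%R.

(** For fixed [k] the block energy is the same for all [l], so the sum over [l] is a sum over gaps.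
    Each of the two sums over blocks needs a factor [h] to become an integral in time, which
    explains the denominator [h ^+ 2]. *)
Lemma total_blocks (M : nat) :
  \sum_(l < M) \sum_(k < M | (k.+1 < l)%N) \int[P]_w (\1_(Alive B (l%:R * h)) w * bsq l k w)%:E
  <= (4 * ((8 * 600 + 1) * (1 + ln h^-1)) / h ^+ 2 *
      (8 * 600 * (1 + 5) * (2 * (L%:R * eta)) ^+ 2))%:E * overlap A delta eta mu L.
Proof.
pose be k := block_energy P B A delta eta h mu L k.
pose gf (l k : nat) := gap_function (l%:R * h - k.+1%:R * h).
have be0 k : 0 <= be k.
  apply: integral_ge0 => u _; apply: mule_ge0.
    by rewrite lee_fin; case/andP: (pair_sum_bound L d0 e0 u).
  apply: mule_ge0; first by rewrite lee_fin pair_indicator_ge0.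
  exact: occupation2_ge0.
have gf0 (l k : nat) : (k.+1 < l)%N -> (0 <= gf l k)%R.
  by move=> kl; apply: gap_function_ge0; rewrite subr_gt0 ltr_pM2r// ltr_nat.
apply: (@le_trans _ _ (\sum_(l < M) \sum_(k < M | (k.+1 < l)%N) (gf l k * 4)%:E * be k)).
  apply: lee_sum => l _; apply: lee_sum => k kl.
  have := decoupled_block pbmB mu d0 e0 h0 mA nh nN kl.
  by rewrite (block_energyE pbmB mu L d0 e0 h0 h1 mA l k).
rewrite (exchange_big_dep xpredT)//=.
apply: (@le_trans _ _ (\sum_(k < M) (4 * ((8 * 600 + 1) * (1 + ln h^-1)) / h ^+ 2)%:E * (h%:E * be k))); last first.
  have D0 : (0 <= 4 * ((8 * 600 + 1) * (1 + ln h^-1)) / h ^+ 2)%R.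
    apply: divr_ge0; last exact: sqr_ge0.
    have : (0 <= ln h^-1)%R by rewrite ln_ge0// invr_ge1// unitfE gt_eqF.
    by lra.
  rewrite -ge0_sume_distrr; last by move=> k _; apply: mule_ge0; rewrite ?lee_fin// ltW.
  rewrite [in leRHS]EFinM -muleA; apply: lee_wpmul2l; first by rewrite lee_fin.
  exact: (block_energy_sum pbmB mu L d0 e0 h0 h1 mA A9).
apply: lee_sum => k _.
rewrite -ge0_sume_distrl; last first.
  by move=> l kl; rewrite lee_fin mulr_ge0// gf0.
rewrite muleA; apply: lee_wpmul2r => //.
rewrite sumEFin -EFinM lee_fin -mulr_suml.
have gs := gap_sum M h0 h1.
have H : (\sum_(l < M | (k.+1 < l)%N) gf l k <= ((8 * 600 + 1) * (1 + ln h^-1)) / h)%R.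
  rewrite ler_pdivlMr// mulrC mulr_sumr; apply: le_trans gs.
  rewrite -(big_mkord (fun l => (k.+1 < l)%N) (fun l => h * gf l k)%R) big_mkord.
  (* With [m = l - k.+2] the gap [l - k.+1] is [m.+1], the indexing of [gap_sum]. *)
  apply: le_trans (_ : \sum_(l < M | (k.+2 <= l)%N) h * gap_function ((l - k.+2).+1%:R * h) <= _)%R.
    apply: ler_sum => l kl; rewrite /gf -mulrBl -natrB; last exact: ltnW.
    by rewrite subnSK.
  apply: (sum_shift_le (F := fun m => h * gap_function (m.+1%:R * h))%R) => m.
  apply: mulr_ge0; first exact: ltW.
  by apply: gap_function_ge0; rewrite mulr_gt0// ltr0n.
apply: (@le_trans _ _ (((8 * 600 + 1) * (1 + ln h^-1)) / h * 4)%R).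
  by apply: ler_wpM2r.
move: ((8 * 600 + 1) * (1 + ln h^-1))%R => D.
rewrite le_eqVlt; apply/orP; left; apply/eqP; field.
by rewrite gt_eqF.
Qed.

End second_moment.

Lemma sum_offset_le (R : realType) (f : nat -> R) (s N L : nat) : (forall i, 0 <= f i) ->
  (s + N <= L)%N -> \sum_(q < N) f (s + q)%N <= \sum_(q < L) f q.
Proof.
move=> f0 sN; rewrite -(big_mkord xpredT f) -(big_mkord xpredT (fun q => f (s + q)%N)).
rewrite [leRHS](big_cat_nat (n := s))//=; last exact: leq_trans (leq_addr _ _) sN.
rewrite [in leRHS](big_cat_nat (n := (s + N)%N) (m := s) (p := L))//=; last exact: leq_addr.
have -> : \sum_(s <= j < s + N) f j = \sum_(0 <= q < N) f (s + q)%N.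
  rewrite -[X in \sum_(X <= i < _) _ = _]add0n big_addn addKn.
  by apply: eq_bigr => q _; rewrite addnC.
by rewrite addrCA lerDl addr_ge0// sumr_ge0.
Qed.

Lemma sum_ge_term (R : realType) (I : finType) (Q : pred I) (F : I -> R) (i : I) :
  (forall i, 0 <= F i) -> Q i -> F i <= \sum_(j | Q j) F j.
Proof. by move=> F0 Qi; rewrite (bigD1 i)//= lerDl sumr_ge0. Qed.

Lemma measurable_sum_cond d (T : measurableType d) (R : realType) (I : Type) (r : seq I)
    (Q : pred I) (f : I -> T -> R) : (forall i, measurable_fun setT (f i)) ->
  measurable_fun setT (fun w => \sum_(i <- r | Q i) f i w).
Proof.
move=> mf; apply: (eq_measurable_fun (fun w => \sum_(i <- r) (if Q i then f i w else 0))).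
  by move=> w _; rewrite [RHS]big_mkcond.
by apply: measurable_sum => i; case: (Q i) => //; exact: measurable_cst.
Qed.

Section averages_le.
Context d1 d2 (T1 : measurableType d1) (T2 : measurableType d2) (R : realType).
Context (mu : probability T2 R) (W V : T1 * T2 -> R) (K K' : R).
Hypotheses (mW : measurable_fun setT W) (W0 : forall x, 0 <= W x).
Hypotheses (WK : forall x, W x <= K).
Hypotheses (mV : measurable_fun setT V) (V0 : forall x, 0 <= V x).
Hypotheses (VK : forall x, V x <= K').

Lemma avg_le_add x (c : R) : 0 <= c -> (forall y, W (x, y) <= V (x, y) + c) ->
  avg mu W x <= avg mu V x + c.
Proof.
move=> c0 H; rewrite -lee_fin EFinD (avgE mu mW W0 WK) (avgE mu mV V0 VK).
rewrite -(integral_prob_cst mu c%:E).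
have mWx : measurable_fun setT (fun y => W (x, y)).
  exact: (measurableT_comp mW (@pair1_measurable _ _ T1 T2 x)).
have mVx : measurable_fun setT (fun y => V (x, y)).
  exact: (measurableT_comp mV (@pair1_measurable _ _ T1 T2 x)).
rewrite (intrD mu mVx (measurable_cst c))//.
apply: intr_le => //; exact: measurable_funD.
Qed.

End averages_le.

(** * Absorption: the squared energy bounded in terms of itself *)

Section second_stage.
Context d (T : measurableType d) (R : realType) (P : probability T R).
Context (B : R -> T -> R * R) (pbmB : planar_brownian_motion P (1, 0) B).
Context (A : set (R * R)) (h : R) (M c : nat).
Hypotheses (cA : closed A) (h0 : 0 < h) (h1 : h <= 1).
Hypothesis A9 : forall y, A y -> nsq y <= 9^-1.
Context (delta : R).
Hypotheses (dE : delta = h / 2 ^+ c) (d0 : 0 < delta).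
Local Notation gr := (grid h).
Local Notation N n := (16 * 2 ^ n)%N.
Local Notation L n := (16 * 2 ^ n + 2 ^ n)%N.
Local Notation win n := (window h 16 delta n).
Local Notation occ n l := (occupation B delta (gr n 1) (l%:R * h) (L n)).
Local Notation bmax mu n l k w := (block_max B A delta (gr n 1) (k%:R * h) mu
     (occ n l w) (N n) (2 ^ n) w).

Let mA : measurable A. Proof. exact: closed_measurable2. Qed.

Let nh n : (2 ^ n)%:R * gr n 1 = h.
Proof. by rewrite -gridE -[X in gr n X]mul1n grid_block mul1r. Qed.

Let gr_block n l q : gr n (l * 2 ^ n + q) = l%:R * h + q%:R * gr n 1.
Proof. by rewrite gridD grid_block -gridE. Qed.

Let g1 n : 0 < gr n 1. Proof. exact: grid1_gt0. Qed.

Definition future_occupation n j (w : T) (y : R * R) : R :=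
  \sum_(q < N n) gr n 1 * gk delta (B (gr n (j.+1 + q)) w - y).

Let K1 : R := 16%:R * h / delta.
Let L1 : R := 16%:R * h * (16 / delta ^+ 2).

Let K10 : 0 <= K1.
Proof. by apply: divr_ge0; [apply: mulr_ge0; [exact: ler0n|exact: ltW]|exact: ltW]. Qed.
Let L10 : 0 <= L1.
Proof.
apply: mulr_ge0; first by apply: mulr_ge0; [exact: ler0n|exact: ltW].
by apply: divr_ge0; [exact: ler0n|exact: sqr_ge0].
Qed.

Let gk0 z : 0 <= gk delta z. Proof. exact: gk_ge0 (ltW d0). Qed.

Lemma future_occupation_bound n j w y : 0 <= future_occupation n j w y <= K1.
Proof.
apply/andP; split; first by apply: sumr_ge0 => q _; apply: mulr_ge0 => //; exact: ltW.
rewrite /K1 -(window_length h 16 n) -mulrA.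
rewrite /future_occupation -[X in X%:R * _]card_ord -sumr_const mulr_suml; apply: ler_sum => q _.
by rewrite mul1r; apply: ler_wpM2l; [exact: ltW|exact: gk_le1].
Qed.

(** [L n] exceeds the window by one block, so a window that starts anywhere in block [l] fits into
    the occupation measured from the beginning of the block. *)
Lemma future_occupation_le n l j w y : (l * 2 ^ n <= j < l.+1 * 2 ^ n)%N ->
  future_occupation n j w y <= occ n l w y.
Proof.
move=> /andP[lj jl].
pose f q := gr n 1 * gk delta (B (l%:R * h + q%:R * gr n 1) w - y).
have f0 q : 0 <= f q by apply: mulr_ge0 => //; exact: ltW.
have sN : (j.+1 - l * 2 ^ n + N n <= L n)%N.
  by rewrite addnC leq_add2l leq_subLR -mulSnr.
apply: le_trans (sum_offset_le f0 sN); apply: ler_sum => q _.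
rewrite /f -gr_block addnA subnKC//; exact: leqW.
Qed.

Lemma window_lipschitz n (x y : R * R) : `|x| <= 8 -> `|y| <= 8 ->
  `|win n x - win n y| <= L1 * `|x - y|.
Proof.
move=> x8 y8; rewrite /L1 -(window_length h 16 n).
by apply: Rk_lipschitz => //; exact: ltW.
Qed.

Let winK n z : 0 <= win n z <= K1.
Proof. by rewrite window_ge0// window_le. Qed.

(** What the squared window becomes when one factor is replaced by the occupation of which it is the
    conditional expectation. *)
Definition past_future n j (z : T * (R * R)) : R :=
  \1_A z.2 * (win n (B (gr n j.+1) z.1 - z.2) * future_occupation n j z.1 z.2).

Let mB n j : measurable_fun setT (B (gr n j)).
Proof. by apply: (measurable_B pbmB); exact: grid_ge0. Qed.

Let mA2 : measurable_fun setT (fun z : T * (R * R) => \1_A z.2 : R).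
Proof.
apply: (measurableT_comp (f := (\1_A : R * R -> R))); last exact: measurable_snd.
exact: measurable_indic.
Qed.

Let mwin n j : measurable_fun setT (fun z : T * (R * R) => win n (B (gr n j) z.1 - z.2)).
Proof.
apply: (measurableT_comp (measurable_window h 16 delta n)).
apply: measurable_funB2; last exact: measurable_snd.
exact: (measurableT_comp (mB n j) measurable_fst).
Qed.

Lemma measurable_past_future n j : measurable_fun setT (past_future n j).
Proof.
apply: measurable_funM => //; apply: measurable_funM => //.
apply: measurable_sum => q; apply: measurable_funM => //.
exact: measurable_gk2.
Qed.

Lemma past_future_ge0 n j z : 0 <= past_future n j z.
Proof.
apply: mulr_ge0; first by rewrite indicE.
apply: mulr_ge0; first by case/andP: (winK n (B (gr n j.+1) z.1 - z.2)).
by case/andP: (future_occupation_bound n j z.1 z.2).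
Qed.

Lemma past_future_le n j z : past_future n j z <= K1 * K1.
Proof.
have /andP[a b] := winK n (B (gr n j.+1) z.1 - z.2).
have /andP[a' b'] := future_occupation_bound n j z.1 z.2.
apply: (@le_trans _ _ (win n (B (gr n j.+1) z.1 - z.2) * future_occupation n j z.1 z.2)).
  by rewrite ler_piMl ?mulr_ge0// indicE; case: (_ \in _).
exact: ler_pM.
Qed.

Let n3 (z : R * R) : nsq z < 9 -> `|z| <= 3.
Proof.
move=> z9; rewrite -(ler_pXn2r (n := 2))// ?nnegrE//.
by have := norm_nsq z; move: (`|z| ^+ 2) => k; lra.
Qed.

(** The window at the later visit is moved to the earlier visit, where the path is within [g]. There
    it is one of the terms in the maximum over block [k], while the occupation after the mark is
    dominated by that of block [l]. *)
Lemma past_future_block (mu : probability (R * R)%type R) (g : R) n j w :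
  (j < M * 2 ^ n)%N -> 0 <= g -> Mark B A h g n j w ->
  exists l k, [/\ (l < M)%N, (k.+1 < l)%N, alive (B ^~ w) (l%:R * h) &
    avg mu (past_future n j) w <= bmax mu n l k w + L1 * g * K1].
Proof.
move=> jM g0 [_ _ al [i ij Bij]].
have t0 : (0 < 2 ^ n)%N by rewrite expn_gt0.
pose l := (j %/ 2 ^ n)%N; pose k := (i %/ 2 ^ n)%N; pose o := (i %% 2 ^ n)%N.
have jE := divn_eq j (2 ^ n); have iE := divn_eq i (2 ^ n).
have jr := ltn_pmod j t0; have ir := ltn_pmod i t0.
have lM : (l < M)%N by rewrite ltn_divLR.
have lj : (l * 2 ^ n <= j)%N by rewrite leq_divM.
have jl : (j < l.+1 * 2 ^ n)%N by rewrite -ltn_divLR.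
(* Visits three block lengths apart lie in blocks with at least one full block between them. *)
have kl : (k.+1 < l)%N.
  have : (k * 2 ^ n + 3 * 2 ^ n <= l.+1 * 2 ^ n)%N.
    apply: leq_trans jl; apply: leq_trans ij; rewrite leq_add2r; exact: leq_divM.
  by rewrite -mulnDl leq_pmul2r// addn3 ltnS.
exists l, k; split => //.
  by apply: alive_le al; rewrite -(grid_block h n) grid_le// leqW.
have ti : gr n i = k%:R * h + o%:R * gr n 1 by rewrite -gr_block -iE.
pose V := weighted A (occ n l w) (fun w y => Rk delta (gr n 1) (N n) (B (k%:R * h + o%:R * gr n 1) w - y)).
have o0 y : 0 <= occ n l w y by apply: sumr_ge0 => q _; apply: mulr_ge0 => //; exact: ltW.
have oK y : occ n l w y <= (L n)%:R * (gr n 1 / delta).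
  rewrite -(predicted_last B delta (gr n 1) (l%:R * h) (L n)).
  by case/andP: (predicted_bound B (l%:R * h) (L n) d0 (g1 n) (L n) w y).
have mo : measurable_fun setT (occ n l w).
  apply: measurable_sum => q; apply: measurable_funM => //.
  rewrite -gr_block.
  exact: (measurableT_comp (measurable_gk2 delta (mB n (l * 2 ^ n + q))) (@pair1_measurable _ _ T (R * R)%type w)).
have V0 z : 0 <= V z by apply: weighted_ge0 => // w' y; apply: Rk_ge0 => //; exact: ltW.
have VK z : V z <= (L n)%:R * (gr n 1 / delta) * K1.
  apply: weighted_le => // w' y; exact: winK.
have mV : measurable_fun setT V.
  by apply: measurable_weighted => //; have := mwin n i; rewrite ti.
apply: (@le_trans _ _ (avg mu V w + L1 * g * K1)).
  apply: (avg_le_add mu (measurable_past_future n j) (past_future_ge0 n j)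
    (past_future_le n j) mV V0 VK).
    by apply: mulr_ge0 => //; apply: mulr_ge0.
  move=> y; rewrite /past_future /V /weighted /=.
  have [Ay|nAy] := pselect (A y); last first.
    rewrite indicE memNset// !mul0r add0r; apply: mulr_ge0 => //; exact: mulr_ge0.
  rewrite indicE mem_set// !mul1r -ti.
  have /andP[f0 fK] := future_occupation_bound n j w y.
  have fo := future_occupation_le w y (introT andP (conj lj jl)).
  have nj : `|B (gr n j.+1) w| <= 3 by apply: n3; apply: al; rewrite lexx grid_ge0.
  have ni : `|B (gr n i) w| <= 3.
    apply: n3; apply: al; rewrite grid_ge0// grid_le//.
    exact: leq_trans (leq_addr _ _) ij.
  have a1 : `|y| <= 1.
    rewrite -(ler_pXn2r (n := 2))// ?nnegrE// expr1n.
    by have := norm_nsq y; have := A9 Ay; move: (`|y| ^+ 2) => q; lra.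
  have b1 : `|B (gr n j.+1) w - y| <= 8 by apply: le_trans (ler_normB _ _) _; lra.
  have b2 : `|B (gr n i) w - y| <= 8 by apply: le_trans (ler_normB _ _) _; lra.
  have := window_lipschitz n b1 b2.
  have -> : B (gr n j.+1) w - y - (B (gr n i) w - y) = - (B (gr n i) w - B (gr n j.+1) w).
    by rewrite opprB addrA subrK opprB.
  rewrite normrN => lip.
  have lg : L1 * `|B (gr n i) w - B (gr n j.+1) w| <= L1 * g by exact: ler_wpM2l.
  have w1 : win n (B (gr n j.+1) w - y) <= win n (B (gr n i) w - y) + L1 * g.
    rewrite -lerBlDl; apply: le_trans (ler_norm _) _; exact: le_trans lip lg.
  have /andP[wi0 _] := winK n (B (gr n i) w - y).
  apply: (@le_trans _ _ ((win n (B (gr n i) w - y) + L1 * g) * future_occupation n j w y)).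
    exact: ler_wpM2r.
  rewrite mulrDl; apply: lerD; last by apply: ler_wpM2l => //; exact: mulr_ge0.
  by rewrite mulrC; apply: ler_wpM2r.
rewrite lerD2r; apply: (running_max_ge (fun o => avg mu (weighted A (occ n l w)
  (fun w y => Rk delta (gr n 1) (N n) (B (k%:R * h + o%:R * gr n 1) w - y))) w)).
exact: ltnW.
Qed.

Local Open Scope ereal_scope.
Local Notation hlaw := (hit_law pbmB M cA h0).

(** The number [34] is twice the 17 block lengths of [L n]; the factor [h ^+ 2] that accompanies its
    square cancels the denominator of [total_blocks]. *)
Definition stage2_constant : R :=
  4 * ((8 * 600 + 1) * (1 + ln h^-1)) * (8 * 600 * (1 + 5) * 34 ^+ 2).

Let C2 := stage2_constant.

Let log1 : (0 <= ln h^-1)%R.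
Proof. by rewrite ln_ge0// invr_ge1// unitfE gt_eqF. Qed.

Let C20 : (0 < C2)%R.
Proof.
rewrite /C2 /stage2_constant; apply: mulr_gt0.
  by have := log1 => l0; apply: mulr_gt0; [lra|apply: mulr_gt0; lra].
by apply: mulr_gt0; [lra|apply: exprn_gt0; lra].
Qed.

Lemma total_bmax (mu : probability (R * R)%type R) n :
  \sum_(l < M) \sum_(k < M | (k.+1 < l)%N)
     \int[P]_w (\1_(Alive B (l%:R * h)) w * bmax mu n l k w ^+ 2)%:E <=
  C2%:E * overlap A delta (gr n 1) mu (L n).
Proof.
have nN : (2 ^ n + N n <= L n)%N by rewrite addnC.
apply: le_trans (total_blocks pbmB mu d0 (g1 n) h0 h1 mA A9 (nh n) nN M) _.
apply: lee_wpmul2r.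
  apply: intr_ge0 => u; apply: mulr_ge0; last exact: sqr_ge0.
  exact: pair_indicator_ge0.
have -> : ((L n)%:R * gr n 1 = 17 * h)%R.
  by rewrite natrD natrM mulrDl -mulrA nh; ring.
rewrite lee_fin /C2 /stage2_constant le_eqVlt; apply/orP; left; apply/eqP.
move: ((8 * 600 + 1) * (1 + ln h^-1))%R (8 * 600 * (1 + 5) : R)%R => p q.
by field; rewrite gt_eqF.
Qed.

(** Doubling the smoothing is a shift by [2 ^ (n - c)] steps, and lengthening the window by at most
    two blocks out of sixteen costs less than 2. The conclusion uses
    [(q + 2) ^+ 2 <= 2 * q ^+ 2 + 8]. *)
Lemma overlap_le (mu : probability (R * R)%type R) n (x : R) : (c <= n)%N ->
  \int[mu]_z \int[mu]_y (restricted A (fun z => win n z ^+ 2)%R (z, y))%:E = x%:E ->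
  overlap A delta (gr n 1) mu (L n) <= (2 * x + 8)%:E.
Proof.
move=> cn xE.
have R2 z : (Rk (2 * delta) (gr n 1) (L n) z <= win n z + 2)%R.
  have -> : (2 * delta = delta + (2 ^ (n - c))%:R * gr n 1)%R.
    rewrite grid1 dE natrX -(subnKC cn) addKn exprD; field.
    by rewrite !expf_neq0 ?pnatr_eq0.
  apply: le_trans (Rk_shift (L n) (2 ^ (n - c)) z d0 (g1 n)) _.
  rewrite -addnA; have N0 : (0 < N n)%N by rewrite muln_gt0 expn_gt0.
  apply: le_trans (Rk_extend (2 ^ n + 2 ^ (n - c)) z d0 (g1 n) N0) _.
  rewrite lerD2l ler_pdivrMr ?ltr0n// -natrM ler_nat.
  have : (2 ^ (n - c) <= 2 ^ n)%N by rewrite leq_exp2l// leq_subr.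
  by lia.
have W0 z : (0 <= win n z ^+ 2)%R by exact: sqr_ge0.
have WK z : (0 <= win n z ^+ 2 <= K1 ^+ 2)%R.
  have /andP[a b] := winK n z; rewrite W0/= ler_sqr ?nnegrE//.
have mW : measurable_fun setT (fun z => win n z ^+ 2)%R.
  by apply: measurable_funX; exact: measurable_window.
have mr := measurable_restricted cA mW.
have r0 := restricted_ge0 A W0.
have mp := measurable_pair_indicator mA.
have mR2 : measurable_fun setT (fun u : (R * R) * (R * R) => Rk (2 * delta) (gr n 1) (L n) (u.1 - u.2)%R).
  exact: measurable_pair_Rk.
apply: (@le_trans _ _ (\int[mu \x mu]_u (2 * restricted A (fun z => win n z ^+ 2) u + 8)%R%:E)).
  apply: intr_le.
  - by apply: measurable_funM => //; exact: measurable_funX.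
  - by apply: measurable_funD => //; exact: measurable_funM.
  - by move=> u; apply: mulr_ge0; [exact: pair_indicator_ge0|exact: sqr_ge0].
  move=> u; rewrite /pair_indicator /restricted.
  have i1 : ((0 : R) <= \1_A u.1)%R && ((\1_A u.1 : R) <= 1)%R by rewrite indicE; case: (_ \in _); rewrite ?lexx ?ler01.
  have i2 : ((0 : R) <= \1_A u.2)%R && ((\1_A u.2 : R) <= 1)%R by rewrite indicE; case: (_ \in _); rewrite ?lexx ?ler01.
  have r2 := R2 (u.1 - u.2)%R; have /andP[w0 _] := winK n (u.1 - u.2)%R.
  have q0 : (0 <= Rk (2 * delta) (gr n 1) (L n) (u.1 - u.2))%R.
    by apply: Rk_ge0; [apply: mulr_gt0|exact: ltW].
  move: r2 w0 q0; move: (Rk _ _ _ _) (win n _) => p q pq qp p0.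
  have s1 : (p ^+ 2 <= 2 * q ^+ 2 + 8)%R.
    apply: (@le_trans _ _ ((q + 2) ^+ 2)%R); first by rewrite ler_sqr ?nnegrE; lra.
    by have := sqr_ge0 (q - 2)%R; rewrite !expr2; lra.
  case/andP: i1; case/andP: i2; move: (\1_A u.1) (\1_A u.2) => i j j0 j1 i0 i1.
  apply: (@le_trans _ _ (j * (2 * q ^+ 2 + 8))%R).
    apply: ler_pM => //; [exact: mulr_ge0|exact: sqr_ge0|by rewrite ler_piMl].
  have q2 := sqr_ge0 q; rewrite mulrDr mulrCA; apply: lerD => //.
  by rewrite ler_piMl.
have mr2 : measurable_fun setT (fun u => 2 * restricted A (fun z => win n z ^+ 2) u)%R.
  exact: measurable_funM.
have m8 : measurable_fun setT (cst 8%R : (R * R) * (R * R) -> R) by exact: measurable_cst.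
have r20 u : (0 <= 2 * restricted A (fun z => win n z ^+ 2) u)%R by apply: mulr_ge0 => //; exact: r0.
pose M2 : probability ((R * R) * (R * R))%type R := (mu \x mu).
rewrite -(intrD M2 mr2 m8 r20)//.
have i8 : \int[M2]_w ((cst 8%R : (R * R) * (R * R) -> R) w)%:E = 8%:E.
  exact: (integral_prob_cst M2 8%:E).
rewrite i8 -(intrZ M2 (ler0n R 2) mr r0) [leRHS]EFinD.
apply: leeD => //; rewrite [leRHS]EFinM; apply: lee_wpmul2l; first by rewrite lee_fin.
rewrite -xE le_eqVlt; apply/orP; left; apply/eqP.
rewrite (fubini_tonelli1 (m1 := mu) (m2 := mu) (fun u => (restricted A (fun z => win n z ^+ 2) u)%R%:E))//.
exact/measurable_EFinP.
Qed.

(** Let [x] be the squared energy and [p] the hitting probability. Young's inequality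
    [V <= a / 2 + V ^+ 2 / (2 * a)] on the hitting event, with [total_bmax] and [overlap_le], bounds
    [p * x] by constants plus a quarter of itself. Smoothing makes [x] finite, so this quarter can
    be absorbed. *)
Lemma energy_window2 : 0 < P (Hit B A h M) ->
  exists2 n, (c <= n)%N & P (Hit B A h M) * \int[hlaw]_x \int[hlaw]_y
    (restricted A (fun z => win n z ^+ 2)%R (x, y))%:E <= (4 * C2 + 4)%:E.
Proof.
(* Small enough for the error [L1 * g * K1] of [past_future_block] to be at most 1. *)
move=> p0; pose e : R := (Num.min 1 (K1 * L1 + 1)^-1)%R.
have KL0 : (0 <= K1 * L1)%R by exact: mulr_ge0.
have e0 : (0 < e)%R by rewrite lt_min ltr01 invr_gt0; lra.
have W0 n z : (0 <= win n z ^+ 2)%R by exact: sqr_ge0.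
have WK n z : (0 <= win n z ^+ 2 <= K1 ^+ 2)%R.
  have /andP[a b] := winK n z; rewrite W0/= ler_sqr ?nnegrE//.
have mW n : measurable_fun setT (fun z => win n z ^+ 2)%R.
  by apply: measurable_funX; exact: measurable_window.
have WL n x y : (`|x| <= 8 -> `|y| <= 8 -> `|win n x ^+ 2 - win n y ^+ 2| <= 2 * K1 * L1 * `|x - y|)%R.
  move=> x8 y8; rewrite subr_sqr mulrC normrM -mulrA.
  have /andP[a b] := winK n x; have /andP[a' b'] := winK n y.
  apply: ler_pM => //; last exact: window_lipschitz.
  by rewrite ger0_norm ?addr_ge0//; lra.
have L0 : (0 <= 2 * K1 * L1)%R by rewrite -mulrA mulr_ge0.
have [g [n0 [g0 ge H]]] := hit_average (W := fun n z => (win n z ^+ 2)%R) pbmB cA h0 A9 p0 mW WK L0 WL e0.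
pose n := (n0 + c)%N; have {}H := H n (leq_addr _ _).
have cn : (c <= n)%N by exact: leq_addl.
exists n => //; set mu := hlaw.
have mr := measurable_restricted cA (mW n).
have r0 := restricted_ge0 A (W0 n).
have rK := restricted_le A (WK n).
pose x := fine (\int[mu]_x \int[mu]_y (restricted A (fun z => win n z ^+ 2)%R (x, y))%:E).
have xE : \int[mu]_x \int[mu]_y (restricted A (fun z => win n z ^+ 2)%R (x, y))%:E = x%:E.
  rewrite /x fineK// ge0_fin_numE; last first.
    by apply: integral_ge0 => z _; exact: intr_ge0.
  apply: (@le_lt_trans _ _ (K1 ^+ 2)%:E); last exact: ltry.
  rewrite (eq_integral (fun z => (avg mu (restricted A (fun z => win n z ^+ 2)%R) z)%:E)); last first.
    by move=> z _; rewrite (avgE mu mr r0 rK).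
  apply: integral_le_cst => //.
  - exact: (measurable_avg mu mr r0).
  - by move=> z; exact: (avg_ge0 mu mr r0 rK).
  - by move=> z; exact: (avg_le mu mr r0 rK).
have mHit := measurable_Hit pbmB M cA h0.
pose p := fine (P (Hit B A h M)).
have pE : P (Hit B A h M) = p%:E by rewrite /p fineK// fin_num_measure.
have pp : (0 < p)%R by rewrite -lte_fin -pE.
have p1 : (p <= 1)%R by rewrite -lee_fin -pE; exact: probability_le1.
(* The parameter in Young's inequality that puts the coefficient [1 / 4] on [p * x] at the right. *)
pose a : R := (4 * C2 / p)%R.
have a0 : (0 < a)%R by apply: divr_gt0 => //; apply: mulr_gt0.
have mi (S : set T) : measurable S -> measurable_fun setT (\1_S : T -> R).
  by move=> mS; exact: measurable_indic.
have mMk j := measurable_Mark pbmB cA h0 g n j.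
have mpf j := measurable_past_future n j.
have pf0 j := past_future_ge0 n j.
have pfK j := past_future_le n j.
have mav j : measurable_fun setT (avg mu (past_future n j)) by exact: (measurable_avg mu (mpf j) (pf0 j)).
have av0 j w : (0 <= avg mu (past_future n j) w)%R by exact: (avg_ge0 mu (mpf j) (pf0 j) (pfK j)).
(* One factor of the squared window is adapted to the time of the mark and stays; the Markov
   property turns the other into the occupation that follows. *)
have step j : \int[mu]_y \int[P]_w (\1_(Mark B A h g n j) w *
      restricted A (fun z => win n z ^+ 2) (B (gr n j.+1) w, y))%:E =
    \int[P]_w (\1_(Mark B A h g n j) w * avg mu (past_future n j) w)%:E.
  rewrite (weighted_average P mu (mpf j) (pf0 j) (pfK j) (mi _ (mMk j))); last first.
    by move=> w; rewrite indicE.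
  apply: eq_integral => y _.
  pose F w : R := (\1_(Mark B A h g n j) w * (\1_A y * win n (B (gr n j.+1) w - y)))%R.
  have mF : measurable_fun setT (F : g_sigma_algebraType (past B (gr n j.+1)) -> R).
    apply: measurable_funM; first by apply: adapted_indic; exact: (adapted_Mark pbmB).
    apply: measurable_funM => //; apply: (measurableT_comp (measurable_window h 16 delta n)).
    apply: measurable_funB2; last exact: measurable_cst.
    by apply: adapted_B; rewrite grid_ge0//= lexx.
  have F0 w : (0 <= F w)%R.
    apply: mulr_ge0; first by rewrite indicE.
    apply: mulr_ge0; first by rewrite indicE.
    by case/andP: (winK n (B (gr n j.+1) w - y)%R).
  have := markov_window pbmB 16 h0 d0 y mF F0; rewrite /F => mk.
  transitivity (\int[P]_w (\1_(Mark B A h g n j) w * (\1_A y * win n (B (gr n j.+1) w - y)) *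
      win n (B (gr n j.+1) w - y))%R%:E).
    by apply: eq_integral => w _; congr EFin; rewrite /restricted /= expr2 !mulrA.
  rewrite mk; apply: eq_integral => w _; congr EFin.
  by rewrite /past_future /future_occupation /= !mulrA.
rewrite (eq_bigr _ (fun (j : 'I_(M * 2 ^ n)) _ => step j)) in H.
rewrite (intr_sum P _ (fun j : 'I_(M * 2 ^ n) => measurable_funM (mi _ (mMk j)) (mav j))) in H; last first.
  by move=> j w; rewrite mulr_ge0 ?indicE.
have bm0 l k w : (0 <= bmax mu n l k w)%R.
  apply: running_max_ge0 => o; apply: fine_ge0; apply: intr_ge0 => y.
  apply: mulr_ge0; last by apply: Rk_ge0 => //; exact: ltW.
  apply: mulr_ge0; first by rewrite indicE.
  by apply: sumr_ge0 => q _; apply: mulr_ge0 => //; exact: ltW.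
have mbm l k : measurable_fun setT (fun w => bmax mu n l k w).
  pose G o (z : T * (R * R)) := (\1_A z.2 * occ n l z.1 z.2 * win n (B (gr n (k * 2 ^ n + o)) z.1 - z.2))%R.
  have mG o : measurable_fun setT (G o).
    apply: measurable_funM => //; apply: measurable_funM => //.
    apply: measurable_sum => q; apply: measurable_funM => //.
    apply: measurable_gk2; rewrite -gr_block; exact: mB.
  have G0 o z : (0 <= G o z)%R.
    apply: mulr_ge0; last by case/andP: (winK n (B (gr n (k * 2 ^ n + o)) z.1 - z.2)%R).
    apply: mulr_ge0; first by rewrite indicE.
    by apply: sumr_ge0 => q _; apply: mulr_ge0 => //; exact: ltW.
  have := @measurable_running_max _ _ R (fun o w => avg mu (G o) w) (fun o => measurable_avg mu (mG o) (G0 o)) (2 ^ n)%N.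
  apply: eq_measurable_fun => w _; apply: running_max_eq => o _.
  by rewrite /G gr_block.
pose Sq w : R := (\sum_(l < M) \sum_(k < M | (k.+1 < l)%N) \1_(Alive B (l%:R * h)) w * bmax mu n l k w ^+ 2)%R.
have t0 (l k : nat) w : (0 <= \1_(Alive B (l%:R * h)) w * bmax mu n l k w ^+ 2)%R.
  by apply: mulr_ge0; [rewrite indicE|exact: sqr_ge0].
have mt (l k : nat) : measurable_fun setT (fun w => \1_(Alive B (l%:R * h)) w * bmax mu n l k w ^+ 2)%R.
  apply: measurable_funM; last exact: measurable_funX.
  by apply: mi; apply: (measurable_Alive pbmB); rewrite mulr_ge0// ltW.
have Sq0 w : (0 <= Sq w)%R by apply: sumr_ge0 => l _; apply: sumr_ge0 => k _; exact: t0.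
have mSq : measurable_fun setT Sq.
  by apply: measurable_sum => l; apply: measurable_sum_cond => k.
have ISq : \int[P]_w (Sq w)%:E <= (C2 * (2 * x + 8))%:E.
  apply: (@le_trans _ _ (C2%:E * overlap A delta (gr n 1) mu (L n))); last first.
    by rewrite [leRHS]EFinM; apply: lee_wpmul2l; [rewrite lee_fin ltW|exact: overlap_le].
  apply: le_trans (total_bmax mu n).
  rewrite -(intr_sum P (index_enum 'I_M) (F := fun (l : 'I_M) w => (\sum_(k < M | (k.+1 < l)%N) \1_(Alive B (l%:R * h)) w * bmax mu n l k w ^+ 2)%R)).
  - apply: lee_sum => l _; rewrite le_eqVlt; apply/orP; left; apply/eqP.
    rewrite [RHS]big_mkcond -[RHS]/(\sum_(k < M) _) /=.
    rewrite (eq_bigr (fun k : 'I_M => \int[P]_w (if (k.+1 < l)%N then \1_(Alive B (l%:R * h)) w * bmax mu n l k w ^+ 2 else 0)%R%:E)); last first.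
      by move=> k _; case: ifP => // _; rewrite integral0.
    rewrite (intr_sum P (index_enum 'I_M) (F := fun (k : 'I_M) w => if (k.+1 < l)%N then (\1_(Alive B (l%:R * h)) w * bmax mu n l k w ^+ 2)%R else 0%R)).
    + by apply: eq_integral => w _; rewrite big_mkcond.
    + by move=> k; case: (k.+1 < l)%N => //; exact: measurable_cst.
    + by move=> k w; case: (k.+1 < l)%N.
  - by move=> l; apply: measurable_sum_cond => k.
  - by move=> l w; apply: sumr_ge0 => k _.
pose e2 : R := (L1 * g * K1)%R.
have e20 : (0 <= e2)%R by apply: mulr_ge0 => //; apply: mulr_ge0 => //; exact: ltW.
have e21 : (e2 <= 1)%R.
  rewrite /e2 mulrAC (mulrC L1); apply: (@le_trans _ _ (K1 * L1 * (K1 * L1 + 1)^-1)%R).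
    by apply: ler_wpM2l => //; apply: le_trans ge _; rewrite /e ge_min lexx orbT.
  by rewrite ler_pdivrMr; lra.
have key : \int[P]_w (\sum_(j < M * 2 ^ n) \1_(Mark B A h g n j) w * avg mu (past_future n j) w)%R%:E
    <= (a / 2 * p + e2 + (2 * a)^-1 * (C2 * (2 * x + 8)))%:E.
  have a2 : (0 <= a / 2)%R by apply: divr_ge0 => //; exact: ltW.
  have ai : (0 <= (2 * a)^-1)%R by rewrite invr_ge0 mulr_ge0// ltW.
  have mHi := mi _ mHit.
  apply: (@le_trans _ _ (\int[P]_w (a / 2 * \1_(Hit B A h M) w + e2 + (2 * a)^-1 * Sq w)%R%:E)).
    apply: intr_le.
    - by apply: measurable_sum => j; apply: measurable_funM => //; exact: mi.
    - apply: measurable_funD; last exact: measurable_funM.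
      by apply: measurable_funD => //; exact: measurable_funM.
    - by move=> w; apply: sumr_ge0 => j _; rewrite mulr_ge0 ?indicE.
    move=> w; apply: (sum_indic_le (@Mark_uniq _ _ _ B A h h0 g n) (F := fun j => avg mu (past_future n j) w)).
      apply: addr_ge0; last exact: mulr_ge0.
      by apply: addr_ge0 => //; apply: mulr_ge0 => //; rewrite indicE.
    move=> j jM Mj.
    have [l [k [lM kl al]]] := past_future_block mu jM (ltW g0) Mj.
    rewrite -/e2 => bb; rewrite [\1_(Hit _ _ _ _) w]indicE mem_set; last exact: (Mark_Hit jM Mj).
    have kM : (k < M)%N by exact: ltn_trans (ltnW kl) lM.
    have V2 : (bmax mu n l k w ^+ 2 <= Sq w)%R.
      apply: (@le_trans _ _ (\sum_(k < M | (k.+1 < l)%N) \1_(Alive B (l%:R * h)) w * bmax mu n l k w ^+ 2)%R).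
        have E1 : (bmax mu n l k w ^+ 2 = \1_(Alive B (l%:R * h)) w * bmax mu n l k w ^+ 2)%R.
          by rewrite indicE mem_set// mul1r.
        rewrite [leLHS]E1.
        exact: (@sum_ge_term _ _ (fun k : 'I_M => (k.+1 < l)%N) (fun k => \1_(Alive B (l%:R * h)) w * bmax mu n l k w ^+ 2)%R (Ordinal kM) (fun k => t0 l k w) kl).
      apply: (@sum_ge_term _ _ xpredT (fun l : 'I_M => \sum_(k < M | (k.+1 < l)%N) \1_(Alive B (l%:R * h)) w * bmax mu n l k w ^+ 2)%R (Ordinal lM) _ isT).
      by move=> i; apply: sumr_ge0 => k' _; exact: t0.
    have V0 := bm0 l k w.
    move: V2 bb V0; move: (bmax mu n l k w) (Sq w) (avg _ _ _) => V S X V2 bb V0.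
    have yng : (V <= a / 2 + (2 * a)^-1 * V ^+ 2)%R.
      rewrite -subr_ge0 (_ : _ - _ = (2 * a)^-1 * (V - a) ^+ 2)%R; last by field; rewrite gt_eqF.
      by apply: mulr_ge0 => //; exact: sqr_ge0.
    move: yng (ler_wpM2l ai V2); rewrite /= mulr1; move: (2 * a)^-1%R => b; lra.
  have mk1 : measurable_fun setT (fun w => a / 2 * \1_(Hit B A h M) w)%R by exact: measurable_funM.
  have k10 w : (0 <= a / 2 * \1_(Hit B A h M) w)%R by apply: mulr_ge0 => //; rewrite indicE.
  have mk2 : measurable_fun setT (fun w => a / 2 * \1_(Hit B A h M) w + e2)%R.
    by apply: measurable_funD => //; exact: measurable_cst.
  have k20 w : (0 <= a / 2 * \1_(Hit B A h M) w + e2)%R by exact: addr_ge0.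
  have mk3 : measurable_fun setT (fun w => (2 * a)^-1 * Sq w)%R by exact: measurable_funM.
  have k30 w : (0 <= (2 * a)^-1 * Sq w)%R by exact: mulr_ge0.
  rewrite -(intrD P mk2 mk3 k20 k30) -(intrD P mk1 (measurable_cst e2) k10 (fun=> e20)).
  rewrite -(intrZ P a2 mHi (fun w => _ : 0 <= \1_(Hit B A h M) w)%R); last by move=> w; rewrite indicE.
  have ic : \int[P]_w ((cst e2 : T -> R) w)%:E = e2%:E by exact: (integral_prob_cst P e2%:E).
  have iH : \int[P]_w (\1_(Hit B A h M) w)%:E = p%:E by rewrite -pE; exact: integral_indicT.
  rewrite -(intrZ P ai mSq Sq0) ic iH.
  rewrite [leRHS]EFinD [X in _ <= X + _]EFinD [X in _ <= X + _ + _]EFinM.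
  apply: leeD => //; rewrite [leRHS]EFinM.
  by apply: lee_wpmul2l; first by rewrite lee_fin.
have := le_trans H (leeD key (lexx e%:E)).
rewrite xE pE -EFinM -EFinD !lee_fin => fin.
have e1 : (e <= 1)%R by rewrite /e ge_min lexx.
have aE : (a / 2 * p = 2 * C2)%R by rewrite /a; field; rewrite gt_eqF.
have aE' : ((2 * a)^-1 * (C2 * (2 * x + 8)) = p * x / 4 + p)%R.
  by rewrite /a; field; rewrite !gt_eqF.
by move: fin; rewrite aE aE'; have := C20; lra.
Qed.

End second_stage.

(** * Comparison of the gauge with the occupation kernels *)

Section log_sums.
Context {R : realType}.
Implicit Types (a eta delta : R).

Lemma ln_le_sub1 (x : R) : 0 < x -> ln x <= x - 1.
Proof. by move=> x0; have := expR_ge1Dx (ln x); rewrite lnK ?posrE//; lra. Qed.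

Lemma ln_step_le (a eta : R) : 0 < a -> 0 <= eta -> ln (a + eta) - ln a <= eta / a.
Proof.
move=> a0 e0; rewrite -ln_div ?posrE//; last by lra.
apply: le_trans (ln_le_sub1 _) _; first by apply: divr_gt0 => //; lra.
by rewrite le_eqVlt; apply/orP; left; apply/eqP; field; rewrite gt_eqF.
Qed.

Lemma ln_step_ge (a eta : R) : 0 < a -> 0 <= eta -> eta / (a + eta) <= ln (a + eta) - ln a.
Proof.
move=> a0 e0; have ae : 0 < a + eta by lra.
have := ln_le_sub1 (divr_gt0 a0 ae); rewrite ln_div ?posrE//.
have -> : a / (a + eta) - 1 = - (eta / (a + eta)) by field; rewrite gt_eqF.
by move: (eta / (a + eta)) => x; lra.
Qed.

Lemma log_sum_lower a eta (G : nat) : 0 < a -> 0 <= eta ->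
  ln (a + G%:R * eta) - ln a <= \sum_(q < G) eta / (a + q%:R * eta).
Proof.
move=> a0 e0; elim: G => [|G IH]; first by rewrite mul0r addr0 subrr big_ord0.
rewrite big_ord_recr/=.
have g0 : 0 < a + G%:R * eta by rewrite ltr_wpDr// mulr_ge0.
have := ln_step_le g0 e0.
have -> : a + G.+1%:R * eta = a + G%:R * eta + eta by rewrite -natr1; ring.
by move: IH; move: (eta / (a + G%:R * eta)) => x; lra.
Qed.

Lemma log_sum_upper a eta (G : nat) : 0 <= eta -> eta <= a -> 0 < a ->
  \sum_(q < G) eta / (a + q%:R * eta) <= 1 + (ln (a + G%:R * eta) - ln a).
Proof.
move=> e0 ea a0.
have up : \sum_(q < G.+1) eta / (a + q%:R * eta) <= 1 + (ln (a + G%:R * eta) - ln a).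
  elim: G => [|G IH].
    by rewrite big_ord1 !mul0r !addr0 subrr addr0 ler_pdivrMr// mul1r.
  rewrite big_ord_recr/=.
  have g0 : 0 < a + G%:R * eta by rewrite ltr_wpDr// mulr_ge0.
  have := ln_step_ge g0 e0.
  have -> : a + G.+1%:R * eta = a + G%:R * eta + eta by rewrite -natr1; ring.
  by move: IH; move: (eta / _) => x; lra.
apply: le_trans up; rewrite big_ord_recr/= lerDl.
by apply: divr_ge0 => //; rewrite addr_ge0 ?mulr_ge0// ltW.
Qed.

(** In this range the exponential is at least [1 / 2], and [2 * pi <= 8]. *)
Lemma gk_lower (t : R) z : 0 < t -> nsq z <= t -> 16^-1 / t <= gk t z.
Proof.
move=> t0 zt; rewrite gk_expR invfM mulrAC; apply: ler_wpM2r; first by rewrite invr_ge0 ltW.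
have p2 := @pi_ge2 R; have /andP[_ p4] := @pihalf_02 R.
have e12 : 2^-1 <= expR (- nsq z / (2 * t)).
  apply: le_trans (expR_ge1Dx _).
  have : nsq z / (2 * t) <= 2^-1.
    by rewrite ler_pdivrMr ?mulr_gt0// mulrA mulVf ?mul1r// pnatr_eq0.
  by rewrite mulNr; lra.
have -> : 16^-1 = 8^-1 * 2^-1 :> R by field.
apply: ler_pM => //; rewrite ?invr_ge0//.
rewrite lef_pV2 ?posrE ?mulr_gt0//; lra.
Qed.

(** Only times above [nsq z] are kept: there [gk_lower] applies and the sum of [eta / t] is a
    logarithm. The factor 3 pays for the smoothing and for the rounding of the first such time. *)
Lemma Rk_lower delta eta (N : nat) (z : R * R) : 0 < eta -> eta <= delta -> (0 < N)%N ->
  16^-1 * ln (N%:R * eta / (3 * Num.max (nsq z) delta)) <= Rk delta eta N z.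
Proof.
move=> e0 ed N0; have d0 : 0 < delta by lra.
set s := Num.max _ _; have sd : delta <= s by rewrite le_max lexx orbT.
have sz : nsq z <= s by rewrite le_max lexx.
have s0 : 0 < s by lra.
pose q0 := (Num.truncn (nsq z / eta)).+1.
have z0 := nsq_ge0 z.
have /andP[t1 t2] : (Num.truncn (nsq z / eta))%:R <= nsq z / eta < q0%:R.
  by rewrite truncn_le ?divr_ge0 ?(ltW e0)//= truncnS_gt.
have q1 : nsq z <= q0%:R * eta by rewrite -ler_pdivrMr// ltW.
have q2 : q0%:R * eta <= nsq z + eta.
  by rewrite /q0 -natr1 mulrDl mul1r lerD2r -ler_pdivlMr.
have Ne : 0 < N%:R * eta by rewrite mulr_gt0// ltr0n.
have [Nq|qN] := leqP N q0.
  apply: (@le_trans _ _ 0); last by apply: Rk_ge0 => //; exact: ltW.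
  rewrite mulr_ge0_le0 ?invr_ge0// ln_le0// ler_pdivrMr ?mulr_gt0// mul1r.
  have : N%:R * eta <= q0%:R * eta by rewrite ler_pM2r// ler_nat.
  by lra.
have -> : N = (q0 + (N - q0))%N by rewrite subnKC// ltnW.
set G := (N - q0)%N; rewrite /Rk big_split_ord/= -[leLHS]add0r; apply: lerD.
  apply: sumr_ge0 => q _; apply: mulr_ge0; first exact: ltW.
  by apply: gk_ge0; rewrite addr_ge0 ?mulr_ge0// ltW.
pose a := delta + q0%:R * eta.
have a0 : 0 < a by rewrite /a; lra.
apply: (@le_trans _ _ (16^-1 * \sum_(q < G) eta / (a + q%:R * eta))).
  apply: ler_wpM2l; first by rewrite invr_ge0.
  apply: le_trans (log_sum_lower G a0 (ltW e0)).
  have aG : 0 < a + G%:R * eta by rewrite ltr_wpDr// mulr_ge0// ltW.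
  rewrite -ln_div ?posrE// ler_ln ?posrE; last 2 first.
  - by rewrite natrD mulrDl; apply: divr_gt0; [rewrite -mulrDl -natrD /G subnKC// ltnW|apply: mulr_gt0].
  - exact: divr_gt0.
  rewrite ler_pdivrMr ?mulr_gt0// mulrAC ler_pdivlMr// natrD mulrDl.
  have as3 : a <= 3 * s by rewrite /a; lra.
  apply: ler_pM => //.
  - by rewrite addr_ge0// mulr_ge0// ltW.
  - exact: ltW.
  - by rewrite /a; lra.
rewrite mulr_sumr; apply: ler_sum => q _.
have tq : 0 < delta + (q0 + q)%:R * eta by rewrite ltr_wpDr// mulr_ge0// ltW.
have ztq : nsq z <= delta + (q0 + q)%:R * eta.
  have : 0 <= q%:R * eta by rewrite mulr_ge0// ltW.
  by rewrite natrD mulrDl; lra.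
rewrite mulrCA; apply: ler_wpM2l; first exact: ltW.
by have := gk_lower tq ztq; rewrite /a natrD mulrDl addrA.
Qed.

End log_sums.

Section gauge.
Context {R : realType}.
Implicit Types (eps : R) (z : R * R).

Lemma eucl_norm_eq0 z : (eucl_norm z == 0) = (nsq z == 0).
Proof. by rewrite eucl_normE sqrtr_eq0 le_eqVlt ltNge nsq_ge0 orbF. Qed.

Lemma ln_nsq z : 0 < nsq z -> ln (nsq z) = 2 * ln (eucl_norm z).
Proof.
move=> z0; rewrite -eucl_norm_sqr lnXn ?mulr_natl//.
by rewrite eucl_normE sqrtr_gt0.
Qed.

Lemma f_gauge_ge eps : 0 < eps -> eps < 1 / 3 -> 2 / 3 <= f_gauge eps /\ f_gauge eps = - ln eps.
Proof.
move=> e0 e3; have h := ln_le_sub1 e0; have ln0 : ln eps < 0 by lra.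
by rewrite /f_gauge ltr0_norm//; split => //; lra.
Qed.

Lemma h_gauge_ge0 eps x : 0 <= h_gauge eps x.
Proof.
rewrite /h_gauge; case: ifP => _; first exact: normr_ge0.
apply: mulr_ge0; first exact: sqr_ge0.
by apply: divr_ge0; [exact: normr_ge0|exact: sqr_ge0].
Qed.

Lemma gauge_kernel_ge0 eps x : (0 <= gauge_kernel (h_gauge eps) x)%E.
Proof. by rewrite /gauge_kernel; case: ifP => _ //; rewrite lee_fin h_gauge_ge0. Qed.

Lemma measurable_gauge_kernel eps :
  measurable_fun setT (fun z : R * R => gauge_kernel (h_gauge eps) (eucl_norm z)).
Proof.
have mn : measurable_fun setT (fun z : R * R => eucl_norm z).
  apply: (eq_measurable_fun (Num.sqrt \o nsq)); first by move=> z _; rewrite /= eucl_normE.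
  apply: continuous_measurable2 => z.
  by apply: continuous_comp; [exact: continuous_nsq|exact: sqrt_continuous].
suff mg : measurable_fun setT (gauge_kernel (h_gauge eps)).
  exact: (measurableT_comp mg mn).
rewrite /gauge_kernel; apply: measurable_fun_ifT.
- exact: measurable_fun_eqr.
- exact: measurable_cst.
apply/measurable_EFinP; rewrite /h_gauge; apply: measurable_fun_ifT.
- exact: measurable_fun_ler.
- by apply: (measurableT_comp (@normr_measurable R setT)); exact: measurable_ln.
- apply: measurable_funM => //; apply: measurable_funX; exact: measurable_ln.
Qed.

Definition log_kernel (delta : R) z : R := - ln (Num.max (nsq z) delta).

Definition log_excess eps (delta : R) z : R :=
  Num.max 0 (ln (eps ^+ 2) - ln (Num.max (nsq z) delta)).

(** A majorant of the gauge built from the two quantities whose energies are under control, a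
    logarithm and a squared logarithm below scale [eps]; truncation at [delta] keeps it finite. *)
Definition capacity_kernel eps delta z : R :=
  log_kernel delta z + log_excess eps delta z ^+ 2 / (2 * f_gauge eps).

(** Below [eps], with [t] and [f] the logarithms of the distance and of [eps], the claim reduces to
    [0 <= (t - f) ^+ 2 + f ^+ 2]; above [eps] the logarithmic part suffices. *)
Lemma gauge_le_kernel eps delta z : 0 < eps -> eps < 1 / 3 -> 0 < nsq z -> nsq z <= 1 ->
  delta <= nsq z -> h_gauge eps (eucl_norm z) <= capacity_kernel eps delta z.
Proof.
move=> e0 e3 z0 z1 dz; have [f23 fE] := f_gauge_ge e0 e3.
rewrite /capacity_kernel /log_kernel /log_excess (max_idPl dz) (ln_nsq z0).
have n0 : 0 < eucl_norm z by rewrite eucl_normE sqrtr_gt0.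
have n1 : eucl_norm z <= 1 by rewrite eucl_normE -sqrtr1 ler_sqrt.
have l0 : ln (eucl_norm z) <= 0 by rewrite ln_le0.
rewrite lnXn// (_ : ln eps *+ 2 = 2 * ln eps); last by rewrite mulr_natl.
have f0 : 0 < 2 * f_gauge eps by lra.
rewrite /h_gauge; case: (leP eps (eucl_norm z)) => [ed|de] /=.
  set Y := Num.max _ _.
  have : 0 <= Y ^+ 2 / (2 * f_gauge eps) by rewrite divr_ge0 ?sqr_ge0// ltW.
  move: (Y ^+ 2 / (2 * f_gauge eps)) => q q0.
  by rewrite /f_gauge ler0_norm//; lra.
have lt : ln (eucl_norm z) < ln eps by rewrite ltr_ln.
rewrite [Num.max _ _](max_idPr _); last by lra.
rewrite /g_gauge; move: f0 f23; rewrite fE; move: lt l0; move: (ln (eucl_norm z)) (ln eps) => t f lt l0 f0 f23.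
have fn : f < 0 by lra.
have -> : t ^+ 2 * (- f / f ^+ 2) = t ^+ 2 / (- f) by field; rewrite lt_eqF.
have -> : - (2 * t) + (2 * f - 2 * t) ^+ 2 / (2 * - f) = (2 * t * f + 2 * (f - t) ^+ 2) / (- f).
  by field; rewrite lt_eqF.
rewrite ler_pM2r ?invr_gt0; last by lra.
have := sqr_ge0 (t - f); have := sqr_ge0 f; rewrite !expr2; lra.
Qed.

End gauge.

Lemma max0_sqr_le (R : realType) (a b : R) : a <= b -> Num.max 0 a ^+ 2 <= Num.max 0 b ^+ 2.
Proof.
move=> ab; have h : Num.max 0 a <= Num.max 0 b.
  by rewrite ge_max !le_max lexx /= ab orbT.
have n1 x : 0 <= Num.max 0 x :> R by rewrite le_max lexx.
by rewrite ler_sqr ?nnegrE.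
Qed.

(** * Energy of the hitting law *)

Section hit_energy.
Context d (T : measurableType d) (R : realType) (P : probability T R).
Context (B : R -> T -> R * R) (pbmB : planar_brownian_motion P (1, 0) B).
Context (A : set (R * R)) (eps h : R) (M : nat).
Hypotheses (cA : closed A) (h0 : 0 < h) (hE : 4 * h = eps ^+ 2).
Hypotheses (eps0 : 0 < eps) (eps3 : eps < 1 / 3).
Hypothesis A9 : forall y, A y -> nsq y <= 9^-1.
Hypothesis pN0 : P (Hit B A h M) != 0%E.
Local Notation mu := (hit_law pbmB M cA h0).
Local Notation m2 := (mu \x mu)%E.
Local Notation del c := (h / 2 ^+ c).
Local Open Scope ereal_scope.

Let h1 : (h <= 1)%R.
Proof.
have e1 : (eps <= 1)%R by have := eps3; lra.
have : (eps ^+ 2 <= 1)%R by rewrite expr_le1// ltW.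
by have := hE; have := h0; lra.
Qed.

Let mA : measurable A. Proof. exact: closed_measurable2. Qed.

Let del0 c : (0 < del c)%R. Proof. by rewrite divr_gt0// exprn_gt0. Qed.

Let delS c c' : (c <= c')%N -> (del c' <= del c)%R.
Proof.
move=> cc; apply: ler_wpM2l; first exact: ltW.
by rewrite lef_pV2 ?posrE ?exprn_gt0// ler_eXn2l// ltr1n.
Qed.

Let del1 c : (del c <= 1)%R.
Proof. by apply: le_trans (delS (leq0n c)) _; rewrite expr0 divr1; exact: h1. Qed.

Let A1 x y : A x -> A y -> (nsq (x - y) <= 1)%R.
Proof.
move=> Ax Ay; have := A9 Ax; have := A9 Ay.
have : (nsq (x - y) <= 2 * nsq x + 2 * nsq y)%R.
  rewrite -subr_ge0 (_ : _ - _ = (x.1 + y.1) ^+ 2 + (x.2 + y.2) ^+ 2)%R.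
    by rewrite addr_ge0 ?sqr_ge0.
  by rewrite /nsq /=; ring.
by lra.
Qed.

Local Notation pind := (pair_indicator A).

Let pind1 u : A u.1 -> A u.2 -> pind u = 1%R.
Proof. by move=> a b; rewrite /pair_indicator !indicE !mem_set// mulr1. Qed.

Let pind0 u : ~ (A u.1 /\ A u.2) -> pind u = 0%R.
Proof.
move=> nA; rewrite /pair_indicator !indicE; case: (boolP (u.1 \in A)) => [|_]; last by rewrite mul0r.
case: (boolP (u.2 \in A)) => [|_]; last by rewrite mulr0.
by rewrite !inE => ? ?; case: nA.
Qed.

Let mlog c : measurable_fun setT (fun u : (R * R) * (R * R) => ln (Num.max (nsq (u.1 - u.2)) (del c)))%R.
Proof.
apply: (measurableT_comp (@measurable_ln R)); apply: measurable_maxr => //.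
apply: (measurableT_comp measurable_nsq).
by apply: measurable_funB2; [exact: measurable_fst|exact: measurable_snd].
Qed.

Let mlk c : measurable_fun setT (fun u : (R * R) * (R * R) => pind u * log_kernel (del c) (u.1 - u.2))%R.
Proof.
apply: measurable_funM; first exact: (measurable_pair_indicator mA).
by apply: measurable_funN.
Qed.

Let mle c : measurable_fun setT (fun u : (R * R) * (R * R) => pind u * log_excess eps (del c) (u.1 - u.2) ^+ 2)%R.
Proof.
apply: measurable_funM; first exact: (measurable_pair_indicator mA).
apply: measurable_funX; apply: measurable_maxr => //.
by apply: measurable_funB.
Qed.

Let lk0 c u : (0 <= pind u * log_kernel (del c) (u.1 - u.2))%R.
Proof.
have [[a b]|n] := pselect (A u.1 /\ A u.2); last by rewrite (pind0 n) mul0r.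
rewrite pind1// mul1r oppr_ge0 ln_le0// ge_max del1 andbT; exact: A1.
Qed.

Let le0 c u : (0 <= pind u * log_excess eps (del c) (u.1 - u.2) ^+ 2)%R.
Proof. by apply: mulr_ge0; [exact: pair_indicator_ge0|exact: sqr_ge0]. Qed.

Lemma restricted_pair (k : R) (W V : R * R -> R) : (0 <= k)%R ->
  measurable_fun setT W -> (forall z, (0 <= W z)%R) ->
  measurable_fun setT (fun u : (R * R) * (R * R) => pind u * V (u.1 - u.2))%R ->
  (forall u, (0 <= pind u * V (u.1 - u.2))%R) ->
  (forall x y, A x -> A y -> (V (x - y) <= k * W (x - y))%R) ->
  \int[m2]_u (pind u * V (u.1 - u.2))%R%:E <=
  k%:E * \int[mu]_x \int[mu]_y (restricted A W (x, y))%:E.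
Proof.
move=> k0 mW W0 mV V0 VW.
have mr := measurable_restricted cA mW; have r0 := restricted_ge0 A W0.
rewrite -(fubini_tonelli1 (m1 := mu) (m2 := mu) (fun u => (restricted A W u)%:E)); last 2 first.
- exact/measurable_EFinP.
- by move=> u; rewrite lee_fin; exact: r0.
pose M2 : probability ((R * R) * (R * R))%type R := (mu \x mu).
rewrite (intrZ M2 k0 mr r0); apply: intr_le => //.
  by apply: measurable_funM => //; exact: measurable_cst.
move=> u; have [[a b]|n] := pselect (A u.1 /\ A u.2); last first.
  by rewrite (pind0 n) mul0r mulr_ge0.
rewrite pind1// mul1r /restricted indicE mem_set// mul1r; exact: VW.
Qed.

(** [51] is ten times a window duration of at most 5, plus the error 1 allowed in
    [energy_window]. *)
Let Ka : R := (8 * 600 * (1 + 5) + 51)%R.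
(** The inner [8] bounds the ratio of [1 + ln h^-1] to [f_gauge eps], and [6 * f_gauge eps] is at
    least 4 because [f_gauge eps >= 2 / 3]. *)
Let Kb : R := (4 * (4 * ((8 * 600 + 1) * 8) * (8 * 600 * (1 + 5) * 34 ^+ 2)) + 6)%R.

Let p0 (_ : unit) : 0 < P (Hit B A h M).
Proof. by rewrite lt0e pN0/=. Qed.

Lemma log_energy c : P (Hit B A h M) * \int[m2]_u (pind u * log_kernel (del c) (u.1 - u.2))%R%:E
  <= (16 * Ka)%:E.
Proof.
(* A window lasting between 4 and 5 units of time: more than 3, to absorb the factor 3 of
   [Rk_lower], yet bounded independently of [eps]. *)
pose N1 := (Num.truncn (4 / h)).+1.
have N1a : (4 <= N1%:R * h)%R by rewrite -ler_pdivrMr// ltW// truncnS_gt.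
have N1b : (N1%:R * h <= 5)%R.
  rewrite /N1 -natr1 mulrDl mul1r.
  have : ((Num.truncn (4 / h))%:R * h <= 4)%R.
    by rewrite -ler_pdivlMr// truncn_le// divr_ge0// ltW.
  by have := h1; lra.
have [n cn H] := energy_window pbmB N1 cA h0 h1 A9 (del0 c) c (p0 tt) ltr01.
pose W := window h N1 (del c) n.
have W0 z : (0 <= W z)%R by exact: window_ge0.
have ed : (grid h n 1 <= del c)%R by rewrite grid1; exact: delS.
have VW x y : A x -> A y -> (log_kernel (del c) (x - y) <= 16 * W (x - y))%R.
  move=> Ax Ay.
  have N0 : (0 < N1 * 2 ^ n)%N by rewrite muln_gt0 expn_gt0.
  have := Rk_lower (x - y)%R (grid1_gt0 h0 n) ed N0.
  rewrite window_length -/(window h N1 (del c) n (x - y)%R) -/W.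
  rewrite /log_kernel; set s := Num.max _ _.
  have s0 : (0 < s)%R by rewrite lt_max del0 orbT.
  have : (- ln s <= ln (N1%:R * h / (3 * s)))%R.
    rewrite -lnV ?posrE// ler_ln ?posrE ?invr_gt0//; last by apply: divr_gt0; [lra|apply: mulr_gt0].
    rewrite invfM mulrA ler_peMl ?invr_ge0 ?(ltW s0)// ler_pdivlMr//; lra.
  move: (ln (N1%:R * h / (3 * s))) (ln s) (W (x - y)%R) => q r v; lra.
have k16 : (0 <= 16 :> R)%R by [].
have R1 := restricted_pair k16 (measurable_window h N1 (del c) n) W0 (mlk c) (lk0 c) VW.
apply: (@le_trans _ _ (P (Hit B A h M) * (16%:E * \int[mu]_x \int[mu]_y (restricted A W (x, y))%:E))).
  by apply: lee_wpmul2l => //; exact: ltW (p0 tt).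
rewrite muleCA [leRHS]EFinM; apply: lee_wpmul2l => //.
apply: le_trans H _; rewrite lee_fin /Ka; lra.
Qed.

(** Sixteen blocks last [4 * eps ^+ 2], long enough for the logarithm in [Rk_lower] to dominate the
    excess. The bound is proportional to [f_gauge eps], which the denominator in [capacity_kernel]
    cancels. *)
Lemma excess_energy c : P (Hit B A h M) *
   \int[m2]_u (pind u * log_excess eps (del c) (u.1 - u.2) ^+ 2)%R%:E
  <= (256 * (Kb * f_gauge eps))%:E.
Proof.
have [f23 fE] := f_gauge_ge eps0 eps3.
have [n cn H] := energy_window2 pbmB cA h0 h1 A9 (erefl (del c)) (del0 c) (p0 tt).
pose W := window h 16 (del c) n.
have W0 z : (0 <= W z)%R by exact: window_ge0.
have W20 z : (0 <= W z ^+ 2)%R by exact: sqr_ge0.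
have ed : (grid h n 1 <= del c)%R by rewrite grid1; exact: delS.
have VW x y : A x -> A y -> (log_excess eps (del c) (x - y) ^+ 2 <= 256 * W (x - y) ^+ 2)%R.
  move=> Ax Ay.
  have N0 : (0 < 16 * 2 ^ n)%N by rewrite muln_gt0 expn_gt0.
  have := Rk_lower (x - y)%R (grid1_gt0 h0 n) ed N0.
  rewrite window_length -/(window h 16 (del c) n (x - y)%R) -/W.
  rewrite /log_excess; set s := Num.max (nsq _) _.
  have s0 : (0 < s)%R by rewrite lt_max del0 orbT.
  have e20 : (0 < eps ^+ 2)%R by exact: exprn_gt0.
  have : (ln (eps ^+ 2) - ln s <= ln (16%:R * h / (3 * s)))%R.
    rewrite -ln_div ?posrE// ler_ln ?posrE ?divr_gt0 ?mulr_gt0//.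
    have -> : (eps ^+ 2 / s = 4 * h / s)%R by rewrite hE.
    have -> : (16%:R * h / (3 * s) = (16 / 3) * (h / s))%R by field; rewrite gt_eqF.
    rewrite -mulrA; apply: ler_wpM2r; last by lra.
    by apply: divr_ge0; exact: ltW.
  have w0 := W0 (x - y)%R => l1 l2.
  have -> : (256 * W (x - y) ^+ 2 = (16 * W (x - y)) ^+ 2)%R by ring.
  rewrite ler_sqr ?nnegrE ?le_max ?lexx ?mulr_ge0// ge_max mulr_ge0//=.
  by move: l1 l2; move: (ln (16%:R * h / (3 * s))) => q; lra.
have k256 : (0 <= 256 :> R)%R by lra.
have mW2 : measurable_fun setT (fun z => W z ^+ 2)%R.
  by apply: measurable_funX; exact: measurable_window.
have R1 := restricted_pair k256 mW2 W20 (V := fun z => (log_excess eps (del c) z ^+ 2)%R) (mle c) (le0 c) VW.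
apply: (@le_trans _ _ (P (Hit B A h M) * (256%:E * \int[mu]_x \int[mu]_y (restricted A (fun z => W z ^+ 2)%R (x, y))%:E))).
  by apply: lee_wpmul2l; [exact: ltW (p0 tt)|exact: R1].
rewrite muleCA [leRHS]EFinM; apply: lee_wpmul2l; first by rewrite lee_fin.
apply: le_trans H _; rewrite lee_fin /stage2_constant /Kb.
have hv : (h^-1 = 4 / eps ^+ 2)%R by rewrite -hE; field; rewrite gt_eqF.
have Lam : (1 + ln h^-1 <= 8 * f_gauge eps)%R.
  rewrite hv ln_div ?posrE ?exprn_gt0// lnXn// fE.
  have : (ln (4 : R) <= 4 - 1)%R by exact: ln_le_sub1.
  have -> : (ln eps *+ 2 = 2 * ln eps)%R by rewrite mulr_natl.
  by move: f23; rewrite fE; lra.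
have q0 : (0 <= 8 * 600 * (1 + 5) * 34 ^+ 2 :> R)%R.
  by apply: mulr_ge0; [lra|exact: sqr_ge0].
have q1 : (0 <= 4 * (8 * 600 + 1) :> R)%R by lra.
move: q0 q1 Lam; move: (8 * 600 * (1 + 5) * 34 ^+ 2 : R)%R (8 * 600 + 1 : R)%R => q r q0 q1 Lam.
have s1 : (4 * (r * (1 + ln h^-1)) * q <= 4 * (r * (8 * f_gauge eps)) * q)%R.
  by rewrite ![(4 * (r * _))%R]mulrA; apply: ler_wpM2r => //; apply: ler_wpM2l.
have -> : ((4 * (4 * (r * 8) * q) + 6) * f_gauge eps = 4 * (4 * (r * (8 * f_gauge eps)) * q) + 6 * f_gauge eps)%R by ring.
by lra.
Qed.

Definition upper_constant : R := (16 * Ka + 128 * Kb)%R.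

Local Notation Hk c u := (pind u * capacity_kernel eps (del c) (u.1 - u.2))%R.

Let HkE c u : (Hk c u = pind u * log_kernel (del c) (u.1 - u.2) +
  (2 * f_gauge eps)^-1 * (pind u * log_excess eps (del c) (u.1 - u.2) ^+ 2))%R.
Proof. by rewrite /capacity_kernel mulrDr; congr (_ + _)%R; rewrite mulrA mulrC. Qed.

Let fi0 : (0 <= (2 * f_gauge eps)^-1)%R.
Proof. by have [f23 _] := f_gauge_ge eps0 eps3; rewrite invr_ge0; lra. Qed.

Let mHk c : measurable_fun setT (fun u => Hk c u).
Proof.
apply: (eq_measurable_fun (fun u => pind u * log_kernel (del c) (u.1 - u.2) +
  (2 * f_gauge eps)^-1 * (pind u * log_excess eps (del c) (u.1 - u.2) ^+ 2))%R).
  by move=> u _; rewrite HkE.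
by apply: measurable_funD; [exact: mlk|apply: measurable_funM => //; exact: mle].
Qed.

Let Hk0 c u : (0 <= Hk c u)%R.
Proof. by rewrite HkE; apply: addr_ge0; [exact: lk0|apply: mulr_ge0 => //; exact: le0]. Qed.

Lemma kernel_energy c : P (Hit B A h M) * \int[m2]_u (Hk c u)%:E <= upper_constant%:E.
Proof.
have [f23 fE] := f_gauge_ge eps0 eps3.
pose M2 : probability ((R * R) * (R * R))%type R := (mu \x mu).
have -> : \int[m2]_u (Hk c u)%:E = \int[m2]_u (pind u * log_kernel (del c) (u.1 - u.2))%R%:E +
    (2 * f_gauge eps)^-1%:E * \int[m2]_u (pind u * log_excess eps (del c) (u.1 - u.2) ^+ 2)%R%:E.
  rewrite (intrZ M2 fi0 (mle c) (le0 c)) (intrD M2 (mlk c) _ (lk0 c) _).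
  - by apply: eq_integral => u _; rewrite HkE.
  - by apply: measurable_funM => //; exact: mle.
  - by move=> u; apply: mulr_ge0 => //; exact: le0.
rewrite ge0_muleDr; last 2 first.
- by apply: intr_ge0 => u; exact: lk0.
- by apply: mule_ge0; [rewrite lee_fin|apply: intr_ge0 => u; exact: le0].
rewrite /upper_constant EFinD; apply: leeD; first exact: log_energy.
rewrite muleCA; apply: (@le_trans _ _ ((2 * f_gauge eps)^-1%:E * (256 * (Kb * f_gauge eps))%:E)).
  by apply: lee_wpmul2l; [rewrite lee_fin|exact: excess_energy].
rewrite -EFinM lee_fin; move: (Kb) => K; rewrite le_eqVlt; apply/orP; left; apply/eqP.
by field; apply: lt0r_neq0; lra.
Qed.

Let Hknd u : {homo (fun c => (Hk c u)%:E) : c c' / (c <= c')%N >-> c <= c'}.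
Proof.
move=> c c' cc; rewrite lee_fin; apply: ler_wpM2l; first exact: pair_indicator_ge0.
have ss : (ln (Num.max (nsq (u.1 - u.2)) (del c')) <= ln (Num.max (nsq (u.1 - u.2)) (del c)))%R.
  rewrite ler_ln ?posrE ?lt_max ?del0 ?orbT// ge_max le_max lexx/= le_max.
  by rewrite (delS cc) orbT.
rewrite /capacity_kernel /log_kernel /log_excess; apply: lerD; first by rewrite lerN2.
apply: ler_wpM2r => //.
apply: max0_sqr_le; exact: lerB.
Qed.

(** As the truncation vanishes, the kernels increase to a majorant of the gauge on pairs of points
    of [A], which carry the full mass; monotone convergence passes the uniform bound [kernel_energy]
    to the limit. *)
Lemma hit_energy : P (Hit B A h M) * energy (h_gauge eps) mu <= upper_constant%:E.
Proof.
pose M2 : probability ((R * R) * (R * R))%type R := (mu \x mu).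
pose g u := gauge_kernel (h_gauge eps) (eucl_norm (u.1 - u.2)%R).
have mg : measurable_fun setT (fun u : (R * R) * (R * R) => g u).
  apply: (measurableT_comp (measurable_gauge_kernel eps)).
  by apply: measurable_funB2; [exact: measurable_fst|exact: measurable_snd].
have g0 u : 0 <= g u by exact: gauge_kernel_ge0.
have -> : energy (h_gauge eps) mu = \int[M2]_u g u.
  by rewrite /energy (fubini_tonelli1 (m1 := mu) (m2 := mu) g).
have cvg_H u : cvgn (fun c => (Hk c u)%:E) by apply: ereal_nondecreasing_is_cvgn; exact: Hknd.
have limE u : limn (fun c => (Hk c u)%:E) = ereal_sup (range (fun c => (Hk c u)%:E)).
  by apply/cvg_lim => //; apply: ereal_nondecreasing_cvgn; exact: Hknd.
have mlim : measurable_fun setT (fun u => limn (fun c => (Hk c u)%:E)).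
  apply: emeasurable_fun_cvg (fun c => _) _ => [c|u _]; last exact: cvg_H.
  by apply/measurable_EFinP; exact: mHk.
have leH u c : (Hk c u)%:E <= limn (fun c => (Hk c u)%:E).
  by rewrite limE; apply: ereal_sup_ubound; exists c.
have gl u : A u.1 -> A u.2 -> g u <= limn (fun c => (Hk c u)%:E).
  move=> a b; rewrite /g /gauge_kernel eucl_norm_eq0.
  set z := (u.1 - u.2)%R; have z0 := nsq_ge0 z.
  (* On the diagonal the gauge is infinite, and [-ln] of the truncation level exceeds any given
     [r]. *)
  case: eqP => [zE|/eqP zN].
    rewrite leye_eq; apply/eqP; apply: eq_infty => r.
    have [n1 H] := grid1_small h (expR_gt0 (- r)).
    apply: le_trans (leH u n1); rewrite lee_fin pind1// mul1r /capacity_kernel.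
    have -> : log_kernel (del n1) z = (- ln (del n1))%R by rewrite /log_kernel zE (max_idPr _)// ltW.
    have : (ln (del n1) <= - r)%R.
      rewrite -[leRHS]expRK ler_ln ?posrE ?expR_gt0// -grid1 ltW//; exact: H.
    have : (0 <= log_excess eps (del n1) z ^+ 2 / (2 * f_gauge eps))%R.
      by apply: mulr_ge0; [exact: sqr_ge0|exact: fi0].
    by move: (_ / _)%R => q; lra.
  have zp : (0 < nsq z)%R by rewrite lt_neqAle eq_sym zN.
  have [c cz] : exists c, (del c <= nsq z)%R.
    have [n1 H] := grid1_small h zp; exists n1.
    by have := H n1 (leqnn _); rewrite grid1 => /ltW.
  apply: le_trans (leH u c); rewrite lee_fin pind1// mul1r.
  by apply: gauge_le_kernel => //; exact: A1.
have AA : M2 (A `*` A) = 1.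
  have muA : mu A = 1 by exact: (hit_lawA pbmB cA h0 (p0 tt)).
  by rewrite -[RHS](mule1 1) -[in RHS]muA; exact: (product_measure1E mu mu mA mA).
have mAA : measurable (A `*` A) by exact: measurableX.
apply: (@le_trans _ _ (P (Hit B A h M) * \int[M2]_u limn (fun c => (Hk c u)%:E))).
  apply: lee_wpmul2l; first exact: ltW (p0 tt).
  apply: ae_ge0_le_integral => //.
  - by move=> u _; apply: le_trans (leH u 0%N); rewrite lee_fin.
  - exists (~` (A `*` A)); split; first exact: measurableC.
      by have := probability_setC M2 mAA; rewrite AA subee// => ->.
    by move=> u /= nu [a b]; apply: nu => _; exact: gl.
rewrite monotone_convergence//; last 2 first.
- by move=> c; apply/measurable_EFinP; exact: mHk.
- by move=> c u _; rewrite lee_fin.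
have nd : {homo (fun c => \int[M2]_u (Hk c u)%:E) : c c' / (c <= c')%N >-> c <= c'}.
  move=> c c' cc; apply: intr_le => // u; by rewrite -lee_fin; exact: Hknd.
have pf : P (Hit B A h M) \is a fin_num by apply: fin_num_measure; exact: (measurable_Hit pbmB M cA h0).
pose p := fine (P (Hit B A h M)).
have pE : P (Hit B A h M) = p%:E by rewrite /p fineK.
have pp : (0 < p)%R by rewrite -lte_fin -pE p0.
have KE : upper_constant%:E = p%:E * (upper_constant / p)%:E.
  by rewrite -EFinM mulrCA mulfV ?mulr1// gt_eqF.
rewrite pE KE; apply: lee_wpmul2l; first by rewrite lee_fin ltW.
apply: lime_le; first exact: ereal_nondecreasing_is_cvgn.
apply: nearW => c; have := kernel_energy c; rewrite pE KE.
by rewrite lee_pmul2l// lte_fin.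
Qed.

End hit_energy.

(** * From the energy of the hitting law to the capacity bound *)

Section double_event.
Context d (T : measurableType d) (R : realType) (P : probability T R).
Context (B : R -> T -> R * R) (pbmB : planar_brownian_motion P (1, 0) B).
Context (A : set (R * R)) (eps h : R).
Hypotheses (cA : closed A) (h0 : 0 < h) (hE : 4 * h = eps ^+ 2).
Hypotheses (eps0 : 0 < eps) (eps3 : eps < 1 / 3).
Hypothesis A9 : forall y, A y -> nsq y <= 9^-1.

Definition double_event := [set w | separated_double_points (B ^~ w) eps `&` A !=set0].

Let cb w : {within `[0, +oo[, continuous (fun t => B t w)}.
Proof. exact: (pbm_continuous pbmB). Qed.

Let start9 : nsq ((1, 0) : R * R) < 9.
Proof. by rewrite /nsq /=; lra. Qed.

(** The start has [nsq] equal to 1 and is therefore not in [A], so the first of the two visits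
    happens at a positive time. *)
Lemma double_in_separated w t : 0 <= t -> alive (B ^~ w) t ->
  double_in (B ^~ w) A (eps ^+ 2) t -> double_event w.
Proof.
move=> t0 al [r [s [r0 rs st bE As]]]; exists (B s w); split => //.
have e2 : 0 < eps ^+ 2 by apply: exprn_gt0; have := eps0.
have rp : 0 < r.
  rewrite lt_neqAle r0 andbT; apply/eqP => r00.
  have := A9 As; rewrite -bE -r00 (pbm_start pbmB) /nsq /=; lra.
have s0 : 0 <= s by lra.
exists r, s; split => //; first by lra.
by apply/(alive_hitting_time (@cb w) (pbm_start pbmB w) start9 s0); exact: alive_le st al.
Qed.

(** A double pair completed before the exit is still present at a slightly later grid time at which
    the path survives; conversely survival at that grid time gives survival at the second visit. *)
Lemma double_eventE : double_event = \bigcup_M Hit B A h M.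
Proof.
apply/seteqP; split => w.
  move=> [x [[r [s [r0 _ rs sh [br bs]]]] Ax]].
  have e2 : 0 < eps ^+ 2 by apply: exprn_gt0; have := eps0.
  have s0 : 0 <= s by lra.
  have al := (alive_hitting_time (@cb w) (pbm_start pbmB w) start9 s0).1 sh.
  have [t' st' al'] := alive_open (@cb w) s0 al.
  have t's : 0 < t' - s by lra.
  have [n0 H] := grid1_small h t's.
  have [j /andP[sj jt]] := grid_near h0 n0 s0.
  (* The horizon index may be the grid index itself, because [j <= j * 2 ^ n0]. *)
  exists j => //; exists n0, j; split.
  - by rewrite leq_pmulr// expn_gt0.
  - by apply: alive_le al'; have := H n0 (leqnn _); lra.
  - apply: double_in_le sj _; have := hE => ->.
    by exists r, s; split => //; [lra|rewrite br bs|rewrite bs].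
move=> [M _ [n [j [_ al db]]]]; have := hE => e; rewrite e in db.
by apply: (double_in_separated _ al db); exact: grid_ge0.
Qed.

Lemma measurable_double_event : measurable double_event.
Proof. by rewrite double_eventE; apply: bigcup_measurable => M _; exact: (measurable_Hit pbmB M cA h0). Qed.

Lemma Hit_mono M M' : (M <= M')%N -> Hit B A h M `<=` Hit B A h M'.
Proof.
move=> MM w [n [j [jM al db]]]; exists n, j; split => //.
by apply: leq_trans jM _; rewrite leq_mul2r MM orbT.
Qed.

Local Open Scope ereal_scope.

Lemma gauge_kernel_h_ge0 z : 0 <= gauge_kernel (h_gauge eps) (eucl_norm z).
Proof. by apply: gauge_kernel_ge0. Qed.

Lemma energy_h_ge0 (mu : probability (R * R)%type R) : 0 <= energy (h_gauge eps) mu.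
Proof.
apply: integral_ge0 => x _; apply: integral_ge0 => y _; exact: gauge_kernel_h_ge0.
Qed.

Let I := ereal_inf [set energy (h_gauge eps) mu |
     mu in [set mu : probability (R * R)%type R | mu A = 1]].

Lemma energy_inf_ge0 : 0 <= I.
Proof. by apply: le_ereal_inf_tmp => _ [mu _ <-]; exact: energy_h_ge0. Qed.

Let K := (upper_constant R : R).

Lemma upper_constant_gt0 : (0 < K)%R.
Proof. rewrite /K /upper_constant /=; lra. Qed.

(** The hitting law competes in the infimum that defines the capacity. A vanishing infimum means
    infinite capacity, and an infinite one contradicts a positive hitting probability. *)
Lemma Hit_capacity M : P (Hit B A h M) <= K%:E * capacity (h_gauge eps) A.
Proof.
have K0 := upper_constant_gt0.
have [->|pN0] := eqVneq (P (Hit B A h M)) 0.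
  by apply: mule_ge0; [rewrite lee_fin ltW|rewrite /capacity inve_ge0 energy_inf_ge0].
have p0 : 0 < P (Hit B A h M) by rewrite lt_def pN0/=.
have en : P (Hit B A h M) * I <= K%:E.
  apply: le_trans (hit_energy pbmB cA h0 hE eps0 eps3 A9 pN0).
  apply: lee_wpmul2l => //; apply: ereal_inf_lbound.
  by exists (hit_law pbmB M cA h0) => //; exact: hit_lawA.
have pf : P (Hit B A h M) \is a fin_num by apply: fin_num_measure; exact: (measurable_Hit pbmB M cA h0).
rewrite /capacity -/I; have := energy_inf_ge0; rewrite -/I.
move: en; case: I => [i| |//].
- move=> en i0; rewrite inver; case: eqP => [_|/eqP iN].
    by rewrite gt0_muley ?lte_fin// leey.
  have ip : (0 < i)%R by rewrite lt_def iN.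
  by rewrite -EFinM -lee_pdivlMr// in en *.
- by rewrite gt0_muley.
Qed.

Lemma double_event_capacity : P double_event <= K%:E * capacity (h_gauge eps) A.
Proof.
have mH M := measurable_Hit pbmB M cA h0.
have mE : measurable (\bigcup_M Hit B A h M) by rewrite -double_eventE; exact: measurable_double_event.
have cv : (P \o Hit B A h) M @[M --> \oo] --> P (\bigcup_M Hit B A h M).
  by apply: nondecreasing_cvg_mu => // M M' MM; apply/subsetPset; exact: Hit_mono.
rewrite double_eventE -(cvg_lim _ cv)//; apply: lime_le.
  by apply/cvg_ex; eexists; exact: cv.
by apply: nearW => M /=; exact: Hit_capacity.
Qed.

End double_event.

(** * Lower bound: the second moment method *)

Lemma eq_ler (R : realType) (x y : R) : x = y -> x <= y. Proof. by move=> ->. Qed.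

Section chain_sums.
Context {R : realType}.
Implicit Types F : nat -> R.

(** The indicator encodes the order of the times, so that sums can run over all indices without
    constraints. *)
Definition step F (i j : nat) : R := (i <= j)%N%:R * F (j - i)%N.

Lemma step_ge0 F i j : (forall g, 0 <= F g) -> 0 <= step F i j.
Proof. by move=> F0; apply: mulr_ge0. Qed.

Lemma step_sum F M i : (forall g, 0 <= F g) ->
  \sum_(j < M) step F i j <= \sum_(g < M) F g.
Proof.
move=> F0; apply: le_trans (sum_shift_le i M F0).
rewrite [leRHS]big_mkcond; apply: ler_sum => j _; rewrite /step.
by case: leqP; rewrite ?mul1r ?mul0r.
Qed.

Lemma chain_sum F1 F2 F3 M : (forall g, 0 <= F1 g) -> (forall g, 0 <= F2 g) ->
  (forall g, 0 <= F3 g) ->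
  \sum_(i < M) \sum_(j < M) \sum_(k < M) \sum_(l < M)
    step F1 i j * (step F2 j k * step F3 k l) <=
  M%:R * ((\sum_(g < M) F1 g) * ((\sum_(g < M) F2 g) * (\sum_(g < M) F3 g))).
Proof.
move=> p1 p2 p3.
have s0 F : (forall g, 0 <= F g) -> 0 <= \sum_(g < M) F g by move=> p; apply: sumr_ge0.
apply: (@le_trans _ _ (\sum_(i < M) ((\sum_(g < M) F1 g) * ((\sum_(g < M) F2 g) * (\sum_(g < M) F3 g))))).
  apply: ler_sum => i _.
  apply: (@le_trans _ _ (\sum_(j < M) step F1 i j * ((\sum_(g < M) F2 g) * (\sum_(g < M) F3 g)))).
    apply: ler_sum => j _; under eq_bigr do rewrite -mulr_sumr.
    rewrite -mulr_sumr; apply: ler_wpM2l; first exact: step_ge0.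
    apply: (@le_trans _ _ (\sum_(k < M) step F2 j k * (\sum_(g < M) F3 g))).
      apply: ler_sum => k _; rewrite -mulr_sumr; apply: ler_wpM2l; first exact: step_ge0.
      exact: step_sum.
    by rewrite -mulr_suml; apply: ler_wpM2r; [exact: s0|exact: step_sum].
  by rewrite -mulr_suml; apply: ler_wpM2r; [apply: mulr_ge0; exact: s0|exact: step_sum].
by rewrite sumr_const card_ord mulr_natl.
Qed.

End chain_sums.

Section lattice_kernels.
Context {R : realType} (eta : R) (L' : nat).
Hypothesis e0 : 0 < eta.
Implicit Types (z : R * R).

(** Up to a constant the bound [1 / (t + nsq z)] for the heat kernel, at [t = eta + g%:R * eta]. *)
Definition kap z (g : nat) : R := (eta + g%:R * eta + nsq z)^-1.

(** Bound for a transition over a long gap, uniform in the displacement. In the application [L']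
    steps are half of the required separation. *)
Definition lam (g : nat) : R := (L' <= g)%N%:R * kap 0 g.

Lemma kap_den z g : 0 < eta + g%:R * eta + nsq z.
Proof.
have := nsq_ge0 z; have : 0 <= g%:R * eta by apply: mulr_ge0 => //; exact: ltW.
have := e0; lra.
Qed.

Lemma kap_ge0 z g : 0 <= kap z g.
Proof. by rewrite invr_ge0 ltW// kap_den. Qed.

Lemma lam_ge0 g : 0 <= lam g.
Proof. by apply: mulr_ge0 => //; exact: kap_ge0. Qed.

Lemma kapN z g : kap (- z) g = kap z g. Proof. by rewrite /kap nsqN. Qed.

Lemma nsq00 : nsq (0 : R * R) = 0.
Proof. by rewrite /nsq /= expr0n/= addr0. Qed.

Lemma kap_lam z g : (L' <= g)%N -> kap z g <= lam g.
Proof.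
move=> Lg; rewrite /lam Lg mul1r /kap lef_pV2 ?posrE ?kap_den// nsq00 addr0.
by rewrite lerDl nsq_ge0.
Qed.

(** Either the middle gap is long or both outer gaps are. Summed over all times, the two terms
    produce the two products of kernel sums in [chain_total]. *)
Definition chain z (p0 p1 p2 p3 : nat) : R :=
  step (kap z) p0 p1 * (step lam p1 p2 * step (kap z) p2 p3) +
  step lam p0 p1 * (step (kap z) p1 p2 * step lam p2 p3).

Let sk z i j : 0 <= step (kap z) i j.
Proof. by apply: step_ge0 => g; exact: kap_ge0. Qed.

Let sl i j : 0 <= step lam i j. Proof. by apply: step_ge0 => g; exact: lam_ge0. Qed.

Let klk0 z p0 p1 p2 p3 : 0 <= step (kap z) p0 p1 * (step lam p1 p2 * step (kap z) p2 p3).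
Proof. exact: mulr_ge0 (sk z p0 p1) (mulr_ge0 (sl p1 p2) (sk z p2 p3)). Qed.

Let lkl0 z p0 p1 p2 p3 : 0 <= step lam p0 p1 * (step (kap z) p1 p2 * step lam p2 p3).
Proof. exact: mulr_ge0 (sl p0 p1) (mulr_ge0 (sk z p1 p2) (sl p2 p3)). Qed.

Lemma chain_ge0 z p0 p1 p2 p3 : 0 <= chain z p0 p1 p2 p3.
Proof. exact: addr_ge0 (klk0 z p0 p1 p2 p3) (lkl0 z p0 p1 p2 p3). Qed.

Let stepE F (i j : nat) : (i <= j)%N -> step F i j = F (j - i)%N :> R.
Proof. by rewrite /step => ->; rewrite mul1r. Qed.

Lemma chain_klk z (u : R * R) p0 p1 p2 p3 : (p0 <= p1)%N -> (p1 + L' <= p2)%N -> (p2 <= p3)%N ->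
  kap z (p1 - p0) * (kap u (p2 - p1) * kap z (p3 - p2)) <= chain z p0 p1 p2 p3.
Proof.
move=> l1 l2 l3; apply: (@le_trans _ _ (step (kap z) p0 p1 * (step lam p1 p2 * step (kap z) p2 p3))).
  rewrite !stepE//; last by lia.
  apply: ler_wpM2l; first exact: kap_ge0.
  apply: ler_wpM2r; first exact: kap_ge0.
  by apply: kap_lam; lia.
by rewrite /chain lerDl; exact: lkl0.
Qed.

Lemma chain_lkl z (u u' : R * R) p0 p1 p2 p3 : (p0 + L' <= p1)%N -> (p1 <= p2)%N -> (p2 + L' <= p3)%N ->
  kap u (p1 - p0) * (kap z (p2 - p1) * kap u' (p3 - p2)) <= chain z p0 p1 p2 p3.
Proof.
move=> l1 l2 l3; apply: (@le_trans _ _ (step lam p0 p1 * (step (kap z) p1 p2 * step lam p2 p3))).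
  rewrite !stepE//; [|by lia..].
  apply: ler_pM; [exact: kap_ge0|apply: mulr_ge0; exact: kap_ge0|apply: kap_lam; lia|].
  apply: ler_wpM2l; first exact: kap_ge0.
  by apply: kap_lam; lia.
by rewrite /chain lerDr; exact: klk0.
Qed.

(** The alternating order, in which each separation covers two consecutive gaps. If the middle gap
    is shorter than [L'], then both outer gaps are longer than [L']. *)
Lemma chain_kkk z p0 p1 p2 p3 : (p0 <= p1)%N -> (p1 <= p2)%N -> (p2 <= p3)%N ->
  (p0 + 2 * L' <= p2)%N -> (p1 + 2 * L' <= p3)%N ->
  kap z (p1 - p0) * (kap z (p2 - p1) * kap z (p3 - p2)) <= chain z p0 p1 p2 p3.
Proof.
move=> l1 l2 l3 l4 l5; case: (leqP (p1 + L') p2) => l6; first exact: chain_klk.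
by apply: chain_lkl => //; lia.
Qed.

Context (M : nat).

Lemma chain_total z :
  \sum_(i < M) \sum_(j < M) \sum_(k < M) \sum_(l < M) chain z i j k l <=
  M%:R * ((\sum_(g < M) kap z g) ^+ 2 * (\sum_(g < M) lam g) +
          (\sum_(g < M) kap z g) * (\sum_(g < M) lam g) ^+ 2).
Proof.
have k0 g : 0 <= kap z g by exact: kap_ge0.
have H1 := chain_sum M k0 lam_ge0 k0.
have H2 := chain_sum M lam_ge0 k0 lam_ge0.
have -> : \sum_(i < M) \sum_(j < M) \sum_(k < M) \sum_(l < M) chain z i j k l =
  \sum_(i < M) \sum_(j < M) \sum_(k < M) \sum_(l < M) step (kap z) i j * (step lam j k * step (kap z) k l) +
  \sum_(i < M) \sum_(j < M) \sum_(k < M) \sum_(l < M) step lam i j * (step (kap z) j k * step lam k l).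
  rewrite -big_split; apply: eq_bigr => i _; rewrite -big_split; apply: eq_bigr => j _.
  by rewrite -big_split; apply: eq_bigr => k _; rewrite -big_split.
apply: le_trans (lerD H1 H2) _; rewrite -mulrDr; apply: ler_wpM2l => //.
move: (\sum_(g < M) kap z g) (\sum_(g < M) lam g) => a b; rewrite !expr2.
by apply: eq_ler; ring.
Qed.

Hypothesis Me : M%:R * eta <= 1 / 2.

Lemma kap_sum z : 0 < nsq z -> nsq z <= 4 / 9 -> eta <= 1 / 2 ->
  \sum_(g < M) eta * kap z g <= 10 * f_gauge (eucl_norm z).
Proof.
move=> z0 z9 e2; have ep := e0; have Mp := Me.
have a0 : 0 < eta + nsq z by lra.
have -> : \sum_(g < M) eta * kap z g = \sum_(q < M) eta / ((eta + nsq z) + q%:R * eta).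
  by apply: eq_bigr => g _; rewrite /kap addrAC.
have ea : eta <= eta + nsq z by lra.
apply: le_trans (log_sum_upper M (ltW e0) ea a0) _.
have l1 : ln (eta + nsq z + M%:R * eta) <= 1.
  apply: le_trans (ln_le_sub1 _) _; last by lra.
  by have : 0 <= M%:R * eta by [apply: mulr_ge0 => //; exact: ltW]; lra.
have l2 : ln (nsq z) <= ln (eta + nsq z) by rewrite ler_ln ?posrE//; lra.
have l3 := ln_le_sub1 z0.
have := ln_nsq z0; rewrite /f_gauge => l4.
have : - ln (eucl_norm z) <= `|ln (eucl_norm z)| by rewrite -normrN ler_norm.
move: l1 l2 l3 l4; move: (ln (_ + _)) (ln (nsq z)) (ln (eucl_norm z)) (ln (eta + nsq z)) => p q r s.
move: (`|r|) => v; lra.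
Qed.

(** The cut-off starts the logarithmic sum at time [eps ^+ 2 / 2]; the additive constants are
    absorbed since [f_gauge eps >= 2 / 3]. *)
Lemma lam_sum eps : (0 < L')%N -> 2 * L'%:R * eta = eps ^+ 2 -> 0 < eps -> eps < 1 / 3 ->
  \sum_(g < M) eta * lam g <= 5 * f_gauge eps.
Proof.
move=> L0 LE ep e3; have e0' := e0; have Mp := Me.
have [f1 f2] := f_gauge_ge ep e3.
have a0 : 0 < L'%:R * eta by apply: mulr_gt0 => //; rewrite ltr0n.
have ea : eta <= L'%:R * eta by rewrite ler_peMl ?ler1n// ltW.
have F0 g : 0 <= eta / (L'%:R * eta + g%:R * eta).
  apply: divr_ge0; first exact: ltW.
  by apply: addr_ge0; [exact: ltW|apply: mulr_ge0 => //; exact: ltW].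
apply: (@le_trans _ _ (\sum_(g < M) eta / (L'%:R * eta + g%:R * eta))).
  apply: le_trans (step_sum M L' F0); apply: ler_sum => g _; rewrite /step /lam.
  case: leqP => Lg; rewrite ?mul0r ?mulr0// !mul1r; apply: ler_wpM2l; first exact: ltW.
  rewrite /kap nsq00 addr0 natrB// mulrBl (_ : L'%:R * eta + (g%:R * eta - L'%:R * eta) = g%:R * eta); last by ring.
  have gp : 0 < g%:R * eta by apply: mulr_gt0 => //; rewrite ltr0n; lia.
  rewrite lef_pV2 ?posrE; [by rewrite lerDr ltW|exact: addr_gt0|exact: gp].
apply: le_trans (log_sum_upper M (ltW e0) ea a0) _.
have e22 : L'%:R * eta = eps ^+ 2 / 2 by rewrite -LE; field.
have ee : eps ^+ 2 <= 1 / 9.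
  by rewrite expr2; apply: (@le_trans _ _ (1 / 3 * (1 / 3))); [apply: ler_pM; lra|lra].
have l1 : ln (L'%:R * eta + M%:R * eta) <= 0.
  apply: ln_le0; rewrite e22; lra.
have l2 : ln (L'%:R * eta) = 2 * ln eps - ln 2.
  by rewrite e22 ln_div ?posrE ?exprn_gt0// lnXn//; ring.
have l3 : ln (2 : R) <= 1 by apply: le_trans (ln_le_sub1 _) _; lra.
rewrite l2 f2 in f1 *; move: l1 l3 f1; move: (ln (_ + _)) (ln (2 : R)) (ln eps) => p q r; lra.
Qed.

End lattice_kernels.

(** At distances above [eps] the second product prevails, below [eps] the first one. The gauge,
    multiplied by [f_gauge eps ^+ 2], is exactly the larger of the two corresponding products of
    [f_gauge] values. *)
Lemma gauge_upper (R : realType) (eps d K Lm : R) : 0 < eps -> eps < 1 / 3 -> 0 < d -> d <= 1 ->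
  0 <= K -> 0 <= Lm -> K <= 10 * f_gauge d -> Lm <= 5 * f_gauge eps ->
  K ^+ 2 * Lm + K * Lm ^+ 2 <= 750 * (f_gauge eps ^+ 2 * h_gauge eps d).
Proof.
move=> e0 e3 d0 d1 K0 L0 KK LL; have [f1 fE] := f_gauge_ge e0 e3.
have fd0 : 0 <= f_gauge d by exact: normr_ge0.
have gg (x : R) : g_gauge x = f_gauge x ^+ 2 by rewrite /g_gauge /f_gauge real_normK// num_real.
have step1 : K ^+ 2 * Lm + K * Lm ^+ 2 <=
   500 * (f_gauge d ^+ 2 * f_gauge eps) + 250 * (f_gauge d * f_gauge eps ^+ 2).
  have a1 : K ^+ 2 <= (10 * f_gauge d) ^+ 2 by rewrite lerXn2r ?nnegrE//; lra.
  have a2 : Lm ^+ 2 <= (5 * f_gauge eps) ^+ 2 by rewrite lerXn2r ?nnegrE//; lra.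
  have b1 : K ^+ 2 * Lm <= (10 * f_gauge d) ^+ 2 * (5 * f_gauge eps) by apply: ler_pM => //; exact: sqr_ge0.
  have b2 : K * Lm ^+ 2 <= (10 * f_gauge d) * (5 * f_gauge eps) ^+ 2 by apply: ler_pM => //; exact: sqr_ge0.
  apply: le_trans (lerD b1 b2) _; apply: eq_ler; ring.
apply: le_trans step1 _; rewrite /h_gauge; case: ifPn => [ed|].
  have le : f_gauge d <= f_gauge eps.
    rewrite fE /f_gauge ler0_norm ?ln_le0// lerN2 ler_ln ?posrE//.
  have : f_gauge d ^+ 2 * f_gauge eps <= f_gauge eps ^+ 2 * f_gauge d.
    rewrite (_ : _ * f_gauge eps = (f_gauge d * f_gauge eps) * f_gauge d); last by ring.
    by rewrite expr2; apply: ler_wpM2r => //; apply: ler_wpM2r => //; lra.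
  rewrite [f_gauge d * _]mulrC; move: (_ * f_gauge eps) (_ * f_gauge d) => p q; lra.
rewrite -ltNge => /ltW de; rewrite !gg.
have ge : f_gauge eps <= f_gauge d.
  rewrite fE /f_gauge ler0_norm ?ln_le0// lerN2 ler_ln ?posrE//.
have fp : f_gauge eps != 0 by apply: lt0r_neq0; lra.
have -> : f_gauge eps ^+ 2 * (f_gauge d ^+ 2 * (f_gauge eps / f_gauge eps ^+ 2)) =
  f_gauge d ^+ 2 * f_gauge eps by field.
have : f_gauge d * f_gauge eps ^+ 2 <= f_gauge d ^+ 2 * f_gauge eps.
  rewrite (_ : f_gauge d * _ = (f_gauge d * f_gauge eps) * f_gauge eps); last by ring.
  by rewrite expr2; apply: ler_wpM2r; [lra|apply: ler_wpM2l].
move: (f_gauge d * _) (_ * f_gauge eps) => p q; lra.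
Qed.

(** * Bumps and chains of four visits *)

Section bump.
Context {R : realType}.

(** Normalised to integral 1: the closed ball of the max norm is a square of side [2 * delta]. *)
Definition bump (delta : R) (y x : R * R) : R :=
  (4 * delta ^+ 2)^-1 * \1_[set z : R * R | `|z| <= delta] (x - y).

Lemma measurable_norm_le (delta : R) : measurable [set z : R * R | `|z| <= delta].
Proof.
have m2 : measurable_fun setT (fun z : R * R => `|z|).
  by apply: continuous_measurable2; exact: norm_continuous.
have := measurable_fun_le measurableT m2 (measurable_cst delta).
by rewrite setTI.
Qed.

Lemma measurable_bump2 d (T : measurableType d) delta (f g : T -> R * R) :
  measurable_fun setT f -> measurable_fun setT g ->
  measurable_fun setT (fun z => bump delta (f z) (g z)).
Proof.
move=> mf mg; apply: measurable_funM => //.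
apply: (measurableT_comp (f := \1_[set z : R * R | `|z| <= delta] : R * R -> R)).
  by apply: measurable_indic; exact: measurable_norm_le.
exact: measurable_funB2.
Qed.

Lemma bump_ge0 delta y x : 0 <= bump delta y x.
Proof. by rewrite mulr_ge0 ?indicE// invr_ge0 mulr_ge0// sqr_ge0. Qed.

Lemma bump_le delta y x : bump delta y x <= (4 * delta ^+ 2)^-1.
Proof.
have c0 : 0 <= (4 * delta ^+ 2)^-1 by rewrite invr_ge0 mulr_ge0// sqr_ge0.
by rewrite /bump indicE; case: (_ \in _); rewrite ?mulr1// mulr0.
Qed.

Lemma bump_supp delta y x : bump delta y x != 0 -> `|x - y| <= delta.
Proof.
by rewrite /bump indicE; case: (boolP (_ \in _)) => [/set_mem//|_]; rewrite mulr0 eqxx.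
Qed.

(** On the support of the bump [nsq (x - y) <= 2 * delta ^+ 2 = eta], which is the range of
    [gk_lower] at time [eta]. *)
Lemma bump_le_gk (delta eta : R) y x : 0 < eta -> 2 * delta ^+ 2 = eta ->
  bump delta y x <= 8 * gk eta (x - y).
Proof.
move=> e0 de; have g0 := gk_ge0 (x - y) (ltW e0).
have [->|/bump_supp xy] := eqVneq (bump delta y x) 0; first by apply: mulr_ge0.
apply: le_trans (bump_le delta y x) _.
have : 16^-1 / eta <= gk eta (x - y).
  apply: gk_lower => //; apply: le_trans (nsq_norm _) _; rewrite -de.
  apply: ler_wpM2l => //; rewrite lerXn2r ?nnegrE//; exact: le_trans xy.
have -> : 4 * delta ^+ 2 = 2 * eta by rewrite -de; ring.
have -> : (2 * eta)^-1 = 8 * (16^-1 / eta).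
  by field; exact: lt0r_neq0.
by move: (16^-1 / eta) => q; lra.
Qed.

Lemma gk_le_inv (t : R) z : 0 < t -> gk t z <= (t + nsq z)^-1.
Proof.
move=> t0; have p2 := pi_ge2 R; have n0 := nsq_ge0 z.
have [nt|tn] := leP (nsq z) t.
  apply: le_trans (gk_le z t0) _; rewrite lef_pV2 ?posrE; [|nra|lra].
  have : 2 * t <= pi * t by apply: ler_wpM2r => //; exact: ltW.
  rewrite -mulrA; lra.
have np : 0 < nsq z by lra.
apply: le_trans (gk_le_nsq t0 np) _; rewrite lef_pV2 ?posrE; [|nra|lra].
have : 2 * nsq z <= pi * nsq z by apply: ler_wpM2r.
lra.
Qed.

Lemma nsq_triangle (x y z : R * R) : nsq (x - z) <= 2 * nsq (x - y) + 2 * nsq (y - z).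
Proof.
rewrite /nsq /=; move: x y z => [x1 x2] [y1 y2] [z1 z2] /=.
have : 0 <= (x1 - y1 - (y1 - z1)) ^+ 2 by exact: sqr_ge0.
have : 0 <= (x2 - y2 - (y2 - z2)) ^+ 2 by exact: sqr_ge0.
nra.
Qed.

(** Moving the argument from [x] to the centre [y] changes the squared distance by an amount that
    the time [eta] in the denominator absorbs, up to constants. *)
Lemma gk_near (delta eta t : R) (x y y' : R * R) : 0 < eta -> 2 * delta ^+ 2 = eta ->
  0 <= t -> `|x - y| <= delta -> gk (eta + t) (x - y') <= 4 * (eta + t + nsq (y - y'))^-1.
Proof.
move=> e0 de t0 xy; have et : 0 < eta + t by lra.
apply: le_trans (gk_le_inv _ et) _.
have n1 := nsq_ge0 (x - y'); have n2 := nsq_ge0 (y - y')%R.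
have n3 : nsq (x - y) <= eta.
  rewrite -de; apply: le_trans (nsq_norm _) _; apply: ler_wpM2l => //.
  by rewrite lerXn2r ?nnegrE//; exact: le_trans xy.
have tri := nsq_triangle y x y'.
have n4 : nsq (y - x) = nsq (x - y) by rewrite -nsqN opprB.
rewrite -[4]invrK -invfM lef_pV2 ?posrE; lra.
Qed.

End bump.

Section chain_moments.
Context d (T : measurableType d) (R : realType) (P : probability T R).
Context (B : R -> T -> R * R) (pbmB : planar_brownian_motion P (1, 0) B).
Context (delta eta : R) (L' M : nat).
Hypotheses (e0 : 0 < eta) (de : 2 * delta ^+ 2 = eta).
Local Notation pT u := (g_sigma_algebraType (past B u)).
Local Notation tm j := (j%:R * eta).
Local Notation psi y p w := (bump delta y (B (tm p) w)).
Local Notation kp := (kap eta).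
Local Notation R2 := (R * R)%type.
Local Open Scope ereal_scope.

Lemma tm_ge0 (p : nat) : (0 <= tm p :> R)%R.
Proof. by apply: mulr_ge0 => //; exact: ltW. Qed.

Lemma tm_le (p q : nat) : (p <= q)%N -> (0 <= tm p <= tm q)%R.
Proof. by move=> pq; rewrite tm_ge0/= ler_pM2r// ler_nat. Qed.

Lemma adapted_psi y (p q : nat) : (p <= q)%N ->
  measurable_fun setT ((fun w => psi y p w) : pT (tm q) -> R).
Proof.
by move=> pq; apply: measurable_bump2 => //; apply: adapted_B; exact: tm_le.
Qed.

Lemma measurable_psi y (p : nat) : measurable_fun setT (fun w => psi y p w).
Proof. by apply: measurable_bump2 => //; apply: (measurable_B pbmB); exact: tm_ge0. Qed.

Let u0 y x : (0 <= bump delta y x)%R. Proof. exact: bump_ge0. Qed.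

Lemma bump_gk_step (p q : nat) (y : R2) (F : T -> R) : (p <= q)%N ->
  measurable_fun setT (F : pT (tm p) -> R) -> (forall w, (0 <= F w)%R) ->
  \int[P]_w (F w * psi y q w)%:E <=
  \int[P]_w (8 * (F w * gk (eta + (tm q - tm p)) (B (tm p) w - y)))%R%:E.
Proof.
move=> pq mF F0.
have mF' := adapted_measurable pbmB mF.
have mg t (r : nat) : measurable_fun setT (fun w => gk t (B (tm r) w - y)%R).
  by apply: (measurableT_comp (measurable_gkB t y)); apply: (measurable_B pbmB); exact: tm_ge0.
have tp := tm_le pq; have tq : (0 < eta + (tm q - tm p))%R by case/andP: tp => _ ?; have := e0; lra.
have g0 w : (0 <= F w * gk eta (B (tm q) w - y))%R by apply: mulr_ge0 => //; apply: gk_ge0; exact: ltW.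
have g0' w : (0 <= F w * gk (eta + (tm q - tm p)) (B (tm p) w - y))%R.
  by apply: mulr_ge0 => //; apply: gk_ge0; exact: ltW.
rewrite -(intrZ P (c := 8) (F := fun w => F w * gk (eta + (tm q - tm p)) (B (tm p) w - y))%R)//; last first.
  exact: measurable_funM.
rewrite -(markov_gk pbmB y tp e0 mF F0).
rewrite (intrZ P (c := 8) (F := fun w => F w * gk eta (B (tm q) w - y))%R)//; last exact: measurable_funM.
apply: intr_le.
- by apply: measurable_funM => //; exact: measurable_psi.
- by apply: measurable_funM => //; exact: measurable_funM.
- by move=> w; exact: mulr_ge0.
- by move=> w; rewrite [leRHS]mulrCA; apply: ler_wpM2l => //; exact: bump_le_gk.
Qed.

(** The bump at the later time is dominated by a heat kernel, pulled back by the Markov property,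
    and evaluated at the centre of the bump at the earlier time; [32] is [8 * 4] from [bump_le_gk]
    and [gk_near]. *)
Lemma chain_step (p q : nat) (y y' : R2) (F : T -> R) : (p <= q)%N ->
  measurable_fun setT (F : pT (tm p) -> R) -> (forall w, (0 <= F w)%R) ->
  \int[P]_w (F w * psi y p w * psi y' q w)%:E <=
  (32 * kp (y - y')%R (q - p))%:E * \int[P]_w (F w * psi y p w)%:E.
Proof.
move=> pq mF F0.
have mFp : measurable_fun setT ((fun w => F w * psi y p w)%R : pT (tm p) -> R).
  by apply: measurable_funM => //; exact: adapted_psi.
have mFp' := adapted_measurable pbmB mFp.
have Fp0 w : (0 <= F w * psi y p w)%R by exact: mulr_ge0.
have k0 : (0 <= kp (y - y')%R (q - p))%R by exact: kap_ge0.
apply: le_trans (bump_gk_step y' pq mFp Fp0) _.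
rewrite (intrZ P (c := 32 * kp (y - y')%R (q - p)) (F := fun w => F w * psi y p w)%R)//; last first.
  by apply: mulr_ge0.
have tq : (0 <= tm q - tm p :> R)%R by rewrite subr_ge0; case/andP: (tm_le pq).
have g0 w : (0 <= gk (eta + (tm q - tm p)) (B (tm p) w - y')%R)%R by apply: gk_ge0; have := e0; lra.
apply: intr_le.
- apply: measurable_funM => //; apply: measurable_funM => //.
  by apply: (measurableT_comp (measurable_gkB _ y')); apply: (measurable_B pbmB); exact: tm_ge0.
- exact: measurable_funM.
- by move=> w; apply: mulr_ge0 => //; exact: mulr_ge0.
- move=> w; have [->|uN] := eqVneq (psi y p w) 0%R; first by rewrite !(mulr0, mul0r).
  have := gk_near y' e0 de tq (bump_supp uN).
  have -> : (eta + (tm q - tm p) + nsq (y - y')%R)^-1%R = kp (y - y')%R (q - p).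
    by rewrite /kap natrB// mulrBl.
  move=> H; have H2 := ler_wpM2l (Fp0 w) H.
  have n8 : (0 <= 8 :> R)%R by [].
  by apply: le_trans (ler_wpM2l n8 H2) _; apply: eq_ler; ring.
Qed.

(** After time [1 / 64] the density of the position is bounded by 64 at every point of the plane, so
    the first visit contributes only a constant. *)
Lemma bump_first (p : nat) (y : R2) : (64^-1 <= tm p)%R -> \int[P]_w (psi y p w)%:E <= (8 * 64)%R%:E.
Proof.
move=> tp.
have t0 : (0 < tm p)%R by apply: lt_le_trans tp; rewrite invr_gt0.
have t00 : (0 <= (0 : R) <= tm p)%R by rewrite lexx ltW.
have m1 : measurable_fun setT ((fun=> 1%R) : pT 0%R -> R) by exact: measurable_cst.
have k1 (w : T) : (0 <= 1 :> R)%R by [].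
have := @bump_gk_step 0 p y (fun=> 1%R) (leq0n _).
rewrite /= mul0r => /(_ m1 k1).
under eq_integral do rewrite mul1r; move=> H; apply: le_trans H _.
have tt : (0 < eta + (tm p - 0))%R by rewrite subr0; exact: addr_gt0.
apply: integral_le_cst => [|w|w].
- apply: measurable_funM => //; apply: measurable_funM => //.
  by apply: (measurableT_comp (measurable_gkB _ y)); exact: (measurable_B pbmB).
- by apply: mulr_ge0 => //; apply: mulr_ge0 => //; apply: gk_ge0; exact: ltW.
- apply: ler_wpM2l => //; rewrite mul1r; apply: le_trans (gk_le_inv _ tt) _.
  rewrite -[leRHS]invrK lef_pV2 ?posrE ?invr_gt0//.
    have n0 := nsq_ge0 (B 0 w - y)%R; have ep := e0; clear k1; lra.
  by apply: ltr_wpDr; [exact: nsq_ge0|exact: tt].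
Qed.

Definition chain_cst : R := (32 * (32 * (32 * (8 * 64))))%R.

Lemma chain_cst_ge0 : (0 <= chain_cst)%R.
Proof. by rewrite /chain_cst !mulr_ge0. Qed.

Lemma chain4 (p0 p1 p2 p3 : nat) (y0 y1 y2 y3 : R2) : (64^-1 <= tm p0)%R ->
  (p0 <= p1)%N -> (p1 <= p2)%N -> (p2 <= p3)%N ->
  \int[P]_w (psi y0 p0 w * psi y1 p1 w * psi y2 p2 w * psi y3 p3 w)%:E <=
  (chain_cst * (kp (y0 - y1)%R (p1 - p0) * (kp (y1 - y2)%R (p2 - p1) * kp (y2 - y3)%R (p3 - p2))))%R%:E.
Proof.
move=> tp l1 l2 l3.
have k0 z g : (0 <= kp z g)%R by exact: kap_ge0.
have m1 : measurable_fun setT ((fun=> 1%R) : pT (tm p0) -> R) by exact: measurable_cst.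
have H3 := chain_step y2 y3 l3 (F := fun w => psi y0 p0 w * psi y1 p1 w)%R
   (measurable_funM (adapted_psi y0 (leq_trans l1 l2)) (adapted_psi y1 l2)) (fun w => mulr_ge0 (u0 _ _) (u0 _ _)).
have H2 := chain_step y1 y2 l2 (F := fun w => psi y0 p0 w) (adapted_psi y0 l1) (fun w => u0 _ _).
have H1 := chain_step y0 y1 l1 m1 (fun w => ler01).
have E1 : \int[P]_w (1 * psi y0 p0 w * psi y1 p1 w)%R%:E = \int[P]_w (psi y0 p0 w * psi y1 p1 w)%R%:E.
  by apply: eq_integral => w _; rewrite mul1r.
have E0 : \int[P]_w (1 * psi y0 p0 w)%R%:E = \int[P]_w (psi y0 p0 w)%R%:E.
  by apply: eq_integral => w _; rewrite mul1r.
rewrite E1 E0 in H1.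
have c0 z g : 0 <= (32 * kp z g)%R%:E by rewrite lee_fin mulr_ge0.
apply: le_trans H3 _; apply: le_trans (lee_wpmul2l (c0 _ _) H2) _.
apply: le_trans (lee_wpmul2l (c0 _ _) (lee_wpmul2l (c0 _ _) H1)) _.
apply: le_trans (lee_wpmul2l (c0 _ _) (lee_wpmul2l (c0 _ _) (lee_wpmul2l (c0 _ _) (bump_first y0 tp)))) _.
rewrite -!EFinM lee_fin /chain_cst; apply: eq_ler; move: (kp _ _) (kp _ _) (kp _ _) => a b c; ring.
Qed.

Local Notation ch z := (chain eta L' z).

(** The three interleavings in which [a] comes first, [b] after [a], and [b'] after [a']. *)
Definition orders z (a b a' b' : nat) : R := (ch z a b a' b' + ch z a a' b b' + ch z a a' b' b)%R.

Lemma orders_ge0 z a b a' b' : (0 <= orders z a b a' b')%R.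
Proof.
have c0 p0 p1 p2 p3 : (0 <= ch z p0 p1 p2 p3)%R by exact: chain_ge0.
exact: addr_ge0 (addr_ge0 (c0 _ _ _ _) (c0 _ _ _ _)) (c0 _ _ _ _).
Qed.

(** The cases are [b] before [a'], between [a'] and [b'], or after [b']. The separations then make
    both outer gaps long, lead to the alternating order, or make the middle gap long. *)
Lemma quad_half (a b a' b' : nat) (y y' : R2) : (64^-1 <= tm a)%R -> (a <= a')%N ->
  (a + 2 * L' <= b)%N -> (a' + 2 * L' <= b')%N ->
  \int[P]_w (psi y a w * psi y b w * (psi y' a' w * psi y' b' w))%:E <=
  (chain_cst * orders (y - y')%R a b a' b')%R%:E.
Proof.
move=> ta aa ab ab'; have C0 := chain_cst_ge0.
have c0 p0 p1 p2 p3 : (0 <= ch (y - y')%R p0 p1 p2 p3)%R by exact: chain_ge0.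
have c1 := c0 a b a' b'; have c2 := c0 a a' b b'; have c3 := c0 a a' b' b.
have ks g : kp (y' - y)%R g = kp (y - y')%R g by rewrite -kapN opprB.
have [ba|ab''] := leqP b a'; last have [bb|bb] := leqP b b'.
- have l1 : (a <= b)%N by lia.
  have l3 : (a' <= b')%N by lia.
  have := chain4 y y y' y' ta l1 ba l3.
  under eq_integral do rewrite -(mulrA (_ * _)%R); move=> H; apply: le_trans H _.
  rewrite lee_fin; apply: ler_wpM2l => //.
  have h1 : (a + L' <= b)%N by lia.
  have h3 : (a' + L' <= b')%N by lia.
  have := chain_lkl e0 (y - y')%R (y - y)%R (y' - y')%R h1 ba h3; rewrite /orders; lra.
- have l2 : (a' <= b)%N by lia.
  have := chain4 y y' y y' ta aa l2 bb.
  rewrite (_ : \int[P]_w (psi y a w * psi y b w * (psi y' a' w * psi y' b' w))%R%:E =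
    \int[P]_w (psi y a w * psi y' a' w * psi y b w * psi y' b' w)%R%:E); last by apply: eq_integral => w _; congr (_%:E); ring.
  move=> H; apply: le_trans H _; rewrite lee_fin; apply: ler_wpM2l => //.
  have h1 : (a + 2 * L' <= b)%N by lia.
  have := chain_kkk e0 (y - y')%R aa l2 bb h1 ab'; rewrite ks /orders; lra.
- have l2 : (a' <= b')%N by lia.
  have l3 : (b' <= b)%N by lia.
  have := chain4 y y' y' y ta aa l2 l3.
  rewrite (_ : \int[P]_w (psi y a w * psi y b w * (psi y' a' w * psi y' b' w))%R%:E =
    \int[P]_w (psi y a w * psi y' a' w * psi y' b' w * psi y b w)%R%:E); last by apply: eq_integral => w _; congr (_%:E); ring.
  move=> H; apply: le_trans H _; rewrite lee_fin; apply: ler_wpM2l => //.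
  have h2 : (a' + L' <= b')%N by lia.
  have := chain_klk e0 (y - y')%R (y' - y')%R aa h2 l3; rewrite ks /orders; lra.
Qed.

Lemma ordersN z a b a' b' : orders (- z)%R a b a' b' = orders z a b a' b'.
Proof. by rewrite /orders /chain /step; rewrite !kapN. Qed.

Lemma quad_bound (a b a' b' : nat) (y y' : R2) : (64^-1 <= tm a)%R -> (64^-1 <= tm a')%R ->
  (a + 2 * L' <= b)%N -> (a' + 2 * L' <= b')%N ->
  \int[P]_w (psi y a w * psi y b w * (psi y' a' w * psi y' b' w))%:E <=
  (chain_cst * (orders (y - y')%R a b a' b' + orders (y - y')%R a' b' a b))%R%:E.
Proof.
move=> ta ta' ab ab'; have C0 := chain_cst_ge0.
have [aa|aa] := leqP a a'.
  apply: le_trans (quad_half y y' ta aa ab ab') _.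
  by rewrite lee_fin; apply: ler_wpM2l => //; rewrite lerDl orders_ge0.
under eq_integral do rewrite mulrC.
apply: le_trans (quad_half y' y ta' (ltnW aa) ab' ab) _.
rewrite -ordersN opprB lee_fin; apply: ler_wpM2l => //.
by rewrite lerDr orders_ge0.
Qed.

(** Renaming the summation indices turns each of the six orders into the same fourfold sum. *)
Lemma orders_total z :
  (\sum_(u : 'I_M * 'I_M) \sum_(v : 'I_M * 'I_M) (orders z u.1 u.2 v.1 v.2 + orders z v.1 v.2 u.1 u.2) <=
  6 * (M%:R * ((\sum_(g < M) kp z g) ^+ 2 * (\sum_(g < M) lam eta L' g) +
          (\sum_(g < M) kp z g) * (\sum_(g < M) lam eta L' g) ^+ 2)))%R.
Proof.
have tot := chain_total L' e0 M z.
pose S (F : nat -> nat -> nat -> nat -> R) : R :=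
  (\sum_(i < M) \sum_(j < M) \sum_(k < M) \sum_(l < M) F i j k l)%R.
have pS (F : nat -> nat -> nat -> nat -> R) : (\sum_(u : 'I_M * 'I_M) \sum_(v : 'I_M * 'I_M) F u.1 u.2 v.1 v.2)%R = S F.
  rewrite -(pair_bigA _ (fun i j : 'I_M => \sum_(v : 'I_M * 'I_M) F i j v.1 v.2)%R) /=.
  apply: eq_bigr => i _; apply: eq_bigr => j _.
  by rewrite -(pair_bigA _ (fun k l : 'I_M => F i j k l)%R).
have S2 : S (fun a b a' b' => ch z a a' b b') = S (ch z).
  by apply: eq_bigr => i _; rewrite exchange_big.
have S3 : S (fun a b a' b' => ch z a a' b' b) = S (ch z).
  apply: eq_bigr => i _; rewrite exchange_big; apply: eq_bigr => j _; by rewrite exchange_big.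
have SD F G : S (fun a b a' b' => F a b a' b' + G a b a' b')%R = (S F + S G)%R.
  rewrite /S -big_split; apply: eq_bigr => i _; rewrite -big_split; apply: eq_bigr => j _.
  by rewrite -big_split; apply: eq_bigr => k _; rewrite -big_split.
have So : S (orders z) = (3 * S (ch z))%R.
  rewrite /orders (SD (fun a b a' b' => ch z a b a' b' + ch z a a' b b')%R) SD S2 S3.
  by rewrite -/(S (ch z)); move: (S _) => x; ring.
have -> : (\sum_(u : 'I_M * 'I_M) \sum_(v : 'I_M * 'I_M) (orders z u.1 u.2 v.1 v.2 + orders z v.1 v.2 u.1 u.2) = 6 * S (ch z))%R.
  under eq_bigr do rewrite big_split.
  rewrite big_split /= [X in (_ + X)%R]exchange_big /= !pS So; move: (S _) => x; ring.
by apply: ler_wpM2l => //; exact: tot.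
Qed.

Context (N1 : nat).

Definition pair_ok (u : 'I_M * 'I_M) : bool := ((N1 <= u.1) && (u.1 + 2 * L' <= u.2))%N.

Definition intersections y w : R :=
  (\sum_(u : 'I_M * 'I_M) (pair_ok u)%:R * eta ^+ 2 * (psi y u.1 w * psi y u.2 w))%R.

(** Of the four factors [eta], three normalise the kernel sums and one the free starting time; [3]
    is [6 * (M%:R * eta)] with [M%:R * eta <= 1 / 2]. *)
Lemma intersections_product y y' : (64^-1 <= tm N1)%R -> (tm M <= 1 / 2)%R ->
  \int[P]_w (intersections y w * intersections y' w)%:E <=
  (chain_cst * (3 * ((\sum_(g < M) eta * kp (y - y')%R g) ^+ 2 * (\sum_(g < M) eta * lam eta L' g) +
          (\sum_(g < M) eta * kp (y - y')%R g) * (\sum_(g < M) eta * lam eta L' g) ^+ 2)))%R%:E.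
Proof.
move=> t1 tM; set z := (y - y')%R; have C0 := chain_cst_ge0.
pose F (u v : 'I_M * 'I_M) w : R := ((pair_ok u)%:R * (pair_ok v)%:R * eta ^+ 4 *
   (psi y u.1 w * psi y u.2 w * (psi y' v.1 w * psi y' v.2 w)))%R.
have F0 u v w : (0 <= F u v w)%R.
  rewrite /F; apply: mulr_ge0; last by apply: mulr_ge0; exact: mulr_ge0.
  by apply: mulr_ge0; [apply: mulr_ge0; exact: ler0n|rewrite exprn_ge0// ltW].
have mF u v : measurable_fun setT (F u v).
  by apply: measurable_funM => //; apply: measurable_funM; apply: measurable_funM; exact: measurable_psi.
have -> : \int[P]_w (intersections y w * intersections y' w)%:E =
    \int[P]_w (\sum_(u : 'I_M * 'I_M) \sum_(v : 'I_M * 'I_M) F u v w)%R%:E.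
  apply: eq_integral => w _; congr (_%:E); rewrite /intersections big_distrlr /=.
  apply: eq_bigr => u _; apply: eq_bigr => v _; rewrite /F; ring.
rewrite -(intr_sum P _ (F := fun u w => (\sum_(v : 'I_M * 'I_M) F u v w)%R)); first last.
- by move=> u w; apply: sumr_ge0 => v _; exact: F0.
- by move=> u; apply: measurable_sum => v; exact: mF.
have Fb u v : \int[P]_w (F u v w)%:E <=
    (eta ^+ 4 * (chain_cst * (orders z u.1 u.2 v.1 v.2 + orders z v.1 v.2 u.1 u.2)))%R%:E.
  have o1 := orders_ge0 z u.1 u.2 v.1 v.2; have o2 := orders_ge0 z v.1 v.2 u.1 u.2.
  have e4 : (0 <= eta ^+ 4)%R by rewrite exprn_ge0// ltW.
  rewrite /F; case pu: (pair_ok u); last first.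
    by under eq_integral do rewrite !mul0r; rewrite integral0 lee_fin mulr_ge0// mulr_ge0// addr_ge0.
  case pv: (pair_ok v); last first.
    by under eq_integral do rewrite mulr0 !mul0r; rewrite integral0 lee_fin mulr_ge0// mulr_ge0// addr_ge0.
  under eq_integral do rewrite !mul1r.
  rewrite -(intrZ P (c := eta ^+ 4) (F := fun w => (psi y u.1 w * psi y u.2 w * (psi y' v.1 w * psi y' v.2 w))%R))//; first last.
  - by move=> w; apply: mulr_ge0; exact: mulr_ge0.
  - by apply: measurable_funM; apply: measurable_funM; exact: measurable_psi.
  rewrite [leRHS]EFinM; apply: lee_wpmul2l; first by rewrite lee_fin.
  case/andP: pu => pu1 pu2; case/andP: pv => pv1 pv2.
  by apply: quad_bound => //; apply: le_trans t1 _; rewrite ler_pM2r// ler_nat.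
apply: (@le_trans _ _ (\sum_(u : 'I_M * 'I_M) \sum_(v : 'I_M * 'I_M)
    (eta ^+ 4 * (chain_cst * (orders z u.1 u.2 v.1 v.2 + orders z v.1 v.2 u.1 u.2)))%R%:E)).
  apply: lee_sum => u _; rewrite -(intr_sum P _ (F := fun v w => F u v w))//.
  by apply: lee_sum => v _; exact: Fb.
under eq_bigr do rewrite sumEFin.
rewrite sumEFin lee_fin.
under eq_bigr do rewrite -mulr_sumr -mulr_sumr.
rewrite -mulr_sumr -mulr_sumr.
have e4 : (0 <= eta ^+ 4)%R by rewrite exprn_ge0// ltW.
apply: le_trans (ler_wpM2l e4 (ler_wpM2l C0 (orders_total z))) _.
rewrite -!mulr_sumr.
have k0 : (0 <= \sum_(g < M) kp z g)%R by apply: sumr_ge0 => g _; exact: kap_ge0.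
have l0 : (0 <= \sum_(g < M) lam eta L' g)%R by apply: sumr_ge0 => g _; exact: lam_ge0.
move: (\sum_(g < M) kp z g)%R (\sum_(g < M) lam eta L' g)%R k0 l0 => k l k0 l0.
rewrite [leLHS]mulrCA; apply: ler_wpM2l => //.
have q0 : (0 <= eta ^+ 3 * (k ^+ 2 * l + k * l ^+ 2))%R.
  apply: mulr_ge0; first by rewrite exprn_ge0// ltW.
  by apply: addr_ge0; apply: mulr_ge0 => //; exact: sqr_ge0.
have -> : (eta ^+ 4 * (6 * (M%:R * (k ^+ 2 * l + k * l ^+ 2))) =
  (6 * (M%:R * eta)) * (eta ^+ 3 * (k ^+ 2 * l + k * l ^+ 2)))%R by ring.
have -> : (3 * ((eta * k) ^+ 2 * (eta * l) + eta * k * (eta * l) ^+ 2) =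
  3 * (eta ^+ 3 * (k ^+ 2 * l + k * l ^+ 2)))%R by ring.
by apply: ler_wpM2r => //; have := tM; lra.
Qed.

End chain_moments.

Section heat_bounds.
Context {R : realType}.

(** Young's inequality with a free weight, to tune the narrow margins between squared radii
    below. *)
Lemma nsqD_le (c : R) (x y : R * R) : 0 < c ->
  nsq (x + y) <= (1 + c) * nsq x + (1 + c^-1) * nsq y.
Proof.
move=> c0; rewrite /nsq /=; move: x y => [x1 x2] [y1 y2] /=.
have H (a b : R) : (a + b) ^+ 2 <= (1 + c) * a ^+ 2 + (1 + c^-1) * b ^+ 2.
  rewrite -subr_ge0 (_ : _ - _ = c^-1 * (c * a - b) ^+ 2); last by field; exact: lt0r_neq0.
  by rewrite mulr_ge0 ?sqr_ge0// invr_ge0 ltW.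
have := H x1 y1; have := H x2 y2; rewrite !mulrDr; lra.
Qed.

(** One of the six units in the exponent absorbs the prefactor [1 / (2 * pi * u)]; the other five
    give a bound monotone in time. *)
Lemma gk_le_expR (u S : R) z : 0 < u -> u <= S -> 6 <= nsq z -> gk u z <= expR (- (5 / (2 * S))).
Proof.
move=> u0 uS z6; have p2 := pi_ge2 R; have S0 : 0 < S by lra.
have pu : 0 < 2 * pi * u by apply: twopi_gt0.
rewrite gk_expR; apply: (@le_trans _ _ ((2 * pi * u)^-1 * (expR (- (5 / (2 * S))) * expR (- (2 * u)^-1)))).
  apply: ler_wpM2l; first by rewrite invr_ge0 ltW.
  rewrite -expRD ler_expR -opprD mulNr lerN2.
  have h5 : 5 / (2 * S) <= 5 * (2 * u)^-1 by apply: ler_wpM2l => //; rewrite lef_pV2 ?posrE; lra.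
  have h6 : 6 * (2 * u)^-1 <= nsq z * (2 * u)^-1 by apply: ler_wpM2r => //; rewrite invr_ge0; lra.
  move: h5 h6; move: (5 / (2 * S)) (nsq z * (2 * u)^-1) ((2 * u)^-1) => p q t h5 h6; lra.
rewrite mulrCA ler_piMr ?expR_ge0// expRN -invfM invf_le1; last by apply: mulr_gt0 => //; exact: expR_gt0.
have h1 := expR_ge1Dx (2 * u)^-1.
have h2 : 1 + (2 * u)^-1 <= expR (2 * u)^-1 by exact: h1.
have h3 : 1 = 2 * u * (2 * u)^-1 by rewrite mulfV// lt0r_neq0// mulr_gt0.
apply: (@le_trans _ _ (2 * pi * u * (2 * u)^-1)).
  rewrite (_ : 2 * pi * u * _ = pi * (2 * u * (2 * u)^-1)); last by ring.
  by rewrite -h3 mulr1; lra.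
by apply: ler_wpM2l; [exact: ltW|lra].
Qed.

Lemma gk_ge_expR (t : R) z : 0 < t -> t <= 16^-1 -> nsq z <= 2 -> expR (- t^-1) <= gk t z.
Proof.
move=> t0 t1 z2; have p4 : pi < (4 : R) by have := pihalf_02 R; rewrite /=; lra.
have p2 := pi_ge2 R; have pu : 0 < 2 * pi * t by apply: twopi_gt0.
rewrite gk_expR -[leLHS]mul1r; apply: ler_pM => //; rewrite ?expR_ge0//.
  rewrite invf_ge1//; have : pi * t <= 4 * t by apply: ler_wpM2r; lra.
  rewrite -mulrA; lra.
rewrite ler_expR mulNr lerN2.
have -> : t^-1 = 2 / (2 * t) by field; exact: lt0r_neq0.
by apply: ler_wpM2r => //; rewrite invr_ge0; lra.
Qed.

Lemma expR_ge_exp2 (n : nat) : 2 ^+ n <= expR (n%:R : R).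
Proof.
rewrite -[n%:R]mulr1 expRM_natl lerXn2r ?nnegrE ?expR_ge0//.
by have := expR_ge1Dx (1 : R); lra.
Qed.

Lemma area_bump (delta : R) y : 0 < delta ->
  (\int[@area R]_v (bump delta y v)%:E = 1)%E.
Proof.
move=> d0; have c0 : 0 <= (4 * delta ^+ 2)^-1 by rewrite invr_ge0 mulr_ge0// sqr_ge0.
pose S := [set z : R * R | `|z| <= delta].
have mS : measurable S by exact: measurable_norm_le.
have mf : measurable_fun setT (fun v : R * R => (bump delta 0 v)%:E).
  by apply/measurable_EFinP; apply: measurable_bump2 => //; exact: measurable_cst.
rewrite (_ : (fun v => (bump delta y v)%:E) = (fun v => (bump delta 0 (v + - y))%:E)); last first.
  by apply/funext => v; rewrite /bump subr0.
rewrite (area_translation (- y) (f := fun v => (bump delta 0 v)%:E))//; last first.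
  by move=> x; rewrite lee_fin bump_ge0.
under eq_integral do rewrite /bump subr0.
have mi : measurable_fun setT (\1_S : R * R -> R) by exact: measurable_indic.
have i0 w : 0 <= \1_S w :> R by rewrite indicE.
rewrite -(intrZ (@area R) c0 mi i0).
rewrite integral_indicT//.
have -> : S = `[- delta, delta] `*` `[- delta, delta].
  apply/seteqP; split => [z zS|z [/= z1 z2]].
    split; rewrite /= in_itv /= -ler_norml.
      by apply: le_trans (norm_fst z) zS.
    by apply: le_trans (norm_snd z) zS.
  rewrite in_itv /= -ler_norml in z1; rewrite in_itv /= -ler_norml in z2.
  by rewrite /S /= /Num.norm /= ge_max z1 z2.
have [m1 m2] : measurable (`[- delta, delta] : set R) /\ measurable (`[- delta, delta] : set R) by split.
have L : lebesgue_measure (`[- delta, delta] : set R) = (2 * delta)%:E.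
  rewrite lebesgue_measure_itv /= lte_fin ifT; last by lra.
  by rewrite -EFinD; congr (_%:E); ring.
have A : area (`[- delta, delta] `*` `[- delta, delta]) = (2 * delta * (2 * delta))%:E.
  by rewrite (area_rect m1 m2) !L -EFinM.
rewrite [X in (_ * X)%E](_ : _ = (2 * delta * (2 * delta))%R%:E); last exact: A.
by rewrite -EFinM; congr (_%:E); field; exact: lt0r_neq0.
Qed.

Lemma window_sum (F : nat -> R) (s n M : nat) : (s + n <= M)%N ->
  \sum_(b < M) ((s <= b) && (b < s + n))%N%:R * F b = \sum_(q < n) F (s + q)%N.
Proof.
move=> snM; rewrite -(big_mkord xpredT (fun b => ((s <= b) && (b < s + n))%N%:R * F b)).
rewrite (big_cat_nat (n := s))//=; last by lia.
rewrite (big_cat_nat (n := (s + n)%N) (m := s))//=; last by lia.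
rewrite big_nat_cond big1 ?add0r => [|i /andP[/andP[_ i1] _]]; last by rewrite leqNgt i1 mul0r.
rewrite [X in _ + X]big_nat_cond [X in _ + X]big1 ?addr0 => [|i /andP[/andP[i1 _] _]]; last first.
  by rewrite [(i < _)%N]ltnNge i1 andbF mul0r.
rewrite -{1}[s]add0n big_addn addKn big_mkord; apply: eq_bigr => q _.
by rewrite leq_addl addnC ltn_add2l ltn_ord mul1r.
Qed.

End heat_bounds.

(** * First moment of the intersections of paths that stay well inside the disk *)

Section first_moment.
Context d (T : measurableType d) (R : realType) (P : probability T R).
Context (B : R -> T -> R * R) (pbmB : planar_brownian_motion P (1, 0) B).
Context (delta eta : R).
Hypotheses (e0 : 0 < eta) (d0 : 0 < delta) (de : 2 * delta ^+ 2 = eta) (esmall : eta <= 512^-1).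
Local Notation pT u := (g_sigma_algebraType (past B u)).
Local Notation tm j := (j%:R * eta).
Local Notation psi y p w := (bump delta y (B (tm p) w)).
Local Notation R2 := (R * R)%type.
Local Open Scope ereal_scope.

Let u0 y x : (0 <= bump delta y x)%R. Proof. exact: bump_ge0. Qed.

(** The lower counterpart of [chain_step]: the bump has total mass 1, so a lower bound on the
    transition density between the two supports passes to the integral. *)
Lemma bump_lower (p q : nat) (y : R2) (F : T -> R) (c : R) : (p < q)%N -> (0 <= c)%R ->
  measurable_fun setT (F : pT (tm p) -> R) -> (forall w, (0 <= F w)%R) ->
  (forall w v, F w != 0%R -> (`|v - y| <= delta)%R -> (c <= gk (tm q - tm p) (v - B (tm p) w))%R) ->
  c%:E * \int[P]_w (F w)%:E <= \int[P]_w (F w * psi y q w)%:E.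
Proof.
move=> pq c0 mF F0 H.
have mF' := adapted_measurable pbmB mF.
have tpq : (0 <= tm p < tm q)%R.
  by rewrite ltr_pM2r// ltr_nat pq andbT; apply: mulr_ge0 => //; exact: ltW.
have tq : (0 < tm q - tm p)%R by rewrite subr_gt0; case/andP: tpq.
have mf : measurable_fun setT ((fun x => (F x.1 * bump delta y x.2)%:E) : pT (tm p) * R2 -> \bar R).
  apply: (adapted_tensor (F := (F : pT (tm p) -> R)) (g := bump delta y)) => //.
  by apply: measurable_bump2 => //; exact: measurable_cst.
have f0 (x : pT (tm p) * R2) : 0 <= (F x.1 * bump delta y x.2)%:E by rewrite lee_fin mulr_ge0.
rewrite (markov pbmB tpq mf f0) /=.
have mb : measurable_fun setT (bump delta y) by apply: measurable_bump2 => //; exact: measurable_cst.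
rewrite (intrZ P c0 mF' F0).
apply: ge0_le_integral => //.
- by move=> w _; rewrite lee_fin mulr_ge0.
- by apply/measurable_EFinP; apply: measurable_funM.
- apply: (measurable_fun_fubini_tonelli_F (m2 := @area R)
    (fun x : T * R2 => (F x.1 * bump delta y x.2)%:E * (gk (tm q - tm p) (x.2 - B (tm p) x.1))%:E)).
    apply: emeasurable_funM.
      apply/measurable_EFinP; apply: measurable_funM.
        by apply: (measurableT_comp mF'); exact: measurable_fst.
      by apply: (measurableT_comp mb); exact: measurable_snd.
    apply/measurable_EFinP; apply: (measurableT_comp (measurable_gk _)).
    apply: measurable_funB2; first exact: measurable_snd.
    apply: (measurableT_comp (measurable_B pbmB _)); last exact: measurable_fst.
    by case/andP: tpq.
  move=> x; apply: mule_ge0; first by rewrite lee_fin mulr_ge0.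
  by rewrite lee_fin; apply: gk_ge0; exact: ltW.
- move=> w _; rewrite -[leLHS]mule1 -(area_bump y d0).
  have cF : (0 <= c * F w)%R by exact: mulr_ge0.
  rewrite (intrZ (@area R) cF mb (fun x => u0 y x)).
  under [leRHS]eq_integral do rewrite -EFinM.
  apply: intr_le.
  - exact: measurable_funM.
  - apply: measurable_funM; first exact: measurable_funM.
    by apply: (measurableT_comp (measurable_gk _)); apply: measurable_funB2 => //; exact: measurable_cst.
  - by move=> v; apply: mulr_ge0.
  - move=> v; have [->|FN] := eqVneq (F w) 0%R; first by rewrite !(mulr0, mul0r).
    have [->|/bump_supp vy] := eqVneq (bump delta y v) 0%R; first by rewrite !(mulr0, mul0r).
    rewrite -mulrA [(c * _)%R]mulrC; apply: ler_wpM2l; first exact: mulr_ge0.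
    exact: H.
Qed.

(** The squared distance from the start to [y] is at most [16 / 9], and the bump is narrow enough to
    keep it below 2, the range of [gk_ge_expR]. *)
Lemma bump_mass_lower (a : nat) (y : R2) : (64^-1 <= tm a)%R -> (tm a <= 16^-1)%R ->
  (nsq y <= 9^-1)%R -> (expR (- (tm a)^-1))%:E <= \int[P]_w (psi y a w)%:E.
Proof.
move=> a1 a2 y9.
have ta : (0 < tm a)%R by apply: lt_le_trans a1; rewrite invr_gt0.
have a0 : (0 < a)%N by rewrite lt0n; apply/eqP => aE; move: ta; rewrite aE mul0r ltxx.
have m1 : measurable_fun setT ((fun=> 1%R) : pT (tm 0) -> R) by exact: measurable_cst.
have := @bump_lower 0 a y (fun=> 1%R) (expR (- (tm a)^-1)) a0 (expR_ge0 _) m1 (fun w => ler01).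
rewrite integral_prob_cst mule1; under [X in (_ -> _ <= X)%E -> _]eq_integral do rewrite mul1r.
apply => w v _ vy; rewrite mul0r subr0 (pbm_start pbmB); apply: gk_ge_expR => //.
have n1 : (nsq (v - y) <= 512^-1)%R.
  apply: le_trans esmall; rewrite -de; apply: le_trans (nsq_norm _) _; apply: ler_wpM2l => //.
  by rewrite lerXn2r ?nnegrE//; exact: ltW.
have n2 : (nsq (y - (1, 0)) <= 16 / 9)%R.
  have c3 : (0 < 3^-1 :> R)%R by rewrite invr_gt0.
  have := nsqD_le (- (1, 0))%R y c3; rewrite invrK addrC nsqN {2}/nsq /= => H; lra.
have c10 : (0 < 10^-1 :> R)%R by rewrite invr_gt0.
have := nsqD_le (y - (1, 0))%R (v - y)%R c10; rewrite invrK addrC addrA subrK => H; lra.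
Qed.

(** The threshold is 8 and not 9: the margin controls the path between grid times when the mesh
    vanishes. *)
Definition exit (p : nat) : set T :=
  [set w | (8 <= nsq (B (tm p) w))%R /\ forall q, (q < p)%N -> (nsq (B (tm q) w) < 8)%R].

Definition quiet (b : nat) : set T := [set w | forall q, (q <= b)%N -> (nsq (B (tm q) w) < 8)%R].

Lemma adapted_small (p q : nat) : (p <= q)%N ->
  measurable ([set w | (nsq (B (tm p) w) < 8)%R] : set (pT (tm q))).
Proof.
by move=> pq; have H := tm_le e0 pq; exact: (adapted_preimage H (measurable_nsq_lt 8)).
Qed.

Lemma adapted_exit p : measurable (exit p : set (pT (tm p))).
Proof.
have -> : exit p = ~` [set w | (nsq (B (tm p) w) < 8)%R] `&`
   \bigcap_(q in [set q | (q < p)%N]) [set w | (nsq (B (tm q) w) < 8)%R].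
  apply/seteqP; split => w /= [h1 h2]; split => //.
    by apply/negP; rewrite -leNgt.
  by rewrite leNgt; apply/negP.
apply: measurableI; first by apply: measurableC; exact: adapted_small.
by apply: bigcap_measurableType => q qp; apply: adapted_small; exact: ltnW.
Qed.

Lemma measurable_quiet b : measurable (quiet b).
Proof.
have -> : quiet b = \bigcap_(q in [set q | (q <= b)%N]) [set w | (nsq (B (tm q) w) < 8)%R].
  by apply/seteqP; split => w h q; exact: h.
by apply: bigcap_measurableType => q qb; apply: (adapted_set pbmB); exact: adapted_small (leqnn q).
Qed.

Lemma measurable_exit p : measurable (exit p).
Proof. by apply: (adapted_set pbmB); exact: adapted_exit. Qed.

Lemma exit_uniq i j w : exit i w -> exit j w -> i = j.
Proof.
wlog ij : i j / (i <= j)%N.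
  move=> H; case: (leqP i j) => [|/ltnW] ij ei ej; first exact: H.
  by apply/esym; exact: H.
move=> [h1 _] [_ h2]; apply/eqP; rewrite eqn_leq ij leqNgt; apply/negP => ji.
by have := h2 i ji; rewrite ltNge h1.
Qed.

Lemma quiet_or_exit b w : quiet b w \/ exists2 p, (p <= b)%N & exit p w.
Proof.
have [q|nq] := pselect (quiet b w); [by left|right].
have ex : exists p, ((p <= b)%N && (8 <= nsq (B (tm p) w))%R).
  apply: contrapT => H; apply: nq => q qb; rewrite ltNge; apply/negP => h; apply: H.
  by exists q; rewrite qb.
case: (ex_minnP ex) => p /andP[pb pe] mn.
exists p => //; split => // q qp; rewrite ltNge; apply/negP => h.
have := mn q; rewrite h andbT => /(_ (ltnW (leq_trans qp pb))); lia.
Qed.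

Lemma exit_far p (y : R2) w : (nsq y <= 9^-1)%R -> exit p w -> (6 <= nsq (B (tm p) w - y))%R.
Proof.
move=> y9 [h _]; set z := B (tm p) w in h *.
have c6 : (0 < 6^-1 :> R)%R by rewrite invr_gt0.
by have := nsqD_le (z - y)%R y c6; rewrite invrK subrK => H'; lra.
Qed.

(** A path with [nsq] at least 8 is at squared distance at least 6 from [y], so a return within a
    short remaining time is exponentially unlikely. *)
Lemma exit_bump (p q : nat) (y : R2) (F : T -> R) (S : R) : (p <= q)%N -> (nsq y <= 9^-1)%R ->
  (eta + (tm q - tm p) <= S)%R ->
  measurable_fun setT (F : pT (tm p) -> R) -> (forall w, (0 <= F w)%R) ->
  \int[P]_w (\1_(exit p) w * F w * psi y q w)%:E <=
  (8 * expR (- (5 / (2 * S))))%:E * \int[P]_w (\1_(exit p) w * F w)%:E.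
Proof.
move=> pq y9 S1 mF F0.
have mG : measurable_fun setT ((fun w => \1_(exit p) w * F w)%R : pT (tm p) -> R).
  by apply: measurable_funM => //; apply: adapted_indic; exact: adapted_exit.
have mG' := adapted_measurable pbmB mG.
have G0 w : (0 <= \1_(exit p) w * F w)%R by apply: mulr_ge0; rewrite ?indicE.
apply: le_trans (bump_gk_step pbmB e0 de y pq mG G0) _.
have tq : (0 < eta + (tm q - tm p))%R.
  by case/andP: (tm_le e0 pq) => _ h; apply: ltr_pwDl => //; rewrite subr_ge0.
have c0 : (0 <= 8 * expR (- (5 / (2 * S))))%R by apply: mulr_ge0 => //; exact: expR_ge0.
rewrite (intrZ P c0 mG' G0); apply: intr_le.
- apply: measurable_funM => //; apply: measurable_funM => //.
  by apply: (measurableT_comp (measurable_gkB _ y)); apply: (measurable_B pbmB); exact: (tm_ge0 e0).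
- exact: measurable_funM.
- by move=> w; apply: mulr_ge0 => //; apply: mulr_ge0 => //; apply: gk_ge0; exact: ltW.
- move=> w; rewrite indicE; case: (boolP (_ \in _)) => [/set_mem ew|_]; last by rewrite !(mul0r, mulr0).
  rewrite mul1r -mulrA; apply: ler_wpM2l => //; rewrite mulrC; apply: ler_wpM2r => //.
  by apply: gk_le_expR => //; exact: exit_far.
Qed.

Lemma exit_total (b : nat) (F : T -> R) : measurable_fun setT F -> (forall w, (0 <= F w)%R) ->
  \sum_(p < b) \int[P]_w (\1_(exit p) w * F w)%:E <= \int[P]_w (F w)%:E.
Proof.
move=> mF F0.
have mG p : measurable_fun setT (fun w => \1_(exit p) w * F w)%R.
  by apply: measurable_funM => //; apply: measurable_indic; exact: measurable_exit.
have G0 p w : (0 <= \1_(exit p) w * F w)%R by apply: mulr_ge0; rewrite ?indicE.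
rewrite (intr_sum P _ (F := fun (p : 'I_b) w => (\1_(exit p) w * F w)%R))//.
apply: intr_le => //.
- by apply: measurable_sum => p; exact: mG.
- by move=> w; apply: sumr_ge0 => p _; exact: G0.
- by move=> w; apply: (sum_indic_le exit_uniq (F := fun=> F w)).
Qed.

(** The contribution of paths that reach squared radius 8 is subtracted from the full expectation.
    For an exit before [a], the loss is of order [expR (- (2 / t))] against a mass of at least
    [expR (- t^-1)], with [t = tm a <= 16^-1]. For an exit between [a] and [b], at most time [1 / 4]
    is left for the return. *)
Lemma pair_lower (a b : nat) (y : R2) : (64^-1 <= tm a)%R -> (tm a <= 16^-1)%R ->
  (nsq y <= 9^-1)%R -> (a + 4 <= b)%N -> (tm (b - a) <= 4^-1)%R ->
  (expR (- 64) / 32 / tm (b - a))%:E <=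
  \int[P]_w (\1_(quiet b) w * (psi y a w * psi y b w))%:E.
Proof.
move=> a1 a2 y9 ab g4.
have ab' : (a < b)%N by lia.
have b4 : (4 <= b - a)%N by lia.
have b0 : (0 < b - a)%N by lia.
set g := tm (b - a).
have gE : (tm b - tm a)%R = g by rewrite /g natrB ?mulrBl// ltnW.
have g0 : (0 < g)%R by apply: mulr_gt0 => //; rewrite ltr0n.
have ta : (0 < tm a)%R by apply: lt_le_trans a1; rewrite invr_gt0.
have mpsi p := measurable_psi pbmB delta e0 y p.
have mm : \int[P]_w (psi y a w)%:E \is a fin_num.
  rewrite ge0_fin_numE; last by apply: intr_ge0.
  by apply: le_lt_trans (bump_first pbmB e0 de y a1) _; rewrite ltry.
set m := fine (\int[P]_w (psi y a w)%:E).
have mE : \int[P]_w (psi y a w)%:E = m%:E by rewrite fineK.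
have mlow : (expR (- (tm a)^-1) <= m)%R by rewrite -lee_fin -mE; exact: bump_mass_lower.
have m0 : (0 <= m)%R by apply: le_trans mlow; exact: expR_ge0.
have g40 : (4 * eta <= g)%R by apply: ler_wpM2r; [exact: ltW|rewrite ler_nat].
have ma : measurable_fun setT ((fun w => psi y a w) : pT (tm a) -> R).
  by apply: (adapted_psi (B := B) delta e0 y (leqnn a)).
(* Four steps make the elapsed time at least the squared distance between points of the bump, so
   that [gk_lower] applies. *)
have low : (16^-1 / g * m)%:E <= \int[P]_w (psi y a w * psi y b w)%:E.
  rewrite EFinM -mE; apply: (@bump_lower a b) => //.
  - by apply: mulr_ge0 => //; rewrite invr_ge0 ltW.
  - move=> w v /bump_supp wy vy; rewrite gE; apply: gk_lower => //; apply: le_trans g40.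
    have n1 : (nsq (v - y) <= eta)%R.
      rewrite -de; apply: le_trans (nsq_norm _) _; apply: ler_wpM2l => //.
      by rewrite lerXn2r ?nnegrE//; exact: ltW.
    have n2 : (nsq (y - B (tm a) w) <= eta)%R.
      have hd : (2 * delta ^+ 2 <= eta)%R by rewrite de.
      rewrite -nsqN opprB; apply: le_trans (nsq_norm _) _; apply: le_trans hd; apply: ler_wpM2l => //.
      by rewrite lerXn2r ?nnegrE ?(ltW d0).
    by have := nsq_triangle v y (B (tm a) w); lra.
pose E p := \int[P]_w (\1_(exit p) w * (psi y a w * psi y b w))%R%:E.
have split : \int[P]_w (psi y a w * psi y b w)%:E <=
    \int[P]_w (\1_(quiet b) w * (psi y a w * psi y b w))%:E + \sum_(p < b.+1) E p.
  have f0 w : (0 <= psi y a w * psi y b w)%R by exact: mulr_ge0.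
  have mf : measurable_fun setT (fun w => psi y a w * psi y b w)%R by exact: measurable_funM.
  have mG (S : set T) : measurable S -> measurable_fun setT (fun w => \1_S w * (psi y a w * psi y b w))%R.
    by move=> mS; apply: measurable_funM => //; exact: measurable_indic.
  have G0 (S : set T) w : (0 <= \1_S w * (psi y a w * psi y b w))%R by apply: mulr_ge0; rewrite ?indicE.
  have mq := measurable_quiet b.
  rewrite /E (intr_sum P _ (F := fun (p : 'I_b.+1) w => (\1_(exit p) w * (psi y a w * psi y b w))%R)); first last.
  - by move=> p w.
  - by move=> p; apply: mG; exact: measurable_exit.
  rewrite (intrD P (F := fun w => (\1_(quiet b) w * (psi y a w * psi y b w))%R)
    (G := fun w => (\sum_(p < b.+1) \1_(exit p) w * (psi y a w * psi y b w))%R)); first last.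
  - by move=> w; apply: sumr_ge0 => p _.
  - by move=> w.
  - by apply: measurable_sum => p; apply: mG; exact: measurable_exit.
  - exact: mG.
  apply: intr_le => //.
  - apply: measurable_funD; first exact: mG.
    by apply: measurable_sum => p; apply: mG; exact: measurable_exit.
  - move=> w; have S0 : (0 <= \sum_(p < b.+1) \1_(exit p) w * (psi y a w * psi y b w))%R.
      by apply: sumr_ge0 => p _.
    case: (quiet_or_exit b w) => [q|[p pb ep]].
      by rewrite indicE mem_set// mul1r lerDl.
    rewrite -[leLHS]add0r; apply: lerD => //.
    have pb' : (p < b.+1)%N by [].
    rewrite (bigD1 (Ordinal pb'))//= indicE mem_set// mul1r lerDl.
    by apply: sumr_ge0 => i _.
(* With [S = 5 / 4 * tm a] the exponent is [-2 / tm a], twice that of [bump_mass_lower]; the factor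
   [32 / g] pays for the second visit. *)
pose r1 := (32 / g * (8 * expR (- (5 / (2 * (5 / 4 * tm a))))))%R.
(* [4 / 15] exceeds [eta + 1 / 4], and the exponent [-75 / 8] lies below [-9]. *)
pose r2 : R := (8 * expR (- (5 / (2 * (4 / 15)))))%R.
have r10 : (0 <= r1)%R by apply: mulr_ge0; [apply: mulr_ge0 => //; rewrite invr_ge0 ltW|apply: mulr_ge0 => //; exact: expR_ge0].
have r20 : (0 <= r2)%R by exact: (mulr_ge0 (ler0n _ 8) (expR_ge0 _)).
have m1 p : measurable_fun setT ((fun=> 1%R) : pT (tm p) -> R) by exact: measurable_cst.
have i01 p w : (0 <= \1_(exit p) w :> R)%R by rewrite indicE.
have Elow (p : nat) : (p <= a)%N -> E p <= r1%:E * \int[P]_w (\1_(exit p) w * 1)%:E.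
  move=> pa.
  have mex : measurable_fun setT (\1_(exit p) : pT (tm a) -> R).
    apply: adapted_indic; apply: (@adapted_set_mono _ _ _ _ (tm p)); last exact: adapted_exit.
    by case/andP: (tm_le e0 pa).
  have := chain_step pbmB e0 de y y (ltnW ab') mex (i01 p).
  under eq_integral do rewrite -mulrA; move=> H; apply: le_trans H _.
  have hS : (eta + (tm a - tm p) <= 5 / 4 * tm a)%R.
    have := tm_ge0 e0 p; have := esmall; move: (tm p) a1; move: (tm a) => x z; lra.
  have := @exit_bump p a y (fun=> 1%R) (5 / 4 * tm a) pa y9 hS (m1 p) (fun w => ler01).
  under eq_integral do rewrite mulr1; move=> H.
  have k0 : (0 <= 32 * kap eta (y - y)%R (b - a))%R by apply: mulr_ge0 => //; exact: kap_ge0.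
  apply: le_trans (lee_wpmul2l (_ : 0 <= (32 * kap eta (y - y)%R (b - a))%R%:E) H) _; first by rewrite lee_fin.
  rewrite muleA -EFinM; apply: lee_wpmul2r.
    by apply: intr_ge0 => w; rewrite mulr1 indicE.
  rewrite lee_fin /r1; apply: ler_wpM2r; first by apply: mulr_ge0 => //; exact: expR_ge0.
  apply: ler_wpM2l => //; rewrite /kap subrr nsq00 addr0 lef_pV2 ?posrE -/g//; last exact: addr_gt0.
  by rewrite lerDr ltW.
have Ehigh (p : nat) : (a < p)%N -> (p <= b)%N -> E p <= r2%:E * \int[P]_w (\1_(exit p) w * psi y a w)%:E.
  move=> ap pb; rewrite /E; under eq_integral do rewrite mulrA.
  apply: exit_bump => //; last exact: (adapted_psi delta e0 y (ltnW ap)).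
  have : (tm a <= tm p)%R by case/andP: (tm_le e0 (ltnW ap)).
  have h1 := esmall; have h2 : (g <= 4^-1)%R := g4.
  move: h1 h2 gE; move: (tm p) (tm a) (tm b) => p1 a3 b1; lra.
have Esum : \sum_(p < b.+1) E p <= r1%:E + r2%:E * m%:E.
  apply: (@le_trans _ _ (\sum_(p < b.+1) (r1%:E * \int[P]_w (\1_(exit p) w * 1)%:E +
      r2%:E * \int[P]_w (\1_(exit p) w * psi y a w)%:E))).
    have i0 p F : (forall w, (0 <= F w :> R)%R) -> 0 <= \int[P]_w (\1_(exit p) w * F w)%R%:E.
      by move=> F0; apply: intr_ge0 => w; apply: mulr_ge0; rewrite ?indicE.
    apply: lee_sum => p _; have [pa|ap] := leqP p a.
      by apply: le_trans (Elow p pa) _; apply: leeDl; apply: mule_ge0; rewrite ?lee_fin//; exact: i0.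
    apply: le_trans (Ehigh p ap (ltn_ord p)) _; apply: leeDr.
    by apply: mule_ge0; rewrite ?lee_fin//; apply: (i0 p (fun=> 1%R)).
  rewrite big_split /= -!ge0_sume_distrr; first last.
  - by move=> p _; apply: intr_ge0 => w; apply: mulr_ge0; rewrite ?indicE.
  - by move=> p _; apply: intr_ge0 => w; apply: mulr_ge0; rewrite ?indicE.
  apply: leeD.
    rewrite -[leRHS]mule1; apply: lee_wpmul2l; first by rewrite lee_fin.
    apply: le_trans (exit_total b.+1 (F := fun=> 1%R) (measurable_cst _) (fun w => ler01)) _.
    by rewrite integral_prob_cst.
  apply: lee_wpmul2l; first by rewrite lee_fin.
  by rewrite -mE; apply: exit_total.
have key : (16^-1 / g * m)%:E <= \int[P]_w (\1_(quiet b) w * (psi y a w * psi y b w))%:E + (r1 + r2 * m)%:E.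
  by apply: le_trans low _; apply: le_trans split _; apply: leeD.
have gi : (0 < g^-1)%R by rewrite invr_gt0.
(* Each of the two losses is at most [1 / 64] of [m / g], which leaves [1 / 32] out of the initial
   [1 / 16]. *)
have R1 : (r1 <= 64^-1 / g * m)%R.
  rewrite /r1; have tai : (16 <= (tm a)^-1)%R.
    by rewrite -[16%R]invrK lef_pV2 ?posrE ?invr_gt0.
  have fE (x : R) : (0 < x)%R -> (5 / (2 * (5 / 4 * x)) = x^-1 + x^-1)%R.
    by move=> x0; field; exact: lt0r_neq0.
  rewrite (fE _ ta).
  rewrite opprD expRD; have h16 : (2 ^+ 16 <= expR (tm a)^-1)%R.
    by apply: le_trans (expR_ge_exp2 16) _; rewrite ler_expR.
  have ex : (expR (- (tm a)^-1) * 2 ^+ 16 <= 1)%R.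
    apply: (@le_trans _ _ (expR (- (tm a)^-1) * expR (tm a)^-1)%R).
      by apply: ler_wpM2l => //; exact: expR_ge0.
    by rewrite -expRD addNr expR0.
  move: mlow ex (expR_ge0 (- (tm a)^-1)); move: (expR (- (tm a)^-1)) => x xm x16 x0.
  rewrite [leLHS](_ : _ = g^-1 * (256 * (x * x)))%R; last by ring.
  rewrite [leRHS](_ : _ = g^-1 * (64^-1 * m))%R; last by ring.
  apply: ler_wpM2l; first exact: ltW.
  have xx : (x * x <= x * m)%R by exact: ler_wpM2l.
  have x1 : (x * m * 2 ^+ 16 <= m)%R.
    by rewrite mulrAC -[leRHS]mul1r; apply: ler_wpM2r.
  move: xx x1; rewrite (_ : 2 ^+ 16 = 256 * 256 :> R)%R; last by ring.
  by move: (x * x)%R (x * m)%R => p q; lra.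
have R2' : (r2 * m <= 64^-1 / g * m)%R.
  apply: ler_wpM2r => //; rewrite /r2.
  have h9 : (expR (- (5 / (2 * (4 / 15)))) * 2 ^+ 9 <= 1 :> R)%R.
    apply: (@le_trans _ _ (expR (- 9%:R) * expR 9%:R)%R); last by rewrite -expRD addNr expR0.
    apply: ler_pM; rewrite ?expR_ge0//; last exact: (expR_ge_exp2 9).
    by rewrite ler_expR; lra.
  have : (64^-1 * 4 <= 64^-1 / g)%R.
    by apply: ler_wpM2l => //; rewrite -[4%R]invrK lef_pV2 ?posrE ?invr_gt0.
  move: h9; rewrite (_ : 2 ^+ 9 = 512 :> R)%R; last by ring.
  by move: (expR _) (64^-1 / g)%R => p q; lra.
have fin : (expR (- 64) / 32 / g <= 32^-1 / g * m)%R.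
  rewrite (_ : expR (- 64) / 32 / g = 32^-1 / g * expR (- 64))%R; last by ring.
  apply: ler_wpM2l; first by apply: mulr_ge0 => //; exact: ltW.
  apply: le_trans mlow; rewrite ler_expR lerN2.
  by rewrite -[leRHS]invrK lef_pV2 ?posrE ?invr_gt0.
move: key; case: (\int[P]_w _) => [e|_|]; [|by rewrite leey|by rewrite addNye leeNy_eq].
rewrite -EFinD !lee_fin; move: fin R1 R2'.
rewrite (_ : 64^-1 / g * m = 64^-1 * (g^-1 * m))%R; last by ring.
rewrite (_ : 32^-1 / g * m = 32^-1 * (g^-1 * m))%R; last by ring.
rewrite (_ : 16^-1 / g * m = 16^-1 * (g^-1 * m))%R; last by ring.
by move: (_ / _)%R (r2 * m)%R (g^-1 * m)%R => p q r; lra.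
Qed.

End first_moment.

(** The parameter is optimised at [a = m / S]; this takes the place of the Cauchy-Schwarz
    inequality. *)
Lemma young_min (R : realType) (m S p : R) : 0 < m -> 0 <= S -> p <= 1 ->
  (forall a, 0 < a -> m <= a / 2 * S + (2 * a)^-1 * p) -> m ^+ 2 <= S * p.
Proof.
move=> m0 S0 p1 H; have [SE|Sp] := eqVneq S 0.
  have mi : 0 < m^-1 by rewrite invr_gt0.
  have := H m^-1 mi; rewrite SE mulr0 add0r invfM invrK => h.
  have : 2^-1 * m * p <= 2^-1 * m * 1 by apply: ler_wpM2l => //; lra.
  lra.
have S1 : 0 < S by rewrite lt_def Sp.
have := H (m / S) (divr_gt0 m0 S1) => h.
have e1 : m / S / 2 * S = m / 2 by field.
have e2 : (2 * (m / S))^-1 * p = S * p / (2 * m) by field; do ?[apply/andP; split]; exact: lt0r_neq0.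
rewrite e1 e2 in h.
have h2 : m / 2 <= S * p / (2 * m) by lra.
have := ler_wpM2r (_ : 0 <= 2 * m) h2.
have -> : S * p / (2 * m) * (2 * m) = S * p by field; exact: lt0r_neq0.
have -> : m / 2 * (2 * m) = m ^+ 2 by field.
by apply; lra.
Qed.

Section average_product.
Context d (T : measurableType d) (R : realType) (P : probability T R).
Context (mu : probability (R * R)%type R) (V : T * (R * R) -> R) (K : R).
Hypotheses (mV : measurable_fun setT V) (V0 : forall x, 0 <= V x) (VK : forall x, V x <= K).
Local Open Scope ereal_scope.

Let mG (G : T -> R) : measurable_fun setT G ->
  measurable_fun setT (fun z : T * (R * R) => (G z.1 * V z)%:E).
Proof.
move=> mG; apply/measurable_EFinP; apply: measurable_funM => //.
by apply: (measurableT_comp mG); exact: measurable_fst.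
Qed.

Lemma avg_swap (G : T -> R) : measurable_fun setT G -> (forall w, (0 <= G w)%R) ->
  \int[P]_w (G w * avg mu V w)%:E = \int[mu]_y \int[P]_w (G w * V (w, y))%:E.
Proof.
move=> mG' G0.
rewrite -(fubini_tonelli (m1 := P) (m2 := mu) (fun z => (G z.1 * V z)%:E))//; last 2 first.
- exact: mG.
- by move=> z; rewrite lee_fin mulr_ge0.
apply: eq_integral => w _ /=; rewrite EFinM (avgE mu mV V0 VK).
rewrite (intrZ mu (c := G w) (F := fun y => V (w, y)))//.
by apply: (measurableT_comp mV); exact: pair1_measurable.
Qed.

Lemma measurable_avg_pair (G : T -> R) : measurable_fun setT G -> (forall w, (0 <= G w)%R) ->
  measurable_fun setT (fun y => \int[P]_w (G w * V (w, y))%:E).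
Proof.
move=> mG' G0; apply: (measurable_fun_fubini_tonelli_G (m1 := P) (fun z => (G z.1 * V z)%:E)).
  exact: mG.
by move=> z; rewrite lee_fin mulr_ge0.
Qed.

Lemma avg_square_le (g : (R * R) * (R * R) -> \bar R) (c : R) : (0 <= c)%R ->
  measurable_fun setT g -> (forall u, 0 <= g u) ->
  (forall y y', \int[P]_w (V (w, y) * V (w, y'))%:E <= c%:E * g (y, y')) ->
  \int[P]_w (avg mu V w * avg mu V w)%:E <= c%:E * \int[mu]_y \int[mu]_y' g (y, y').
Proof.
move=> c0 mg g0 H.
have mA := measurable_avg mu mV V0.
have A0 := avg_ge0 mu mV V0 VK.
rewrite (avg_swap mA A0).
have mVy y : measurable_fun setT (fun w => V (w, y)).
  by apply: (measurableT_comp mV); exact: pair2_measurable.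
have mgy y : measurable_fun setT (fun y' => g (y, y')).
  by apply: (measurableT_comp mg); exact: pair1_measurable.
have mgg : measurable_fun setT (fun y => \int[mu]_y' g (y, y')).
  exact: (measurable_fun_fubini_tonelli_F (m2 := mu) g).
rewrite -ge0_integralZl//; last by move=> y _; apply: integral_ge0.
apply: ge0_le_integral => //.
- by move=> y _; apply: integral_ge0 => w _; rewrite lee_fin mulr_ge0.
- exact: measurable_avg_pair.
- exact: measurable_funeM.
move=> y _; under eq_integral do rewrite mulrC.
rewrite (avg_swap (mVy y) (fun w => V0 (w, y))) -ge0_integralZl//.
apply: ge0_le_integral => //.
- by move=> y' _; apply: integral_ge0 => w _; rewrite lee_fin mulr_ge0.
- exact: measurable_avg_pair.
- exact: measurable_funeM.
Qed.

End average_product.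

(** * Positive probability of approximate double points at a fixed mesh *)

Section positive_probability.
Context d (T : measurableType d) (R : realType) (P : probability T R).
Context (B : R -> T -> R * R) (pbmB : planar_brownian_motion P (1, 0) B).
Context (A : set (R * R)) (eps delta eta : R) (L' N1 G : nat).
Hypotheses (cA : closed A) (A9 : forall y, A y -> nsq y <= 9^-1).
Hypotheses (eps0 : 0 < eps) (eps3 : eps < 1 / 3).
Hypotheses (e0 : 0 < eta) (d0 : 0 < delta) (de : 2 * delta ^+ 2 = eta) (esmall : eta <= 512^-1).
Hypotheses (L2 : (2 <= L')%N) (LE : 2 * L'%:R * eta = eps ^+ 2).
Hypotheses (N1l : 64^-1 <= N1%:R * eta) (N1u : N1%:R * eta <= 32^-1).
Hypotheses (Gl : 5^-1 <= G%:R * eta) (Gu : G%:R * eta <= 4^-1).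
Local Notation tm j := (j%:R * eta).
Local Notation psi y p w := (bump delta y (B (tm p) w)).
Local Notation R2 := (R * R)%type.
Local Notation M := (2 * N1 + G)%N.

(** In real time the first visit lies between [1 / 64] and [1 / 16], and the gap between [eps ^+ 2]
    and [1 / 4], as [pair_lower] requires. *)
Definition window_ok (u : 'I_M * 'I_M) : bool :=
  ((N1 <= u.1) && (u.1 < N1 + N1) && ((u.1 + 2 * L' <= u.2) && (u.2 < u.1 + 2 * L' + (G - 2 * L'))))%N.

Definition quiet_intersections y w : R :=
  \sum_(u : 'I_M * 'I_M) (window_ok u)%:R * eta ^+ 2 *
    (\1_(quiet B eta u.2) w * (psi y u.1 w * psi y u.2 w)).

Let u0 y x : 0 <= bump delta y x. Proof. exact: bump_ge0. Qed.

Let LG : (2 * L' <= G)%N.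
Proof.
have h1 := LE; have h2 := Gl; have h3 := eps3; have h4 := eps0.
rewrite -(ler_nat R) natrM -(ler_pM2r e0) h1; apply: le_trans h2.
rewrite expr2; apply: (@le_trans _ _ (1 / 3 * (1 / 3))); [apply: ler_pM; lra|lra].
Qed.

Lemma quiet_intersections_ge0 y w : 0 <= quiet_intersections y w.
Proof.
apply: sumr_ge0 => u _; apply: mulr_ge0; first by apply: mulr_ge0; [exact: ler0n|exact: sqr_ge0].
by apply: mulr_ge0; [rewrite indicE|exact: mulr_ge0].
Qed.

Lemma quiet_intersections_le y w :
  quiet_intersections y w <= intersections B delta eta L' (M) N1 y w.
Proof.
apply: ler_sum => u _; have p0 : 0 <= psi y u.1 w * psi y u.2 w by exact: mulr_ge0.
apply: ler_pM => //.
- by apply: mulr_ge0; [exact: ler0n|exact: sqr_ge0].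
- by apply: mulr_ge0 => //; rewrite indicE.
- apply: ler_wpM2r; first exact: sqr_ge0.
  rewrite /window_ok /pair_ok; case: (N1 <= u.1)%N => //=.
  by case: (u.1 < _)%N => //=; case: (_ <= u.2)%N => //=; case: (_ < _)%N.
- by rewrite indicE; case: (_ \in _); rewrite ?mul1r ?mul0r.
Qed.

Lemma quiet_intersections_bound y w : quiet_intersections y w <=
  \sum_(u : 'I_M * 'I_M) eta ^+ 2 * ((4 * delta ^+ 2)^-1 * (4 * delta ^+ 2)^-1).
Proof.
apply: ler_sum => u _; have p0 : 0 <= psi y u.1 w * psi y u.2 w by exact: mulr_ge0.
apply: ler_pM.
- by apply: mulr_ge0; [exact: ler0n|exact: sqr_ge0].
- by apply: mulr_ge0 => //; rewrite indicE.
- by case: (window_ok u); rewrite ?mul1r// mul0r sqr_ge0.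
- apply: (@le_trans _ _ (psi y u.1 w * psi y u.2 w)).
    by rewrite indicE; case: (_ \in _); rewrite ?mul1r ?mul0r.
  by apply: ler_pM => //; exact: bump_le.
Qed.

Local Open Scope ereal_scope.

Definition first_cst : R := (expR (- 64) / 32 / 128)%R.

(** Summing the inverse gaps produces [ln 5^-1 - 2 * ln eps], at least half of [f_gauge eps]; the
    admissible first visits occupy a time of at least [1 / 64], whence the [128] in [first_cst]. *)
Lemma quiet_first_moment (y : R2) : (nsq y <= 9^-1)%R ->
  (first_cst * f_gauge eps)%:E <= \int[P]_w (quiet_intersections y w)%:E.
Proof.
move=> y9; pose k : R := (expR (- 64) / 32)%R.
have k0 : (0 <= k)%R by apply: mulr_ge0; [exact: expR_ge0|rewrite invr_ge0].
have mq (u : 'I_M * 'I_M) : measurable_fun setT (fun w => \1_(quiet B eta u.2) w * (psi y u.1 w * psi y u.2 w))%R.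
  apply: measurable_funM; first by apply: measurable_indic; exact: (measurable_quiet pbmB e0).
  by apply: measurable_funM; exact: (measurable_psi pbmB).
have q0 (u : 'I_M * 'I_M) w : (0 <= \1_(quiet B eta u.2) w * (psi y u.1 w * psi y u.2 w))%R.
  by apply: mulr_ge0; [rewrite indicE|exact: mulr_ge0].
have c0 (u : 'I_M * 'I_M) : (0 <= (window_ok u)%:R * eta ^+ 2)%R.
  by apply: mulr_ge0; [exact: ler0n|exact: sqr_ge0].
rewrite -(intr_sum P _ (F := fun u w => ((window_ok u)%:R * eta ^+ 2 *
    (\1_(quiet B eta u.2) w * (psi y u.1 w * psi y u.2 w)))%R)); first last.
- by move=> u w; exact: (mulr_ge0 (c0 u) (q0 u w)).
- by move=> u; apply: measurable_funM => //.
pose kk (a b : nat) : R := (eta * (eta / tm (b - a)))%R.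
apply: (@le_trans _ _ (\sum_(u : 'I_M * 'I_M) ((window_ok u)%:R * (k * kk u.1 u.2))%R%:E)).
  rewrite sumEFin lee_fin -(pair_bigA _ (fun i j : 'I_M =>
    ((window_ok (i, j))%:R * (k * kk i j))%R)) /=.
  pose S := (\sum_(q < G - 2 * L') eta / tm (2 * L' + q))%R.
  have inner (i : 'I_M) : (N1 <= i)%N -> (i < N1 + N1)%N ->
      (\sum_(j < M) (window_ok (i, j))%:R * (k * kk i j) = k * (eta * S))%R.
    move=> i1 i2; rewrite /window_ok /= i1 i2 /=.
    have nb : (i + 2 * L' + (G - 2 * L') <= M)%N.
      rewrite -addnA subnKC ?LG//; apply: (@leq_trans (N1 + N1 + G)%N).
        by rewrite leq_add2r ltnW.
      by rewrite mul2n -addnn.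
    rewrite (window_sum (fun b => k * kk i b)%R nb).
    rewrite /S 2!mulr_sumr; apply: eq_bigr => q _; rewrite /kk.
    by rewrite -addnA addKn.
  have -> : (\sum_(i < M) \sum_(j < M) (window_ok (i, j))%:R * (k * kk i j) =
      \sum_(i < M) ((N1 <= i) && (i < N1 + N1))%N%:R * (k * (eta * S)))%R.
    apply: eq_bigr => i _; case: (boolP ((N1 <= i) && (i < N1 + N1))%N) => [/andP[i1 i2]|ni].
      by rewrite mul1r inner.
    rewrite mul0r big1// => j _; rewrite /window_ok /= (negbTE ni) /= mul0r //.
  have nb : (N1 + N1 <= M)%N by rewrite mul2n -addnn leq_addr.
  rewrite (window_sum (fun=> k * (eta * S))%R nb).
  rewrite sumr_const card_ord -mulr_natl.
  have Sl : (f_gauge eps / 2 <= S)%R.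
    have ep := eps0; have e3 := eps3; have [f1 fE] := f_gauge_ge ep e3.
    have a0 : (0 < eps ^+ 2)%R by rewrite exprn_gt0.
    have := log_sum_lower (G - 2 * L') a0 (ltW e0).
    have -> : (\sum_(q < G - 2 * L') eta / (eps ^+ 2 + q%:R * eta) = S)%R.
      by apply: eq_bigr => q _; rewrite natrD natrM mulrDl LE.
    apply: le_trans.
    have -> : (eps ^+ 2 + (G - 2 * L')%:R * eta = tm G)%R.
      by rewrite natrB// mulrBl natrM LE addrC subrK.
    have l1 : (ln (5^-1) <= ln (tm G))%R.
      by rewrite ler_ln ?posrE ?invr_gt0//; apply: lt_le_trans Gl; rewrite invr_gt0.
    have l2 : (ln (eps ^+ 2) = 2 * ln eps)%R by rewrite lnXn//; ring.
    have l3 : (ln (5^-1 : R) = - ln 5)%R by rewrite lnV// posrE.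
    have l4 : (ln 3 <= - ln eps :> R)%R.
      rewrite -lnV ?posrE// ler_ln ?posrE ?invr_gt0//.
      by rewrite -[3%R]invrK lef_pV2 ?posrE ?invr_gt0//; apply: ltW; move: e3; rewrite mul1r.
    (* This is [25 <= 27]. With [eps < 1 / 3] it bounds [ln 5] by three halves of [f_gauge eps]. *)
    have l5 : (2 * ln 5 <= 3 * ln 3 :> R)%R.
      have -> : (2 * ln 5 = ln (5 ^+ 2) :> R)%R by rewrite lnXn//; ring.
      have -> : (3 * ln 3 = ln (3 ^+ 3) :> R)%R by rewrite lnXn//; ring.
      by rewrite ler_ln ?posrE ?exprn_gt0//; lra.
    rewrite fE l2; move: l1 l3 l4 l5; move: (ln (tm G)) (ln eps) (ln 5) (ln 3) (ln 5^-1) => p q r s t; lra.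
  have ee : (64^-1 * (k * (f_gauge eps / 2)) <= N1%:R * eta * (k * S))%R.
    apply: ler_pM => //; first by apply: mulr_ge0 => //; apply: divr_ge0 => //; exact: normr_ge0.
    by apply: ler_wpM2l.
  rewrite (_ : N1%:R * (k * (eta * S)) = N1%:R * eta * (k * S))%R; last by ring.
  apply: le_trans ee; rewrite /first_cst -/k; apply: eq_ler.
  have H (x f : R) : (x / 128 * f = 64^-1 * (x * (f / 2)))%R by field.
  exact: H.
apply: lee_sum => u _; rewrite /window_ok.
case: (boolP (_ && _)) => [/andP[/andP[a1 a2] /andP[b1 b2]]|_]; last first.
  by rewrite !mul0r; apply: intr_ge0 => w; rewrite !mul0r.
rewrite (_ : \int[P]_w _ = \int[P]_w (eta ^+ 2 * (\1_(quiet B eta u.2) w * (psi y u.1 w * psi y u.2 w)))%R%:E); last first.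
  by apply: eq_integral => w _; rewrite mul1r.
rewrite -(intrZ P (sqr_ge0 eta) (mq u) (q0 u)).
have -> : (1 * (k * kk u.1 u.2) = eta ^+ 2 * (k / tm (u.2 - u.1)))%R by rewrite /kk; ring.
rewrite EFinM; apply: lee_wpmul2l; first by rewrite lee_fin sqr_ge0.
have ep := ltW e0; apply: (pair_lower pbmB e0 d0 de esmall) => //.
- by apply: le_trans N1l _; apply: ler_wpM2r => //; rewrite ler_nat.
- apply: (@le_trans _ _ (tm (N1 + N1))); first by apply: ler_wpM2r => //; rewrite ler_nat ltnW.
  by rewrite natrD mulrDl; have := N1u; move: (N1%:R * eta)%R => q; lra.
- by apply: leq_trans b1; rewrite leq_add2l (leq_mul2l 2 2 L').
- apply: le_trans Gu; apply: ler_wpM2r => //; by rewrite ler_nat leq_subLR (leq_trans (ltnW b2))// -addnA subnKC ?LG.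
Qed.

Definition second_cst : R := (chain_cst R * (3 * 750))%R.

Lemma second_cst_gt0 : (0 < second_cst)%R.
Proof. by rewrite /second_cst /chain_cst; lra. Qed.

Lemma second_moment_pair (y y' : R2) : A y -> A y' ->
  \int[P]_w (quiet_intersections y w * quiet_intersections y' w)%:E <=
  (second_cst * f_gauge eps ^+ 2)%:E * gauge_kernel (h_gauge eps) (eucl_norm (y - y')%R).
Proof.
move=> Ay Ay'; have C0 : (0 <= chain_cst R)%R by exact: chain_cst_ge0.
have mI z : measurable_fun setT (fun w => intersections B delta eta L' (M) N1 z w).
  apply: measurable_sum => u; apply: measurable_funM => //.
  by apply: measurable_funM; exact: (measurable_psi pbmB).
have mQ z : measurable_fun setT (fun w => quiet_intersections z w).
  apply: measurable_sum => u; apply: measurable_funM => //.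
  apply: measurable_funM; first by apply: measurable_indic; exact: (measurable_quiet pbmB e0).
  by apply: measurable_funM; exact: (measurable_psi pbmB).
have Q0 := quiet_intersections_ge0; have QI := quiet_intersections_le.
have I0 z w : (0 <= intersections B delta eta L' (M) N1 z w)%R by apply: le_trans (QI z w).
have tM : (tm M <= 1 / 2)%R.
  by rewrite natrD natrM mulrDl -mulrA; have := N1u; have := Gu; move: (N1%:R * eta)%R (G%:R * eta)%R => p q; lra.
have fe0 : (0 < f_gauge eps)%R by have [] := f_gauge_ge eps0 eps3; lra.
have zz := nsq_ge0 (y - y')%R.
rewrite /gauge_kernel eucl_norm_eq0; case: eqP => [zE|/eqP zN].
  rewrite gt0_muley; first exact: leey.
  by rewrite lte_fin; apply: mulr_gt0; [exact: second_cst_gt0|exact: exprn_gt0].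
have zp : (0 < nsq (y - y')%R)%R by rewrite lt_def zN.
apply: (@le_trans _ _ (\int[P]_w (intersections B delta eta L' (M) N1 y w *
   intersections B delta eta L' (M) N1 y' w)%:E)).
  apply: intr_le.
  - exact: measurable_funM.
  - exact: measurable_funM.
  - by move=> w; exact: mulr_ge0.
  - by move=> w; exact: ler_pM.
apply: le_trans (intersections_product pbmB L' e0 de y y' N1l tM) _.
have z49 : (nsq (y - y')%R <= 4 / 9)%R.
  have := nsqD_le y (- y')%R (ltr01 : (0 < 1 :> R)%R); rewrite invr1 nsqN.
  by have := A9 Ay; have := A9 Ay'; lra.
have e2 : (eta <= 1 / 2)%R by have := esmall; lra.
have Kb := kap_sum e0 tM zp z49 e2.
have Lb := lam_sum e0 tM (ltnW L2) LE eps0 eps3.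
have K0 : (0 <= \sum_(g < M) eta * kap eta (y - y')%R g)%R.
  by apply: sumr_ge0 => g _; apply: mulr_ge0; [exact: ltW|exact: kap_ge0].
have L0 : (0 <= \sum_(g < M) eta * lam eta L' g)%R.
  by apply: sumr_ge0 => g _; apply: mulr_ge0; [exact: ltW|exact: lam_ge0].
have en0 : (0 < eucl_norm (y - y')%R)%R.
  by rewrite lt_def sqrtr_ge0 andbT eucl_norm_eq0.
have en1 : (eucl_norm (y - y')%R <= 1)%R.
  rewrite -(ler_pXn2r (n := 2))// ?nnegrE//; last exact: sqrtr_ge0.
  by rewrite eucl_norm_sqr expr1n; lra.
have := gauge_upper eps0 eps3 en0 en1 K0 L0 Kb Lb.
move: (_ + _)%R => X HX; rewrite -EFinM lee_fin.
have := ler_wpM2l C0 HX; move=> H2; have H3 := ler_wpM2l (ler0n R 3) H2.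
rewrite mulrCA; apply: le_trans H3 _; rewrite /second_cst.
by move: (h_gauge _ _) (f_gauge eps ^+ 2)%R (chain_cst R) => h f C; apply: eq_ler; ring.
Qed.

Context (mu : probability (R * R)%type R).
Hypothesis muA : mu A = 1.

Definition mark_density (x : T * R2) : R := (\1_A x.2 * quiet_intersections x.2 x.1)%R.

Let bound : R := (\sum_(u : 'I_M * 'I_M) eta ^+ 2 * ((4 * delta ^+ 2)^-1 * (4 * delta ^+ 2)^-1))%R.

Lemma measurable_mark_density : measurable_fun setT mark_density.
Proof.
have mA : measurable A by exact: closed_measurable2.
apply: measurable_funM.
  apply: (measurableT_comp (f := (\1_A : R2 -> R))); last exact: measurable_snd.
  exact: measurable_indic.
have mps (p : nat) : measurable_fun setT (fun x : T * R2 => psi x.2 p x.1).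
  apply: measurable_bump2; first exact: measurable_snd.
  apply: (measurableT_comp (measurable_B pbmB _)); last exact: measurable_fst.
  exact: tm_ge0.
apply: measurable_sum => u; apply: measurable_funM => //; apply: measurable_funM.
  apply: (measurableT_comp (f := (\1_(quiet B eta u.2) : T -> R))); last exact: measurable_fst.
  by apply: measurable_indic; exact: (measurable_quiet pbmB e0).
exact: measurable_funM.
Qed.

Lemma mark_density_ge0 x : (0 <= mark_density x)%R.
Proof. by apply: mulr_ge0; [rewrite indicE|exact: quiet_intersections_ge0]. Qed.

Lemma mark_density_le x : (mark_density x <= bound)%R.
Proof.
apply: le_trans (quiet_intersections_bound x.2 x.1).
by rewrite /mark_density indicE; case: (_ \in _); rewrite ?mul1r// mul0r quiet_intersections_ge0.
Qed.

Definition mark_event : set T := [set w | (0 < avg mu mark_density w)%R].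

Let mV := measurable_mark_density.
Let mZ := measurable_avg mu mV mark_density_ge0.
Let Z0 := avg_ge0 mu mV mark_density_ge0 mark_density_le.

Lemma measurable_mark_event : measurable mark_event.
Proof.
have -> : mark_event = ~` [set w | (avg mu mark_density w <= 0)%R].
  by apply/seteqP; split => w; rewrite /mark_event /= ltNge => /negP.
apply: measurableC.
have := measurable_fun_le measurableT mZ (measurable_cst (0%R : R)).
by rewrite setTI.
Qed.

(** Without an admissible pair of visits near a common point of [A], every term of the count would
    vanish for every point, and so would the average. *)
Lemma mark_event_witness w : mark_event w -> exists a b y,
  [/\ (a + 2 * L' <= b)%N, (tm b <= 1)%R, A y, quiet B eta b w &
      (`|B (tm a) w - y| <= delta)%R /\ (`|B (tm b) w - y| <= delta)%R].
Proof.
move=> Zw; apply: contrapT => H.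
suff : avg mu mark_density w = 0%R by move=> ZE; move: Zw; rewrite /mark_event /= ZE ltxx.
rewrite /avg integral0_eq// => y _; rewrite /mark_density /= indicE.
case: (boolP (_ \in _)) => [/set_mem Ay|_]; last by rewrite mul0r.
rewrite mul1r /quiet_intersections big1// => u _.
rewrite /window_ok; case: (boolP (_ && _)) => [/andP[_ /andP[b1 b2]]|_]; last by rewrite !mul0r.
have [q|nq] := pselect (quiet B eta u.2 w); last by rewrite indicE memNset// mul0r mulr0.
have [->|/bump_supp p1] := eqVneq (psi y u.1 w) 0%R; first by rewrite mul0r !mulr0.
have [->|/bump_supp p2] := eqVneq (psi y u.2 w) 0%R; first by rewrite !mulr0.
exfalso; apply: H; exists u.1, u.2, y; split => //.
apply: (@le_trans _ _ (tm M)); first by apply: ler_wpM2r; [exact: ltW|rewrite ler_nat ltnW].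
by rewrite natrD natrM mulrDl -mulrA; have := N1u; have := Gu; move: (N1%:R * eta)%R (G%:R * eta)%R => p q'; lra.
Qed.

(** On the event that the average [Z] is positive, [Z <= a / 2 * Z ^+ 2 + 1 / (2 * a)]; taking
    expectations and optimising by [young_min] compares the squared first moment with the second.
    The powers of [f_gauge eps] cancel. *)
Lemma mark_event_prob (e : R) : energy (h_gauge eps) mu = e%:E ->
  (first_cst ^+ 2 <= second_cst * e * fine (P mark_event))%R.
Proof.
move=> eE; have C0 : (0 <= chain_cst R)%R by exact: chain_cst_ge0.
have [f1 fE] := f_gauge_ge eps0 eps3.
have fe0 : (0 < f_gauge eps)%R by lra.
have c10 : (0 < first_cst)%R by rewrite /first_cst !divr_gt0// expR_gt0.
have mE := measurable_mark_event.
have pf : P mark_event \is a fin_num by exact: fin_num_measure.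
set p := fine (P mark_event); have pE : P mark_event = p%:E by rewrite /p fineK.
have p1 : (p <= 1)%R by rewrite -lee_fin -pE; exact: probability_le1.
have ee0 : (0 <= e)%R by rewrite -lee_fin -eE; exact: energy_h_ge0.
pose C := second_cst.
have CC : (0 <= C)%R by exact: ltW second_cst_gt0.
pose Sm := (C * f_gauge eps ^+ 2)%R.
have Sm0 : (0 <= Sm)%R by apply: mulr_ge0 => //; exact: sqr_ge0.
have mA : measurable A by exact: closed_measurable2.
have first : (first_cst * f_gauge eps)%:E <= \int[P]_w (avg mu mark_density w)%:E.
  have := avg_swap P mu mV mark_density_ge0 mark_density_le (measurable_cst (1%R : R)) (fun w : T => ler01).
  under eq_integral do rewrite mul1r.
  move=> ->.
  rewrite -[leLHS](integral_prob_cst mu).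
  apply: ae_ge0_le_integral => //.
  - by move=> y _; rewrite lee_fin; apply: mulr_ge0; exact: ltW.
  - by move=> y _; apply: integral_ge0 => w _; rewrite lee_fin mul1r mark_density_ge0.
  - exact: (measurable_avg_pair P mV mark_density_ge0 (measurable_cst (1%R : R)) (fun w : T => ler01)).
  exists (~` A); split; first exact: measurableC.
    by have := probability_setC mu mA; rewrite muA subee// => ->.
  move=> y /= ny Ay; apply: ny => _; apply: le_trans (quiet_first_moment (A9 Ay)) _.
  by rewrite le_eqVlt; apply/orP; left; apply/eqP; apply: eq_integral => w _; rewrite mul1r /mark_density /= indicE mem_set// mul1r.
have mg : measurable_fun setT (fun u : R2 * R2 => gauge_kernel (h_gauge eps) (eucl_norm (u.1 - u.2)%R)).
  apply: (measurableT_comp (measurable_gauge_kernel eps)).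
  by apply: measurable_funB2; [exact: measurable_fst|exact: measurable_snd].
have second : \int[P]_w (avg mu mark_density w * avg mu mark_density w)%:E <= (Sm * e)%:E.
  rewrite [leRHS]EFinM -eE /energy.
  have H0 (u : R2 * R2) : 0 <= gauge_kernel (h_gauge eps) (eucl_norm (u.1 - u.2)%R) by exact: gauge_kernel_ge0.
  have H1 y y' : \int[P]_w (mark_density (w, y) * mark_density (w, y'))%:E <=
      Sm%:E * gauge_kernel (h_gauge eps) (eucl_norm (y - y')%R).
    have g0 : 0 <= Sm%:E * gauge_kernel (h_gauge eps) (eucl_norm (y - y')%R).
      by apply: mule_ge0; [rewrite lee_fin|exact: gauge_kernel_ge0].
    have [Ay|nAy] := pselect (A y); last first.
      under eq_integral do rewrite /mark_density /= indicE memNset// !mul0r.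
      by rewrite integral0.
    have [Ay'|nAy'] := pselect (A y'); last first.
      under eq_integral do rewrite /mark_density /= mulrC indicE memNset// !mul0r.
      by rewrite integral0.
    under eq_integral do rewrite /mark_density /= !indicE !mem_set// !mul1r.
    exact: second_moment_pair.
  exact: (avg_square_le mu mV mark_density_ge0 mark_density_le Sm0 mg H0 H1).
suff : ((first_cst * f_gauge eps) ^+ 2 <= Sm * e * p)%R.
  rewrite exprMn /Sm (_ : C * f_gauge eps ^+ 2 * e * p = (C * e * p) * f_gauge eps ^+ 2)%R; last by ring.
  by rewrite ler_pM2r// exprn_gt0.
apply: young_min => // [||a a0]; [exact: mulr_gt0|exact: mulr_ge0|].
rewrite -lee_fin; apply: le_trans first _.
have ai : (0 <= (2 * a)^-1)%R by rewrite invr_ge0; lra.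
have a2 : (0 <= a / 2)%R by lra.
have mZ2 : measurable_fun setT (fun w => avg mu mark_density w * avg mu mark_density w)%R by exact: measurable_funM.
have mI : measurable_fun setT (\1_mark_event : T -> R) by exact: measurable_indic.
have Z20 w : (0 <= avg mu mark_density w * avg mu mark_density w)%R by exact: mulr_ge0.
have i0 w : (0 <= \1_mark_event w :> R)%R by rewrite indicE.
apply: (@le_trans _ _ ((a / 2)%:E * \int[P]_w (avg mu mark_density w * avg mu mark_density w)%:E +
   (2 * a)^-1%:E * \int[P]_w (\1_mark_event w)%:E)).
  rewrite (intrZ P a2 mZ2 Z20) (intrZ P ai mI i0).
  rewrite (intrD P (F := fun w => (a / 2 * (avg mu mark_density w * avg mu mark_density w))%R)
     (G := fun w => ((2 * a)^-1 * \1_mark_event w)%R)); first last.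
  - by move=> w; exact: mulr_ge0.
  - by move=> w; exact: mulr_ge0.
  - exact: measurable_funM.
  - exact: measurable_funM.
  apply: intr_le => //.
  - by apply: measurable_funD; exact: measurable_funM.
  - move=> w; have := Z0 w; rewrite le_eqVlt => /orP[/eqP <-|zw].
      by rewrite !(mulr0, mul0r) add0r; exact: mulr_ge0.
    rewrite indicE mem_set// mulr1; move: (avg mu mark_density w) zw => z zw.
    rewrite -subr_ge0 (_ : _ - _ = (2 * a)^-1 * (a * z - 1) ^+ 2)%R; last by field; exact: lt0r_neq0.
    by apply: mulr_ge0 => //; exact: sqr_ge0.
have IE : \int[P]_w (\1_mark_event w)%:E = p%:E by rewrite integral_indicT//; exact: pE.
rewrite IE EFinD; apply: leeD; last by rewrite -EFinM.
by rewrite [leRHS]EFinM; apply: lee_wpmul2l; [rewrite lee_fin|exact: second].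
Qed.

End positive_probability.

(** * Vanishing mesh and genuine double points *)

Section lower_bound.
Context d (T : measurableType d) (R : realType) (P : probability T R).
Context (B : R -> T -> R * R) (pbmB : planar_brownian_motion P (1, 0) B).
Context (A : set (R * R)) (eps : R).
Hypotheses (cA : closed A) (A9 : forall y, A y -> nsq y <= 9^-1).
Hypotheses (eps0 : 0 < eps) (eps3 : eps < 1 / 3).
Context (mu : probability (R * R)%type R).

Let cb w : {within `[0, +oo[, continuous (fun t => B t w)}.
Proof. exact: (pbm_continuous pbmB). Qed.

(** Half of the separation counted in steps, so that [2 * half k] steps of [mesh k] make exactly
    [eps ^+ 2]. A power of 4 keeps square roots out of the relation [2 * radius k ^+ 2 = mesh k]. *)
Let half (k : nat) : nat := (4 ^ k.+3)%N.
Let mesh (k : nat) : R := eps ^+ 2 / (2 * (half k)%:R).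
Let radius (k : nat) : R := eps / (2 * 2 ^+ k.+3).
Let count (t : R) k : nat := Num.truncn (t / mesh k).

Let half_gt0 k : 0 < (half k)%:R :> R.
Proof. by rewrite ltr0n expn_gt0. Qed.

Let mesh_gt0 k : 0 < mesh k.
Proof. by apply: divr_gt0; [exact: exprn_gt0|exact: mulr_gt0]. Qed.

Let radius_gt0 k : 0 < radius k.
Proof. by apply: divr_gt0 => //; apply: mulr_gt0 => //; exact: exprn_gt0. Qed.

Let radius_mesh k : 2 * radius k ^+ 2 = mesh k.
Proof.
have -> : mesh k = eps ^+ 2 / (2 * (2 ^+ k.+3) ^+ 2).
  by rewrite /mesh /half natrX (_ : 4%:R = 2 ^+ 2 :> R) -?exprM 1?mulnC ?exprM//; ring.
have p0 : 2 ^+ k.+3 != 0 :> R by apply: lt0r_neq0; exact: exprn_gt0.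
by rewrite /radius; move: (2 ^+ k.+3) p0 => x x0; field.
Qed.

Let mesh_small k : mesh k <= 512^-1.
Proof.
have ep := eps0; have e3 := eps3.
have e9 : eps ^+ 2 <= 9^-1.
  by rewrite expr2; apply: (@le_trans _ _ (1 / 3 * (1 / 3))); [apply: ler_pM; lra|lra].
have h64 : 64 <= (half k)%:R :> R.
  by rewrite (_ : 64 = (4 ^ 3)%:R :> R)// ler_nat leq_exp2l.
have hp := half_gt0 k; rewrite /mesh; move: (half k)%:R h64 hp => x h64 hp.
have x2 : 0 < 2 * x by exact: mulr_gt0.
by rewrite ler_pdivrMr//; lra.
Qed.

Let mesh_le k : mesh k <= k.+1%:R^-1.
Proof.
have ep := eps0; have e3 := eps3; have kp : 0 < k.+1%:R :> R by rewrite ltr0n.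
have e1 : eps ^+ 2 <= 1 by rewrite expr_le1//; lra.
apply: (@le_trans _ _ (1 / k.+1%:R)); last by rewrite mul1r.
have hp : 0 < 2 * (half k)%:R :> R by exact: mulr_gt0.
have i0 : 0 <= (2 * (half k)%:R)^-1 :> R by rewrite invr_ge0 ltW.
apply: (ler_pM (sqr_ge0 eps) i0 e1); rewrite lef_pV2 ?posrE//.
apply: (@le_trans _ _ (half k)%:R); last by have := half_gt0 k; lra.
by rewrite ler_nat; apply: leq_trans (ltn_expl k.+3 (isT : (1 < 4)%N)); lia.
Qed.

Let radius_le k : radius k <= k.+1%:R^-1.
Proof.
have ep := eps0; have e3 := eps3; have kp : 0 < k.+1%:R :> R by rewrite ltr0n.
have xp : 0 < 2 ^+ k.+3 :> R by exact: exprn_gt0.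
apply: (@le_trans _ _ (1 / k.+1%:R)); last by rewrite mul1r.
have hp : 0 < 2 * 2 ^+ k.+3 :> R by exact: mulr_gt0.
have i0 : 0 <= (2 * 2 ^+ k.+3)^-1 :> R by rewrite invr_ge0 ltW.
have e1 : eps <= 1 by lra.
apply: (ler_pM (ltW ep) i0 e1); rewrite lef_pV2 ?posrE//.
apply: (@le_trans _ _ (2 ^+ k.+3)); last by lra.
by rewrite -natrX ler_nat; apply: leq_trans (ltn_expl k.+3 (isT : (1 < 2)%N)); lia.
Qed.

Let count_le t k : 0 <= t -> (count t k)%:R * mesh k <= t /\ t - 512^-1 <= (count t k)%:R * mesh k.
Proof.
move=> t0; have m0 := mesh_gt0 k; have ms := mesh_small k.
have /andP[c1 c2] := truncn_itv (divr_ge0 t0 (ltW m0)).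
rewrite -/(count t k) in c1 c2; split; first by rewrite -ler_pdivlMr.
move: c2; rewrite ltr_pdivrMr// -natr1 mulrDl mul1r => c2; lra.
Qed.

Let event k := mark_event B A (radius k) (mesh k) (half k) (count 32^-1 k) (count 4^-1 k) mu.

Let measurable_event k : measurable (event k).
Proof. exact: (measurable_mark_event pbmB). Qed.

Let N1u k : (count 32^-1 k)%:R * mesh k <= 32^-1.
Proof. by have [] := count_le (t := 32^-1) k _; rewrite ?invr_ge0. Qed.

Let Gu k : (count 4^-1 k)%:R * mesh k <= 4^-1.
Proof. by have [] := count_le (t := 4^-1) k _; rewrite ?invr_ge0. Qed.

Let event_prob (e : R) k : mu A = 1%E -> energy (h_gauge eps) mu = e%:E ->
  first_cst R ^+ 2 <= second_cst R * e * fine (P (event k)).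
Proof.
move=> muA eE.
have i32 : 0 <= 32^-1 :> R by rewrite invr_ge0.
have i4 : 0 <= 4^-1 :> R by rewrite invr_ge0.
have [_ h1] := count_le k i32; have [_ h2] := count_le k i4.
apply: (mark_event_prob pbmB cA A9 eps0 eps3 (mesh_gt0 k) (radius_gt0 k) (radius_mesh k)
  (mesh_small k) _ _ _ (N1u k) _ (Gu k) muA eE).
- by apply: (@leq_trans (4 ^ 1)%N) => //; rewrite leq_exp2l.
- by rewrite /mesh; have h0 := half_gt0 k; field; exact: lt0r_neq0.
- by apply: le_trans h1; lra.
- by apply: le_trans h2; lra.
Qed.

(** Witnesses at infinitely many levels converge to a double point by [double_limit]. For survival,
    any time up to the second visit is approached by grid times at which [nsq] is below 8, which
    leaves a margin below 9. *)
Lemma limsup_event : \bigcap_k \bigcup_(n in [set n | (k <= n)%N]) event n `<=` double_event B A eps.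
Proof.
move=> w H.
have wit k : exists x : nat * nat * nat * (R * R),
    [/\ (k <= x.1.1.1)%N, (x.1.1.2 + 2 * half x.1.1.1 <= x.1.2)%N,
      x.1.2%:R * mesh x.1.1.1 <= 1, A x.2 & quiet B (mesh x.1.1.1) x.1.2 w /\
      (`|B (x.1.1.2%:R * mesh x.1.1.1) w - x.2| <= radius x.1.1.1 /\
      `|B (x.1.2%:R * mesh x.1.1.1) w - x.2| <= radius x.1.1.1)].
  have [n kn En] := H k I.
  have [a [b [y [h1 h2 h3 h4 h5]]]] := mark_event_witness (mesh_gt0 n) (N1u n) (Gu n) En.
  by exists (n, a, b, y).
have [x xP] := choice wit.
pose n k := (x k).1.1.1; pose r_ k := (x k).1.1.2%:R * mesh (n k).
pose s_ k := (x k).1.2%:R * mesh (n k).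
have r0 k : 0 <= r_ k by apply: mulr_ge0 => //; exact: ltW.
have s1 k : 0 <= s_ k <= 1.
  by have [_ _ h _ _] := xP k; apply/andP; split => //; apply: mulr_ge0 => //; exact: ltW.
have rs k : r_ k + eps ^+ 2 <= s_ k.
  have [_ h _ _ _] := xP k.
  have -> : eps ^+ 2 = (2 * half (n k))%:R * mesh (n k).
    by rewrite /mesh natrM; have h0 := half_gt0 (n k); field; exact: lt0r_neq0.
  by rewrite -mulrDl -natrD; apply: ler_wpM2r; [exact: ltW|rewrite ler_nat].
have e2 : 0 < eps ^+ 2 by exact: exprn_gt0.
have r1 k : 0 <= r_ k <= 1.
  by rewrite r0/=; have := rs k; have /andP[_] := s1 k; lra.
have inv_le k : (n k).+1%:R^-1 <= k.+1%:R^-1 :> R.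
  by rewrite lef_pV2 ?posrE ?ltr0n// ler_nat ltnS; have [] := xP k.
pose e_ (k : nat) : R := k.+1%:R^-1.
have ec : e_ k @[k --> \oo] --> (0 : R) by exact: cvg_harmonic.
have H4 k : [/\ r_ k + eps ^+ 2 <= s_ k + e_ k, `|B (r_ k) w - (x k).2| <= e_ k,
    `|B (s_ k) w - (x k).2| <= e_ k & A (x k).2].
  have ek : radius (n k) <= e_ k by exact: le_trans (radius_le _) (inv_le k).
  have [_ _ _ hA [_ [h1 h2]]] := xP k; split => //.
  - by apply: le_trans (rs k) _; rewrite lerDl invr_ge0.
  - exact: le_trans h1 ek.
  - exact: le_trans h2 ek.
have [f [r [s [fi fs [rr ss rs' st] bE As]]]] := double_limit (@cb w) cA (ltW e2) r1 s1 ec H4.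
apply: (double_in_separated pbmB eps0 A9 ss); last by exists r, s.
move=> u /andP[u0 us].
have tenth : 0 < 10^-1 :> R by rewrite invr_gt0.
have [dd1 dd10 near_u1] := path_near (@cb w) u0 tenth.
have d2 : 0 < dd1 / 2 by lra.
move/cvgrPdist_lt: (fs) => /(_ _ d2) [K _ HK].
move/cvgrPdist_lt: (ec) => /(_ _ d2) [K' _ HK'].
pose k := maxn K K'; pose j := f k.
have kj : (k <= j)%N.
  have fge i : (i <= f i)%N.
    elim: i => // i IH; apply: leq_ltn_trans IH _.
    have h : (f i.+1 <= f i)%N = (i.+1 <= i)%N := fi i.+1 i.
    by rewrite ltnNge h ltnn.
  exact: fge.
have sj : `|s - s_ j| < dd1 / 2 by apply: HK; rewrite /= leq_maxl.
have mj : mesh (n j) < dd1 / 2.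
  apply: le_lt_trans (mesh_le _) _; apply: le_lt_trans (inv_le j) _.
  have := HK' k (leq_maxr _ _); rewrite sub0r normrN ger0_norm ?invr_ge0//.
  apply: le_lt_trans; rewrite lef_pV2 ?posrE ?ltr0n// ler_nat ltnS; exact: kj.
have /andP[c1 c2] := truncn_itv (divr_ge0 u0 (ltW (mesh_gt0 (n j)))).
set c := Num.truncn _ in c1 c2.
have c1' : c%:R * mesh (n j) <= u by rewrite -ler_pdivlMr.
have c2' : u < c%:R * mesh (n j) + mesh (n j).
  by move: c2; rewrite ltr_pdivrMr// -natr1 mulrDl mul1r.
(* The grid index just below [u], capped at the second visit because quietness is known only up to
   there. *)
pose q := minn c (x j).1.2.
have q0 : 0 <= q%:R * mesh (n j) by apply: mulr_ge0 => //; exact: ltW.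
have qu : `|q%:R * mesh (n j) - u| < dd1.
  rewrite /q; have [cb'|bc] := leqP c (x j).1.2.
    by rewrite ltr_norml; apply/andP; split; lra.
  have : s_ j <= c%:R * mesh (n j) by apply: ler_wpM2r; [exact: ltW|rewrite ler_nat ltnW].
  move: sj; rewrite -/(s_ j) !ltr_norml => /andP[h1 h2] h3; apply/andP; split; lra.
have Q : nsq (B (q%:R * mesh (n j)) w) < 8.
  by have [_ _ _ _ [h _]] := xP j; apply: h; rewrite geq_minr.
have := near_u1 _ q0 qu; set v := B _ w in Q * => vu.
(* This weight in [nsqD_le] gives [17 / 16 * 8 + 17 * 2 / 100 < 9]. *)
have c16 : 0 < 16^-1 :> R by rewrite invr_gt0.
have := nsqD_le v (B u w - v) c16; rewrite addrC subrK invrK.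
have n1 : nsq (B u w - v) <= 2 * (10^-1) ^+ 2.
  rewrite -nsqN opprB; apply: le_trans (nsq_norm _) _; apply: ler_wpM2l => //.
  by rewrite lerXn2r ?nnegrE ?(ltW tenth)// ltW.
lra.
Qed.

(** By continuity from above, the upper limit of the events has probability at least the lower bound
    common to all levels; no convergence of the events themselves is involved. *)
Lemma double_event_lower (e : R) : mu A = 1%E -> energy (h_gauge eps) mu = e%:E ->
  first_cst R ^+ 2 <= second_cst R * e * fine (P (double_event B A eps)).
Proof.
move=> muA eE; have evp k := event_prob k muA eE.
pose E k := \bigcup_(n in [set n | (k <= n)%N]) event n.
have mE k : measurable (E k) by apply: bigcup_measurable => n _; exact: measurable_event.
have mI : measurable (\bigcap_k E k) by exact: bigcapT_measurable.
have cv : (P \o E) k @[k --> \oo] --> P (\bigcap_k E k).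
  apply: nonincreasing_cvg_mu => //.
    by apply: le_lt_trans (probability_le1 _ (mE 0%N)) _; rewrite ltry.
  by move=> m n mn; apply/subsetPset => w [i ni Ei]; exists i => //; exact: leq_trans ni.
have h0 : 0 < eps ^+ 2 / 4 by apply: divr_gt0 => //; exact: exprn_gt0.
have hE : 4 * (eps ^+ 2 / 4) = eps ^+ 2 by field.
have mD : measurable (double_event B A eps) by exact: (measurable_double_event pbmB cA h0 hE eps0 A9).
have pf : P (double_event B A eps) \is a fin_num by exact: fin_num_measure.
have e0 : 0 <= e by rewrite -lee_fin -eE energy_h_ge0.
have s0 : 0 < second_cst R by exact: second_cst_gt0.
have f0 : 0 < first_cst R ^+ 2 by rewrite exprn_gt0// /first_cst !divr_gt0// expR_gt0.
have ep : 0 < second_cst R * e.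
  rewrite lt_def mulr_ge0 ?andbT//; last exact: ltW.
  by apply/eqP => z; have := evp 0%N; rewrite z mul0r; lra.
rewrite -ler_pdivrMl// -lee_fin fineK//.
apply: (@le_trans _ _ (P (\bigcap_k E k))); last first.
  by apply: le_measure; rewrite ?inE//; exact: limsup_event.
rewrite -(cvg_lim _ cv)//; apply: lime_ge; first by apply/cvg_ex; eexists; exact: cv.
apply: nearW => k /=; apply: (@le_trans _ _ (P (event k))); last first.
  by apply: le_measure; rewrite ?inE// => w Ew; exists k => //=.
have pk : P (event k) \is a fin_num by exact: fin_num_measure.
by rewrite -(fineK pk) lee_fin ler_pdivrMl.
Qed.

End lower_bound.

Theorem theorem2p2 (R : realType) :
  exists c C : R, [/\ 0 < c, 0 < C &
    forall (d : measure_display) (Omega : measurableType d)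
      (P : probability Omega R) (B : R -> Omega -> R * R),
    planar_brownian_motion P (1, 0) B ->
    forall (eps : R) (A : set (R * R)),
    0 < eps < 1 / 3 ->
    closed A -> A `<=` [set x | eucl_norm x <= 1 / 3] ->
    (c%:E * capacity (h_gauge eps) A
      <= P [set w | separated_double_points (B ^~ w) eps `&` A !=set0])%E /\
    (P [set w | separated_double_points (B ^~ w) eps `&` A !=set0]
      <= C%:E * capacity (h_gauge eps) A)%E].
Proof.
have s0 : 0 < second_cst R by exact: second_cst_gt0.
have f0 : 0 < first_cst R ^+ 2 by rewrite exprn_gt0// /first_cst !divr_gt0// expR_gt0.
exists (first_cst R ^+ 2 / second_cst R), (upper_constant R); split.
- exact: divr_gt0.
- exact: upper_constant_gt0.
move=> d T P B pbmB eps A /andP[eps0 eps3] cA A3.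
have A9 y : A y -> nsq y <= 9^-1.
  move=> /A3 /= y3; rewrite -eucl_norm_sqr.
  have -> : 9^-1 = (1 / 3) ^+ 2 :> R by field.
  by rewrite lerXn2r ?nnegrE ?sqrtr_ge0 ?divr_ge0.
have h0 : 0 < eps ^+ 2 / 4 by apply: divr_gt0 => //; exact: exprn_gt0.
have hE : 4 * (eps ^+ 2 / 4) = eps ^+ 2 by field.
split; last exact: (double_event_capacity pbmB cA h0 hE eps0 eps3 A9).
have mD : measurable (double_event B A eps) by exact: (measurable_double_event pbmB cA h0 hE eps0 A9).
rewrite -/(double_event B A eps).
have pf : P (double_event B A eps) \is a fin_num by exact: fin_num_measure.
have low (mu : probability (R * R)%type R) e := @double_event_lower _ _ _ _ _ pbmB A eps cA A9 eps0 eps3 mu e.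
have I0 := energy_inf_ge0 A eps.
rewrite /capacity; set I := ereal_inf _ in I0 *.
have cc : 0 < first_cst R ^+ 2 / second_cst R by exact: divr_gt0.
move: (fineK pf) low; set p := fine _ => pE low.
have p0 : 0 <= p by rewrite /p fine_ge0.
(* If the probability vanishes, no probability measure carried by [A] has finite energy, so the
   capacity is [+oo^-1], that is 0. *)
have [pz|pN] := eqVneq p 0.
  have -> : I = +oo%E.
    apply/ereal_inf_pinfty => _ [mu /= muA <-].
    have := energy_h_ge0 eps mu; case eE: (energy _ _) => [e| |]// _.
    by have := low mu e muA eE; rewrite pz mulr0 leNgt f0.
  by rewrite invey mule0 -pE lee_fin.
have pp : 0 < p by rewrite lt_def pN.
have cI : ((first_cst R ^+ 2 / second_cst R / p)%:E <= I)%E.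
  apply: le_ereal_inf_tmp => _ [mu /= muA <-].
  have := energy_h_ge0 eps mu; case eE: (energy _ _) => [e| |] en0; [|by rewrite leey|by []].
  have := low mu e muA eE; rewrite lee_fin => H.
  by rewrite ler_pdivrMr// ler_pdivrMr// mulrAC [e * _]mulrC.
move: I0 cI; case: I => [i| |]// I0 cI; last by rewrite invey mule0 -pE lee_fin.
rewrite lee_fin in cI; have ip : 0 < i by apply: lt_le_trans cI; exact: divr_gt0.
rewrite inver gt_eqF// -pE -EFinM lee_fin ler_pdivrMr// [leRHS]mulrC.
by rewrite -ler_pdivrMr.
Qed.
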